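(* Let $\mathcal{C}$ be a connected cooperad in chain complexes over a commutative ring $\Bbbk$. Let $f\colon A\to B$, $g\colon B\to A$, $h\colon A\to A$ be a contraction of chain complexes, and let $t$ be an $\Omega(\mathcal{C})$-algebra structure on $A$. Let $\mathbf{f}_n=f^{\otimes n}$, $\mathbf{g}_n=g^{\otimes n}$, and let $\mathbf{h}\colon A\to A$ be any symmetric pseudo-derivation with $\mathbf{h}_1=h$ and $$\partial(\mathbf{h})=\mathbf{g}\mathbf{f}-\mathbf{1},\quad \mathbf{f}\mathbf{h}=\mathbf{0},\quad \mathbf{h}\mathbf{g}=\mathbf{0},\quad \mathbf{h}\mathbf{h}=\mathbf{0}.$$ Let $F\colon\mathcal{C}[A]\to\mathcal{C}[B]$ and $G\colon\mathcal{C}[B]\to\mathcal{C}[A]$ be the morphisms of $\mathcal{C}$-coalgebras induced by $f$ and $g$, and let $H=\mathcal{C}[\mathbf{h}]\colon\mathcal{C}[A]\to\mathcal{C}[A]$. Then the formulas $$F'=F+FtH+F(tH)^2+\cdots,\qquad G'=G+HtG+(Ht)^2G+\cdots,$$ $$H'=H+HtH+H(tH)^2+\cdots,\qquad t'=FtG+FtHtG+Ft(Ht)^2G+\cdots$$ define an $\Omega(\mathcal{C})$-algebra structure $t'$ on $B$ and $\Omega(\mathcal{C})$-structures $F',G',H'$ on $f,g,h$ which make $$F'\colon\mathbb{B}(A,t)\to\mathbb{B}(B,t'),\quad G'\colon\mathbb{B}(B,t')\to\mathbb{B}(A,t),\quad H'\colon\mathbb{B}(A,t)\to\mathbb{B}(A,t)$$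 into a contraction of $\mathcal{C}$-coalgebras. If $\mathcal{C}$ is a non-symmetric cooperad, then one may drop the condition that $\mathbf{h}$ be symmetric, and a possible choice of pseudo-derivation is $$\mathbf{h}_n=\sum_{p+1+q=n}1^{\otimes p}\otimes h\otimes(gf)^{\otimes q}.$$ If $\mathbb{Q}\subseteq\Bbbk$, then a possible choice of symmetric pseudo-derivation is the symmetrization $\mathbf{h}^\Sigma_n=\frac1{n!}\sum_{\sigma\in\Sigma_n}\sigma^{-1}\mathbf{h}_n\sigma$ of this $\mathbf{h}_n$.
   Context: Chain complexes are unbounded complexes over $\Bbbk$ with differential of degree $-1$; the Koszul sign rule is used. A contraction of chain complexes consists of maps $f\colon A\to B$, $g\colon B\to A$ of degree $0$ and $h\colon A\to A$ of degree $1$ with $\partial(f)=0$, $\partial(g)=0$, $\partial(h)=gf-1_A$, $fg=1_B$, $fh=0$, $hh=0$, $hg=0$. A thick map $\mathbf{f}\colon A\to B$ is a sequence of maps $\mathbf{f}_n\colon A^{\otimes n}\to B^{\otimes n}$, $n\ge0$, all of the same degree; it is symmetric if each $\mathbf{f}_n$ is $\Sigma_n$-equivariant. Composition, sums and $\partial(\mathbf{f})_n=d_{B^{\otimes n}}\mathbf{f}_n-(-1)^{|\mathbf{f}|}\mathbf{f}_nd_{A^{\otimes n}}$ are levelwise; $\mathbf{1}_n=1$, $\mathbf{0}_n=0$. It is a morphism if $\mathbf{f}_{p+q}=\mathbf{f}_p\otimes\mathbf{f}_q$ for all $p,q\ge0$, and a derivation (for $A=B$) if $\mathbf{f}_{p+q}=\mathbf{f}_p\otimes1+1\otimes\mathbf{f}_q$.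 A thick map $\mathbf{h}\colon A\to A$ of degree $1$ is a pseudo-derivation if for all $p,q\ge0$ $$(\mathbf{h}_p\otimes 1-1\otimes\mathbf{h}_q)\mathbf{h}_{p+q}=\mathbf{h}_p\otimes\mathbf{h}_q,\qquad \mathbf{h}_{p+q}(\mathbf{h}_p\otimes 1-1\otimes\mathbf{h}_q)=-\mathbf{h}_p\otimes\mathbf{h}_q .$$ A cooperad $\mathcal{C}$ is connected if $\mathcal{C}(0)=0$ and $\mathcal{C}(1)=\Bbbk$. The cofree $\mathcal{C}$-coalgebra is $\mathcal{C}[A]=\bigoplus_{n\ge0}\mathcal{C}(n)\otimes_{\Sigma_n}A^{\otimes n}$; the $n$-th summand has weight $n$ (for non-symmetric $\mathcal{C}$ replace $\otimes_{\Sigma_n}$ by $\otimes$). A $\mathcal{C}$-coalgebra is a coalgebra $\Delta_A\colon A\to\mathcal{C}[A]$ over the comonad $\mathcal{C}[-]$. For a symmetric thick map $\mathbf{f}\colon A\to B$ set $\mathcal{C}[\mathbf{f}]=\bigoplus_n1\otimes_{\Sigma_n}\mathbf{f}_n\colon\mathcal{C}[A]\to\mathcal{C}[B]$. More generally $\mathcal{C}_\bullet[\mathbf{f}]$ is the thick map $\mathcal{C}[A]\to\mathcal{C}[B]$ whose $n$-th level acts as $1\otimes\mathbf{f}_{r_1+\cdots+r_n}$ on the summand $(\mathcal{C}(r_1)\otimes\cdots\otimes\mathcal{C}(r_n))\otimes_{\Sigma_{r_1}\times\cdots\times\Sigma_{r_n}}A^{\otimes(r_1+\cdots+r_n)}$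 of $\mathcal{C}[A]^{\otimes n}$; its first level is $\mathcal{C}[\mathbf{f}]$. A thick map of $\mathcal{C}$-coalgebras $A\to B$ is a symmetric thick map $\mathbf{f}$ with $\Delta_B\mathbf{f}_1=\mathcal{C}[\mathbf{f}]\Delta_A$ (symmetry dropped in the non-symmetric case). A contraction of $\mathcal{C}$-coalgebras consists of thick maps of $\mathcal{C}$-coalgebras $\mathbf{f}\colon A\to B$, $\mathbf{g}\colon B\to A$, $\mathbf{h}\colon A\to A$ of degrees $0,0,1$ satisfying $\partial(\mathbf{f})=\mathbf{0}$, $\partial(\mathbf{g})=\mathbf{0}$, $\partial(\mathbf{h})=\mathbf{g}\mathbf{f}-\mathbf{1}$, $\mathbf{f}\mathbf{g}=\mathbf{1}$, $\mathbf{f}\mathbf{h}=\mathbf{0}$, $\mathbf{h}\mathbf{h}=\mathbf{0}$, $\mathbf{h}\mathbf{g}=\mathbf{0}$, with $\mathbf{f},\mathbf{g}$ morphisms and $\mathbf{h}$ a pseudo-derivation. An $\Omega(\mathcal{C})$-algebra structure on a chain complex $A$ (where $\Omega$ is the cobar construction) is identified with a weight decreasing coderivation $t\colon\mathcal{C}[A]\to\mathcal{C}[A]$ of degree $-1$ with $\partial(t)+t^2=0$. The bar construction is the $\mathcal{C}$-coalgebra $\mathbb{B}(A,t)=(\mathcal{C}[A],d_{\mathcal{C}[A]}+t)$. An $\Omega(\mathcal{C})$-structure on a chain map $f\colon A\to B$ is a morphism of $\mathcal{C}$-coalgebras $F\colon\mathbb{B}(A,t)\to\mathbb{B}(B,t')$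 whose linear part (restriction to weight $1$, $A\to\mathcal{C}[B]$, followed by projection to $B$) is $f$; likewise $H'$ is an $\Omega(\mathcal{C})$-structure on the homotopy $h$ in the sense that it is the first level of a thick map of $\mathcal{C}$-coalgebras of degree $1$ and has linear part $h$. Saying that the ordinary maps $F',G',H'$ form a contraction of $\mathcal{C}$-coalgebras refers to the thick maps of which they are the first levels: $F',G'$ extend to thick maps by $(F')^{\otimes n}$, $(G')^{\otimes n}$, and $H'$ extends to the thick map $\mathbf{H}'=\mathbf{H}+\mathbf{H}\mathbf{t}\mathbf{H}+\mathbf{H}(\mathbf{t}\mathbf{H})^2+\cdots$, where $\mathbf{H}=\mathcal{C}_\bullet[\mathbf{h}]$ and $\mathbf{t}_n=\sum_{p+1+q=n}1^{\otimes p}\otimes t\otimes1^{\otimes q}$. *)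

(* Defs.v *)
From HB Require Import structures.
From mathcomp Require Import all_boot all_order all_algebra all_fingroup.
From mathcomp Require Import boolp classical_sets fsbigop.

Set Implicit Arguments.
Unset Strict Implicit.
Unset Printing Implicit Defensive.

Import GRing.Theory.
Local Open Scope ring_scope.

(** * Modules by generators and relations

   [pres P] is the [k]-module generated by a type [X] in which the relations
   [P] hold universally: [P V phi] says that the family [phi : X -> V] of a
   module [V] satisfies the relations, and two formal linear combinations of
   generators are identified iff they agree under every such [phi].  Hence a
   [phi] with [P V phi] factors through [pres P], by [lift phi].  *)

Section Presented.
Context {k : comPzRingType} {X : Type}.
Context (P : forall V : lmodType k, (X -> V) -> Prop).

Definition ev (V : lmodType k) (phi : X -> V) (s : seq (k * X)) : V :=
  \sum_(p <- s) p.1 *: phi p.2.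

Definition pres_eq (s t : {classic (seq (k * X))}) : bool :=
  `[< forall (V : lmodType k) (phi : X -> V), P phi -> ev phi s = ev phi t >].

Fact pres_eq_refl : reflexive pres_eq.
Proof. by move=> s; apply/asboolP. Qed.

Fact pres_eq_sym : symmetric pres_eq.
Proof.
by move=> s t; apply/asboolP/asboolP => H V phi Pphi; rewrite (H V phi Pphi).
Qed.

Fact pres_eq_trans : transitive pres_eq.
Proof.
move=> t s u /asboolP H /asboolP K; apply/asboolP => V phi Pphi.
by rewrite (H V phi Pphi) (K V phi Pphi).
Qed.

Canonical pres_equiv := EquivRel pres_eq pres_eq_refl pres_eq_sym pres_eq_trans.

Definition pres := {eq_quot pres_equiv}%qT.
HB.instance Definition _ := Choice.on pres.

Definition pres_cls (s : seq (k * X)) : pres := (\pi s)%qT.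
Definition pres_rep (x : pres) : seq (k * X) := generic_quotient.repr x.

Lemma pres_repK x : pres_cls (pres_rep x) = x.
Proof. exact: reprK. Qed.

Lemma pres_clsP s t :
  (forall (V : lmodType k) (phi : X -> V), P phi -> ev phi s = ev phi t) <->
  pres_cls s = pres_cls t.
Proof.
split=> [H|/eqmodP/asboolP //]; apply/eqmodP/asboolP; exact: H.
Qed.

Lemma ev_rep (V : lmodType k) (phi : X -> V) s : P phi -> ev phi (pres_rep (pres_cls s)) = ev phi s.
Proof. by move=> Pphi; have /pres_clsP-> := pres_repK (pres_cls s). Qed.

Definition scale_seq (a : k) (s : seq (k * X)) := [seq (a * p.1, p.2) | p <- s].

Lemma ev_cat (V : lmodType k) (phi : X -> V) s t : ev phi (s ++ t) = ev phi s + ev phi t.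
Proof. exact: big_cat. Qed.

Lemma ev_scale (V : lmodType k) (phi : X -> V) a s : ev phi (scale_seq a s) = a *: ev phi s.
Proof.
by rewrite /ev big_map scaler_sumr; apply: eq_bigr => p _; rewrite scalerA.
Qed.

Definition pres_zero : pres := pres_cls [::].
Definition pres_add (x y : pres) : pres := pres_cls (pres_rep x ++ pres_rep y).
Definition pres_scale (a : k) (x : pres) : pres :=
  pres_cls (scale_seq a (pres_rep x)).
Definition pres_opp (x : pres) : pres := pres_scale (-1) x.

Fact pres_addA : associative pres_add.
Proof.
move=> x y z; apply/pres_clsP => V phi Pphi.
by rewrite !ev_cat !ev_rep // !ev_cat addrA.
Qed.

Fact pres_addC : commutative pres_add.
Proof.
by move=> x y; apply/pres_clsP => V phi Pphi; rewrite !ev_cat addrC.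
Qed.

Fact pres_add0 : left_id pres_zero pres_add.
Proof.
move=> x; rewrite -[RHS]pres_repK; apply/pres_clsP => V phi Pphi.
by rewrite ev_cat ev_rep // /ev big_nil add0r.
Qed.

Fact pres_addN : left_inverse pres_zero pres_opp pres_add.
Proof.
move=> x; apply/pres_clsP => V phi Pphi.
by rewrite ev_cat ev_rep // ev_scale scaleN1r addNr /ev big_nil.
Qed.

HB.instance Definition _ :=
  GRing.isZmodule.Build pres pres_addA pres_addC pres_add0 pres_addN.

Fact pres_scaleA a b (v : pres) :
  pres_scale a (pres_scale b v) = pres_scale (a * b) v.
Proof.
apply/pres_clsP => V phi Pphi.
by rewrite ev_scale ev_rep // !ev_scale scalerA.
Qed.

Fact pres_scale1 : left_id 1 pres_scale.
Proof.
move=> x; rewrite -[RHS]pres_repK; apply/pres_clsP => V phi Pphi.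
by rewrite ev_scale scale1r.
Qed.

Fact pres_scaleDr : right_distributive pres_scale +%R.
Proof.
move=> a x y; apply/pres_clsP => V phi Pphi.
by rewrite ev_scale ev_rep // !ev_cat !ev_rep // !ev_scale scalerDr.
Qed.

Fact pres_scaleDl (v : pres) : {morph pres_scale^~ v : a b / a + b}.
Proof.
move=> a b; apply/pres_clsP => V phi Pphi.
by rewrite ev_cat !ev_rep // !ev_scale scalerDl.
Qed.

HB.instance Definition _ := GRing.Zmodule_isLmodule.Build k pres
  pres_scaleA pres_scale1 pres_scaleDr pres_scaleDl.

Definition gen (x : X) : pres := pres_cls [:: (1, x)].

Definition lift (V : lmodType k) (phi : X -> V) (x : pres) : V :=
  ev phi (pres_rep x).

Lemma lift_gen (V : lmodType k) (phi : X -> V) x :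
  P phi -> lift phi (gen x) = phi x.
Proof. by move=> Pphi; rewrite /lift ev_rep // /ev big_seq1 scale1r. Qed.

Lemma lift_is_linear (V : lmodType k) (phi : X -> V) : P phi -> linear (lift phi).
Proof.
move=> Pphi a x y; rewrite /lift ev_rep // ev_cat; congr (_ + _).
by rewrite ev_rep // ev_scale.
Qed.

End Presented.

(** The multilinear extension of a function of finitely many generators. *)
Definition mlift {k : comPzRingType} {n} {X : 'I_n -> Type}
    {P : forall i (V : lmodType k), (X i -> V) -> Prop} {V : lmodType k}
    (phi : (forall i, X i) -> V) (x : forall i, pres (P i)) : V :=
  \sum_(j : {dffun forall i, 'I_(size (pres_rep (x i)))})
    (\prod_i (tnth (in_tuple (pres_rep (x i))) (j i)).1) *:
    phi (fun i => (tnth (in_tuple (pres_rep (x i))) (j i)).2).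

(** * Graded modules and complexes

   A graded module is represented by its total module together with the
   projections [pr i] onto the homogeneous components; [gmod] and [cx] hold
   the data and [is_gmod], [is_cx] the axioms.  *)

Record gmod (k : comPzRingType) := Gmod {
  gcar :> lmodType k;
  pr : int -> gcar -> gcar }.
Arguments pr {k} M i x : rename.

Record cx (k : comPzRingType) := Cx {
  cgr :> gmod k;
  dif : cgr -> cgr }.
Arguments dif {k} A x : rename.

Definition is_gmod k (M : gmod k) : Prop :=
  [/\ forall i, linear (pr M i),
      forall i j x, pr M i (pr M j x) = if i == j then pr M i x else 0 &
      forall x, exists2 s : seq int, uniq s & x = \sum_(i <- s) pr M i x].

(** Homogeneous linear maps of degree [m]. *)
Definition homog k (m : int) (M N : gmod k) (f : M -> N) : Prop :=
  linear f /\ forall i x, f (pr M i x) = pr N (i + m) (f x).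

Definition is_cx k (A : cx k) : Prop :=
  [/\ is_gmod A, homog (-1) (dif A) & forall x, dif A (dif A x) = 0].

Record chain_complex (k : comPzRingType) := ChainComplex {
  ccx :> cx k;
  ccxP : is_cx ccx }.

Definition sgn (k : comPzRingType) (e : int) : k := (-1) ^+ `|e|%N.
Arguments sgn {k} e.

(** Koszul sign of moving, for all [i], the [i]-th letter (of degree [deg i])
   of a word to the place [key i]. *)
Definition koszul {k : comPzRingType} n (deg : 'I_n -> int) (key : 'I_n -> nat)
  : k := sgn (\sum_(i < n) \sum_(j < n | (i < j)%N && (key j < key i)%N) deg i * deg j).

(** Koszul sign of [a_1 .. a_n b_1 .. b_n -> a_1 b_1 .. a_n b_n], where
   [a_i] and [b_i] have degrees [x i] and [y i]. *)
Definition shuffle {k : comPzRingType} n (x y : 'I_n -> int) : k :=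
  sgn (\sum_(i < n) \sum_(j < n | (j < i)%N) x i * y j).

(** * Tensor powers

   A pair [(e, a) : int * M] stands for the homogeneous element [pr M e a] of
   degree [e], so that signs can be read off from the generators.  *)

Definition upd n (Y : Type) (x : {ffun 'I_n -> Y}) (i : 'I_n) (y : Y) :=
  [ffun j => if j == i then y else x j].

Definition slotwise (k : comPzRingType) (Y : Type)
    (Q : forall V : lmodType k, (Y -> V) -> Prop) n
    (V : lmodType k) (phi : {ffun 'I_n -> Y} -> V) : Prop :=
  forall x i, Q V (fun y => phi (upd x i y)).

Definition hlin k (M : gmod k) (V : lmodType k) (phi : int * M -> V) : Prop :=
  (forall e (a : k) x y, phi (e, a *: x + y) = a *: phi (e, x) + phi (e, y)) /\
  (forall e x, phi (e, pr M e x) = phi (e, x)).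

Section TensorPower.
Context {k : comPzRingType}.
Implicit Types M N : gmod k.

Definition tgen M n := {ffun 'I_n -> int * M}.

Definition tmod M n := pres (@slotwise k (int * M) (@hlin k M) n).
HB.instance Definition _ M n := GRing.Lmodule.on (tmod M n).

Definition ten M n (x : tgen M n) : tmod M n := gen _ x.

Definition tdeg M n (x : tgen M n) : int := \sum_i (x i).1.

Definition T M n : gmod k := @Gmod k (tmod M n)
  (fun m => lift (fun x : tgen M n => if tdeg x == m then ten x else 0)).

(** [M] is identified with its first tensor power by [one] and [unone]. *)
Definition one M (a : M) : T M 1 :=
  \sum_(e \in [set: int]) ten [ffun _ : 'I_1 => (e, a)].
Definition unone M : T M 1 -> M :=
  lift (fun x : tgen M 1 => pr M (x ord0).1 (x ord0).2).

(** Left action of the symmetric group: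
   [sigma (a_1 .. a_n) = +- a_(sigma^-1 1) .. a_(sigma^-1 n)]. *)
Definition tact M n (sigma : 'S_n) : T M n -> T M n :=
  lift (fun x : tgen M n =>
    koszul (fun i => (x i).1) (fun i => sigma i) *:
    ten [ffun i => x (sigma^-1%g i)]).

Definition tcat M p q (u : T M p) (v : T M q) : T M (p + q) :=
  lift (fun x : tgen M p => lift (fun y : tgen M q =>
    ten [ffun s => match split s with inl i => x i | inr j => y j end]) v) u.

Definition tflat M n (r : 'I_n -> nat) (u : forall i, T M (r i)) :
    T M (\sum_i r i) :=
  mlift (fun x : (forall i, tgen M (r i)) =>
    ten [ffun s => x (tagnat.sig1 s) (tagnat.sig2 s)]) u.

(** [f (x) g] for [f : T M p -> T N p] and [g : T M q -> T N q] of degree [m]. *)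
Definition tens M N p q (m : int) (f : T M p -> T N p) (g : T M q -> T N q) :
    T M (p + q) -> T N (p + q) :=
  lift (fun x : tgen M (p + q) =>
    sgn (m * \sum_i (x (lshift q i)).1) *:
    tcat (f (ten [ffun i => x (lshift q i)])) (g (ten [ffun j => x (rshift p j)]))).

(** [f^{(x) n}] for [f] of degree 0. *)
Definition tpow M N (f : M -> N) n : T M n -> T N n :=
  lift (fun x : tgen M n => ten [ffun i => ((x i).1, f (x i).2)]).

(** [\sum_(p + 1 + q = n) 1^{(x) p} (x) u (x) v^{(x) q}] for [u] of degree [m] and
   [v] of degree 0. *)
Definition tins M (m : int) (u v : M -> M) n : T M n -> T M n :=
  lift (fun x : tgen M n => \sum_(i < n)
    sgn (m * \sum_(j < n | (j < i)%N) (x j).1) *: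
    ten [ffun j : 'I_n => if (j < i)%N then x j
                          else if j == i then ((x j).1 + m, u (x j).2)
                          else ((x j).1, v (x j).2)]).

Definition tdif M (d : M -> M) n (u : T M n) : T M n := tins (-1) d id u.

End TensorPower.

(** * Thick maps *)

Definition thick k (M N : gmod k) := forall n, T M n -> T N n.

Section Thick.
Context {k : comPzRingType}.
Implicit Types M N L : gmod k.

(** The groups over which coinvariants are taken: [Sigma_n] if [sym], and the
   trivial group for the non-symmetric theory. *)
Definition adm (sym : bool) n (sigma : 'S_n) : bool := sym || (sigma == 1%g).

Definition is_thick m M N (f : thick M N) : Prop := forall n, homog m (@f n).

Definition symmetric_thick sym M N (f : thick M N) : Prop :=
  forall n (sigma : 'S_n), adm sym sigma ->
  forall u, f n (tact sigma u) = tact sigma (f n u).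

Definition thick_morphism M N (f : thick M N) : Prop :=
  forall p q u, f (p + q)%N u = tens 0 (@f p) (@f q) u.

Definition pseudo_derivation M (h : thick M M) : Prop :=
  forall p q u,
    tens 0 (@h p) id (h (p + q)%N u) - tens 1 id (@h q) (h (p + q)%N u)
      = tens 1 (@h p) (@h q) u /\
    h (p + q)%N (tens 0 (@h p) id u - tens 1 id (@h q) u)
      = - tens 1 (@h p) (@h q) u.

(** [thick_bound dM dN m f g] is [partial f = g], for [f] of degree [m]. *)
Definition thick_bound M N (dM : M -> M) (dN : N -> N) (m : int)
    (f g : thick M N) : Prop :=
  forall n u, tdif dN (f n u) - sgn m *: f n (tdif dM u) = g n u.

Definition thick_eq M N (f g : thick M N) : Prop := forall n u, f n u = g n u.
Definition thick_comp M N L (f : thick N L) (g : thick M N) : thick M L :=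
  fun n u => f n (g n u).
Definition thick_id M : thick M M := fun n u => u.
Definition thick_zero M N : thick M N := fun n u => 0.
Definition thick_sub M N (f g : thick M N) : thick M N :=
  fun n u => f n u - g n u.

Definition first_level M N (f : thick M N) (a : M) : N := unone (f 1 (one a)).

End Thick.
Arguments thick_id {k} M n u.
Arguments thick_zero {k} M N n u.

(** * Contractions of complexes *)

Definition contraction k (A B : cx k) (f : A -> B) (g : B -> A) (h : A -> A) :=
  [/\ homog 0 f, homog 0 g & homog 1 h] /\
  [/\ forall x, dif B (f x) = f (dif A x),
      forall y, dif A (g y) = g (dif B y) &
      forall x, dif A (h x) + h (dif A x) = g (f x) - x] /\
  [/\ forall y, f (g y) = y, forall x, f (h x) = 0,
      forall x, h (h x) = 0 & forall y, h (g y) = 0].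

(** The pseudo-derivations extending [h] which are allowed in the theorem. *)
Definition thick_homotopy sym k (A B : cx k)
    (f : A -> B) (g : B -> A) (h : A -> A) (hh : thick A A) : Prop :=
  [/\ is_thick 1 hh, symmetric_thick sym hh, pseudo_derivation hh &
      forall a, first_level hh a = h a] /\
  [/\ thick_bound (dif A) (dif A) 1 hh
        (thick_sub (thick_comp (tpow g) (tpow f)) (thick_id A)),
      thick_eq (thick_comp (tpow f) hh) (thick_zero A B),
      thick_eq (thick_comp hh (tpow g)) (thick_zero B A) &
      thick_eq (thick_comp hh hh) (thick_zero A A)].

Definition standard_homotopy k (A B : cx k)
    (f : A -> B) (g : B -> A) (h : A -> A) : thick A A :=
  tins 1 h (g \o f).

Definition symmetrize (k : comPzRingType) (iota : rat -> k) (M : gmod k)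
    (h : thick M M) : thick M M :=
  fun n u => iota (n`!%:R^-1) *:
    \sum_(sigma : 'S_n) tact sigma^-1%g (h n (tact sigma u)).

(** * Symmetric sequences, composition product and cooperads *)

(** [ract] is a right action: with the product of [perm.v], for which
   [(s * t) x = t (s x)], this reads [ract (s * t) = ract s \o ract t]. *)
Record sseq (k : comPzRingType) := Sseq {
  scx :> nat -> cx k;
  ract : forall n, 'S_n -> scx n -> scx n }.
Arguments ract {k} C {n} sigma c : rename.

Definition is_sseq sym k (C : sseq k) : Prop :=
  (forall n, is_cx (C n)) /\
  forall n (s t : 'S_n), adm sym s -> adm sym t ->
    [/\ homog 0 (ract C s),
        forall c, ract C s (dif (C n) c) = dif (C n) (ract C s c),
        forall c, @ract _ C n 1%g c = c &
        forall c, ract C (s * t)%g c = ract C s (ract C t c)].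

(** A sequence of graded modules with left actions. *)
Record lseq (k : comPzRingType) := Lseq {
  lgr :> nat -> gmod k;
  lact : forall n, 'S_n -> lgr n -> lgr n }.
Arguments lact {k} M {n} sigma u : rename.

(** [tot sym C M] is the sum over [n] of [C n (x)_{Sigma_n} M n] (of
   [C n (x) M n] in the non-symmetric case). *)
Section Tot.
Context {k : comPzRingType} (sym : bool).
Implicit Types (C D : sseq k) (M N : lseq k).

Definition totgen C M := {n : nat & ((int * C n) * M n)%type}.

Definition Totgen C M n (c : int * C n) (u : M n) : totgen C M :=
  existT (fun n => ((int * C n) * M n)%type) n (c, u).

Definition totrel C M (V : lmodType k) (phi : totgen C M -> V) : Prop :=
  [/\ forall n (u : M n), hlin (fun c : int * C n => phi (Totgen c u)),
      forall n (c : int * C n) (a : k) (u v : M n),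
        phi (Totgen c (a *: u + v)) = a *: phi (Totgen c u) + phi (Totgen c v) &
      forall n (sigma : 'S_n), adm sym sigma -> forall e (c : C n) (u : M n),
        phi (Totgen (e, ract C sigma c) u) = phi (Totgen (e, c) (lact M sigma u))].

Definition totmod C M := pres (totrel (C := C) (M := M)).
HB.instance Definition _ C M := GRing.Lmodule.on (totmod C M).

Definition totg C M n (c : int * C n) (u : M n) : totmod C M :=
  gen _ (Totgen c u).

Definition tlift C M (V : lmodType k)
    (phi : forall n, int * C n -> M n -> V) : totmod C M -> V :=
  lift (fun z : totgen C M => phi (tag z) (tagged z).1 (tagged z).2).

Definition tot C M : gmod k := @Gmod k (totmod C M)
  (fun m => tlift (fun n c u => totg c (pr (M n) (m - c.1) u))).

Definition totdif C M (dM : forall n, M n -> M n) : tot C M -> tot C M :=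
  tlift (fun n c u =>
    totg (c.1 - 1, dif (C n) c.2) u + sgn c.1 *: totg c (dM n u)).

(** [1 (x) phi], for [phi] of degree [m] *)
Definition totmap C M N (m : int) (phi : forall n, M n -> N n) :
    tot C M -> tot C N :=
  tlift (fun n c u => sgn (m * c.1) *: totg c (phi n u)).

(** [psi (x) 1], for [psi] of degree 0 *)
Definition totmapl C D M (psi : forall n, C n -> D n) : tot C M -> tot D M :=
  tlift (fun n c u => totg (c.1, psi n c.2) u).

(** Component of weight [m]. *)
Definition wpr C M (m : nat) : tot C M -> tot C M :=
  tlift (fun n c u => if n == m then totg c u else 0).

End Tot.

(** [day sym D j n] is the [n]-th term of the [j]-fold tensor power of the
   sequence [D], i.e. the sum over all [r_1 + .. + r_j = n] of the modules
   induced from [D r_1 (x) .. (x) D r_j] along the inclusion of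
   [Sigma_{r_1} * .. * Sigma_{r_j}] into [Sigma_n].  A generator consists of
   elements [d_i] of [D r_i] with inputs labelled by elements of [0..n-1], each
   label being used exactly once; in the non-symmetric case the labels have to
   occur in order.  The other labellings are set to 0 by [dayrel].  *)
Section Day.
Context {k : comPzRingType} (sym : bool).
Implicit Types (C D : sseq k).

Definition blk D n := {r : nat & ((int * D r) * {ffun 'I_r -> 'I_n})%type}.

Definition Blk D n r (d : int * D r) (l : {ffun 'I_r -> 'I_n}) : blk D n :=
  existT (fun r => ((int * D r) * {ffun 'I_r -> 'I_n})%type) r (d, l).

Definition arty D n (b : blk D n) : nat := tag b.
Definition bel D n (b : blk D n) : int * D (arty b) := (tagged b).1.
Definition blb D n (b : blk D n) : {ffun 'I_(arty b) -> 'I_n} := (tagged b).2.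

Definition daygen D j n := {ffun 'I_j -> blk D n}.

(** All labels of [g], in the order in which they occur. *)
Definition daylab D j n (g : daygen D j n) (z : 'I_(\sum_i arty (g i))) : 'I_n :=
  blb (g (tagnat.sig1 z)) (tagnat.sig2 z).
Arguments daylab {D j n} g z.

Definition dayok D j n (g : daygen D j n) : bool :=
  [&& (\sum_i arty (g i) == n)%N, injectiveb (daylab g) &
      sym || [forall z, daylab g z == z :> nat]].

Definition blkrel D n (V : lmodType k) (phi : blk D n -> V) : Prop :=
  (forall r (l : {ffun 'I_r -> 'I_n}),
     hlin (fun d : int * D r => phi (Blk d l))) /\
  (forall r (tau : 'S_r), adm sym tau -> forall e (d : D r) l,
     phi (Blk (e, ract D tau d) l) =
     phi (Blk (e, d) [ffun s => l (tau^-1%g s)])).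

Definition dayrel D j n (V : lmodType k) (phi : daygen D j n -> V) : Prop :=
  slotwise (@blkrel D n) phi /\ forall g, ~~ dayok g -> phi g = 0.

Definition daymod D j n := pres (@dayrel D j n).
HB.instance Definition _ D j n := GRing.Lmodule.on (daymod D j n).

Definition dayg D j n (g : daygen D j n) : daymod D j n := gen _ g.

(** Linear extension of a function of the admissible generators. *)
Definition daylift D j n (V : lmodType k) (phi : daygen D j n -> V) :
    daymod D j n -> V :=
  lift (fun g : daygen D j n => if dayok g then phi g else 0).

Definition day D n : lseq k := @Lseq k
  (fun j => @Gmod k (daymod D j n) (fun m => lift (fun g : daygen D j n =>
     if \sum_i (bel (g i)).1 == m then dayg g else 0)))
  (fun j sigma => lift (fun g : daygen D j n =>
     koszul (fun i => (bel (g i)).1) (fun i => sigma i) *: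
     dayg [ffun i => g (sigma^-1%g i)])).

Definition daydif D n j : day D n j -> day D n j :=
  lift (fun g : daygen D j n => \sum_(i < j)
    sgn (\sum_(i' < j | (i' < i)%N) (bel (g i')).1) *:
    dayg (upd g i (Blk ((bel (g i)).1 - 1, dif (D _) (bel (g i)).2) (blb (g i))))).

Definition daymap C D (phi : forall r, C r -> D r) n j : day C n j -> day D n j :=
  lift (fun g : daygen C j n =>
    dayg [ffun i => Blk ((bel (g i)).1, phi _ (bel (g i)).2) (blb (g i))]).

Definition dayrelabel D n (sigma : 'S_n) j : day D n j -> day D n j :=
  lift (fun g : daygen D j n =>
    dayg [ffun i => Blk (bel (g i)) [ffun s => sigma^-1%g (blb (g i) s)]]).

(** The composition product. *)
Definition comp C D : sseq k := @Sseq k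
  (fun n => @Cx k (tot sym C (day D n)) (totdif (@daydif D n)))
  (fun n sigma => totmap 0 (@dayrelabel D n sigma)).

(** Sign of [d_1 .. d_j x_1 .. x_n -> d_1 x_{B_1} .. d_j x_{B_j}], where [x_s]
   has degree [e s] and [B_i] is the sequence of labels of [d_i]. *)
Definition daysign D j n (g : daygen D j n) (e : 'I_n -> int) : k :=
  shuffle (fun i => (bel (g i)).1) (fun i => \sum_s e (blb (g i) s)) *
  koszul (fun z => e (daylab g z)) (fun z => daylab g z).

(** The associativity isomorphism of the composition product, described by
   [((c; d_1, .., d_j); e_1, .., e_m) |-> +- (c; (d_1; e_{B_1}), .., (d_j; e_{B_j}))]. *)
Section Assoc.
Context {C D E : sseq k} {n : nat}.

Definition assoc_arity m (b : blk D m) (w : daygen E m n) : nat :=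
  \sum_(s < arty b) arty (w (blb b s)).

Definition assoc_inner m (b : blk D m) (w : daygen E m n) :
    comp D E (assoc_arity b w) :=
  totg sym (bel b)
    (dayg [ffun s : 'I_(arty b) =>
       Blk (bel (w (blb b s)))
           [ffun t => @tagnat.Rank _ (fun s => arty (w (blb b s))) s t]]
     : day E (assoc_arity b w) (arty b)).

Definition assoc_blk m (b : blk D m) (w : daygen E m n) : blk (comp D E) n :=
  @Blk (comp D E) n (assoc_arity b w)
    ((bel b).1 + \sum_s (bel (w (blb b s))).1, assoc_inner b w)
    [ffun z => blb (w (blb b (tagnat.sig1 z))) (tagnat.sig2 z)].

Definition assoc : comp (comp C D) E n -> comp C (comp D E) n :=
  tlift (fun m (x : int * comp C D m) (u : day E n m) =>
    tlift (fun j (c : int * C j) (v : day D m j) =>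
      daylift (fun g : daygen D j m =>
        daylift (fun w : daygen E m n =>
          daysign g (fun s => (bel (w s)).1) *:
          totg sym c (dayg [ffun i => assoc_blk (g i) w] : day (comp D E) n j))
        u) v) (pr (comp C D m) x.1 x.2)).

End Assoc.

(** [x] of arity [r], relabelled by the permutation of [0..n-1] described by
   [Q]; 0 if [r] is not [n]. *)
Definition relabel C n r (x : C r) (Q : pred 'S_n) : C n :=
  match r =P n with
  | ReflectT e => \sum_(sigma : 'S_n | Q sigma)
      ract C sigma (eq_rect r (fun r => C r : Type) x n e)
  | ReflectF _ => 0
  end.

(** The map [comp C C -> C] which applies the counit [eps] to the root, resp. to
   all the other vertices.  [eps r] is to vanish unless [r = 1]. *)
Definition counit_root C (eps : forall r, C r -> k) n : comp C C n -> C n :=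
  tlift (M := day C n) (fun j c => daylift (fun g : daygen C j n =>
    eps j (pr (C j) c.1 c.2) *:
    \sum_i relabel (pr (C _) (bel (g i)).1 (bel (g i)).2)
             [pred sigma : 'S_n | [forall s, sigma (blb (g i) s) == s :> nat]])).

Definition counit_leaves C (eps : forall r, C r -> k) n : comp C C n -> C n :=
  tlift (M := day C n) (fun j c => daylift (fun g : daygen C j n =>
    (\prod_i eps _ (pr (C _) (bel (g i)).1 (bel (g i)).2)) *:
    relabel (pr (C j) c.1 c.2)
      [pred sigma : 'S_n |
        [forall i, forall s, sigma (blb (g i) s) == i :> nat]])).

End Day.

(** A cooperad (non-symmetric if [sym = false]): a comonoid for the composition
   product, with counit [eps] to the sequence which is [k] in arity 1 and
   degree 0. *)
Record cooperad (sym : bool) (k : comPzRingType) := Cooperad {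
  cseq :> sseq k;
  decomp : forall n, cseq n -> comp sym cseq cseq n;
  eps : forall n, cseq n -> k;
  cseqP : is_sseq sym cseq;
  decompP : forall n,
    [/\ homog 0 (@decomp n),
        forall c, decomp (dif (cseq n) c) = dif (comp sym cseq cseq n) (decomp c) &
        forall sigma : 'S_n, adm sym sigma ->
          forall c, decomp (ract cseq sigma c) = ract (comp sym cseq cseq) sigma (decomp c)];
  epsP : forall n,
    [/\ linear (@eps n : cseq n -> k^o),
        forall i c, i != 0 -> eps (pr (cseq n) i c) = 0,
        forall c, eps (dif (cseq n) c) = 0 &
        n != 1%N -> forall c, @eps n c = 0];
  counitl : forall n (c : cseq n), counit_root eps (decomp c) = c;
  counitr : forall n (c : cseq n), counit_leaves eps (decomp c) = c;
  coassoc : forall n (c : cseq n),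
    assoc (totmapl (M := day sym cseq n) decomp (decomp c)) =
    totmap (N := day sym (comp sym cseq cseq) n) 0
      (fun j => daymap decomp (n := n) (j := j)) (decomp c) }.
Arguments decomp {sym k} C {n} c : rename.
Arguments eps {sym k} C {n} c : rename.

(** [C 1] is identified with [k] by the counit. *)
Definition connected sym k (C : cooperad sym k) : Prop :=
  (forall c : C 0%N, c = 0) /\ bijective (@eps sym k C 1).

(** * Cofree coalgebras *)

Section Cofree.
Context {k : comPzRingType} {sym : bool} (C : cooperad sym k).
Implicit Types M N : gmod k.

Definition Tseq M : lseq k := @Lseq k (T M) (@tact k M).

Definition cofree M : gmod k := tot sym C (Tseq M).

Definition cof M n (c : int * C n) (u : T M n) : cofree M :=
  @totg k sym C (Tseq M) n c u.

Definition cofdif M (d : M -> M) : cofree M -> cofree M :=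
  totdif (M := Tseq M) (tdif d).

Definition cofmap M N (m : int) (f : thick M N) : cofree M -> cofree N :=
  totmap (M := Tseq M) (N := Tseq N) m f.

(** The projection [C[M] -> M]. *)
Definition cofproj M : cofree M -> M :=
  tlift (M := Tseq M) (fun n c => lift (fun x : tgen M n =>
    eps C (pr (C n) c.1 c.2) *: \sum_i pr M (x i).1 (x i).2)).

(** The comultiplication [C[M] -> (C o C)[M] = C[C[M]]]. *)
Definition cofdelta M : cofree M -> cofree (cofree M) :=
  tlift (M := Tseq M) (fun n c (u : T M n) =>
    tlift (M := day sym C n) (fun j c' v =>
      daylift (fun g : daygen C j n =>
        lift (fun x : tgen M n =>
          daysign g (fun s => (x s).1) *:
          cof c' (ten [ffun i =>
            ((bel (g i)).1 + \sum_s (x (blb (g i) s)).1,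
             cof (bel (g i)) (ten [ffun s => x (blb (g i) s)]))]))
        u) v) (decomp C (pr (C n) c.1 c.2))).

(** The thick map induced by a thick map [f] of degree [m].  On the tensor
   product of the elements [(c_i; u_i)] of [C r_i (x) T M r_i] it moves the
   [c_i] to the left, applies [f] to the product of the [u_i], and moves the
   [c_i] back. *)
Definition cofunsplit M n (b : forall i : 'I_n, {r : nat & (int * C r)%type}) :
    T M (\sum_i tag (b i)) -> T (cofree M) n :=
  lift (fun y : tgen M (\sum_i tag (b i)) =>
    let z i := [ffun s => y (@tagnat.Rank _ (fun i => tag (b i)) i s)] in
    shuffle (fun i => (tagged (b i)).1) (fun i => tdeg (z i)) *:
    ten [ffun i => ((tagged (b i)).1 + tdeg (z i), cof (tagged (b i)) (ten (z i)))]).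

Definition cofthick M N (m : int) (f : thick M N) : thick (cofree M) (cofree N) :=
  fun n => lift (fun x : tgen (cofree M) n =>
    mlift (fun b : 'I_n -> totgen C (Tseq M) =>
      let c i := (tagged (b i)).1 in
      let e i := (x i).1 - (c i).1 in
      let u i : T M (tag (b i)) := pr (T M _) (e i) (tagged (b i)).2 in
      (shuffle (fun i => (c i).1) e * sgn (m * \sum_i (c i).1)) *:
      @cofunsplit N n (fun i => existT (fun r => (int * C r)%type) (tag (b i)) (c i))
        (f _ (tflat u)))
    (fun i => (x i).2 : totmod sym C (Tseq M))).

(** Thick maps and contractions of [C]-coalgebras, for coalgebras with
   differentials [dM], [dN] and structure maps [DM], [DN]. *)
Definition thick_coalg_map (m : int) M N
    (DM : M -> cofree M) (DN : N -> cofree N) (f : thick M N) : Prop :=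
  [/\ is_thick m f, symmetric_thick sym f &
      forall a, DN (first_level f a) = cofmap m f (DM a)].

Definition coalg_contraction M N (dM : M -> M) (dN : N -> N)
    (DM : M -> cofree M) (DN : N -> cofree N)
    (f : thick M N) (g : thick N M) (h : thick M M) : Prop :=
  [/\ thick_coalg_map 0 DM DN f, thick_coalg_map 0 DN DM g &
      thick_coalg_map 1 DM DM h] /\
  [/\ thick_bound dM dN 0 f (thick_zero M N),
      thick_bound dN dM 0 g (thick_zero N M) &
      thick_bound dM dM 1 h (thick_sub (thick_comp g f) (thick_id M))] /\
  [/\ thick_eq (thick_comp f g) (thick_id N),
      thick_eq (thick_comp f h) (thick_zero M N),
      thick_eq (thick_comp h h) (thick_zero M M) &
      thick_eq (thick_comp h g) (thick_zero N M)] /\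
  [/\ thick_morphism f, thick_morphism g & pseudo_derivation h].

(** Derivation extending [t] of degree -1. *)
Definition derivation M (t : M -> M) : thick M M := tins (-1) t id.

Definition omega_algebra (A : cx k) (t : cofree A -> cofree A) : Prop :=
  [/\ homog (-1) t,
      forall x, cofdelta (t x) = cofmap (-1) (derivation t) (cofdelta x),
      forall m n x, (n <= m)%N -> wpr m (t (wpr n x)) = 0 &
      forall x, cofdif (dif A) (t x) + t (cofdif (dif A) x) + t (t x) = 0].

(** The bar construction is [cofree A] with the structure map [cofdelta] and
   the following differential. *)
Definition bardif (A : cx k) (t : cofree A -> cofree A) : cofree A -> cofree A :=
  fun x => cofdif (dif A) x + t x.

(** The restriction to weight 1 followed by the projection; the source is
   identified with the weight 1 part of the cofree coalgebra. *)
Definition linear_part M N (F : cofree M -> cofree N) (f : M -> N) : Prop :=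
  forall x, cofproj (F (wpr 1 x)) = f (cofproj (wpr 1 x)).

Definition omega_morphism (A B : cx k) t t' (f : A -> B)
    (F : cofree A -> cofree B) : Prop :=
  [/\ homog 0 F,
      forall x, bardif t' (F x) = F (bardif t x),
      forall x, cofdelta (F x) = cofmap 0 (tpow F) (cofdelta x) &
      linear_part F f].

(** [F] is the first level of the thick map of coalgebras [FF] and has linear part
   [h].  Differentials do not enter: that [FF] is a homotopy is part of
   [coalg_contraction]. *)
Definition omega_homotopy (A : cx k) (h : A -> A)
    (F : cofree A -> cofree A) (FF : thick (cofree A) (cofree A)) : Prop :=
  [/\ thick_coalg_map 1 (@cofdelta A) (@cofdelta A) FF,
      forall x, first_level FF x = F x & linear_part F h].

End Cofree.

(** * The perturbation series *)

(** Series with only finitely many nonzero terms. *)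
Definition summable (V : zmodType) (s : nat -> V) : Prop :=
  exists N, forall i, (N <= i)%N -> s i = 0.
Definition ssum (V : zmodType) (s : nat -> V) : V := \sum_(i \in [set: nat]) s i.

Section Perturb.
Context {X Y : zmodType}.
Implicit Types (F : X -> Y) (G : Y -> X) (H t : X -> X).

Definition termF F t H i x := F (iter i (t \o H) x).
Definition termG t H G i y := iter i (H \o t) (G y).
Definition termH t H i x := H (iter i (t \o H) x).
Definition termt F t H G i y := F (t (iter i (H \o t) (G y))).

Definition pertF F t H x := ssum (fun i => termF F t H i x).
Definition pertG t H G y := ssum (fun i => termG t H G i y).
Definition pertH t H x := ssum (fun i => termH t H i x).
Definition pertt F t H G y := ssum (fun i => termt F t H G i y).

Definition pert_summable F t H G : Prop :=
  [/\ forall x, summable (fun i => termF F t H i x),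
      forall y, summable (fun i => termG t H G i y),
      forall x, summable (fun i => termH t H i x) &
      forall y, summable (fun i => termt F t H G i y)].

End Perturb.

Definition pert_thick k (M : gmod k) (tt hh : thick M M) : thick M M :=
  fun n => pertH (@tt n) (@hh n).

(* Main.v *)
From HB Require Import structures.
Require Import Defs.
From mathcomp Require Import all_boot all_order all_algebra all_fingroup.
From mathcomp Require Import boolp classical_sets fsbigop.
From mathcomp Require Import zify ring.
From Stdlib Require Ncring Ncring_tac.
(* Imported again so that [lift] is the map out of a presented module and not
   the one of [fintype]. *)
Import Defs.

Set Implicit Arguments.
Unset Strict Implicit.
Unset Printing Implicit Defensive.

Import GRing.Theory.
Local Open Scope ring_scope.

(** On every tensor power of [C[A]], [t] lowers the weight and [H] preserves it,
    so [1 - t H] and [1 - H t] are invertible, the inverses [W] and [Wt] being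
    given by finite geometric series.  Then [F' = F W], [G' = Wt G], [H' = H W]
    and [t' = F t Wt G], and the equations of a contraction are the identities
    of the basic perturbation lemma, valid in any noncommutative ring.

    Multiplicativity is an identity of the same kind.  Write [p = g f],
    [h_1 = h_p (x) 1], [h_2 = 1 (x) h_q], [h = h_(p+q)] and similarly for the
    other maps.  The pseudo-derivation property and [d h + h d = p_1 p_2 - 1]
    give [p_1 h = p_1 h_2] and [p_2 h = h_1 p_2], and these imply
    [p_1 p_2 W = p_1 p_2 W_1 W_2], that is, [F W] is a morphism of thick maps.
    It is therefore [(F')^(x)n], where [F'] is its first level; likewise [t'] is a
    derivation, and [H W] a pseudo-derivation.  The comultiplication intertwines
    [t H] with its extension to thick maps, hence also their resolvents.

    For the symmetrization, [A] is the sum of the kernel and the image of [g f].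
    On a word with letters in the kernel at the places of [S] and in the image
    elsewhere, it acts as [1/|S|] times the sum over [i] in [S] of the insertions
    of [h] at the place [i], from which its properties are read off. *)

(** * Signs, linear maps and presented modules *)

Section Signs.
Context {k : comPzRingType}.
Implicit Types e : int.

Lemma sgnE e : sgn e = (-1) ^+ odd `|e|%N :> k.
Proof. by rewrite /sgn signr_odd. Qed.

Lemma sgnD e e' : sgn (e + e') = sgn e * sgn e' :> k.
Proof.
rewrite !sgnE -signr_addb; congr (_ ^+ nat_of_bool _); lia.
Qed.

Lemma sgn0 : sgn 0 = 1 :> k. Proof. by []. Qed.

Lemma sgn_sqr e : sgn e * sgn e = 1 :> k.
Proof. by rewrite sgnE -signr_addb addbb. Qed.

Lemma sgn_eq e e' (z : int) : e = e' + z + z -> sgn e = sgn e' :> k.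
Proof. by move->; rewrite !sgnD -mulrA sgn_sqr mulr1. Qed.

Lemma sgn_sum (I : Type) (r : seq I) (P : pred I) (F : I -> int) :
  sgn (\sum_(i <- r | P i) F i) = \prod_(i <- r | P i) sgn (F i) :> k.
Proof. exact: (big_morph (@sgn k) sgnD sgn0). Qed.

End Signs.

Section LinearMaps.
Context {k : comPzRingType}.
Implicit Types U V W : lmodType k.

Lemma linD U V (f : U -> V) x y : linear f -> f (x + y) = f x + f y.
Proof. by move=> Lf; rewrite -[x in LHS]scale1r Lf scale1r. Qed.

Lemma lin0 U V (f : U -> V) : linear f -> f 0 = 0.
Proof. by move=> Lf; apply: (addrI (f 0)); rewrite -linD // !addr0. Qed.

Lemma linZ U V (f : U -> V) a x : linear f -> f (a *: x) = a *: f x.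
Proof. by move=> Lf; rewrite -[a *: x]addr0 Lf lin0 // addr0. Qed.

Lemma linN U V (f : U -> V) x : linear f -> f (- x) = - f x.
Proof. by move=> Lf; rewrite -scaleN1r linZ // scaleN1r. Qed.

Lemma linB U V (f : U -> V) x y : linear f -> f (x - y) = f x - f y.
Proof. by move=> Lf; rewrite linD // linN. Qed.

Lemma lin_sum U V (f : U -> V) (I : Type) (r : seq I) (P : pred I) (F : I -> U) :
  linear f -> f (\sum_(i <- r | P i) F i) = \sum_(i <- r | P i) f (F i).
Proof.
move=> Lf; apply: (big_morph f) => [x y|]; [exact: linD|exact: lin0].
Qed.

Lemma linear_id U : linear (@id U). Proof. by []. Qed.

Lemma linear_zero U V : linear (fun _ : U => 0 : V).
Proof. by move=> a x y; rewrite scaler0 addr0. Qed.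

Lemma linear_comp U V W (f : V -> W) (g : U -> V) :
  linear f -> linear g -> linear (fun x => f (g x)).
Proof. by move=> Lf Lg a x y; rewrite Lg Lf. Qed.

Lemma linear_add U V (f g : U -> V) :
  linear f -> linear g -> linear (fun x => f x + g x).
Proof. by move=> Lf Lg a x y; rewrite Lf Lg scalerDr addrACA. Qed.

Lemma linear_scale U V (f : U -> V) c :
  linear f -> linear (fun x => c *: f x).
Proof. by move=> Lf a x y; rewrite Lf scalerDr !scalerA mulrC. Qed.

Lemma linear_opp U V (f : U -> V) : linear f -> linear (fun x => - f x).
Proof. by move=> Lf a x y; rewrite Lf opprD scalerN. Qed.

Lemma linear_sub U V (f g : U -> V) :
  linear f -> linear g -> linear (fun x => f x - g x).
Proof. by move=> Lf Lg; apply/linear_add/linear_opp. Qed.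

Lemma linear_sum U V (I : Type) (r : seq I) (P : pred I) (F : I -> U -> V) :
  (forall i, linear (F i)) -> linear (fun x => \sum_(i <- r | P i) F i x).
Proof.
move=> LF a x y; rewrite scaler_sumr -big_split /=; apply: eq_bigr => i _.
exact: LF.
Qed.

Lemma linear_iter U (f : U -> U) n : linear f -> linear (iter n f).
Proof. by move=> Lf; elim: n => // n IH a x y; rewrite !iterS IH Lf. Qed.

End LinearMaps.

Section PresTheory.
Context {k : comPzRingType} {X : Type}.
Context {P : forall V : lmodType k, (X -> V) -> Prop}.

Lemma pres_cls_cons a y (s : seq (k * X)) :
  pres_cls P ((a, y) :: s) = a *: gen P y + pres_cls P s.
Proof.
rewrite -[RHS]pres_repK; apply/pres_clsP => V phi Pphi.
rewrite -/(lift phi _) lift_is_linear // lift_gen // /lift ev_rep //.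
by rewrite /ev big_cons.
Qed.

Lemma pres_clsE s : pres_cls P s = \sum_(p <- s) p.1 *: gen P p.2.
Proof.
elim: s => [|[a y] s IH]; first by rewrite big_nil.
by rewrite pres_cls_cons IH big_cons.
Qed.

Lemma pres_repE (x : pres P) : x = \sum_(p <- pres_rep x) p.1 *: gen P p.2.
Proof. by rewrite -pres_clsE pres_repK. Qed.

Lemma pres_ext (V : lmodType k) (f g : pres P -> V) :
  linear f -> linear g -> (forall y, f (gen P y) = g (gen P y)) -> f =1 g.
Proof.
move=> Lf Lg fg x; rewrite [x]pres_repE !lin_sum //; apply: eq_bigr => p _.
by rewrite !linZ // fg.
Qed.

Lemma pres_ind (Q : pres P -> Prop) :
  Q 0 -> (forall a x y, Q x -> Q y -> Q (a *: x + y)) ->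
  (forall y, Q (gen P y)) -> forall x, Q x.
Proof.
move=> Q0 QD Qg x; rewrite [x]pres_repE; elim: (pres_rep x) => [|p s IH].
  by rewrite big_nil.
by rewrite big_cons; apply: QD.
Qed.

Lemma gen_relE (s t : seq (k * X)) :
  (forall (V : lmodType k) (phi : X -> V), P phi -> ev phi s = ev phi t) ->
  \sum_(p <- s) p.1 *: gen P p.2 = \sum_(p <- t) p.1 *: gen P p.2.
Proof. by move/pres_clsP; rewrite !pres_clsE. Qed.

End PresTheory.

(** * Graded modules and words *)

Inductive span {k : comPzRingType} {V : lmodType k} (S : V -> Prop) : V -> Prop :=
| span0 : span S 0
| spanD a x y : S x -> span S y -> span S (a *: x + y).

Section Span.
Context {k : comPzRingType}.
Implicit Types V W : lmodType k.

Lemma span_gen V (S : V -> Prop) x : S x -> span S x.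
Proof. by move=> Sx; rewrite -[x]scale1r -[_ *: _]addr0; apply/spanD/span0. Qed.

Lemma span_add V (S : V -> Prop) x y : span S x -> span S y -> span S (x + y).
Proof.
move=> sx sy; elim: sx => [|a u v Su _ IH]; first by rewrite add0r.
by rewrite -addrA; apply: spanD.
Qed.

Lemma span_scale V (S : V -> Prop) a x : span S x -> span S (a *: x).
Proof.
elim=> [|b u v Su _ IH]; first by rewrite scaler0; apply: span0.
by rewrite scalerDr scalerA; apply: spanD.
Qed.

Lemma span_sum V (S : V -> Prop) (I : Type) (r : seq I) (P : pred I) F :
  (forall i, P i -> span S (F i)) -> span S (\sum_(i <- r | P i) F i).
Proof.
move=> H; elim/big_rec: _ => [|i x Pi]; first exact: span0.
by apply: span_add; apply: H.
Qed.

Lemma span_lin V W (S : V -> Prop) (S' : W -> Prop) (L : V -> W) x :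
  linear L -> (forall y, S y -> span S' (L y)) -> span S x -> span S' (L x).
Proof.
move=> LL H; elim=> [|a u v Su _ IH]; first by rewrite lin0 //; apply: span0.
by rewrite LL; apply: span_add => //; apply/span_scale/H.
Qed.

Lemma span_eq V W (S : V -> Prop) (L1 L2 : V -> W) x :
  linear L1 -> linear L2 -> (forall y, S y -> L1 y = L2 y) ->
  span S x -> L1 x = L2 x.
Proof.
move=> l1 l2 H; elim=> [|a u v Su _ IH]; first by rewrite !lin0.
by rewrite l1 l2 IH H.
Qed.

End Span.

Section Graded.
Context {k : comPzRingType}.
Implicit Types M N L : gmod k.

Lemma homog_id M : homog 0 (@id M).
Proof. by split=> // i x; rewrite addr0. Qed.

Lemma homog_comp M N L m m' (f : N -> L) (g : M -> N) :
  homog m f -> homog m' g -> homog (m' + m) (fun x => f (g x)).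
Proof.
by move=> [Lf Hf] [Lg Hg]; split=> [|i x]; rewrite ?Hg ?Hf ?addrA //; exact: linear_comp.
Qed.

Lemma homog_lin M N m (f : M -> N) : homog m f -> linear f.
Proof. by case. Qed.

Lemma homog_add M N m (f g : M -> N) : is_gmod N ->
  homog m f -> homog m g -> homog m (fun x => f x + g x).
Proof.
move=> [LN _ _] [Lf Hf] [Lg Hg]; split=> [|i x]; first exact: linear_add.
by rewrite Hf Hg linD.
Qed.

Lemma homog_scale M N m (f : M -> N) c : is_gmod N ->
  homog m f -> homog m (fun x => c *: f x).
Proof.
move=> [LN _ _] [Lf Hf]; split=> [|i x]; first exact: linear_scale.
by rewrite Hf linZ.
Qed.

Lemma homog_zero M N m : is_gmod N -> homog m (fun _ : M => 0 : N).
Proof. by move=> [LN _ _]; split=> [|i x]; [exact: linear_zero|rewrite lin0]. Qed.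

Lemma homog_eq M N m (f g : M -> N) : f =1 g -> homog m f -> homog m g.
Proof. by move=> /funext->. Qed.

Definition hdeg M i (x : M) : Prop := pr M i x = x.

Lemma hdeg_homog M N m i (f : M -> N) x : homog m f -> hdeg i x -> hdeg (i + m) (f x).
Proof. by move=> [_ Hf] hx; rewrite /hdeg -Hf hx. Qed.

Lemma hdeg_pr M i x : is_gmod M -> hdeg i (pr M i x).
Proof. by move=> [_ H _]; rewrite /hdeg H eqxx. Qed.

Lemma prE M i j (x : M) : is_gmod M -> hdeg i x -> pr M j x = if j == i then x else 0.
Proof. by move=> [_ H _] <-; rewrite H; case: eqP => // ->. Qed.

Lemma pr_notin M (s : seq int) x i : is_gmod M ->
  x = \sum_(j <- s) pr M j x -> i \notin s -> pr M i x = 0.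
Proof.
move=> [Lp H _] -> nis; rewrite lin_sum //= big_seq big1 // => j js.
by rewrite H; case: eqP nis => // ->; rewrite js.
Qed.

Definition finsupp_pr M (x : M) := exists2 s : seq int, uniq s & x = \sum_(i <- s) pr M i x.

Lemma finsupp_lin M (x y : M) a :
  (forall i, linear (pr M i)) ->
  (forall i j x, pr M i (pr M j x) = if i == j then pr M i x else 0) ->
  finsupp_pr x -> finsupp_pr y -> finsupp_pr (a *: x + y).
Proof.
move=> Lp H [s us Ex] [t ut Ey]; exists (undup (s ++ t)); first exact: undup_uniq.
have W r z : uniq r -> z = \sum_(i <- r) pr M i z -> {subset r <= s ++ t} ->
    z = \sum_(i <- undup (s ++ t)) pr M i z.
  move=> ur Ez rst; rewrite {1}Ez.
  rewrite [RHS](bigID (mem r)) /= [X in _ + X]big1 ?addr0 => [|i nir]; last first.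
    rewrite Ez lin_sum //= big_seq big1 // => j js.
    by rewrite H; case: eqP nir => // ->; rewrite js.
  rewrite -[RHS]big_filter; apply: perm_big; apply: uniq_perm => //.
    by rewrite filter_uniq // undup_uniq.
  move=> i; rewrite mem_filter mem_undup andbC.
  by case ir: (i \in r); rewrite ?andbF // rst.
under eq_bigr do rewrite Lp; rewrite big_split /= -scaler_sumr.
by rewrite -(W s x) // -?(W t y) // => i ir; rewrite mem_cat ir ?orbT.
Qed.

Lemma finsupp0 M : (forall i, linear (pr M i)) -> finsupp_pr (0 : M).
Proof. by exists [::]; rewrite ?big_nil. Qed.

Lemma finsupp_hdeg M i (x : M) : hdeg i x -> finsupp_pr x.
Proof. by move=> hx; exists [:: i] => //; rewrite big_seq1 hx. Qed.

Lemma gmod_ext M (V : lmodType k) (f g : M -> V) : is_gmod M ->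
  linear f -> linear g -> (forall i x, hdeg i x -> f x = g x) -> f =1 g.
Proof.
move=> gM Lf Lg fg x; have [_ _ /(_ x) [s _ ->]] := gM.
by rewrite !lin_sum //; apply: eq_bigr => i _; apply: (fg i); exact: hdeg_pr.
Qed.

End Graded.

Section Hlin.
Context {k : comPzRingType}.
Implicit Types M N : gmod k.
Implicit Types V W : lmodType k.

Lemma hlin_scale M V (s : int -> k) (phi : int * M -> V) :
  hlin phi -> hlin (fun y => s y.1 *: phi y).
Proof.
move=> [H1 H2]; split=> [e a x y|e x] /=; last by rewrite H2.
by rewrite H1 scalerDr !scalerA mulrC.
Qed.

Lemma hlin_lin M V W (L : V -> W) (phi : int * M -> V) :
  linear L -> hlin phi -> hlin (fun y => L (phi y)).
Proof. by move=> LL [H1 H2]; split=> [e a x y|e x] /=; rewrite ?H1 ?H2 ?LL. Qed.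

Lemma hlin_homog M N V (s : int) (u : M -> N) (phi : int * N -> V) :
  homog s u -> hlin phi -> hlin (fun y : int * M => phi (y.1 + s, u y.2)).
Proof.
move=> [Lu Hu] [H1 H2]; split=> [e a x y|e x] /=; first by rewrite Lu H1.
by rewrite Hu H2.
Qed.

Lemma hlin_sum M V (I : Type) (r : seq I) (P : pred I) (F : I -> int * M -> V) :
  (forall i, P i -> hlin (F i)) -> hlin (fun y => \sum_(i <- r | P i) F i y).
Proof.
move=> HF; split=> [e a x y|e x].
  by rewrite scaler_sumr -big_split /=; apply: eq_bigr => i Pi; rewrite (HF i Pi).1.
by apply: eq_bigr => i Pi; rewrite (HF i Pi).2.
Qed.

Lemma hlin0 M V (phi : int * M -> V) e : hlin phi -> phi (e, 0) = 0.
Proof.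
move=> [H1 _]; apply: (addrI (phi (e, 0))).
by rewrite -[X in X + _]scale1r -H1 scaler0 !addr0.
Qed.

Lemma hlinD M V (phi : int * M -> V) e x y : hlin phi ->
  phi (e, x + y) = phi (e, x) + phi (e, y).
Proof. by move=> [H1 _]; rewrite -[x]scale1r H1 !scale1r. Qed.

Lemma hlinZ M V (phi : int * M -> V) e a x : hlin phi ->
  phi (e, a *: x) = a *: phi (e, x).
Proof. by move=> H; rewrite -[a *: x]addr0 H.1 hlin0 // addr0. Qed.

Lemma hlin_linear M V (phi : int * M -> V) e : hlin phi -> linear (fun x => phi (e, x)).
Proof. by move=> [H _] a x y; apply: H. Qed.

Lemma hlin_hdeg M V (phi : int * M -> V) e e' x : is_gmod M -> hlin phi ->
  hdeg e' x -> phi (e, x) = if e == e' then phi (e, x) else 0.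
Proof.
by move=> gM H hx; rewrite -[LHS]H.2 (prE _ gM hx); case: eqP => // _; rewrite hlin0.
Qed.

Lemma slotwise_sum M n V (I : Type) (r : seq I) (P : pred I)
    (F : I -> tgen M n -> V) :
  (forall i, P i -> slotwise (@hlin k M) (F i)) ->
  slotwise (@hlin k M) (fun y => \sum_(i <- r | P i) F i y).
Proof. by move=> HF x i; apply: hlin_sum => j Pj; apply: HF. Qed.

Lemma slotwise_scale M n V (s : ('I_n -> int) -> k) (phi : tgen M n -> V) :
  slotwise (@hlin k M) phi ->
  slotwise (@hlin k M) (fun x => s (fun j => (x j).1) *: phi x).
Proof.
move=> HF x i; set S := fun e => s (fun j => if j == i then e else (x j).1).
have E : (fun y : int * M => s (fun j => (upd x i y j).1) *: phi (upd x i y)) =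
         (fun y => S y.1 *: phi (upd x i y)).
  apply/funext => y; congr (s _ *: _); apply/funext => j.
  by rewrite ffunE; case: eqP.
by rewrite E; apply: hlin_scale.
Qed.

End Hlin.

Section Ten.
Context {k : comPzRingType}.
Implicit Types M N : gmod k.
Implicit Types V W : lmodType k.

Lemma upd_same n Y (x : {ffun 'I_n -> Y}) i : upd x i (x i) = x.
Proof. by apply/ffunP => j; rewrite ffunE; case: eqP => // ->. Qed.

Lemma ten_slot M n : slotwise (@hlin k M) (@ten k M n).
Proof.
move=> x i; split=> [e a u v|e u].
  have /= := @gen_relE k _ (@slotwise k _ (@hlin k M) n)
    [:: (1, upd x i (e, a *: u + v))] [:: (a, upd x i (e, u)); (1, upd x i (e, v))].
  rewrite !big_cons !big_nil /= !scale1r !addr0; apply=> V phi H.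
  by rewrite /ev !big_cons !big_nil /= !scale1r !addr0 (H x i).1.
have /= := @gen_relE k _ (@slotwise k _ (@hlin k M) n)
    [:: (1, upd x i (e, pr M e u))] [:: (1, upd x i (e, u))].
rewrite !big_cons !big_nil /= !scale1r !addr0; apply=> V phi H.
by rewrite /ev !big_cons !big_nil /= !scale1r !addr0 (H x i).2.
Qed.

Lemma lift_ten M n V (phi : tgen M n -> V) x :
  slotwise (@hlin k M) phi -> lift phi (ten x) = phi x.
Proof. exact: lift_gen. Qed.

Lemma lift_lin M n V (phi : tgen M n -> V) :
  slotwise (@hlin k M) phi -> linear (lift phi : T M n -> V).
Proof. exact: lift_is_linear. Qed.

Lemma ten_ext M n V (f g : T M n -> V) :
  linear f -> linear g -> (forall x, f (ten x) = g (ten x)) -> f =1 g.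
Proof. exact: pres_ext. Qed.

Lemma ten_span M n (S : int -> M -> Prop) V (f g : T M n -> V) :
  linear f -> linear g ->
  (forall e x, span (S e) (pr M e x)) ->
  (forall x : tgen M n, (forall i, S (x i).1 (x i).2) -> f (ten x) = g (ten x)) ->
  f =1 g.
Proof.
move=> Lf Lg HS H; apply: ten_ext => // x.
have: forall i, i \notin enum 'I_n -> S (x i).1 (x i).2 by move=> i; rewrite mem_enum.
elim: (enum 'I_n) x => [|i l IH] x Hx; first by apply: H => i; apply: Hx.
rewrite -(upd_same x i); case xi: (x i) => [e u].
have [_ <-] := @ten_slot M n x i; set y := pr M e u.
have Lt : linear (fun y => ten (upd x i (e, y))).
  exact: (hlin_linear e (@ten_slot M n x i)).
have [F G] : linear (fun y => f (ten (upd x i (e, y)))) /\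
    linear (fun y => g (ten (upd x i (e, y)))) by split; exact: linear_comp.
apply: (span_eq F G _ (HS e u)) => z Sz; apply: IH => j jl; rewrite ffunE.
by case: eqP => [//|/eqP ji]; apply: Hx; rewrite inE negb_or ji.
Qed.

Lemma slotwise_ten M N m n (b : 'I_m -> 'I_n) (s : ('I_n -> int) -> k)
    (mu : 'I_m -> int) (u : 'I_m -> M -> N) :
  bijective b -> (forall j, homog (mu j) (u j)) ->
  slotwise (@hlin k M) (fun x : tgen M n => s (fun j => (x j).1) *:
    ten [ffun j => ((x (b j)).1 + mu j, u j (x (b j)).2)]).
Proof.
move=> [c bK cK] Hu; apply: slotwise_scale => x i.
set z := [ffun j => ((x (b j)).1 + mu j, u j (x (b j)).2)].
have E : (fun y : int * M => ten
    [ffun j => ((upd x i y (b j)).1 + mu j, u j (upd x i y (b j)).2)]) =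
    fun y => ten (upd z (c i) (y.1 + mu (c i), u (c i) y.2)).
  apply/funext => y; congr ten; apply/ffunP => j; rewrite !ffunE.
  by rewrite -(can2_eq bK cK); case: eqP => // <-; rewrite bK.
rewrite E; apply: (hlin_homog (phi := fun y => ten (upd z (c i) y))) => //.
exact: ten_slot.
Qed.

Lemma slotwise_ten_id M n (s : ('I_n -> int) -> k) :
  slotwise (@hlin k M) (fun x : tgen M n => s (fun j => (x j).1) *: ten x).
Proof. by apply: slotwise_scale; apply: ten_slot. Qed.

Lemma slotwise_ten_same M N n (s : ('I_n -> int) -> k)
    (mu : 'I_n -> int) (u : 'I_n -> M -> N) :
  (forall j, homog (mu j) (u j)) ->
  slotwise (@hlin k M) (fun x : tgen M n => s (fun j => (x j).1) *:
    ten [ffun j => ((x j).1 + mu j, u j (x j).2)]).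
Proof. by move=> Hu; apply: (slotwise_ten (b := id)) => //; exists id. Qed.

Lemma pr_slot M n m : slotwise (@hlin k M)
  (fun x : tgen M n => if tdeg x == m then ten x else 0).
Proof.
have := @slotwise_ten_id M n (fun e => if \sum_j e j == m then 1 else 0).
by congr slotwise; apply/funext => x; rewrite /tdeg; case: ifP; rewrite ?scale1r ?scale0r.
Qed.

Lemma pr_ten M n m (x : tgen M n) :
  pr (T M n) m (ten x) = if tdeg x == m then ten x else 0.
Proof. by rewrite /= lift_ten //; apply: pr_slot. Qed.

Lemma pr_T_lin M n m : linear (pr (T M n) m).
Proof. by apply: lift_lin; apply: pr_slot. Qed.

Lemma hdeg_ten M n (x : tgen M n) : hdeg (M := T M n) (tdeg x) (ten x).
Proof. by rewrite /hdeg pr_ten eqxx. Qed.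

Lemma T_gmod M n : is_gmod (T M n).
Proof.
have H i j : (fun x => pr (T M n) i (pr (T M n) j x)) =1
    (fun x => if i == j then pr (T M n) i x else 0).
  apply: ten_ext; first exact/linear_comp/pr_T_lin/pr_T_lin.
    by case: eqP => _; [exact: pr_T_lin|exact: linear_zero].
  move=> x; rewrite !pr_ten; case: (tdeg x =P j) => [xj|xj].
    by rewrite pr_ten xj eq_sym; case: eqP.
  rewrite lin0; last exact: pr_T_lin.
  by case: (i =P j) => // ->; case: eqP.
split=> [i|i j x|]; first exact: pr_T_lin.
  exact: H.
apply: pres_ind => [|a x y Hx Hy|x].
- exact/finsupp0/pr_T_lin.
- by apply: finsupp_lin => // i; exact: pr_T_lin.
- exact/finsupp_hdeg/hdeg_ten.
Qed.

Lemma homog_ten M n (N : gmod k) m (f : T M n -> N) : is_gmod N -> linear f ->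
  (forall x, hdeg (tdeg x + m) (f (ten x))) -> homog m f.
Proof.
move=> gN Lf Hf; split=> // i; apply: ten_ext.
- exact/linear_comp/pr_T_lin.
- by apply: linear_comp => //; case: gN.
move=> x; rewrite pr_ten (prE _ gN (Hf x)) eq_sym (inj_eq (addIr m)).
by case: ifP => // _; rewrite lin0.
Qed.

End Ten.

(** * Koszul signs *)

Section Koszul.
Context {k : comPzRingType}.

Lemma koszulE n (deg : 'I_n -> int) (key : 'I_n -> nat) :
  koszul deg key = \prod_(i < n) \prod_(j < n | (i < j)%N && (key j < key i)%N)
    sgn (deg i * deg j) :> k.
Proof. by rewrite /koszul sgn_sum; apply: eq_bigr => i _; rewrite sgn_sum. Qed.

Lemma koszul_sqr n (deg : 'I_n -> int) (key : 'I_n -> nat) :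
  koszul deg key * koszul deg key = 1 :> k.
Proof. exact: sgn_sqr. Qed.

Lemma shuffle_sqr n (x y : 'I_n -> int) : shuffle x y * shuffle x y = 1 :> k.
Proof. exact: sgn_sqr. Qed.

Lemma koszul_mono n (deg : 'I_n -> int) (key : 'I_n -> nat) :
  {homo key : i j / (i < j)%N >-> (i <= j)%N} -> koszul deg key = 1 :> k.
Proof.
move=> H; rewrite koszulE big1 // => i _; rewrite big1 // => j /andP[ij].
by rewrite ltnNge H.
Qed.

Lemma prod_pairs n (P : 'I_n -> 'I_n -> bool) (f : 'I_n -> 'I_n -> k) :
  (forall i, P i i = false) ->
  \prod_(i < n) \prod_(j | P i j) f i j =
  \prod_(i < n) \prod_(j : 'I_n | (i < j)%N)
    ((if P i j then f i j else 1) * (if P j i then f j i else 1)).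
Proof.
move=> P0; under [RHS]eq_bigr do rewrite big_split /=.
rewrite big_split /=.
have -> : \prod_(i < n) \prod_(j : 'I_n | (i < j)%N) (if P j i then f j i else 1) =
          \prod_(i < n) \prod_(j : 'I_n | (j < i)%N) (if P i j then f i j else 1) :> k.
  under eq_bigr do rewrite big_mkcond /=.
  rewrite exchange_big /=; apply: eq_bigr => i _.
  by rewrite [RHS]big_mkcond.
rewrite -big_split /=; apply: eq_bigr => i _.
rewrite [LHS]big_mkcond (bigID (fun j : 'I_n => (i < j)%N)) /=; congr (_ * _).
rewrite (bigID (fun j : 'I_n => j == i)) /= [X in X * _]big1 ?mul1r.
  by apply: eq_bigl => j; rewrite -leqNgt ltn_neqAle andbC.
by move=> j /andP[_ /eqP ->]; rewrite P0.
Qed.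

Lemma koszul_comp m n (b : 'I_m -> 'I_n) (deg : 'I_n -> int) (key : 'I_n -> nat) :
  bijective b -> injective key ->
  koszul (fun a => deg (b a)) (fun a => key (b a)) =
  koszul (fun a => deg (b a)) (fun a => b a) * koszul deg key :> k.
Proof.
move=> bb kI; have bI := bij_inj bb.
rewrite !koszulE.
have -> : \prod_(i < n) \prod_(j < n | (i < j)%N && (key j < key i)%N) sgn (deg i * deg j) =
    \prod_(a < m) \prod_(c < m | (b a < b c)%N && (key (b c) < key (b a))%N)
      sgn (deg (b a) * deg (b c)) :> k.
  rewrite (reindex b) /=; last exact: onW_bij.
  by apply: eq_bigr => a _; rewrite (reindex b) /=; last exact: onW_bij.
rewrite (prod_pairs (P := fun a c => (b a < b c)%N && (key (b c) < key (b a))%N)); last first.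
  by move=> a; rewrite ltnn.
rewrite -big_split /=; apply: eq_bigr => a _.
rewrite [LHS]big_mkcondr [X in _ = X * _]big_mkcondr -big_split /=.
apply: eq_bigr => c ac.
have nbac : b a != b c :> nat by apply/eqP => /val_inj/bI E; rewrite E ltnn in ac.
have nkac : key (b a) != key (b c) by apply/eqP => /kI/bI E; rewrite E ltnn in ac.
rewrite [deg (b c) * _]mulrC.
case: (ltngtP (b a) (b c)) nbac => // _ _;
  case: (ltngtP (key (b a)) (key (b c))) nkac => // _ _ /=;
  by rewrite ?mulr1 ?mul1r ?sgn_sqr.
Qed.

Lemma koszul_invl n (deg : 'I_n -> int) (s : 'S_n) :
  koszul deg (fun i => s i) =
  koszul (fun i => deg ((s^-1)%g i)) (fun i => (s^-1)%g i) :> k.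
Proof.
have sI : injective (fun i : 'I_n => (s^-1)%g i : nat) by move=> i j /val_inj/perm_inj.
have := koszul_comp (fun i => deg ((s^-1)%g i)) (Bijective (permK s) (permKV s)) sI.
rewrite koszul_mono => [/(congr1 (fun x => koszul deg (fun i => s i) * x))|i j]; last first.
  by rewrite !permK => /ltnW.
have -> : (fun a : 'I_n => deg ((s^-1)%g (s a))) = deg by apply/funext => a; rewrite permK.
by rewrite mulr1 mulrA koszul_sqr mul1r.
Qed.

Lemma koszul_ins n (deg : 'I_n -> int) (key : 'I_n -> nat) (m : int) (i : 'I_n) :
  injective key ->
  koszul (fun a => if a == i then deg a + m else deg a) key =
  koszul deg key *
  \prod_(a < n) (if (a < i)%N (+) (key a < key i)%N then sgn (m * deg a) else 1) :> k.
Proof.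
move=> kI; rewrite !koszulE.
pose X a : k := sgn (m * deg a).
have E (a c : 'I_n) : (a < c)%N -> sgn ((if a == i then deg a + m else deg a) *
      (if c == i then deg c + m else deg c)) =
    sgn (deg a * deg c) * (if a == i then X c else 1) * (if c == i then X a else 1) :> k.
  move=> ac; case: eqP => [ai|_]; case: eqP => [ci|_].
  - by rewrite ai ci ltnn in ac.
  - by rewrite mulr1 -sgnD; congr sgn; ring.
  - by rewrite mulr1 -sgnD; congr sgn; ring.
  - by rewrite !mulr1.
under eq_bigr => a _ do under eq_bigr => c /andP[ac _] do rewrite (E _ _ ac).
under eq_bigr => a _ do rewrite !big_split /=.
rewrite !big_split /= -mulrA; congr (_ * _).
rewrite (bigD1 i) //= [X in _ * X * _]big1 ?mulr1; last first.
  by move=> a /negPf ai; rewrite big1 // => c _; rewrite ai.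
have -> : \prod_(a < n) \prod_(c < n | (a < c)%N && (key c < key a)%N) (if c == i then X a else 1) =
   \prod_(a < n | (a < i)%N && (key i < key a)%N) X a :> k.
  rewrite [RHS]big_mkcond; apply: eq_bigr => a _.
  rewrite big_mkcond (bigD1 i) //= eqxx big1 ?mulr1 //.
  by move=> c /negPf ->; rewrite if_same.
rewrite eqxx big_mkcond [X in _ * X]big_mkcond -big_split; apply: eq_bigr => a _ /=.
case: (a =P i) => [->|/eqP ai]; first by rewrite !ltnn /= mulr1.
have ai' : (a : nat) != i by [].
have ki : key a != key i by apply: contra_neq ai => /kI.
by case: (ltngtP a i) ai' => //= _ _; case: (ltngtP (key a) (key i)) ki => //= _ _;
  rewrite ?mulr1 ?mul1r.
Qed.

End Koszul.

(** * Permutations and concatenation of words *)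

Section Reindex.
Context {k : comPzRingType}.
Implicit Types M N : gmod k.

(** The inverse image of a word under a bijection [b] of the places, with its
    Koszul sign; [tact s] is [reind s^-1]. *)
Definition reind M m n (b : 'I_m -> 'I_n) : T M n -> T M m :=
  lift (fun x : tgen M n =>
    koszul (fun a => (x (b a)).1) (fun a => b a) *: ten [ffun a => x (b a)]).

Lemma reind_slot M m n (b : 'I_m -> 'I_n) : bijective b ->
  slotwise (@hlin k M) (fun x : tgen M n =>
    koszul (fun a => (x (b a)).1) (fun a => b a) *: ten [ffun a => x (b a)]).
Proof.
move=> bb; have := slotwise_ten (fun e : 'I_n -> int => koszul (fun a => e (b a)) (fun a => b a))
   bb (fun j => homog_id M).
congr slotwise; apply/funext => x; congr (_ *: ten _); apply/ffunP => a.
by rewrite !ffunE addr0; case: (x (b a)).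
Qed.

Lemma reind_lin M m n (b : 'I_m -> 'I_n) : bijective b -> linear (@reind M m n b).
Proof. by move=> bb; apply/lift_lin/reind_slot. Qed.

Lemma reind_ten M m n (b : 'I_m -> 'I_n) x : bijective b ->
  reind b (ten x : T M n) =
  koszul (fun a => (x (b a)).1) (fun a => b a) *: ten [ffun a => x (b a)].
Proof. by move=> bb; rewrite /reind lift_ten //; apply: reind_slot. Qed.

Lemma reind_comp M l m n (b : 'I_m -> 'I_n) (c : 'I_l -> 'I_m) :
  bijective b -> bijective c ->
  forall u : T M n, reind c (reind b u) = reind (fun a => b (c a)) u.
Proof.
move=> bb cb; have bcb : bijective (fun a => b (c a)) by exact: bij_comp bb cb.
apply: ten_ext; [by apply: linear_comp; exact: reind_lin|exact: reind_lin|].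
move=> x; rewrite !reind_ten // linZ; last exact: reind_lin.
rewrite reind_ten // scalerA; congr (_ *: ten _); last first.
  by apply/ffunP => a; rewrite !ffunE.
have bI : injective (fun a => nat_of_ord (b a)).
  by move=> i j /val_inj; exact: (bij_inj bb).
rewrite (koszul_comp (fun a => (x (b a)).1) cb bI) mulrC; congr (koszul _ _ * _).
by apply/funext => a; rewrite ffunE.
Qed.

Lemma reind_mono M n (b : 'I_n -> 'I_n) : (forall a, b a = a) ->
  forall u : T M n, reind b u = u.
Proof.
move=> /funext ->; have ib : bijective (fun a : 'I_n => a) by exists id.
apply: ten_ext => //; first exact: reind_lin.
move=> x; rewrite reind_ten // koszul_mono => [|i j /ltnW //].
by rewrite scale1r; congr ten; apply/ffunP => a; rewrite ffunE.
Qed.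

Lemma tactE M n (s : 'S_n) (u : T M n) : tact s u = reind (fun a => (s^-1)%g a) u.
Proof.
congr (lift _ u); apply/funext => x; congr (_ *: _).
by rewrite (koszul_invl (fun i => (x i).1)).
Qed.

Lemma perm_bij n (s : 'S_n) : bijective (fun a => s a).
Proof. by exists (fun a => (s^-1)%g a); [exact: permK|exact: permKV]. Qed.

Lemma tact_lin M n (s : 'S_n) : linear (@tact k M n s).
Proof. by move=> a u v; rewrite !tactE (reind_lin (@perm_bij _ _)). Qed.

Lemma tact1 M n (u : T M n) : tact 1%g u = u.
Proof. by rewrite tactE reind_mono // => a; rewrite invg1 perm1. Qed.

Lemma tactM M n (s t : 'S_n) (u : T M n) : tact (s * t)%g u = tact t (tact s u).
Proof.
rewrite !tactE reind_comp; [|exact: perm_bij|exact: perm_bij].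
by congr reind; apply/funext => a; rewrite invMg permM.
Qed.

Lemma tact_ten M n (s : 'S_n) (x : tgen M n) :
  tact s (ten x) = koszul (fun i => (x i).1) (fun i => s i) *:
    ten [ffun i => x ((s^-1)%g i)].
Proof.
rewrite tactE reind_ten; last exact: perm_bij.
by rewrite (koszul_invl (fun i => (x i).1)).
Qed.

(** Admissible relabellings: those which the group of the theory realises. *)
Definition admb sym m n (b : 'I_m -> 'I_n) : Prop :=
  [/\ m = n, bijective b & sym || [forall a, b a == a :> nat]].

Lemma thick_reind sym M N (f : thick M N) m n (b : 'I_m -> 'I_n) :
  symmetric_thick sym f -> admb sym b ->
  forall u, f m (reind b u) = reind b (f n u).
Proof.
move=> fs [mn bb ad]; subst m; move=> u.
pose s := perm (bij_inj bb); have bE : b = fun a => (s^-1^-1)%g a.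
  by apply/funext => a; rewrite invgK permE.
rewrite bE -!tactE; apply: fs.
rewrite /adm; case: sym ad => //= /forallP ad; apply/eqP/permP => a.
by apply: (canLR (permK _)); apply: val_inj; rewrite perm1 permE /= (eqP (ad a)).
Qed.

Lemma admb_comp sym l m n (b : 'I_m -> 'I_n) (c : 'I_l -> 'I_m) :
  admb sym b -> admb sym c -> admb sym (fun a => b (c a)).
Proof.
move=> [mn bb ab] [lm cb ac]; split; [by rewrite lm|exact: bij_comp bb cb|].
case: sym ab ac => //= /forallP ab /forallP ac; apply/forallP => a.
by rewrite (eqP (ab _)) (eqP (ac _)).
Qed.

Lemma reind_homog M m n (b : 'I_m -> 'I_n) : bijective b ->
  homog 0 (@reind M m n b).
Proof.
move=> bb; apply: homog_ten; [exact: T_gmod|exact: reind_lin|move=> x].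
rewrite reind_ten // /hdeg (linZ _ _ (@pr_T_lin _ _ _ _)) pr_ten addr0.
suff -> : tdeg [ffun a => x (b a)] = tdeg x by rewrite eqxx.
rewrite /tdeg [RHS](reindex b) /=; last exact: onW_bij.
by apply: eq_bigr => a _; rewrite ffunE.
Qed.

End Reindex.

Lemma split_lshift m n (i : 'I_m) : split (lshift n i) = inl i.
Proof. exact: (unsplitK (inl i)). Qed.
Lemma split_rshift m n (i : 'I_n) : split (rshift m i) = inr i.
Proof. exact: (unsplitK (inr i)). Qed.

Section Concat.
Context {k : comPzRingType}.
Implicit Types M N L : gmod k.

Definition gcat M p q (x : tgen M p) (y : tgen M q) : tgen M (p + q) :=
  [ffun s => match split s with inl i => x i | inr j => y j end].
Definition gl M p q (x : tgen M (p + q)) : tgen M p := [ffun i => x (lshift q i)].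
Definition gr M p q (x : tgen M (p + q)) : tgen M q := [ffun i => x (rshift p i)].

Lemma gcatl M p q (x : tgen M p) (y : tgen M q) i : gcat x y (lshift q i) = x i.
Proof. by rewrite ffunE split_lshift. Qed.
Lemma gcatr M p q (x : tgen M p) (y : tgen M q) i : gcat x y (rshift p i) = y i.
Proof. by rewrite ffunE split_rshift. Qed.

Lemma gcatK M p q (x : tgen M (p + q)) : gcat (gl x) (gr x) = x.
Proof.
apply/ffunP => s; case: (split_ordP s) => i ->.
  by rewrite gcatl ffunE.
by rewrite gcatr ffunE.
Qed.
Lemma glK M p q (x : tgen M p) (y : tgen M q) : gl (gcat x y) = x.
Proof. by apply/ffunP => i; rewrite ffunE gcatl. Qed.
Lemma grK M p q (x : tgen M p) (y : tgen M q) : gr (gcat x y) = y.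
Proof. by apply/ffunP => i; rewrite ffunE gcatr. Qed.

Lemma gcat_updl M p q (x : tgen M p) (y : tgen M q) i a :
  gcat (upd x i a) y = upd (gcat x y) (lshift q i) a.
Proof.
apply/ffunP => s; rewrite [RHS]ffunE; case: (split_ordP s) => j ->.
  by rewrite !gcatl ffunE (inj_eq (@lshift_inj _ _)).
by rewrite !gcatr eq_rlshift.
Qed.
Lemma gcat_updr M p q (x : tgen M p) (y : tgen M q) i a :
  gcat x (upd y i a) = upd (gcat x y) (rshift p i) a.
Proof.
apply/ffunP => s; rewrite [RHS]ffunE; case: (split_ordP s) => j ->.
  by rewrite !gcatl eq_lrshift.
by rewrite !gcatr ffunE (inj_eq (@rshift_inj _ _)).
Qed.

Lemma tcat_slotr M p q (x : tgen M p) :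
  slotwise (@hlin k M) (fun y : tgen M q => ten (gcat x y)).
Proof.
move=> y i; have := @ten_slot k M _ (gcat x y) (rshift p i).
by congr hlin; apply/funext => a; rewrite gcat_updr.
Qed.

Lemma tcat_slotl M p q (v : T M q) :
  slotwise (@hlin k M) (fun x : tgen M p => lift (fun y => ten (gcat x y)) v).
Proof.
move=> x i; split=> [e a u w|e u].
  apply: (@ten_ext _ _ _ _ (fun v => lift (fun y => ten (gcat (upd x i (e, a *: u + w)) y)) v)
    (fun v => a *: lift (fun y => ten (gcat (upd x i (e, u)) y)) v
            + lift (fun y => ten (gcat (upd x i (e, w)) y)) v)).
  - exact/lift_lin/tcat_slotr.
  - apply/linear_add; last exact/lift_lin/tcat_slotr.
    exact/linear_scale/lift_lin/tcat_slotr.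
  - move=> y; rewrite !lift_ten; try exact: tcat_slotr.
    by rewrite !gcat_updl (@ten_slot k M _ (gcat x y) (lshift q i)).1.
apply: (@ten_ext _ _ _ _ (fun v => lift (fun y => ten (gcat (upd x i (e, pr M e u)) y)) v)
    (fun v => lift (fun y => ten (gcat (upd x i (e, u)) y)) v)).
- exact/lift_lin/tcat_slotr.
- exact/lift_lin/tcat_slotr.
- move=> y; rewrite !lift_ten; try exact: tcat_slotr.
  by rewrite !gcat_updl (@ten_slot k M _ (gcat x y) (lshift q i)).2.
Qed.

Lemma tcat_linl M p q (v : T M q) : linear (fun u : T M p => tcat u v).
Proof. exact/lift_lin/tcat_slotl. Qed.

Lemma tcat_tenl M p q (x : tgen M p) (v : T M q) :
  tcat (ten x) v = lift (fun y => ten (gcat x y)) v.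
Proof. by rewrite /tcat lift_ten //; apply: tcat_slotl. Qed.

Lemma tcat_ten M p q (x : tgen M p) (y : tgen M q) :
  tcat (ten x) (ten y) = ten (gcat x y).
Proof. by rewrite tcat_tenl lift_ten //; apply: tcat_slotr. Qed.

Lemma tcat_linr M p q (u : T M p) : linear (fun v : T M q => tcat u v).
Proof.
move=> a v w.
apply: (@ten_ext _ _ _ _ (fun u => tcat u (a *: v + w))
  (fun u => a *: tcat u v + tcat u w)).
- exact: tcat_linl.
- by apply/linear_add/tcat_linl/linear_scale/tcat_linl.
- by move=> x; rewrite !tcat_tenl (lift_lin (@tcat_slotr M p q x)).
Qed.

Lemma tcat0l M p q (v : T M q) : tcat (0 : T M p) v = 0.
Proof. exact: (lin0 (@tcat_linl M p q v)). Qed.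
Lemma tcat0r M p q (u : T M p) : tcat u (0 : T M q) = 0.
Proof. exact: (lin0 (@tcat_linr M p q u)). Qed.
Lemma tcatZl M p q a (u : T M p) (v : T M q) : tcat (a *: u) v = a *: tcat u v.
Proof. exact: (linZ _ _ (@tcat_linl M p q v)). Qed.
Lemma tcatZr M p q a (u : T M p) (v : T M q) : tcat u (a *: v) = a *: tcat u v.
Proof. exact: (linZ _ _ (@tcat_linr M p q u)). Qed.

Lemma ten_cat M p q (x : tgen M (p + q)) : ten x = tcat (ten (gl x)) (ten (gr x)).
Proof. by rewrite tcat_ten gcatK. Qed.

Lemma gl_upd M p q (x : tgen M (p + q)) s a :
  gl (upd x s a) = match split s with inl i => upd (gl x) i a | inr _ => gl x end.
Proof.
case: split_ordP => i ->; apply/ffunP => j; rewrite !ffunE.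
  by rewrite (inj_eq (@lshift_inj _ _)).
by rewrite eq_lrshift.
Qed.
Lemma gr_upd M p q (x : tgen M (p + q)) s a :
  gr (upd x s a) = match split s with inl _ => gr x | inr i => upd (gr x) i a end.
Proof.
case: split_ordP => i ->; apply/ffunP => j; rewrite !ffunE.
  by rewrite eq_rlshift.
by rewrite (inj_eq (@rshift_inj _ _)).
Qed.

Lemma tens_slot M N p q m (f : T M p -> T N p) (g : T M q -> T N q) :
  linear f -> linear g ->
  slotwise (@hlin k M) (fun x : tgen M (p + q) =>
    sgn (m * \sum_i (x (lshift q i)).1) *: tcat (f (ten (gl x))) (g (ten (gr x)))).
Proof.
move=> Lf Lg; apply: (slotwise_scale (fun e => sgn (m * \sum_i e (lshift q i)))).
move=> x s; case: (split_ordP s) => i Es.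
  have E : (fun y => tcat (f (ten (gl (upd x s y)))) (g (ten (gr (upd x s y))))) =
      (fun y => tcat (f (ten (upd (gl x) i y))) (g (ten (gr x)))).
    by apply/funext => y; rewrite gl_upd gr_upd Es split_lshift.
  rewrite E; apply: (hlin_lin (L := fun u => tcat (f u) (g (ten (gr x))))).
    by apply: (linear_comp (f := fun u => tcat u _)) => //; exact: tcat_linl.
  exact: ten_slot.
have E : (fun y => tcat (f (ten (gl (upd x s y)))) (g (ten (gr (upd x s y))))) =
    (fun y => tcat (f (ten (gl x))) (g (ten (upd (gr x) i y)))).
  by apply/funext => y; rewrite gl_upd gr_upd Es split_rshift.
rewrite E; apply: (hlin_lin (L := fun u => tcat (f (ten (gl x))) (g u))).
  by apply: linear_comp => //; exact: tcat_linr.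
exact: ten_slot.
Qed.

Lemma tens_ten M N p q m (f : T M p -> T N p) (g : T M q -> T N q) x :
  linear f -> linear g ->
  tens m f g (ten x) = sgn (m * tdeg (gl x)) *: tcat (f (ten (gl x))) (g (ten (gr x))).
Proof.
move=> Lf Lg; rewrite /tens lift_ten; last exact: tens_slot.
by congr (sgn (m * _) *: _); apply: eq_bigr => i _; rewrite ffunE.
Qed.

Lemma tens_lin M N p q m (f : T M p -> T N p) (g : T M q -> T N q) :
  linear f -> linear g -> linear (tens m f g).
Proof. by move=> Lf Lg; apply/lift_lin/tens_slot. Qed.

Lemma tens_tcat M N p q m (f : T M p -> T N p) (g : T M q -> T N q) i u v :
  linear f -> linear g -> hdeg i u ->
  tens m f g (tcat u v) = sgn (m * i) *: tcat (f u) (g v).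
Proof.
move=> Lf Lg <-; have Lt := tens_lin m Lf Lg.
have Lp := @pr_T_lin k M p i.
apply: (@ten_ext _ _ _ _ (fun v => tens m f g (tcat (pr (T M p) i u) v))
  (fun v => sgn (m * i) *: tcat (f (pr (T M p) i u)) (g v))).
- by apply: linear_comp => //; exact: tcat_linr.
- by apply: linear_scale; apply: linear_comp => //; exact: tcat_linr.
move=> y; apply: (@ten_ext _ _ _ _ (fun u => tens m f g (tcat (pr (T M p) i u) (ten y)))
  (fun u => sgn (m * i) *: tcat (f (pr (T M p) i u)) (g (ten y)))).
- apply: linear_comp => //.
  by apply: (linear_comp (f := fun u => tcat u _)) => //; exact: tcat_linl.
- apply: linear_scale.
  apply: (linear_comp (f := fun u => tcat u _)); first exact: tcat_linl.
  exact: linear_comp.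
move=> x; rewrite pr_ten; case: eqP => [<-|_].
  by rewrite tcat_ten tens_ten // glK grK.
by rewrite (lin0 Lf) !tcat0l scaler0 lin0.
Qed.

Lemma tens_comp M N L p q m m' d (f : T N p -> T L p) (g : T N q -> T L q)
    (f' : T M p -> T N p) (g' : T M q -> T N q) :
  linear f -> linear g -> homog d f' -> linear g' ->
  forall u, tens m f g (tens m' f' g' u) =
  sgn (m * d) *: tens (m + m') (fun x => f (f' x)) (fun x => g (g' x)) u.
Proof.
move=> Lf Lg [Lf' Hf'] Lg'.
have Lff : linear (fun x => f (f' x)) by exact: linear_comp.
have Lgg : linear (fun x => g (g' x)) by exact: linear_comp.
have Lt := tens_lin m Lf Lg; have Lt' := tens_lin m' Lf' Lg'.
apply: ten_ext; [exact: linear_comp|exact/linear_scale/tens_lin|move=> x].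
rewrite !tens_ten // linZ // (@tens_tcat _ _ _ _ _ _ _ (tdeg (gl x) + d)) //; last first.
  by apply: (@hdeg_homog _ (T M p) (T N p)) => //; exact: hdeg_ten.
rewrite !scalerA -!sgnD; congr (sgn _ *: _); ring.
Qed.

Lemma tens_id M p q u : tens 0 (@id (T M p)) (@id (T M q)) u = u.
Proof.
move: u; apply: ten_ext => //; first exact: tens_lin.
by move=> x; rewrite tens_ten // mul0r scale1r -ten_cat.
Qed.

Lemma tens_lincombl M N p q m a (f f' : T M p -> T N p) (g : T M q -> T N q) :
  linear f -> linear f' -> linear g ->
  forall u, tens m (fun x => a *: f x + f' x) g u = a *: tens m f g u + tens m f' g u.
Proof.
move=> Lf Lf' Lg; have Lff : linear (fun x => a *: f x + f' x).
  exact/linear_add/Lf'/linear_scale.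
apply: ten_ext; first exact: tens_lin.
  by apply: linear_add; [apply: linear_scale|]; exact: tens_lin.
move=> x; rewrite !tens_ten // (tcat_linl (g _)).
by rewrite scalerDr !scalerA mulrC.
Qed.

Lemma tens_lincombr M N p q m a (f : T M p -> T N p) (g g' : T M q -> T N q) :
  linear f -> linear g -> linear g' ->
  forall u, tens m f (fun x => a *: g x + g' x) u = a *: tens m f g u + tens m f g' u.
Proof.
move=> Lf Lg Lg'; have Lgg : linear (fun x => a *: g x + g' x).
  exact/linear_add/Lg'/linear_scale.
apply: ten_ext; first exact: tens_lin.
  by apply: linear_add; [apply: linear_scale|]; exact: tens_lin.
move=> x; rewrite !tens_ten // (tcat_linr (f _)).
by rewrite scalerDr !scalerA mulrC.
Qed.

Lemma tens0l M N p q m (g : T M q -> T N q) u : linear g ->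
  tens m (fun _ : T M p => 0 : T N p) g u = 0.
Proof.
move=> Lg; have Lz : linear (fun _ : T M p => 0 : T N p) by exact: linear_zero.
move: u; apply: ten_ext; [exact: tens_lin|exact: linear_zero|move=> x].
by rewrite tens_ten // tcat0l scaler0.
Qed.

Lemma tens0r M N p q m (f : T M p -> T N p) u : linear f ->
  tens m f (fun _ : T M q => 0 : T N q) u = 0.
Proof.
move=> Lf; have Lz : linear (fun _ : T M q => 0 : T N q) by exact: linear_zero.
move: u; apply: ten_ext; [exact: tens_lin|exact: linear_zero|move=> x].
by rewrite tens_ten // tcat0r scaler0.
Qed.

End Concat.

(** * Endomorphisms of tensor powers *)

Section Lend.
Context {k : comPzRingType}.

Record lend (V : lmodType k) := Lend { lfun :> V -> V; lfunP : linear lfun }.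

Section Ring.
Context {V : lmodType k}.
Implicit Types f g : lend V.

Lemma lendP f g : f =1 g -> f = g.
Proof.
case: f g => [f Lf] [g Lg] /= /funext fg; subst g.
by congr Lend; apply: Prop_irrelevance.
Qed.

HB.instance Definition _ := gen_eqMixin (lend V).
HB.instance Definition _ := gen_choiceMixin (lend V).

Definition lend0 := Lend (@linear_zero k V V).
Definition lend1 := Lend (@linear_id k V).
Definition lend_add f g := Lend (linear_add (lfunP f) (lfunP g)).
Definition lend_opp f := Lend (linear_opp (lfunP f)).
Definition lend_mul f g := Lend (linear_comp (lfunP f) (lfunP g)).

Fact lend_addA : associative lend_add.
Proof. by move=> f g h; apply: lendP => x /=; rewrite addrA. Qed.
Fact lend_addC : commutative lend_add.
Proof. by move=> f g; apply: lendP => x /=; rewrite addrC. Qed.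
Fact lend_add0 : left_id lend0 lend_add.
Proof. by move=> f; apply: lendP => x /=; rewrite add0r. Qed.
Fact lend_addN : left_inverse lend0 lend_opp lend_add.
Proof. by move=> f; apply: lendP => x /=; rewrite addNr. Qed.
HB.instance Definition _ :=
  GRing.isZmodule.Build (lend V) lend_addA lend_addC lend_add0 lend_addN.

Fact lend_mulA : associative lend_mul. Proof. by move=> f g h; apply: lendP. Qed.
Fact lend_mul1 : left_id lend1 lend_mul. Proof. by move=> f; apply: lendP. Qed.
Fact lend_mulr1 : right_id lend1 lend_mul. Proof. by move=> f; apply: lendP. Qed.
Fact lend_mulDl : left_distributive lend_mul lend_add.
Proof. by move=> f g h; apply: lendP. Qed.
Fact lend_mulDr : right_distributive lend_mul lend_add.
Proof. by move=> f g h; apply: lendP => x /=; rewrite linD //; apply: lfunP. Qed.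
HB.instance Definition _ := GRing.Zmodule_isPzRing.Build (lend V)
  lend_mulA lend_mul1 lend_mulr1 lend_mulDl lend_mulDr.

Lemma lendM f g x : (f * g) x = f (g x). Proof. by []. Qed.
Lemma lendD f g x : (f + g) x = f x + g x. Proof. by []. Qed.
Lemma lendN f x : (- f) x = - f x. Proof. by []. Qed.
Lemma lend1E x : (1 : lend V) x = x. Proof. by []. Qed.
Lemma lend0E x : (0 : lend V) x = 0. Proof. by []. Qed.
Definition lendE := (lendM, lendD, lendN, lend1E, lend0E).

End Ring.
End Lend.

Section Tens.
Context {k : comPzRingType}.
Implicit Types M N L : gmod k.

Lemma tens0_tcat M N p q (f : T M p -> T N p) (g : T M q -> T N q) u v :
  linear f -> linear g -> tens 0 f g (tcat u v) = tcat (f u) (g v).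
Proof.
move=> Lf Lg; have Lt := tens_lin 0 Lf Lg.
move: u; apply: ten_ext.
- by apply: linear_comp => //; exact: tcat_linl.
- by apply: (linear_comp (f := fun u => tcat u _)) => //; exact: tcat_linl.
by move=> x; rewrite (tens_tcat _ _ Lf Lg (hdeg_ten x)) mul0r scale1r.
Qed.

Definition tl M p q (f : lend (T M p)) : lend (T M (p + q)) :=
  Lend (tens_lin 0 (lfunP f) (@linear_id k (T M q))).
Definition tr M p q m (g : lend (T M q)) : lend (T M (p + q)) :=
  Lend (tens_lin m (@linear_id k (T M p)) (lfunP g)).

Section TL.
Context {M : gmod k} {p q : nat}.
Implicit Types (f : lend (T M p)) (g : lend (T M q)).
Local Notation tl := (@tl M p q).
Local Notation tr := (@tr M p q).

Lemma tens_lr m f g : Lend (tens_lin m (lfunP f) (lfunP g)) = tl f * tr m g.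
Proof.
apply: lendP => u; rewrite lendE /= (tens_comp _ _ (lfunP f) _ (@homog_id _ _) (lfunP g)) //.
by rewrite mulr0 scale1r add0r.
Qed.

Lemma tl1 : tl 1 = 1.
Proof. by apply: lendP => u /=; rewrite tens_id. Qed.

Lemma tr1 : tr 0 1 = 1.
Proof. by apply: lendP => u /=; rewrite tens_id. Qed.

Lemma tlM f f' : tl (f * f') = tl f * tl f'.
Proof.
have [[Lf Lf'] Lff] := (lfunP f, lfunP f', lfunP (f * f')).
apply: lendP => u; move: u; apply: ten_ext; [exact: lfunP|exact: lfunP|].
move=> x; rewrite lendE /= !tens_ten // !mul0r !scale1r.
by rewrite tens0_tcat.
Qed.

Lemma trM m m' g g' : tr (m + m') (g * g') = tr m g * tr m' g'.
Proof.
apply: lendP => u /=.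
rewrite (tens_comp _ _ (@linear_id k (T M p)) (lfunP g) (@homog_id _ (T M p)) (lfunP g')).
by rewrite mulr0 scale1r.
Qed.

Lemma tlD f f' : tl (f + f') = tl f + tl f'.
Proof.
apply: lendP => u /=.
have /= := tens_lincombl 0 1 (lfunP f) (lfunP f') (@linear_id k (T M q)) u.
rewrite scale1r => <-; congr tens; apply/funext => x; by rewrite scale1r.
Qed.

Lemma trD m g g' : tr m (g + g') = tr m g + tr m g'.
Proof.
apply: lendP => u /=.
have /= := tens_lincombr m 1 (@linear_id k (T M p)) (lfunP g) (lfunP g') u.
rewrite scale1r => <-; congr tens; apply/funext => x; by rewrite scale1r.
Qed.

Lemma tl0 : tl 0 = 0.
Proof. by apply: lendP => u; apply: tens0l. Qed.
Lemma tr0 m : tr m 0 = 0.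
Proof. by apply: lendP => u; apply: tens0r. Qed.
Lemma tlN f : tl (- f) = - tl f.
Proof. by apply: (addrI (tl f)); rewrite -tlD !subrr tl0. Qed.
Lemma trN m g : tr m (- g) = - tr m g.
Proof. by apply: (addrI (tr m g)); rewrite -trD !subrr tr0. Qed.

Lemma tr_tl m d f g : homog (M := T M p) (N := T M p) d f ->
  forall u, (tr m g * tl f) u = sgn (m * d) *: (tl f * tr m g) u.
Proof.
move=> Hf u; rewrite -tens_lr lendE /=.
by rewrite (tens_comp _ _ (@linear_id k (T M p)) (lfunP g) Hf (@linear_id k (T M q))) addr0.
Qed.

Lemma tr_tl_comm m d f g : homog (M := T M p) (N := T M p) d f ->
  ~~ odd `|(m * d)%R|%N -> tr m g * tl f = tl f * tr m g.
Proof.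
move=> Hf md; apply: lendP => u.
by rewrite (tr_tl _ _ Hf) sgnE (negPf md) expr0 scale1r.
Qed.

Lemma tr_tl_anti m d f g : homog (M := T M p) (N := T M p) d f ->
  odd `|(m * d)%R|%N -> tr m g * tl f = - (tl f * tr m g).
Proof.
move=> Hf md; apply: lendP => u.
by rewrite (tr_tl _ _ Hf) sgnE md expr1 scaleN1r.
Qed.

End TL.
End Tens.

Section PowIns.
Context {k : comPzRingType}.
Implicit Types M N L : gmod k.

Lemma ten_zero M n (x : tgen M n) i : (x i).2 = 0 -> ten x = 0.
Proof.
move=> xi; rewrite -(upd_same x i); case: (x i) xi => e a /= ->.
exact: (hlin0 e (@ten_slot k M n x i)).
Qed.

Lemma tpow_slot M N (f : M -> N) n : homog 0 f ->
  slotwise (@hlin k M) (fun x : tgen M n => ten [ffun i => ((x i).1, f (x i).2)]).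
Proof.
move=> Hf; have := slotwise_ten_same (fun _ : 'I_n -> int => 1) (fun j => Hf).
congr slotwise; apply/funext => x; rewrite scale1r; congr ten; apply/ffunP => i.
by rewrite !ffunE addr0.
Qed.

Lemma tpow_ten M N (f : M -> N) n (x : tgen M n) : homog 0 f ->
  tpow f (ten x) = ten [ffun i => ((x i).1, f (x i).2)].
Proof. by move=> Hf; rewrite /tpow lift_ten //; apply: tpow_slot. Qed.

Lemma tpow_lin M N (f : M -> N) n : homog 0 f -> linear (@tpow k M N f n).
Proof. by move=> Hf; apply/lift_lin/tpow_slot. Qed.

Lemma tpow_homog M N (f : M -> N) n : homog 0 f -> homog 0 (@tpow k M N f n).
Proof.
move=> Hf; apply: homog_ten; [exact: T_gmod|exact: tpow_lin|move=> x].
rewrite tpow_ten // addr0.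
suff -> : tdeg x = tdeg [ffun i => ((x i).1, f (x i).2)] by exact: hdeg_ten.
by apply: eq_bigr => i _; rewrite ffunE.
Qed.

Lemma tpow_split M N (f : M -> N) p q : homog 0 f ->
  forall u, tpow f u = tens 0 (@tpow k M N f p) (@tpow k M N f q) u.
Proof.
move=> Hf; have L n := @tpow_lin M N f n Hf.
apply: ten_ext => //; first exact: tens_lin.
move=> x; rewrite tens_ten // mul0r scale1r !tpow_ten // tcat_ten; congr ten.
apply/ffunP => s; rewrite ffunE -{1 2}(gcatK x); case: (split_ordP s) => i ->.
  by rewrite !gcatl !ffunE.
by rewrite !gcatr !ffunE.
Qed.

Lemma tpow_comp M N L (f : N -> L) (g : M -> N) n : homog 0 f -> homog 0 g ->
  forall u : T M n, tpow f (tpow g u) = tpow (fun x => f (g x)) u.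
Proof.
move=> Hf Hg; have Hfg : homog 0 (fun x => f (g x)) := homog_comp Hf Hg.
apply: ten_ext; [by apply: linear_comp; exact: tpow_lin|exact: tpow_lin|].
move=> x; rewrite !tpow_ten //; congr ten; apply/ffunP => i.
by rewrite !ffunE.
Qed.

Lemma tpow_id M n (u : T M n) : tpow id u = u.
Proof.
have Hi := homog_id M; move: u; apply: ten_ext => //; first exact: tpow_lin.
move=> x; rewrite tpow_ten //; congr ten; apply/ffunP => i.
by rewrite !ffunE; case: (x i).
Qed.

Lemma tpow_reind M N (f : M -> N) m n (b : 'I_m -> 'I_n) : homog 0 f -> bijective b ->
  forall u : T M n, tpow f (reind b u) = reind b (tpow f u).
Proof.
move=> Hf bb; have Lf n' := @tpow_lin M N f n' Hf.
have Lb := fun M => @reind_lin k M _ _ b bb.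
apply: ten_ext; [exact: linear_comp|exact: linear_comp|move=> x].
rewrite reind_ten // linZ // !tpow_ten // reind_ten //.
congr (_ *: ten _); last by apply/ffunP => i; rewrite !ffunE.
by congr koszul; apply/funext => a; rewrite ffunE.
Qed.

Definition ginsf M (m : int) (u v : M -> M) n (i : 'I_n) (x : tgen M n) : tgen M n :=
  [ffun j : 'I_n => if (j < i)%N then x j
                    else if j == i then ((x j).1 + m, u (x j).2)
                    else ((x j).1, v (x j).2)].

Lemma tins_slot1 M m (u v : M -> M) n (i : 'I_n) : homog m u -> homog 0 v ->
  slotwise (@hlin k M) (fun x : tgen M n =>
    sgn (m * \sum_(j < n | (j < i)%N) (x j).1) *: ten (ginsf m u v i x)).
Proof.
move=> Hu Hv.
pose mu (j : 'I_n) := if j == i then m else 0.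
pose U (j : 'I_n) := if (j < i)%N then id else if j == i then u else v.
have HU j : homog (mu j) (U j).
  rewrite /mu /U; case: (j =P i) => [->|_]; first by rewrite ltnn.
  by case: ifP => // _; exact: homog_id.
have := slotwise_ten_same (fun e : 'I_n -> int => sgn (m * \sum_(j < n | (j < i)%N) e j)) HU.
congr slotwise; apply/funext => x; congr (_ *: ten _); apply/ffunP => j.
rewrite !ffunE /mu /U; case: (j =P i) => [->|_]; first by rewrite ltnn.
by case: ifP => _; rewrite addr0 //; case: (x j).
Qed.

Lemma tins_slot M m (u v : M -> M) n : homog m u -> homog 0 v ->
  slotwise (@hlin k M) (fun x : tgen M n => \sum_(i < n)
    sgn (m * \sum_(j < n | (j < i)%N) (x j).1) *: ten (ginsf m u v i x)).
Proof. by move=> Hu Hv; apply: slotwise_sum => i _; exact: tins_slot1. Qed.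

Lemma tins_ten M m (u v : M -> M) n (x : tgen M n) : homog m u -> homog 0 v ->
  tins m u v (ten x) = \sum_(i < n)
    sgn (m * \sum_(j < n | (j < i)%N) (x j).1) *: ten (ginsf m u v i x).
Proof. by move=> Hu Hv; rewrite /tins lift_ten //; apply: tins_slot. Qed.

Lemma tins_lin M m (u v : M -> M) n : homog m u -> homog 0 v ->
  linear (@tins k M m u v n).
Proof. by move=> Hu Hv; apply/lift_lin/tins_slot. Qed.

Lemma tdeg_gins M m (u v : M -> M) n (i : 'I_n) x : tdeg (ginsf m u v i x) = tdeg x + m.
Proof.
rewrite /tdeg (bigD1 i) //= [\sum_j (x j).1](bigD1 i) //= ffunE ltnn eqxx /= addrAC; congr (_ + _ + _).
by apply: eq_bigr => j /negPf ji; rewrite ffunE ji; case: ifP.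
Qed.

Lemma tins_homog M m (u v : M -> M) n : homog m u -> homog 0 v ->
  homog m (@tins k M m u v n).
Proof.
move=> Hu Hv; apply: homog_ten; [exact: T_gmod|exact: tins_lin|move=> x].
rewrite tins_ten // /hdeg (lin_sum _ _ _ (@pr_T_lin _ _ _ _)).
apply: eq_bigr => i _; rewrite (linZ _ _ (@pr_T_lin _ _ _ _)).
by rewrite pr_ten tdeg_gins eqxx.
Qed.

Lemma tins_split M m (u v : M -> M) p q : homog m u -> homog 0 v ->
  forall w, tins m u v w = tens 0 (@tins k M m u v p) (@tpow k M M v q) w
    + tens m id (@tins k M m u v q) w.
Proof.
move=> Hu Hv; have Li n := @tins_lin M m u v n Hu Hv.
have Lv n := @tpow_lin M M v n Hv.
apply: ten_ext => //.
  by apply: linear_add; apply: tens_lin.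
move=> x; rewrite !tens_ten // mul0r scale1r !tins_ten // tpow_ten //.
rewrite big_split_ord /=; congr (_ + _).
  rewrite (lin_sum _ _ _ (@tcat_linl _ _ _ _ _)); apply: eq_bigr => i _.
  rewrite (linZ _ _ (@tcat_linl _ _ _ _ _)) tcat_ten; congr (sgn (m * _) *: ten _).
    rewrite big_split_ord /= [X in _ + X]big1 ?addr0; last first.
      by move=> j; rewrite ltnNge ltnW //; apply: ltn_addr.
    by apply: eq_bigr => j _; rewrite ffunE.
  apply/ffunP => s; rewrite !ffunE; case: splitP => j js; rewrite !ffunE.
    have -> : s = lshift q j by apply: val_inj.
    by rewrite (inj_eq (@lshift_inj _ _)).
  have -> : s = rshift p j by apply: val_inj.
  by rewrite eq_rlshift /= ltnNge ltnW //=; apply: ltn_addr.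
rewrite (lin_sum _ _ _ (@tcat_linr _ _ _ _ _)) scaler_sumr; apply: eq_bigr => i _.
rewrite (linZ _ _ (@tcat_linr _ _ _ _ _)) tcat_ten scalerA -sgnD -mulrDr.
congr (sgn (m * _) *: ten _).
  rewrite big_split_ord /=; congr (_ + _).
    rewrite /tdeg big_mkcond; apply: eq_bigr => j _ /=.
    by rewrite ffunE ltn_addr.
  by rewrite big_mkcond [RHS]big_mkcond; apply: eq_bigr => j _; rewrite ltn_add2l ffunE.
apply/ffunP => s; rewrite !ffunE; case: splitP => j js; rewrite !ffunE.
  have -> : s = lshift q j by apply: val_inj.
  by rewrite /= ltn_addr.
have -> : s = rshift p j by apply: val_inj.
by rewrite (inj_eq (@rshift_inj _ _)) /= ltn_add2l.
Qed.

Lemma tins0 M m (u v : M -> M) (w : T M 0) : homog m u -> homog 0 v -> tins m u v w = 0.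
Proof.
move=> Hu Hv; move: w; apply: ten_ext; [exact: tins_lin|exact: linear_zero|].
by move=> x; rewrite tins_ten // big_ord0.
Qed.

Lemma tpow0 M (v : M -> M) (w : T M 0) : homog 0 v -> tpow v w = w.
Proof.
move=> Hv; move: w; apply: ten_ext => //; [exact: tpow_lin|].
by move=> x; rewrite tpow_ten //; congr ten; apply/ffunP => -[].
Qed.

Lemma tinsD M m (u u' : M -> M) n : is_gmod M -> homog m u -> homog m u' ->
  forall w : T M n, tins m (fun x => u x + u' x) id w = tins m u id w + tins m u' id w.
Proof.
move=> gM Hu Hu'; have Hi := homog_id M.
have Huu := homog_add gM Hu Hu'.
apply: ten_ext; first exact: tins_lin.
  by apply: linear_add; exact: tins_lin.
move=> x; rewrite !tins_ten // -big_split /=; apply: eq_bigr => i _.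
rewrite -scalerDr; congr (_ *: _).
have E (w : M -> M) : ginsf m w id i x = upd x i ((x i).1 + m, w (x i).2).
  apply/ffunP => j; rewrite !ffunE; case: (j =P i) => [->|_]; first by rewrite ltnn.
  by case: ifP => //; case: (x j).
by rewrite !E (hlinD _ _ _ (@ten_slot k M n x i)).
Qed.

Lemma ginsE M m (u : M -> M) n (i : 'I_n) x :
  ginsf m u id i x = upd x i ((x i).1 + m, u (x i).2).
Proof.
apply/ffunP => j; rewrite !ffunE; case: (j =P i) => [->|_]; first by rewrite ltnn.
by case: ifP => //; case: (x j).
Qed.

Lemma reind_gins M m (u : M -> M) l n (b : 'I_l -> 'I_n) (i : 'I_l) (x : tgen M n) :
  bijective b -> homog m u ->
  reind b (sgn (m * \sum_(j < n | (j < b i)%N) (x j).1) *: ten (ginsf m u id (b i) x)) =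
  koszul (fun a => (x (b a)).1) (fun a => b a) *:
  (sgn (m * \sum_(j < l | (j < i)%N) (x (b j)).1) *:
   ten (ginsf m u id i [ffun a => x (b a)])) :> T M l.
Proof.
move=> bb Hu; have bI := bij_inj bb.
rewrite (linZ _ _ (reind_lin bb)) reind_ten // !scalerA; congr (_ *: ten _); last first.
  rewrite !ginsE; apply/ffunP => a; rewrite !ffunE (inj_eq bI).
  by [].
have -> : (fun a => (ginsf m u id (b i) x (b a)).1) =
    (fun a => if a == i then (x (b a)).1 + m else (x (b a)).1).
  by apply/funext => a; rewrite ginsE ffunE (inj_eq bI); case: eqP => [->|].
rewrite (koszul_ins (fun a => (x (b a)).1)); last by move=> a c /val_inj/bI.
rewrite mulrCA; congr (_ * _).
rewrite !mulr_sumr !sgn_sum (reindex b) /=; last exact: onW_bij.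
rewrite big_mkcond -big_split /= [RHS]big_mkcond; apply: eq_bigr => a _.
by case: (a < i)%N; case: (b a < b i)%N; rewrite /= ?mulr1 ?mul1r ?sgn_sqr.
Qed.

Lemma tins_reind M m (u : M -> M) l n (b : 'I_l -> 'I_n) : bijective b -> homog m u ->
  forall w : T M n, tins m u id (reind b w) = reind b (tins m u id w).
Proof.
move=> bb Hu; have Hi := homog_id M.
have Lu n' := @tins_lin M m u id n' Hu Hi; have Lb := @reind_lin k M _ _ b bb.
apply: ten_ext; [exact: linear_comp|exact: linear_comp|move=> x].
rewrite reind_ten // linZ // !tins_ten // (lin_sum _ _ _ Lb).
rewrite [RHS](reindex b) /=; last exact: onW_bij.
rewrite scaler_sumr; apply: eq_bigr => i _.
rewrite reind_gins //; congr (_ *: (sgn (m * _) *: _)).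
by apply: eq_bigr => j _; rewrite ffunE.
Qed.

End PowIns.

Section One.
Context {k : comPzRingType}.
Implicit Types M N : gmod k.

Lemma ten1_hlin M : hlin (fun y : int * M => ten [ffun _ : 'I_1 => y]).
Proof.
have := @ten_slot k M 1 [ffun=> (0, 0)] ord0.
congr hlin; apply/funext => y; congr ten; apply/ffunP => i.
by rewrite !ffunE (ord1 i) eqxx.
Qed.

Lemma one_hdeg M e (a : M) : is_gmod M -> hdeg e a -> one a = ten [ffun _ : 'I_1 => (e, a)].
Proof.
move=> gM ha; rewrite /one (fsbigE [:: e]) //=.
- by rewrite big_mkcond big_seq1 mem_set.
- by move=> i _ /=; rewrite inE => ie; rewrite (hlin_hdeg _ gM (ten1_hlin M) ha) (negPf ie).
Qed.

Lemma one_sum M (s : seq int) (a : M) : is_gmod M -> uniq s -> a = \sum_(i <- s) pr M i a ->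
  one a = \sum_(i <- s) ten [ffun _ : 'I_1 => (i, a)].
Proof.
move=> gM us Ea; rewrite /one (fsbigE s) //=.
- by apply: eq_bigl => i; rewrite mem_set.
- move=> i _ /= nis; have [_ <-] := ten1_hlin M; rewrite (pr_notin gM Ea nis).
  exact: (hlin0 _ (ten1_hlin M)).
Qed.

Lemma one_lin M : is_gmod M -> linear (@one k M).
Proof.
move=> gM c a a'; have [_ _ F] := gM; have [Lp PP _] := gM.
have [s us Ea] := F a; have [t ut Ea'] := F a'.
have W r (z : M) : uniq r -> z = \sum_(i <- r) pr M i z -> {subset r <= s ++ t} ->
    z = \sum_(i <- undup (s ++ t)) pr M i z.
  move=> ur Ez rst; rewrite {1}Ez.
  rewrite [RHS](bigID (mem r)) /= [X in _ + X]big1 ?addr0 => [|i nir]; last first.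
    exact: pr_notin nir.
  rewrite -[RHS]big_filter; apply: perm_big; apply: uniq_perm => //.
    by rewrite filter_uniq // undup_uniq.
  move=> i; rewrite mem_filter mem_undup andbC.
  by case ir: (i \in r); rewrite ?andbF // rst.
have Wa := W s a us Ea; have Wa' := W t a' ut Ea'.
have {}Wa : a = \sum_(i <- undup (s ++ t)) pr M i a.
  by apply: Wa => i ir; rewrite mem_cat ir.
have {}Wa' : a' = \sum_(i <- undup (s ++ t)) pr M i a'.
  by apply: Wa' => i ir; rewrite mem_cat ir orbT.
rewrite !(@one_sum _ (undup (s ++ t))) ?undup_uniq //; last first.
  under eq_bigr do rewrite Lp; by rewrite big_split /= -scaler_sumr -Wa -Wa'.
rewrite scaler_sumr -big_split /=; apply: eq_bigr => i _.
exact: (ten1_hlin M).1.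
Qed.

Lemma unone_slot M : is_gmod M ->
  slotwise (@hlin k M) (fun x : tgen M 1 => pr M (x ord0).1 (x ord0).2).
Proof.
move=> [Lp PP _] x i; rewrite (ord1 i); split=> [e c a a'|e a]; rewrite !ffunE eqxx /=.
  exact: Lp.
by rewrite PP eqxx.
Qed.

Lemma unone_ten M (x : tgen M 1) : is_gmod M -> unone (ten x) = pr M (x ord0).1 (x ord0).2.
Proof. by move=> gM; rewrite /unone lift_ten //; apply: unone_slot. Qed.

Lemma unone_lin M : is_gmod M -> linear (@unone k M).
Proof. by move=> gM; apply/lift_lin/unone_slot. Qed.

Lemma oneK M : is_gmod M -> cancel (@one k M) (@unone k M).
Proof.
move=> gM; apply: (gmod_ext gM) => //.
  by apply: linear_comp; [exact: unone_lin|exact: one_lin].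
by move=> i x hx; rewrite (one_hdeg gM hx) unone_ten // ffunE.
Qed.

Lemma unoneK M : is_gmod M -> cancel (@unone k M) (@one k M).
Proof.
move=> gM; apply: ten_ext => //.
  by apply: linear_comp; [exact: one_lin|exact: unone_lin].
move=> x; rewrite unone_ten // (one_hdeg gM (hdeg_pr _ _ gM)).
have [_ ->] := ten1_hlin M; congr ten; apply/ffunP => i.
by rewrite ffunE (ord1 i); case: (x ord0).
Qed.

Lemma tpow_one M N (f : M -> N) a : is_gmod M -> is_gmod N -> homog 0 f ->
  tpow f (one a) = one (f a).
Proof.
move=> gM gN Hf; move: a; apply: (gmod_ext gM).
- by apply: linear_comp; [exact: tpow_lin|exact: one_lin].
- by apply: linear_comp; [exact: one_lin|case: Hf].
move=> i x hx; have hfx : hdeg i (f x) by rewrite -[i]addr0; exact: hdeg_homog hx.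
rewrite (one_hdeg gM hx) (one_hdeg gN hfx) tpow_ten //; congr ten.
by apply/ffunP => j; rewrite !ffunE.
Qed.

Lemma tins_one M m (u v : M -> M) a : is_gmod M -> homog m u -> homog 0 v ->
  tins m u v (one a) = one (u a).
Proof.
move=> gM Hu Hv; move: a; apply: (gmod_ext gM).
- by apply: linear_comp; [exact: tins_lin|exact: one_lin].
- by apply: linear_comp; [exact: one_lin|case: Hu].
move=> i x hx; have hux := hdeg_homog Hu hx.
rewrite (one_hdeg gM hx) (one_hdeg gM hux) tins_ten // big_ord1.
rewrite big_pred0 ?mulr0 ?scale1r //; congr ten.
by apply/ffunP => j; rewrite !ffunE !ord1.
Qed.

End One.

(** * Perturbation identities in noncommutative rings *)

Section NoncommutativeRing.
Context (R : pzRingType).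

#[local] Instance ncr_ops : @Ncring.Ring_ops R 0 1 (fun x y => x + y)
  (fun x y => x * y) (fun x y => x - y) (fun x => - x) eq := {}.
#[local] Instance ncr_ring : @Ncring.Ring R 0 1 (fun x y => x + y)
  (fun x y => x * y) (fun x y => x - y) (fun x => - x) eq ncr_ops.
Proof.
split; try (by typeclasses eauto); try (by move=> ? ? -> ? ? ->);
  try (by move=> ? ? ->).
- exact: add0r.
- exact: (@addrC R).
- exact: (@addrA R).
- exact: mul1r.
- exact: mulr1.
- exact: mulrA.
- exact: (@mulrDl R).
- move=> x y z; exact: (@mulrDr R).
- by [].
- exact: (@subrr R).
Qed.

Ltac ncring := Ncring_tac.non_commutative_ring.

(* [cert (u * (l - r) * v + ...)] reduces an identity to the equations [l = r]
   that a subsequent rewriting uses. *)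
Ltac cert e := apply/eqP; rewrite -subr_eq0; apply/eqP; transitivity e; first by ncring.

Definition resolvent (x W : R) := (1 - x) * W = 1 /\ W * (1 - x) = 1.

Lemma resolvent_uniq x W X y : resolvent x W -> X * (1 - x) = y -> X = y * W.
Proof. by move=> [H1 H2] <-; rewrite -mulrA H1 mulr1. Qed.

Lemma resolvent_right x W : resolvent x W -> W = 1 + W * x.
Proof.
move=> [_ H]; cert (W * (1 - x) - 1); by rewrite H subrr.
Qed.

Lemma resolvent_left x W : resolvent x W -> W = 1 + x * W.
Proof.
move=> [H _]; cert ((1 - x) * W - 1); by rewrite H subrr.
Qed.

Section Perturbation.
Context {d t H p W Wt : R}.
Hypotheses (rW : resolvent (t * H) W) (rWt : resolvent (H * t) Wt).
Hypotheses (dH : d * H + H * d = p - 1) (dt : d * t + t * d + t * t = 0).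
Hypotheses (HH : H * H = 0) (pH : p * H = 0) (Hp : H * p = 0).

Lemma pert_HW : H * W = Wt * H.
Proof.
have [a _] := rW; have [_ b] := rWt.
cert ((1 - Wt * (1 - H * t)) * (H * W) + Wt * H * ((1 - t * H) * W - 1)).
by rewrite a b !subrr mul0r mulr0 addr0.
Qed.

Lemma pert_tWt : t * Wt = W * t.
Proof.
have [_ a] := rW; have [b _] := rWt.
cert ((1 - W * (1 - t * H)) * (t * Wt) + W * t * ((1 - H * t) * Wt - 1)).
by rewrite a b !subrr mul0r mulr0 addr0.
Qed.

Lemma pert_Wd : W * (d + t) = d * W + W * t * p * W.
Proof.
have [a b] := rW.
cert (W * (d + t) * (1 - (1 - t * H) * W) - (1 - W * (1 - t * H)) * d * W
  - W * t * (p - 1 - (d * H + H * d)) * W - W * (d * t + t * d + t * t) * H * W).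
by rewrite a b dH dt !subrr !(mulr0, mul0r) !subr0.
Qed.

Lemma pert_dWt : (d + t) * Wt = Wt * d + Wt * p * t * Wt.
Proof.
have [a b] := rWt.
cert ((1 - Wt * (1 - H * t)) * (d + t) * Wt - Wt * d * (1 - (1 - H * t) * Wt)
  - Wt * (p - 1 - (d * H + H * d)) * t * Wt - Wt * H * (d * t + t * d + t * t) * Wt).
by rewrite a b dH dt !subrr !(mulr0, mul0r) !subr0.
Qed.

Lemma pert_dt' : d * (t * Wt) + t * Wt * d + t * Wt * p * t * Wt = 0.
Proof.
transitivity (d * t * Wt + t * (Wt * d + Wt * p * t * Wt)); first by ncring.
by rewrite -pert_dWt; transitivity ((d * t + t * d + t * t) * Wt); [ncring|rewrite dt mul0r].
Qed.

Lemma pert_dH' : (d + t) * (H * W) + H * W * (d + t) = Wt * p * W - 1.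
Proof.
have [a _] := rW; have [_ b] := rWt.
cert ((H * W - Wt * H) * (d + t) + (1 - Wt * (1 - H * t)) * (d + t) * H * W
  + Wt * H * (d + t) * (1 - (1 - t * H) * W) + Wt * (d * H + H * d - (p - 1)) * W
  - Wt * H * (d * t + t * d + t * t) * H * W
  + (1 - Wt * (1 - H * t)) + Wt * (1 - H * t) * (1 - (1 - t * H) * W)).
by rewrite pert_HW a b dH dt !subrr !(mulr0, mul0r) !(addr0, oppr0).
Qed.

Lemma pert_pWH : p * W * H = 0.
Proof.
rewrite (resolvent_right rW); transitivity (p * H + p * W * t * (H * H)); first by ncring.
by rewrite HH pH mulr0 addr0.
Qed.

Lemma pert_HWp : H * Wt * p = 0.
Proof.
rewrite (resolvent_left rWt); transitivity (H * p + (H * H) * t * Wt * p); first by ncring.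
by rewrite HH Hp !mul0r addr0.
Qed.

Lemma pert_HWHW : H * W * (H * W) = 0.
Proof. by rewrite {1}pert_HW -mulrA [H * (H * W)]mulrA HH mul0r mulr0. Qed.

Lemma pert_WWt : W * Wt = Wt + W * t * (H * Wt).
Proof. by rewrite {1}(resolvent_right rW); ncring. Qed.

End Perturbation.

(** [h1] and [h2] stand for [h_p (x) 1] and [1 (x) h_q], and [H] for [h_(p+q)]. *)
Section Homotopies.
Context {d d1 d2 h1 h2 H p1 p2 : R}.
Hypotheses (dE : d = d1 + d2)
  (dh1 : d1 * h1 + h1 * d1 = p1 - 1) (dh2 : d2 * h2 + h2 * d2 = p2 - 1)
  (dH : d * H + H * d = p1 * p2 - 1)
  (c12 : h2 * h1 = - (h1 * h2))
  (cd1h2 : d1 * h2 = - (h2 * d1)) (cd2h1 : d2 * h1 = - (h1 * d2))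
  (cp2h1 : p2 * h1 = h1 * p2) (cp1h2 : p1 * h2 = h2 * p1) (cp : p2 * p1 = p1 * p2)
  (h1p : h1 * p1 = 0) (ph1 : p1 * h1 = 0) (h2p : h2 * p2 = 0) (ph2 : p2 * h2 = 0)
  (pp1 : p1 * p1 = p1) (pp2 : p2 * p2 = p2) (pH : p1 * p2 * H = 0)
  (PD : (h1 - h2) * H = h1 * h2).

Lemma proj_homotopies : (p2 - p1) * H = h1 * p2 - p1 * h2.
Proof.
have D1 : d * h1 + h1 * d = p1 - 1.
  by rewrite dE; cert ((d1 * h1 + h1 * d1 - (p1 - 1)) + (d2 * h1 - - (h1 * d2)));
     rewrite dh1 cd2h1 !subrr addr0.
have D2 : d * h2 + h2 * d = p2 - 1.
  by rewrite dE; cert ((d2 * h2 + h2 * d2 - (p2 - 1)) + (d1 * h2 - - (h2 * d1)));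
     rewrite dh2 cd1h2 !subrr addr0.
have Z1 : h1 * (p1 * p2) = 0 by rewrite mulrA h1p mul0r.
have Z2 : h2 * (p1 * p2) = 0 by rewrite -cp mulrA h2p mul0r.
cert ((d * h1 + h1 * d - (p1 - 1)) * H - (d * h2 + h2 * d - (p2 - 1)) * H
  - d * ((h1 - h2) * H - h1 * h2) + ((h1 - h2) * H - h1 * h2) * d
  + (h2 - h1) * (d * H + H * d - (p1 * p2 - 1))
  + h2 * (p1 * p2) - h1 * (p1 * p2)
  - (d * h1 + h1 * d - (p1 - 1)) * h2 + h1 * (d * h2 + h2 * d - (p2 - 1))).
by rewrite D1 D2 dH PD Z1 Z2 !subrr !(mul0r, mulr0) !(oppr0, addr0).
Qed.

Lemma proj1_homotopy : p1 * H = p1 * h2.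
Proof.
cert (- (p1 * ((p2 - p1) * H - (h1 * p2 - p1 * h2))) + p1 * p2 * H
  - p1 * h1 * p2 - (p1 * p1 - p1) * H + (p1 * p1 - p1) * h2).
by rewrite proj_homotopies pH ph1 pp1 !subrr !(mulr0, mul0r) oppr0 !addr0.
Qed.

Lemma proj2_homotopy : p2 * H = h1 * p2.
Proof.
cert (p2 * ((p2 - p1) * H - (h1 * p2 - p1 * h2)) - (p2 * p2 - p2) * H
  + p2 * p1 * H + (p2 * h1 - h1 * p2) * p2 + h1 * (p2 * p2 - p2)
  - (p2 * p1 - p1 * p2) * h2 - p1 * (p2 * h2)).
by rewrite proj_homotopies cp pH cp2h1 pp2 ph2 !subrr !(mulr0, mul0r) !(oppr0, addr0).
Qed.

End Homotopies.

Section Multiplicativity.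
Context {a b h1 h2 H p1 p2 U V W : R}.
Hypotheses (rU : resolvent (a * h1) U) (rV : resolvent (b * h2) V)
  (rW : resolvent ((a + b) * H) W).
Hypotheses (c12 : h2 * h1 = - (h1 * h2)) (cab : b * a = - (a * b))
  (cah2 : h2 * a = - (a * h2)) (cbh1 : b * h1 = - (h1 * b))
  (cp2h1 : p2 * h1 = h1 * p2) (cp1h2 : p1 * h2 = h2 * p1) (cp : p2 * p1 = p1 * p2)
  (cp2a : p2 * a = a * p2) (cp1b : p1 * b = b * p1).
Hypotheses (p1H : p1 * H = p1 * h2) (p2H : p2 * H = h1 * p2)
  (PD : (h1 - h2) * H = h1 * h2).

Lemma comm_resolvent x X y : resolvent x X -> y * x = x * y -> y * X = X * y.
Proof.
move=> [r1 r2] c; transitivity (X * (1 - x) * y * X); first by rewrite r2 mul1r.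
transitivity (X * y * ((1 - x) * X)); last by rewrite r1 mulr1.
by cert (X * (y * x - x * y) * X); rewrite c subrr mulr0 mul0r.
Qed.

Lemma morphism_resolvents : p1 * p2 * W = p1 * p2 * U * V.
Proof.
suff E : p1 * p2 * U * V * (1 - (a + b) * H) = p1 * p2.
  by rewrite -(resolvent_uniq rW E).
have cU2 : p2 * U = U * p2.
  by apply: (comm_resolvent rU); rewrite mulrA cp2a -mulrA cp2h1 mulrA.
have h2U : h2 * U = U * h2.
  by apply: (comm_resolvent rU); rewrite mulrA cah2 mulNr -mulrA c12 mulrN opprK mulrA.
have bU : b * U = U * b.
  by apply: (comm_resolvent rU); rewrite mulrA cab mulNr -mulrA cbh1 mulrN opprK mulrA.
have aV : a * V = V * a.
  apply: (comm_resolvent rV); transitivity (- (b * a * h2)).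
    by rewrite cab mulNr opprK mulrA.
  by rewrite -!mulrA cah2 mulrN.
have h1V : h1 * V = V * h1.
  apply: (comm_resolvent rV); transitivity (- (b * h1 * h2)).
    by rewrite cbh1 mulNr opprK mulrA.
  by rewrite -!mulrA c12 mulrN.
have p1V : p1 * V = V * p1.
  by apply: (comm_resolvent rV); rewrite mulrA cp1b -mulrA cp1h2 mulrA.
have Ua : U - 1 = U * (a * h1) by rewrite {1}(resolvent_right rU) addrAC subrr add0r.
have Vb : V - 1 = V * (b * h2) by rewrite {1}(resolvent_right rV) addrAC subrr add0r.
pose P := p1 * U * a; pose Q := p2 * V * b.
have QPh : Q * h2 = p2 * V - p2.
  by rewrite /Q -!mulrA -Vb mulrBr mulr1.
have Ph1 : P * h1 = p1 * U - p1.
  by rewrite /P -!mulrA -Ua mulrBr mulr1.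
have c2 x y z : z * x = x * z -> z * y = y * z -> z * (x * y) = x * y * z.
  by move=> zx zy; rewrite mulrA zx -mulrA zy mulrA.
have Uh2 : p1 * U * h2 = h2 * (p1 * U) by rewrite c2.
have h2P : P * h2 = - (h2 * P).
  by rewrite /P -mulrA -[a * h2]opprK -cah2 mulrN [in LHS]mulrA Uh2 !mulrA.
have p2P : p2 * P = P * p2 by rewrite /P c2 // c2.
have VU : V * U = U * V by apply: (comm_resolvent rU); rewrite c2.
pose X := p1 * U; pose Y := p2 * V.
have pX : p2 * X = X * p2 by rewrite /X c2.
have VX : V * X = X * V by rewrite /X c2.
have XY : X * Y = Y * X by rewrite /Y c2.
have XE : p1 * p2 * U * V = X * Y by rewrite /X /Y -!mulrA (mulrA p2) cU2 -mulrA.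
have Ya : Y * a = a * Y by rewrite /Y c2.
have Xb : X * b = b * X by apply/esym/c2.
have XQ : X * Q = Q * X by rewrite /Q -/Y mulrA XY -[LHS]mulrA Xb mulrA.
have X1 : X * H = h2 * X - h2 * P * H.
  rewrite -/X in Uh2 Ph1; clearbody X P.
  cert ((X - p1 - P * h1) * H + (p1 * H - p1 * h2) + P * ((h1 - h2) * H - h1 * h2)
    + (P * h1 - (X - p1)) * h2 + (P * h2 + h2 * P) * H + (X * h2 - h2 * X)).
  by rewrite Ph1 p1H PD h2P Uh2 !subrr !(mulr0, mul0r) addNr mul0r !addr0.
have E1 : X * Y * a = Y * P by rewrite XY /P -/X mulrA.
have E2 : X * Y * b * H = (Y - p2) * X - (Y - p2) * (P * H).
  have -> : X * Y * b = Q * X by rewrite -XQ /Q -/Y mulrA.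
  by rewrite -mulrA X1 mulrBr !mulrA QPh.
have E3 : p2 * (P * H) = X * p2 - p1 * p2.
  by rewrite mulrA p2P -mulrA p2H mulrA Ph1 mulrBl.
rewrite XE; transitivity (X * Y - X * Y * a * H - X * Y * b * H); first by ncring.
rewrite E1 E2 XY; transitivity (p2 * X - p2 * (P * H)); first by ncring.
by rewrite E3 pX; ncring.
Qed.

End Multiplicativity.

Section PseudoDerivation.
Context {a b h1 h2 H U V W : R}.
Hypotheses (rU : resolvent (a * h1) U) (rV : resolvent (b * h2) V)
  (rW : resolvent ((a + b) * H) W).
Hypotheses (c12 : h2 * h1 = - (h1 * h2)) (cab : b * a = - (a * b))
  (cah2 : h2 * a = - (a * h2)) (cbh1 : b * h1 = - (h1 * b))
  (PD : (h1 - h2) * H = h1 * h2).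

Lemma pseudo_derivation_resolvents :
  (h1 * U - h2 * V) * (H * W) = h1 * U * (h2 * V).
Proof.
have aV : a * V = V * a.
  apply: (comm_resolvent rV); transitivity (- (b * a * h2)).
    by rewrite cab mulNr opprK mulrA.
  by rewrite -!mulrA cah2 mulrN.
have h1V : h1 * V = V * h1.
  apply: (comm_resolvent rV); transitivity (- (b * h1 * h2)).
    by rewrite cbh1 mulNr opprK mulrA.
  by rewrite -!mulrA c12 mulrN.
pose P := h1 * U * a; pose Q := h2 * V * b.
have EU : h1 * U = h1 + P * h1.
  by rewrite {1}(resolvent_right rU) mulrDr mulr1 /P !mulrA.
have EV : h2 * V = h2 + Q * h2.
  by rewrite {1}(resolvent_right rV) mulrDr mulr1 /Q !mulrA.
have h2a : h1 * U * (h2 * V) * a = - (P * (h2 * V)).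
  rewrite -[LHS]mulrA -[h2 * V * a]mulrA -aV [h2 * (a * V)]mulrA cah2.
  by rewrite mulNr mulrN /P !mulrA.
have h1b : h1 * U * (h2 * V) * b = h1 * U * Q by rewrite -[LHS]mulrA.
have h1Q : h1 * Q = Q * h1.
  rewrite /Q mulrA [h1 * (h2 * V)]mulrA -[h1 * h2]opprK -c12 !mulNr.
  rewrite -[h2 * h1 * V]mulrA h1V -!mulrA -[h1 * b]opprK -cbh1.
  by rewrite !mulrN opprK.
have E : h1 * U * (h2 * V) * (1 - (a + b) * H) = (h1 * U - h2 * V) * H.
  transitivity (h1 * U * (h2 * V) - h1 * U * (h2 * V) * a * H - h1 * U * (h2 * V) * b * H).
    by ncring.
  rewrite h2a h1b EU EV; clearbody P Q.
  cert (- ((h1 - h2) * H - h1 * h2) - P * ((h1 - h2) * H - h1 * h2)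
    - Q * ((h1 - h2) * H - h1 * h2) - P * Q * ((h1 - h2) * H - h1 * h2)
    + (h1 * Q - Q * h1) * h2 + P * (h1 * Q - Q * h1) * h2
    - (h1 * Q - Q * h1) * H - P * (h1 * Q - Q * h1) * H).
  by rewrite PD h1Q !subrr !(mulr0, mul0r) !(oppr0, addr0).
by rewrite mulrA (resolvent_uniq rW E).
Qed.

End PseudoDerivation.
Lemma tensor_homotopy (a b h1 h2 p1 p2 : R) :
  a * h1 + h1 * a = p1 - 1 -> b * h2 + h2 * b = p2 - 1 ->
  b * h1 = - (h1 * b) -> h2 * a = - (a * h2) -> p2 * a = a * p2 -> b * p2 = p2 * b ->
  (a + b) * (h1 * p2 + h2) + (h1 * p2 + h2) * (a + b) = p1 * p2 - 1.
Proof.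
move=> c5 c6 c1 c2 c3 c4.
cert ((a * h1 + h1 * a - (p1 - 1)) * p2 + (b * h2 + h2 * b - (p2 - 1))
  + (b * h1 + h1 * b) * p2 + h1 * (p2 * b - b * p2) + (h2 * a + a * h2)
  + h1 * (p2 * a - a * p2)).
by rewrite c5 c6 c1 c2 c3 c4 !addNr !subrr !(mul0r, mulr0) !addr0.
Qed.

Lemma tensor_homotopy_pd (h1 h2 p2 : R) :
  h1 * h1 = 0 -> h2 * h2 = 0 -> h2 * p2 = 0 -> p2 * h2 = 0 ->
  h2 * h1 = - (h1 * h2) -> p2 * h1 = h1 * p2 ->
  (h1 - h2) * (h1 * p2 + h2) = h1 * h2 /\ (h1 * p2 + h2) * (h1 - h2) = - (h1 * h2).
Proof.
move=> e1 e2 e3 e4 c1 c2; split.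
  cert (h1 * h1 * p2 - (h2 * h1 + h1 * h2) * p2 + h1 * (h2 * p2) - h2 * h2).
  by rewrite e1 e2 e3 c1 addNr !(mul0r, mulr0) !(addr0, subr0).
cert (h1 * (p2 * h1 - h1 * p2) + h1 * h1 * p2 - h1 * (p2 * h2) - h2 * h2
  + (h2 * h1 + h1 * h2)).
by rewrite e1 e2 e4 c1 c2 addNr subrr !(mul0r, mulr0) !(addr0, subr0).
Qed.

Lemma weighted_homotopy_pd (x1 x2 : R) : x1 * x1 = 0 -> x2 * x2 = 0 ->
  x2 * x1 = - (x1 * x2) ->
  [/\ x1 * (x1 + x2) = x1 * x2, x2 * (x1 + x2) = - (x1 * x2),
      (x1 + x2) * x1 = - (x1 * x2) & (x1 + x2) * x2 = x1 * x2].
Proof. by move=> e1 e2 c; rewrite !mulrDr !mulrDl e1 e2 c !add0r !addr0. Qed.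

End NoncommutativeRing.

(** * The standard pseudo-derivation and its symmetrization *)

Section LendTensor.
Context {k : comPzRingType}.
Implicit Types M : gmod k.

Lemma T1_ext M (V : lmodType k) (u v : T M 1 -> V) : is_gmod M ->
  (forall a, u (one a) = v (one a)) -> u =1 v.
Proof. by move=> gM uv w; rewrite -(unoneK gM w). Qed.

Lemma T_ind (Q : nat -> Prop) : Q 0%N -> Q 1%N ->
  (forall n, Q 1%N -> Q n -> Q (1 + n)%N) -> forall n, Q n.
Proof. by move=> Q0 Q1 QS; elim=> // n IH; apply: QS. Qed.

Definition ins M m (u : M -> M) (Hu : homog m u) n : lend (T M n) :=
  Lend (@tins_lin k M m u id n Hu (homog_id M)).

Lemma ins_split M m (u : M -> M) (Hu : homog m u) p q :
  ins Hu (p + q) = tl q (ins Hu p) + tr p m (ins Hu q).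
Proof.
apply: lendP => w; rewrite lendE /= (tins_split Hu (homog_id M)); congr (tens _ _ _ _ + _).
by apply/funext => v; rewrite /= tpow_id.
Qed.

Lemma ins_homog M m (u : M -> M) (Hu : homog m u) n :
  homog (M := T M n) (N := T M n) m (ins Hu n).
Proof. exact: tins_homog (homog_id M). Qed.

Lemma ins0 M m (u : M -> M) (Hu : homog m u) : ins Hu 0 = 0.
Proof. by apply: lendP => w; apply: (tins0 _ Hu (homog_id M)). Qed.

Lemma ins_sqr M m (u : M -> M) (Hu : homog m u) : is_gmod M -> odd `|m|%N ->
  (forall x, u (u x) = 0) -> forall n, ins Hu n * ins Hu n = 0.
Proof.
move=> gM om uu; apply: T_ind => [||n I1 In].
- by rewrite ins0 mul0r.
- apply: lendP; apply: (T1_ext gM) => a.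
  rewrite lendE /= !(tins_one _ gM Hu (homog_id M)) uu.
  by rewrite (lin0 (one_lin gM)).
- rewrite ins_split mulrDl !mulrDr -tlM I1 tl0 -trM In tr0 add0r addr0.
  by rewrite (tr_tl_anti _ (ins_homog Hu 1)) ?subrr // abszM oddM om.
Qed.

End LendTensor.

Section Contraction.
Context {k : comPzRingType} {A B : chain_complex k}.
Context {f : A -> B} {g : B -> A} {h : A -> A} (cfgh : contraction f g h).

Let gA : is_gmod A. Proof. by case: (ccxP A). Qed.
Let Hd : homog (-1) (dif A). Proof. by case: (ccxP A). Qed.
Let Hf : homog 0 f. Proof. by case: cfgh => [[]]. Qed.
Let Hg : homog 0 g. Proof. by case: cfgh => [[]]. Qed.
Let Hh : homog 1 h. Proof. by case: cfgh => [[]]. Qed.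
Let fd x : dif B (f x) = f (dif A x). Proof. by case: cfgh => [_ [[]]]. Qed.
Let gd y : dif A (g y) = g (dif B y). Proof. by case: cfgh => [_ [[]]]. Qed.
Let dh x : dif A (h x) + h (dif A x) = g (f x) - x. Proof. by case: cfgh => [_ [[]]]. Qed.
Let fg y : f (g y) = y. Proof. by case: cfgh => [_ [_ []]]. Qed.
Let fh x : f (h x) = 0. Proof. by case: cfgh => [_ [_ []]]. Qed.
Let hh x : h (h x) = 0. Proof. by case: cfgh => [_ [_ []]]. Qed.
Let hg y : h (g y) = 0. Proof. by case: cfgh => [_ [_ []]]. Qed.
Let g0 : g 0 = 0. Proof. by rewrite lin0 //; case: Hg. Qed.
Let P := g \o f.
Let HP : homog 0 P. Proof. by rewrite -[X in homog X _]addr0; exact: homog_comp Hg Hf. Qed.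

Let SH n : lend (T A n) := Lend (@tins_lin k A 1 h P n Hh HP).
Let SP n : lend (T A n) := Lend (@tpow_lin k A A P n HP).
Let SD n : lend (T A n) := ins Hd n.

Let tpow_fSH n (u : T A n) : tpow f (SH n u) = 0.
Proof.
move: u; apply: ten_ext.
- by apply: linear_comp; [exact: tpow_lin|exact: lfunP].
- exact: linear_zero.
move=> x; rewrite /= tins_ten // (lin_sum _ _ _ (@tpow_lin _ _ _ _ _ Hf)) big1 // => i _.
rewrite (linZ _ _ (@tpow_lin _ _ _ _ _ Hf)) tpow_ten // (ten_zero (i := i)) ?scaler0 //.
by rewrite !ffunE ltnn eqxx /= fh.
Qed.

Let SH_tpow_g n (u : T B n) : SH n (tpow g u) = 0.
Proof.
move: u; apply: ten_ext.
- by apply: linear_comp; [exact: lfunP|exact: tpow_lin].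
- exact: linear_zero.
move=> x; rewrite /= tpow_ten // tins_ten // big1 // => i _.
rewrite (ten_zero (i := i)) ?scaler0 //.
by rewrite !ffunE ltnn eqxx /= hg.
Qed.

Let SPE n (u : T A n) : SP n u = tpow g (tpow f u).
Proof. by rewrite /= tpow_comp. Qed.

Let SPSH n : SP n * SH n = 0.
Proof.
apply: lendP => u; rewrite lendE SPE tpow_fSH lin0 //; exact: tpow_lin.
Qed.

Let SHSP n : SH n * SP n = 0.
Proof. by apply: lendP => u; rewrite lendE SPE SH_tpow_g. Qed.

Let SH_split p q : SH (p + q) = tl q (SH p) * tr p 0 (SP q) + tr p 1 (SH q).
Proof. by apply: lendP => u; rewrite -tens_lr lendE /= (tins_split Hh HP). Qed.

Let SP_split p q : SP (p + q) = tl q (SP p) * tr p 0 (SP q).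
Proof. by apply: lendP => u; rewrite -tens_lr /= (tpow_split HP). Qed.

Let SH_homog n : homog (M := T A n) (N := T A n) 1 (SH n).
Proof. exact: tins_homog. Qed.

Let SP_homog n : homog (M := T A n) (N := T A n) 0 (SP n).
Proof. exact: tpow_homog. Qed.

Let SHSH : forall n, SH n * SH n = 0.
Proof.
apply: T_ind => [||n I1 In].
- by apply: lendP => u; rewrite lendE /= tins0.
- apply: lendP; apply: (T1_ext gA) => a.
  by rewrite lendE /= !(tins_one _ gA Hh HP) hh (lin0 (one_lin gA)).
rewrite SH_split mulrDl !mulrDr -[tr 1 1 _ * tr 1 1 _]trM In tr0 addr0.
rewrite -[in X in X + _]mulrA [tr 1 0 _ * (_ * _)]mulrA.
rewrite [tr 1 0 _ * tl n _](tr_tl_comm _ (SH_homog 1)) // -!mulrA !mulrA -tlM I1 tl0 !mul0r add0r.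
rewrite -mulrA -trM SPSH tr0 mulr0 add0r (tr_tl_anti _ (SH_homog 1)) // mulNr.
by rewrite -mulrA -trM SHSP tr0 mulr0 oppr0.
Qed.

Let SDSP n : SD n * SP n = SP n * SD n.
Proof.
elim/T_ind: n => [||n I1 In].
- by rewrite /SD ins0 mul0r mulr0.
- apply: lendP; apply: (T1_ext gA) => a.
  rewrite !lendE /= tpow_one // !(tins_one _ gA Hd (homog_id A)) tpow_one //.
  by rewrite /P /= gd fd.
rewrite SP_split /SD ins_split mulrDl mulrDr; congr (_ + _).
  rewrite mulrA -tlM I1 -mulrA (tr_tl_comm _ (ins_homog Hd 1)) // mulrA.
  by rewrite -tlM.
rewrite mulrA (tr_tl_comm _ (SP_homog 1)) // -!mulrA -!trM addr0 add0r.
by rewrite In.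
Qed.

Let SDSH n : SD n * SH n + SH n * SD n = SP n - 1.
Proof.
elim/T_ind: n => [||n I1 In].
- rewrite /SD ins0 mul0r mulr0 addr0; apply: lendP => u.
  by rewrite lendE /= tpow0 // subrr.
- apply: lendP; apply: (T1_ext gA) => a.
  rewrite !lendE /= tpow_one // !(tins_one _ gA Hd (homog_id A)) !(tins_one _ gA Hh HP).
  rewrite (tins_one _ gA Hd (homog_id A)) -(linD _ _ (one_lin gA)) dh.
  by rewrite (linB _ _ (one_lin gA)).
set a := tl n (SD 1); set b := tr 1 (-1) (SD n).
set h1 := tl n (SH 1); set h2 := tr 1 1 (SH n).
set p1 := tl n (SP 1); set p2 := tr 1 0 (SP n).
have e1 : SD (1 + n) = a + b by rewrite /SD ins_split.
have e2 : SH (1 + n) = h1 * p2 + h2 by rewrite SH_split.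
have e3 : SP (1 + n) = p1 * p2 by rewrite SP_split.
have c1 : b * h1 = - (h1 * b) by apply: (tr_tl_anti _ (SH_homog 1)).
have c2 : h2 * a = - (a * h2) by apply: (tr_tl_anti _ (ins_homog Hd 1)).
have c3 : p2 * a = a * p2 by apply: (tr_tl_comm _ (ins_homog Hd 1)).
have c4 : b * p2 = p2 * b by rewrite /b /p2 -!trM SDSP addr0 add0r.
have c5 : a * h1 + h1 * a = p1 - 1 by rewrite -!tlM -tlD I1 tlD tlN tl1.
have c6 : b * h2 + h2 * b = p2 - 1.
  by rewrite -!trM [1 + -1]addrC -trD In addNr trD trN tr1.
by rewrite e1 e2 e3; apply: tensor_homotopy.
Qed.

Let SH_pd p q : (tl q (SH p) - tr p 1 (SH q)) * SH (p + q) = tl q (SH p) * tr p 1 (SH q) /\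
  SH (p + q) * (tl q (SH p) - tr p 1 (SH q)) = - (tl q (SH p) * tr p 1 (SH q)).
Proof.
rewrite SH_split; apply: tensor_homotopy_pd.
- by rewrite -tlM SHSH tl0.
- by rewrite -trM SHSH tr0.
- by rewrite -trM SHSP tr0.
- by rewrite -trM SPSH tr0.
- exact: (tr_tl_anti _ (SH_homog p)).
- exact: (tr_tl_comm _ (SH_homog p)).
Qed.

Lemma standard_homotopy_thick : thick_homotopy false f g h (standard_homotopy f g h).
Proof.
split; split.
- by move=> n; exact: tins_homog.
- by move=> n s /eqP -> u; rewrite !tact1.
- move=> p q u; have [e1 e2] := SH_pd p q; split.
    by have := congr1 (fun F : lend _ => F u) e1; rewrite -tens_lr.
  by have := congr1 (fun F : lend _ => F u) e2; rewrite -tens_lr.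
- by move=> a; rewrite /first_level /standard_homotopy (tins_one _ gA Hh HP) oneK.
- move=> n u; have := congr1 (fun F : lend _ => F u) (SDSH n).
  rewrite !lendE SPE /thick_sub /thick_comp /thick_id => <-.
  by rewrite scaleN1r opprK.
- by move=> n u; apply: tpow_fSH.
- by move=> n u; apply: SH_tpow_g.
- by move=> n u; have := congr1 (fun F : lend _ => F u) (SHSH n).
Qed.

Section Symmetrize.
Context (iota : {rmorphism rat -> k}).

Let hs : thick A A := symmetrize iota (standard_homotopy f g h).
Let c (n : nat) : k := iota (n%:R^-1).
Let SQ n : lend (T A n) := ins Hh n.

Let iota_fact n (v : T A n) : iota (n`!%:R^-1) *: (v *+ #|'S_n|) = v.
Proof.
rewrite card_Sn -scaler_nat scalerA -(rmorph_nat iota) -rmorphM mulVf ?rmorph1 ?scale1r //.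
by rewrite Num.Theory.pnatr_eq0 -lt0n fact_gt0.
Qed.

Let hs_lin n : linear (@hs n).
Proof.
apply: linear_scale; apply: linear_sum => s.
apply: linear_comp; first exact: tact_lin.
by apply: linear_comp; [exact: (lfunP (SH n))|exact: tact_lin].
Qed.

Let tact_homog n (s : 'S_n) : homog 0 (@tact k A n s).
Proof.
have -> : tact s = reind (M := A) (fun a => (s^-1)%g a) by apply/funext => u; rewrite tactE.
exact: reind_homog (perm_bij _).
Qed.

Let hs_homog n : homog 1 (@hs n).
Proof.
apply: homog_scale; first exact: T_gmod.
have E (r : seq 'S_n) : homog 1 (fun u : T A n =>
    \sum_(s <- r) tact s^-1%g (standard_homotopy f g h (tact s u))).
  elim: r => [|s r IH].
    apply: (homog_eq (f := fun _ => 0)); first by move=> u; rewrite big_nil.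
    exact/homog_zero/T_gmod.
  apply: (homog_eq (f := fun u => tact s^-1%g (standard_homotopy f g h (tact s u)) +
    \sum_(s <- r) tact s^-1%g (standard_homotopy f g h (tact s u)))).
    by move=> u; rewrite big_cons.
  apply: homog_add => //; first exact: T_gmod.
  have := homog_comp (homog_comp (@tact_homog n s^-1%g) (SH_homog n)) (@tact_homog n s).
  by rewrite add0r addr0.
exact: E.
Qed.

Let hs_sym n (s : 'S_n) u : hs (tact s u) = tact s (hs u).
Proof.
rewrite /hs /symmetrize (linZ _ _ (@tact_lin _ _ _ _)) (lin_sum _ _ _ (@tact_lin _ _ _ _)).
congr (_ *: _); rewrite [RHS](reindex_inj (mulgI s)) /=; apply: eq_bigr => t _.
by rewrite -!tactM invMg -mulgA mulVg mulg1.
Qed.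

(** A word whose letters in the places [S] lie in the kernel of [gf], and whose
    other letters lie in its image. *)
Let pure n (S : {set 'I_n}) (x : tgen A n) : Prop :=
  forall i, if i \in S then P (x i).2 = 0 else P (x i).2 = (x i).2.

Let E n (i : 'I_n) (x : tgen A n) : T A n :=
  sgn (1 * \sum_(j < n | (j < i)%N) (x j).1) *: ten (ginsf 1 h id i x).

Let PP x : P (P x) = P x. Proof. by rewrite /P /= fg. Qed.
Let hP x : h (P x) = 0. Proof. exact: hg. Qed.
Let P0 : P 0 = 0. Proof. by rewrite lin0 //; case: HP. Qed.

Let E_out n (S : {set 'I_n}) x i : pure S x -> i \notin S -> E i x = 0.
Proof.
move=> /(_ i) /[swap] /negPf -> Px; rewrite /E (ten_zero (i := i)) ?scaler0 //.
by rewrite ffunE ltnn eqxx /= -Px hP.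
Qed.

Let SH_pure n (S : {set 'I_n}) x : pure S x ->
  SH n (ten x) = \sum_(i in S | [forall j in S, (j <= i)%N]) E i x.
Proof.
move=> Sx; rewrite /= tins_ten // [RHS]big_mkcond /=; apply: eq_bigr => i _.
case: (boolP (i \in S)) => [iS|niS] /=; last first.
  rewrite (ten_zero (i := i)) ?scaler0 // ffunE ltnn eqxx /=.
  by have := Sx i; rewrite (negPf niS) => <-; rewrite hP.
case: ifPn => [/'forall_implyP Hi|]; last first.
  rewrite negb_forall => /existsP [j]; rewrite negb_imply -ltnNge => /andP[jS ij].
  rewrite (ten_zero (i := j)) ?scaler0 // ffunE ltnNge (ltnW ij) /=.
  case: eqP => [ji|_]; first by rewrite ji ltnn in ij.
  by have := Sx j; rewrite jS.
congr (_ *: ten _); apply/ffunP => j; rewrite !ffunE.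
case: ltnP => // ij; case: eqP => // /eqP nij.
have := Sx j; case: ifP => [jS|_ -> //].
by have := Hi j jS; rewrite leqNgt ltn_neqAle ij andbT eq_sym nij.
Qed.

Let SQ_pure n (S : {set 'I_n}) x : pure S x -> SQ n (ten x) = \sum_(i in S) E i x.
Proof.
move=> Sx; rewrite /= (tins_ten _ Hh (homog_id A)) [RHS]big_mkcond; apply: eq_bigr => i _.
by case: ifPn => // niS; rewrite -(E_out Sx niS).
Qed.

(* A permutation attains its maximum on [S] at a given element of [S] in [n!/|S|] cases. *)
Let card_max n (S : {set 'I_n}) i : i \in S ->
  (#|[set s : 'S_n | [forall j in S, (s j <= s i)%N]]| * #|S|)%N = n`!.
Proof.
move=> iS; rewrite -card_Sn.
pose N i := [set s : 'S_n | [forall j in S, (s j <= s i)%N]].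
have cN j : j \in S -> #|N j| = #|N i|.
  move=> jS; rewrite -(card_imset _ (@mulgI _ (tperm i j))); apply: eq_card => s.
  apply/imsetP/idP => [[t]|].
    rewrite !inE => /'forall_implyP Ht ->; apply/'forall_implyP => l lS.
    rewrite !permM tpermL.
    by case: tpermP => [_|_|_ _]; exact: Ht.
  rewrite inE => /'forall_implyP Hs; exists (tperm i j * s)%g; last first.
    by rewrite mulgA tperm2 mul1g.
  rewrite inE; apply/'forall_implyP => l lS; rewrite !permM tpermR.
  by case: tpermP => [_|_|_ _]; exact: Hs.
have -> : (#|N i| * #|S| = \sum_(j in S) #|N j|)%N.
  by rewrite (eq_bigr _ cN) sum_nat_const mulnC.
under eq_bigr do rewrite -sum1_card big_mkcond /=.
rewrite exchange_big /= -sum1_card; apply: eq_bigr => s _.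
have [m mS Hm] := @arg_maxnP _ i (mem S) (fun j => s j) iS.
rewrite (bigD1 m) //= inE.
have -> : [forall j in S, (s j <= s m)%N] by apply/'forall_implyP.
rewrite big1 ?addn0 // => j /andP[jS jm]; rewrite inE; case: ifP => // /'forall_implyP /(_ m mS).
move=> mj; case/eqP: jm; apply: (@perm_inj _ s); apply: val_inj; apply/eqP.
by rewrite eqn_leq mj andbT; exact: Hm.
Qed.

(** On such words the symmetrization is the mean over [S] of the operators that
    insert [h]. *)
Let hs_pure n (S : {set 'I_n}) x : pure S x -> hs (ten x) = c #|S| *: SQ n (ten x).
Proof.
move=> Sx; rewrite (SQ_pure Sx) /hs /symmetrize.
have K (s : 'S_n) : tact s^-1%g (standard_homotopy f g h (tact s (ten x))) =
    \sum_(i in S | [forall j in S, (s j <= s i)%N]) E i x.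
  rewrite tact_ten; set y := [ffun i => _].
  have yE a : y (s a) = x a by rewrite ffunE permK.
  have Sy : pure (s @: S) y.
    move=> i; rewrite ffunE -{1}(permKV s i) mem_imset; last exact: perm_inj.
    exact: Sx.
  rewrite -[standard_homotopy f g h _]/(SH n _).
  rewrite (linZ _ _ (lfunP (SH n))) (linZ _ _ (@tact_lin _ _ _ _)).
  rewrite (SH_pure Sy) (lin_sum _ _ _ (@tact_lin _ _ _ _)).
  rewrite (reindex_inj (@perm_inj _ s)) scaler_sumr /=.
  apply: eq_big => [i|i _].
    rewrite mem_imset; last exact: perm_inj.
    congr (_ && _); apply/'forall_implyP/'forall_implyP => Hi j jS.
      by apply: Hi; apply: imset_f.
    by case/imsetP: jS => l lS ->; apply: Hi.
  rewrite tactE (_ : (fun a => (s^-1^-1)%g a) = (fun a => s a)); last by rewrite invgK.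
  rewrite reind_gins //; last exact: perm_bij.
  have -> : (fun a => (y (s a)).1) = (fun a => (x a).1) by apply/funext => a; rewrite yE.
  rewrite /E [LHS]scalerA koszul_sqr scale1r; congr (sgn (1 * _) *: ten _).
    by apply: eq_bigr => a _; rewrite yE.
  by congr ginsf; apply/ffunP => a; rewrite ffunE yE.
rewrite (eq_bigr _ (fun s _ => K s)) (exchange_big_dep (mem S)) /=; last by move=> s i _ /andP[].
rewrite !scaler_sumr; apply: eq_bigr => i iS.
rewrite sumr_const -scaler_nat scalerA; congr (_ *: _).
rewrite -(rmorph_nat iota) -rmorphM; congr (iota _).
have := card_max iS; set N := #|[set _ | _]| => NS.
have -> : #|[pred s : 'S_n | (i \in S) && [forall j in S, (s j <= s i)%N]]| = N.
  by apply: eq_card => s; rewrite !inE iS.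
have S0 : (0 < #|S|)%N by apply/card_gt0P; exists i.
have n0 := fact_gt0 n; rewrite -NS natrM.
have N0 : (N%:R : rat) != 0.
  by rewrite Num.Theory.pnatr_eq0 -lt0n; move: n0; rewrite -NS muln_gt0 => /andP[].
by rewrite invfM mulrAC mulVf ?mul1r.
Qed.

Let Pure n (S : {set 'I_n}) (u : T A n) := span (fun v => exists2 x, pure S x & v = ten x) u.

Let Pure_ten n (S : {set 'I_n}) x : pure S x -> Pure S (ten x).
Proof. by move=> Sx; apply: span_gen; exists x. Qed.

Let hs_Pure n (S : {set 'I_n}) u : Pure S u -> hs u = c #|S| *: SQ n u.
Proof.
apply: (span_eq (L1 := @hs n) (L2 := fun u => c #|S| *: SQ n u));
  [exact: hs_lin|by apply: linear_scale; exact: lfunP|].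
by move=> v [x Sx ->]; exact: hs_pure.
Qed.

Let SQ_Pure n (S : {set 'I_n}) u : Pure S u -> Pure S (SQ n u).
Proof.
apply: (span_lin (L := SQ n)); first exact: lfunP.
move=> v [x Sx ->]; rewrite (SQ_pure Sx); apply: span_sum => i iS.
apply: span_scale; apply: Pure_ten => j; rewrite ginsE ffunE.
case: eqP => [->|_]; last exact: Sx.
by rewrite iS /= /P /= fh g0.
Qed.

Let SQ_set0 n (S : {set 'I_n}) u : Pure S u -> #|S| = 0%N -> SQ n u = 0.
Proof.
move=> Su /eqP; rewrite cards_eq0 => /eqP S0; subst S; move: Su.
apply: (span_eq (L1 := SQ n) (L2 := fun _ => 0));
  [exact: lfunP|exact: linear_zero|move=> v [x Sx ->]].
by rewrite (SQ_pure Sx) big_set0.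
Qed.

Let pure_ext n (V : lmodType k) (L1 L2 : T A n -> V) : linear L1 -> linear L2 ->
  (forall S x, pure S x -> L1 (ten x) = L2 (ten x)) -> L1 =1 L2.
Proof.
move=> l1 l2 L; apply: (ten_span (S := fun _ a => P a = 0 \/ P a = a)) => //.
  move=> e a; rewrite -[pr A e a](subrK (P (pr A e a))); apply: span_add; apply: span_gen.
    by left; rewrite linB ?PP ?subrr //; case: HP.
  by right.
move=> x Hx; apply: (L [set i | P (x i).2 != (x i).2]) => i; rewrite inE.
by case: eqP => //= Pi; case: (Hx i).
Qed.

Let SQSQ n : SQ n * SQ n = 0.
Proof. exact: ins_sqr. Qed.

Section Pair.
Context {p q : nat} {S : {set 'I_(p + q)}}.
Let Sl := [set i | lshift q i \in S].
Let Sr := [set i | rshift p i \in S].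

Let cardS : #|S| = (#|Sl| + #|Sr|)%N.
Proof.
rewrite -!sum1_card [LHS]big_mkcond big_split_ord /= -!big_mkcond /=.
by congr (_ + _)%N; apply: eq_bigl => i; rewrite inE.
Qed.

Let pure_l x : pure S x -> pure Sl (gl x).
Proof. by move=> Sx i; rewrite inE ffunE; exact: Sx. Qed.
Let pure_r x : pure S x -> pure Sr (gr x).
Proof. by move=> Sx i; rewrite inE ffunE; exact: Sx. Qed.

Let Pure_tcat u v : Pure Sl u -> Pure Sr v -> Pure S (tcat u v).
Proof.
move=> Su Sv; have K y : pure Sl y -> Pure S (tcat (ten y) v).
  move=> Sy; move: Sv; apply: (span_lin (L := tcat (ten y))); first exact: tcat_linr.
  move=> _ [z Sz ->]; rewrite tcat_ten; apply: Pure_ten => s.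
  case: (split_ordP s) => i ->; rewrite ?gcatl ?gcatr.
    by have := Sy i; rewrite inE.
  by have := Sz i; rewrite inE.
elim: Su => [|a y z [x Sx ->] _ IH]; first by rewrite tcat0l; apply: span0.
by rewrite tcat_linl; apply: span_add => //; apply/span_scale/K.
Qed.

Let HSl : lend (T A p) := Lend (@hs_lin p).
Let HSr : lend (T A q) := Lend (@hs_lin q).

Let tl_hs u : Pure S u -> tl q HSl u = c #|Sl| *: tl q (SQ p) u /\ Pure S (tl q (SQ p) u)
  /\ (#|Sl| = 0%N -> tl q (SQ p) u = 0).
Proof.
have Lp := @linear_id k (T A q).
move=> Su; split; last split.
- move: Su; apply: (span_eq (L1 := tl q HSl) (L2 := fun u => c #|Sl| *: tl q (SQ p) u));
    [exact: lfunP|by apply: linear_scale; exact: lfunP|].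
  move=> v [x Sx ->]; rewrite /= !tens_ten //; try exact: hs_lin; last exact: (lfunP (SQ p)).
  by rewrite (hs_pure (pure_l Sx)) tcatZl !mul0r !scale1r.
- move: Su; apply: (span_lin (L := tl q (SQ p))); first exact: lfunP.
  move=> v [x Sx ->]; rewrite /= tens_ten //; last exact: (lfunP (SQ p)).
  apply: span_scale; apply: Pure_tcat.
    exact/SQ_Pure/Pure_ten/pure_l.
  exact/Pure_ten/pure_r.
- move=> S0; move: Su; apply: (span_eq (L1 := tl q (SQ p)) (L2 := fun _ => 0));
    [exact: lfunP|exact: linear_zero|].
  move=> v [x Sx ->]; rewrite /= tens_ten //; last exact: (lfunP (SQ p)).
  have /= -> := SQ_set0 (Pure_ten (pure_l Sx)) S0.
  by rewrite tcat0l scaler0.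
Qed.

Let tr_hs u m : Pure S u -> tr p m HSr u = c #|Sr| *: tr p m (SQ q) u /\ Pure S (tr p m (SQ q) u)
  /\ (#|Sr| = 0%N -> tr p m (SQ q) u = 0).
Proof.
have Lp := @linear_id k (T A p).
move=> Su; split; last split.
- move: Su; apply: (span_eq (L1 := tr p m HSr) (L2 := fun u => c #|Sr| *: tr p m (SQ q) u));
    [exact: lfunP|by apply: linear_scale; exact: lfunP|].
  move=> v [x Sx ->]; rewrite /= !tens_ten //; try exact: hs_lin; last exact: (lfunP (SQ q)).
  by rewrite (hs_pure (pure_r Sx)) tcatZr !scalerA mulrC.
- move: Su; apply: (span_lin (L := tr p m (SQ q))); first exact: lfunP.
  move=> v [x Sx ->]; rewrite /= tens_ten //; last exact: (lfunP (SQ q)).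
  apply: span_scale; apply: Pure_tcat; last exact/SQ_Pure/Pure_ten/pure_r.
  exact/Pure_ten/pure_l.
- move=> S0; move: Su; apply: (span_eq (L1 := tr p m (SQ q)) (L2 := fun _ => 0));
    [exact: lfunP|exact: linear_zero|].
  move=> v [x Sx ->]; rewrite /= tens_ten //; last exact: (lfunP (SQ q)).
  have /= -> := SQ_set0 (Pure_ten (pure_r Sx)) S0.
  by rewrite tcat0r scaler0.
Qed.

Let cD : (#|Sl| != 0)%N -> (#|Sr| != 0)%N -> c #|S| * (c #|Sl| + c #|Sr|) = c #|Sl| * c #|Sr|.
Proof.
rewrite cardS /c -!rmorphD -!rmorphM => l0 r0; congr (iota _).
have L : (#|Sl|%:R : rat) != 0 by rewrite Num.Theory.pnatr_eq0.
have R : (#|Sr|%:R : rat) != 0 by rewrite Num.Theory.pnatr_eq0.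
have LR : (#|Sl|%:R + #|Sr|%:R : rat) != 0.
  by rewrite -natrD Num.Theory.pnatr_eq0 addn_eq0 negb_and l0.
by rewrite natrD; field; rewrite L R.
Qed.

Lemma hs_pd_pure u : Pure S u ->
  tl q HSl (hs u) - tr p 1 HSr (hs u) = tl q HSl (tr p 1 HSr u) /\
  hs (tl q HSl u - tr p 1 HSr u) = - tl q HSl (tr p 1 HSr u).
Proof.
move=> Su; set x1 := tl q (SQ p); set x2 := tr p 1 (SQ q).
have SQE : SQ (p + q) = x1 + x2 by rewrite /SQ ins_split.
have x11 : x1 * x1 = 0 by rewrite -tlM SQSQ tl0.
have x22 : x2 * x2 = 0 by rewrite -trM SQSQ tr0.
have x21 : x2 * x1 = - (x1 * x2) by apply: (tr_tl_anti _ (ins_homog Hh p)).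
have [e1 e2 e3 e4] := weighted_homotopy_pd x11 x22 x21.
have [lu [Plu lu0]] := tl_hs Su; have [ru [Pru ru0]] := tr_hs 1 Su.
have [lru _] := tl_hs Pru.
have PQ : Pure S (SQ (p + q) u) := SQ_Pure Su.
have [lQ _] := tl_hs PQ; have [rQ _] := tr_hs 1 PQ.
have RHSE : tl q HSl (tr p 1 HSr u) = (c #|Sl| * c #|Sr|) *: (x1 * x2) u.
  by rewrite ru (linZ _ _ (lfunP _)) lru scalerA mulrC.
have Z : (c #|S| * (c #|Sl| + c #|Sr|)) *: (x1 * x2) u = (c #|Sl| * c #|Sr|) *: (x1 * x2) u.
  have [l0|l0] := eqVneq #|Sl| 0%N.
    have -> : (x1 * x2) u = - (x2 * x1) u by rewrite x21 lendN opprK.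
    by rewrite lendM /x1 lu0 // (lin0 (lfunP _)) oppr0 !scaler0.
  have [r0|r0] := eqVneq #|Sr| 0%N; last by rewrite cD.
  by rewrite lendM /x2 ru0 // (lin0 (lfunP _)) !scaler0.
split.
  rewrite RHSE (hs_Pure Su) !(linZ _ _ (lfunP _)) lQ rQ -!lendM -/x1 -/x2 SQE e1 e2.
  by rewrite -Z lendN !scalerN opprK -scalerDr -scalerDl scalerA.
rewrite RHSE (linB _ _ (@hs_lin _)) lu ru !(linZ _ _ (@hs_lin _)) (hs_Pure Plu) (hs_Pure Pru).
rewrite -!lendM -/x1 -/x2 SQE e3 e4 -Z lendN !scalerN !scalerA -opprD -scalerDl.
by congr (- (_ *: _)); rewrite mulrDr ![c #|S| * _]mulrC.
Qed.

End Pair.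

Lemma symmetrize_thick : thick_homotopy true f g h hs.
Proof.
have Lsn n := @tact_lin k A n.
split; split.
- exact: hs_homog.
- by move=> n s _ u; exact: hs_sym.
- move=> p q u.
  pose HSl : lend (T A p) := Lend (@hs_lin p); pose HSr : lend (T A q) := Lend (@hs_lin q).
  pose Hpq : lend (T A (p + q)) := Lend (@hs_lin (p + q)).
  have K1 : (tl q HSl - tr p 1 HSr) * Hpq = tl q HSl * tr p 1 HSr.
    apply: lendP; apply: pure_ext; [exact: lfunP|exact: lfunP|move=> S x Sx].
    exact: (hs_pd_pure (Pure_ten Sx)).1.
  have K2 : Hpq * (tl q HSl - tr p 1 HSr) = - (tl q HSl * tr p 1 HSr).
    apply: lendP; apply: pure_ext; [exact: lfunP|exact: lfunP|move=> S x Sx].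
    exact: (hs_pd_pure (Pure_ten Sx)).2.
  split.
    by have := congr1 (fun F : lend _ => F u) K1; rewrite -tens_lr.
  by have := congr1 (fun F : lend _ => F u) K2; rewrite -tens_lr.
- move=> a; have s1 (s : 'S_1) : s = 1%g by apply/permP => i; rewrite !ord1.
  rewrite /first_level /hs /symmetrize.
  have K (s : 'S_1) : tact s^-1%g (standard_homotopy f g h (tact s (one a))) =
      standard_homotopy f g h (one a) by rewrite (s1 s) invg1 !tact1.
  rewrite (eq_bigr _ (fun s _ => K s)) sumr_const iota_fact.
  by rewrite /standard_homotopy (tins_one _ gA Hh HP) oneK.
- move=> n u; rewrite scaleN1r opprK /thick_sub /thick_comp /thick_id -SPE.
  have LD := lfunP (SD n); change (SD n (hs u) + hs (SD n u) = SP n u - u).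
  rewrite /hs /symmetrize (linZ _ _ LD) (lin_sum _ _ _ LD) -scalerDr -big_split /=.
  have K (s : 'S_n) : SD n (tact s^-1%g (standard_homotopy f g h (tact s u))) +
      tact s^-1%g (standard_homotopy f g h (tact s (SD n u))) = SP n u - u.
    have DS t v : SD n (tact t v) = tact t (SD n v).
      by rewrite !tactE; exact: (tins_reind (perm_bij _) Hd).
    have PS t v : SP n (tact t v) = tact t (SP n v).
      by rewrite !tactE; exact: (tpow_reind HP (perm_bij _)).
    rewrite DS -[tact s (SD n u)]DS -(linD _ _ (Lsn n s^-1%g)).
    have D := congr1 (fun F : lend _ => F (tact s u)) (SDSH n); rewrite !lendE in D.
    rewrite [X in tact _ X](_ : _ = SP n (tact s u) - tact s u); last exact: D.
    by rewrite PS (linB _ _ (Lsn n s^-1%g)) -!tactM mulgV !tact1.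
  by rewrite (eq_bigr _ (fun s _ => K s)) sumr_const iota_fact.
- move=> n u; rewrite /thick_comp /hs /symmetrize (linZ _ _ (@tpow_lin _ _ _ _ _ Hf)).
  rewrite (lin_sum _ _ _ (@tpow_lin _ _ _ _ _ Hf)) big1 ?scaler0 // => s _.
  rewrite tactE (tpow_reind Hf (perm_bij _)).
  rewrite [X in reind _ X](_ : _ = 0); last exact: tpow_fSH.
  exact: (lin0 (reind_lin (perm_bij _))).
- move=> n u; rewrite /thick_comp /hs /symmetrize big1 ?scaler0 // => s _.
  rewrite [tact s _]tactE -(tpow_reind Hg (perm_bij _)).
  rewrite [X in tact _ X](_ : _ = 0); last exact: SH_tpow_g.
  exact: (lin0 (Lsn n _)).
- move=> n u; move: n u => n; apply: pure_ext; [by apply: linear_comp; exact: hs_lin|exact: linear_zero|].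
  move=> S x Sx; rewrite /thick_comp (hs_pure Sx) (linZ _ _ (@hs_lin n)).
  rewrite (hs_Pure (SQ_Pure (Pure_ten Sx))) -lendM SQSQ.
  by rewrite !scaler0.
Qed.

End Symmetrize.

End Contraction.

(** * Cofree coalgebras *)

Section TotTheory.
Context {k : comPzRingType} {sym : bool} {C : sseq k}.
Implicit Types M N : lseq k.

Lemma totg_hlin M n (u : M n) : hlin (fun c : int * C n => totg sym c u).
Proof.
split=> [e a c c'|e c].
  have /= := @gen_relE k _ (@totrel k sym C M)
    [:: (1, Totgen (e, a *: c + c') u)] [:: (a, Totgen (e, c) u); (1, Totgen (e, c') u)].
  rewrite !big_cons !big_nil /= !scale1r !addr0; apply=> V phi [H _ _].
  by rewrite /ev !big_cons !big_nil /= !scale1r !addr0 (H n u).1.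
have /= := @gen_relE k _ (@totrel k sym C M)
    [:: (1, Totgen (e, pr (C n) e c) u)] [:: (1, Totgen (e, c) u)].
rewrite !big_cons !big_nil /= !scale1r !addr0; apply=> V phi [H _ _].
by rewrite /ev !big_cons !big_nil /= !scale1r !addr0 (H n u).2.
Qed.

Lemma totg_lin M n (c : int * C n) : linear (fun u : M n => totg sym c u).
Proof.
move=> a u v.
have /= := @gen_relE k _ (@totrel k sym C M)
    [:: (1, Totgen c (a *: u + v))] [:: (a, Totgen c u); (1, Totgen c v)].
rewrite !big_cons !big_nil /= !scale1r !addr0; apply=> V phi [_ H _].
by rewrite /ev !big_cons !big_nil /= !scale1r !addr0 H.
Qed.

Lemma totg_act M n (s : 'S_n) e (c : C n) (u : M n) : adm sym s ->
  totg sym (e, ract C s c) u = totg sym (e, c) (lact M s u).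
Proof.
move=> As.
have /= := @gen_relE k _ (@totrel k sym C M)
    [:: (1, Totgen (e, ract C s c) u)] [:: (1, Totgen (e, c) (lact M s u))].
rewrite !big_cons !big_nil /= !scale1r !addr0; apply=> V phi [_ _ H].
by rewrite /ev !big_cons !big_nil /= !scale1r !addr0 H.
Qed.

Definition totbal M (V : lmodType k) (phi : forall n, int * C n -> M n -> V) : Prop :=
  [/\ forall n (u : M n), hlin (fun c : int * C n => phi n c u),
      forall n c, linear (phi n c) &
      forall n (s : 'S_n), adm sym s -> forall e (c : C n) (u : M n),
        phi n (e, ract C s c) u = phi n (e, c) (lact M s u)].

Lemma totbal_rel M (V : lmodType k) (phi : forall n, int * C n -> M n -> V) :
  totbal phi -> @totrel k sym C M V (fun z => phi (tag z) (tagged z).1 (tagged z).2).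
Proof. by case=> H1 H2 H3; split. Qed.

Lemma tlift_totg M (V : lmodType k) (phi : forall n, int * C n -> M n -> V) n c u :
  totbal phi -> tlift (sym := sym) phi (totg sym c u) = phi n c u.
Proof. by move=> /totbal_rel H; rewrite /tlift /totg lift_gen. Qed.

Lemma tlift_lin M (V : lmodType k) (phi : forall n, int * C n -> M n -> V) :
  totbal phi -> linear (tlift (sym := sym) phi).
Proof. by move=> /totbal_rel H; apply: lift_is_linear. Qed.

Lemma tot_ext M (V : lmodType k) (f g : tot sym C M -> V) : linear f -> linear g ->
  (forall n (c : int * C n) (u : M n), f (totg sym c u) = g (totg sym c u)) -> f =1 g.
Proof. by move=> Lf Lg H; apply: pres_ext => // -[n [c u]]; exact: H. Qed.

Lemma totbal_totg M : totbal (fun n c u => totg sym c u : tot sym C M).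
Proof. by split=> *; [exact: totg_hlin|exact: totg_lin|exact: totg_act]. Qed.

Definition is_lseq M : Prop := (forall n, is_gmod (M n)) /\
  (forall n (s : 'S_n), adm sym s -> homog 0 (@lact k M n s)).

Lemma totbal_comp M N (V : lmodType k) (phi : forall n, int * C n -> N n -> V)
    (s : int -> k) (f : forall n, int -> M n -> N n) :
  totbal phi -> (forall n e, linear (f n e)) ->
  (forall n (s : 'S_n), adm sym s -> forall e u, f n e (lact M s u) = lact N s (f n e u)) ->
  totbal (fun n c u => s c.1 *: phi n c (f n c.1 u)).
Proof.
move=> [H1 H2 H3] Lf fs; split=> [n u|n c|n t At e c u] /=.
- apply: (hlin_scale s (phi := fun c => phi n c (f n c.1 u))).
  split=> [e a x y|e x] /=; first by have [-> _] := H1 n (f n e u).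
  by have [_ ->] := H1 n (f n e u).
- by apply: linear_scale; apply: linear_comp.
- by rewrite H3 // fs.
Qed.

Lemma pr_totbal M m : is_lseq M ->
  totbal (fun n c u => totg sym c (pr (M n) (m - c.1) u) : tot sym C M).
Proof.
move=> [gM aM].
have := @totbal_comp M M _ _ (fun _ => 1) (fun n e => pr (M n) (m - e)) (totbal_totg M).
have -> : (fun n c u => (fun=> 1) c.1 *: totg sym c (pr (M n) (m - c.1) u)) =
  (fun n c u => totg sym c (pr (M n) (m - c.1) u) : tot sym C M).
  by do 3!apply/functional_extensionality_dep => ?; rewrite scale1r.
apply.
- by move=> n e; case: (gM n).
- by move=> n s As e u; have [_ H] := aM n s As; rewrite H addr0.
Qed.

Lemma pr_totg M m n (c : int * C n) (u : M n) : is_lseq M ->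
  pr (tot sym C M) m (totg sym c u) = totg sym c (pr (M n) (m - c.1) u).
Proof. by move=> lM; rewrite /= tlift_totg //; exact: pr_totbal. Qed.

Lemma tot_gmod M : is_lseq M -> is_gmod (tot sym C M).
Proof.
move=> lM; have [gM aM] := lM.
have Lp m : linear (pr (tot sym C M) m) by apply/tlift_lin/pr_totbal.
have PP i j : (fun x => pr (tot sym C M) i (pr (tot sym C M) j x)) =1
    (fun x => if i == j then pr (tot sym C M) i x else 0).
  apply: tot_ext; first exact: linear_comp.
    by case: eqP => _; [exact: Lp|exact: linear_zero].
  move=> n c u; rewrite !pr_totg //; have [_ H _] := gM n.
  rewrite H (inj_eq (addIr _)); case: eqP => // _.
  by rewrite (lin0 (@totg_lin M n c)).
split=> //.
apply: pres_ind => [|a x y Hx Hy|[n [c u]]].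
- exact: finsupp0.
- exact: finsupp_lin.
have [_ _ /(_ u) [s us Eu]] := gM n.
exists [seq i + c.1 | i <- s]; first by rewrite map_inj_uniq //; exact: addIr.
rewrite big_map -[gen _ _]/(totg sym c u) [in LHS]Eu (lin_sum _ _ _ (@totg_lin M n c)).
by apply: eq_bigr => i _; rewrite pr_totg // addrK.
Qed.

Lemma totg_hdeg M n (c : int * C n) (u : M n) i : is_lseq M -> hdeg i u ->
  hdeg (M := tot sym C M) (c.1 + i) (totg sym c u).
Proof. by move=> lM hu; rewrite /hdeg pr_totg // addrAC subrr add0r hu. Qed.

Lemma wpr_totbal M m : totbal (fun n c u => if n == m then totg sym c u else 0 : tot sym C M).
Proof.
split=> [n u|n c|n s As e c u]; case: eqP => _ //.
- exact: totg_hlin.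
- by split=> [*|//]; rewrite scaler0 addr0.
- exact: totg_lin.
- exact: linear_zero.
- exact: totg_act.
Qed.

Lemma wpr_totg M m n (c : int * C n) (u : M n) :
  wpr m (totg sym c u) = if n == m then totg sym c u else 0.
Proof. by rewrite /wpr tlift_totg //; exact: wpr_totbal. Qed.

Lemma wpr_lin M m : linear (wpr m : tot sym C M -> tot sym C M).
Proof. exact/tlift_lin/wpr_totbal. Qed.

End TotTheory.
Arguments totbal {k sym C M V} phi.

Section CofreeTheory.
Context {k : comPzRingType} {sym : bool} {C : cooperad sym k}.
Implicit Types M N L : gmod k.

Lemma Tseq_lseq M : is_lseq (sym := sym) (Tseq M).
Proof.
split=> n; first exact: T_gmod.
move=> s _; apply: (homog_eq (M := T M n) (N := T M n) (f := reind (fun a => (s^-1)%g a))).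
  by move=> u; rewrite /= tactE.
exact: reind_homog (perm_bij _).
Qed.

Lemma cofree_gmod M : is_gmod (cofree C M).
Proof. exact: tot_gmod (Tseq_lseq M). Qed.

Lemma cof_hlin M n (u : T M n) : hlin (fun c : int * C n => cof c u).
Proof. exact: (@totg_hlin k sym C (Tseq M)). Qed.

Lemma cof_lin M n (c : int * C n) : linear (fun u : T M n => cof c u).
Proof. exact: (@totg_lin k sym C (Tseq M)). Qed.

Lemma cof_act M n (s : 'S_n) e (c : C n) (u : T M n) : adm sym s ->
  cof (e, ract C s c) u = cof (e, c) (tact s u).
Proof. exact: (@totg_act k sym C (Tseq M)). Qed.

Lemma cof_ext M (V : lmodType k) (f g : cofree C M -> V) : linear f -> linear g ->
  (forall n (c : int * C n) (u : T M n), f (cof c u) = g (cof c u)) -> f =1 g.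
Proof. by move=> Lf Lg H; apply: tot_ext. Qed.

Lemma pr_cof M m n (c : int * C n) (u : T M n) :
  pr (cofree C M) m (cof c u) = cof c (pr (T M n) (m - c.1) u).
Proof. exact: (pr_totg _ _ _ (Tseq_lseq M)). Qed.

Lemma hdeg_cof M n (c : int * C n) (u : T M n) i : hdeg i u ->
  hdeg (M := cofree C M) (c.1 + i) (cof c u).
Proof. exact: (totg_hdeg _ (Tseq_lseq M)). Qed.

Lemma wpr_cof M m n (c : int * C n) (u : T M n) :
  wpr m (cof c u) = if n == m then cof c u else 0.
Proof. exact: wpr_totg. Qed.

Lemma cof_span M (S : cofree C M -> Prop) :
  (forall n (c : int * C n) (x : tgen M n), S (cof c (ten x))) ->
  forall z : cofree C M, span S z.
Proof.
move=> H; apply: pres_ind => [|a x y Hx Hy|[n [c u]]]; first exact: span0.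
  by apply: span_add => //; apply: span_scale.
rewrite -[gen _ _]/(cof c u); move: u; apply: pres_ind => [|a x y Hx Hy|x].
- by rewrite (lin0 (@cof_lin M n c)); apply: span0.
- by rewrite (@cof_lin M n c); apply: span_add => //; apply: span_scale.
- exact/span_gen/H.
Qed.

Definition thick_lin M N (f : thick M N) : Prop :=
  (forall n, linear (f n)) /\ symmetric_thick sym f.

Lemma thick_linP m M N (f : thick M N) : is_thick m f -> symmetric_thick sym f -> thick_lin f.
Proof. by move=> Hf sf; split=> // n; case: (Hf n). Qed.

Lemma thick_lin_comp M N L (f : thick N L) (g : thick M N) :
  thick_lin f -> thick_lin g -> thick_lin (fun n u => f n (g n u)).
Proof.
by move=> [Lf sf] [Lg sg]; split=> [n|n s As u]; [exact: linear_comp|rewrite sg // sf].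
Qed.

Lemma thick_lin_id M : thick_lin (thick_id M).
Proof. by split. Qed.

Lemma thick_lin_lincomb M N (f g : thick M N) a : thick_lin f -> thick_lin g ->
  thick_lin (fun n u => a *: f n u + g n u).
Proof.
move=> [Lf sf] [Lg sg]; split=> [n|n s As u]; first exact/linear_add/Lg/linear_scale.
by rewrite sf // sg // (@tact_lin _ _ _ s).
Qed.

Lemma thick_lin_tpow M N (f : M -> N) : homog 0 f -> thick_lin (tpow f).
Proof.
move=> Hf; split=> n; first exact: tpow_lin.
by move=> s _ u; rewrite !tactE; exact: tpow_reind (perm_bij _) _.
Qed.

Lemma thick_lin_tins M m (u : M -> M) : homog m u -> thick_lin (@tins k M m u id).
Proof.
move=> Hu; split=> n; first exact: tins_lin (homog_id M).
by move=> s _ w; rewrite !tactE; exact: tins_reind (perm_bij _) Hu _.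
Qed.

Lemma cofmap_totbal M N m (f : thick M N) : thick_lin f ->
  @totbal k sym C (Tseq M) _ (fun n (c : int * C n) (u : T M n) => sgn (m * c.1) *: cof c (f n u)).
Proof.
move=> [Lf sf].
apply: (@totbal_comp k sym C (Tseq M) (Tseq N) _ _ (fun e => sgn (m * e)) (fun n _ => f n)).
- exact: totbal_totg.
- by move=> n _; exact: Lf.
- by move=> n s As _ u; exact: (sf n s As u).
Qed.

Lemma cofmap_cof M N m (f : thick M N) n (c : int * C n) (u : T M n) : thick_lin f ->
  cofmap m f (cof c u) = sgn (m * c.1) *: cof c (f n u).
Proof.
move=> Lf; rewrite /cofmap /totmap.
exact: (tlift_totg (M := Tseq M) c u (cofmap_totbal m Lf)).
Qed.

Lemma cofmap_lin M N m (f : thick M N) : thick_lin f ->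
  linear (cofmap m f : cofree C M -> cofree C N).
Proof. by move=> Lf; apply/(tlift_lin (M := Tseq M))/cofmap_totbal. Qed.

Lemma cofmap_comp M N L m m' (f : thick N L) (g : thick M N) :
  thick_lin f -> thick_lin g -> forall x : cofree C M,
  cofmap m f (cofmap m' g x) = cofmap (m + m') (fun n u => f n (g n u)) x.
Proof.
move=> Lf Lg; have Lfg := thick_lin_comp Lf Lg.
apply: cof_ext; [by apply: linear_comp; exact: cofmap_lin|exact: cofmap_lin|].
move=> n c u; rewrite !cofmap_cof // (linZ _ _ (cofmap_lin m Lf)) cofmap_cof //.
by rewrite scalerA -sgnD; congr (sgn _ *: _); ring.
Qed.

Lemma cofmap_lincomb M N m (f g : thick M N) a : thick_lin f -> thick_lin g ->
  forall x : cofree C M,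
  cofmap m (fun n u => a *: f n u + g n u) x = a *: cofmap m f x + cofmap m g x.
Proof.
move=> Lf Lg; have Lfg := thick_lin_lincomb a Lf Lg.
apply: cof_ext; first exact: cofmap_lin.
  by apply: linear_add; [apply: linear_scale|]; exact: cofmap_lin.
move=> n c u; rewrite !cofmap_cof // (@cof_lin _ _ c) scalerDr !scalerA.
by rewrite mulrC.
Qed.

Lemma cofmap_id M (x : cofree C M) : cofmap 0 (thick_id M) x = x.
Proof.
move: x; apply: cof_ext => //; first exact/cofmap_lin/thick_lin_id.
move=> n c u; rewrite cofmap_cof; last exact: thick_lin_id.
by rewrite mul0r scale1r.
Qed.

Lemma cofmap_eq M N m (f g : thick M N) (x : cofree C M) :
  thick_eq f g -> cofmap m f x = cofmap m g x.
Proof.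
by move=> fg; congr (cofmap m _ x); do 2!apply/functional_extensionality_dep => ?; exact: fg.
Qed.

Lemma homog_cof M (N : gmod k) m (f : cofree C M -> N) : is_gmod N -> linear f ->
  (forall n (c : int * C n) (u : T M n) i, hdeg i u -> hdeg (c.1 + i + m) (f (cof c u))) ->
  homog m f.
Proof.
move=> gN Lf Hf; split=> // i; have [LN _ _] := gN; have [LC _ _] := cofree_gmod M.
apply: cof_ext; [exact: linear_comp|exact: linear_comp|move=> n c].
have gT := T_gmod M n.
apply: (gmod_ext gT).
- apply: (linear_comp Lf); apply: (linear_comp (LC i)); exact: cof_lin.
- apply: (linear_comp (LN _)); apply: (linear_comp Lf); exact: cof_lin.
move=> j u hu; rewrite pr_cof (prE _ gT hu) (prE _ gN (Hf n c u j hu)).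
rewrite (inj_eq (addIr m)) [c.1 + j]addrC -subr_eq.
by case: eqP => // _; rewrite (lin0 (@cof_lin M n c)) lin0.
Qed.

Lemma cofmap_homog M N m (f : thick M N) : is_thick m f -> symmetric_thick sym f ->
  homog m (cofmap m f : cofree C M -> cofree C N).
Proof.
move=> Hf sf; have Lf := thick_linP Hf sf.
apply: homog_cof; [exact: cofree_gmod|exact: cofmap_lin|move=> n c u i hu].
rewrite cofmap_cof // /hdeg (linZ _ _ _); last by case: (cofree_gmod N).
by congr (_ *: _); rewrite -addrA; apply: hdeg_cof; apply: hdeg_homog hu.
Qed.

Section Dif.
Context {M : gmod k} {d : M -> M} (Hd : homog (-1) d).

Lemma cofdif_totbal : @totbal k sym C (Tseq M) _ (fun n (c : int * C n) (u : T M n) =>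
  cof (c.1 - 1, dif (C n) c.2) u + sgn c.1 *: cof c (tdif d u)).
Proof.
have [Ccx Cact] := cseqP C; have [Ltd std] := thick_lin_tins Hd.
split=> [n u|n c|n s As e c u] /=.
- have [_ Hdif _] := Ccx n.
  have h1 := hlin_homog Hdif (@cof_hlin M n u).
  have h2 := hlin_scale (fun e => sgn e) (@cof_hlin M n (tdif d u)).
  split=> [e a x y|e x].
    by have := h1.1 e a x y; have := h2.1 e a x y => /= -> ->; rewrite scalerDr addrACA.
  by have := h1.2 e x; have := h2.2 e x => /= -> ->.
- apply: linear_add; first exact: cof_lin.
  apply: linear_scale; apply: (linear_comp (f := fun u => cof c u)); first exact: cof_lin.
  exact: Ltd.
- have [_ cd _ _] := Cact n s s As As.
  rewrite -cd !cof_act //; congr (_ + _ *: cof _ _).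
  by rewrite /tdif std.
Qed.

Lemma cofdif_cof n (c : int * C n) (u : T M n) :
  cofdif d (cof c u) = cof (c.1 - 1, dif (C n) c.2) u + sgn c.1 *: cof c (tdif d u).
Proof. exact: (tlift_totg (M := Tseq M) c u cofdif_totbal). Qed.

Lemma cofdif_lin : linear (cofdif d : cofree C M -> cofree C M).
Proof. exact: (tlift_lin cofdif_totbal). Qed.

Lemma cofdif_homog : homog (-1) (cofdif d : cofree C M -> cofree C M).
Proof.
have gC := cofree_gmod M; have [LC _ _] := gC.
apply: homog_cof => //; first exact: cofdif_lin.
move=> n c u i hu; rewrite /hdeg cofdif_cof (linD _ _ (LC _)) (linZ _ _ (LC _)); congr (_ + _ *: _).
  by rewrite addrAC; exact: (hdeg_cof (c.1 - 1, dif (C n) c.2) hu).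
rewrite -addrA; apply: hdeg_cof; apply: (hdeg_homog (M := T M n) (N := T M n)) => //.
exact: tins_homog (homog_id M).
Qed.

End Dif.

End CofreeTheory.

(** * Multilinear maps and blocks of words *)

Section Blocks.
Context {n : nat} {r : 'I_n -> nat}.
Local Notation Rank := (@tagnat.Rank n r).
Local Notation sum_r := 'I_(\sum_i r i).

Lemma flatE (Y : Type) (F : forall i, 'I_(r i) -> Y) i (s : 'I_(r i)) :
  F (tagnat.sig1 (Rank i s)) (tagnat.sig2 (Rank i s)) = F i s.
Proof. exact: (congr1 (fun p => F (tag p) (tagged p)) (tagnat.rankK _)). Qed.

Lemma Rank_ind (Q : sum_r -> Prop) : (forall i s, Q (Rank i s)) -> forall z, Q z.
Proof. by move=> H z; rewrite -(tagnat.sig2K z); apply: H. Qed.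

Lemma Rank_inj i : injective (Rank i).
Proof.
move=> s t /(congr1 val) /eqP; rewrite tagnat.eq_Rank eqxx /= => /eqP /val_inj //.
Qed.

Lemma Rank_eq i (s t : 'I_(r i)) : (Rank i s == Rank i t) = (s == t).
Proof. exact: (inj_eq (@Rank_inj i)). Qed.

Lemma Rank_neq i j (s : 'I_(r i)) (t : 'I_(r j)) : i != j -> (Rank i s == Rank j t) = false.
Proof. by move=> ij; rewrite -val_eqE /= tagnat.eq_Rank (negPf ij). Qed.

Lemma Rank_lt_in i (s t : 'I_(r i)) : (Rank i s < Rank i t)%N = (s < t)%N.
Proof. exact: tagnat.lt_Rank. Qed.

Lemma Rank_lt i j (s : 'I_(r i)) (t : 'I_(r j)) : (i < j)%N -> (Rank i s < Rank j t)%N.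
Proof.
move=> ij; rewrite ltnNge; apply/negP => /(tagnat.le_sig1 (p_ := r)).
by rewrite !tagnat.Rank1K leEord leqNgt ij.
Qed.

Lemma big_Rank (R : Type) (idx : R) (op : Monoid.com_law idx) (F : sum_r -> R) :
  \big[op/idx]_z F z = \big[op/idx]_(i < n) \big[op/idx]_(s < r i) F (Rank i s).
Proof.
rewrite (reindex (tagnat.rank (p_ := r))) /=; last exact: onW_bij (tagnat.rank_bij).
by rewrite sig_big_dep /=; apply: eq_bigr => p _; rewrite tagnat.rankE.
Qed.

Context {k : comPzRingType}.

(** The sign of a rearrangement of a concatenation of blocks: [cross] collects
    the inversions between two given blocks. *)
Definition cross (deg : sum_r -> int) (key : sum_r -> nat) (i j : 'I_n) : k :=
  \prod_(s < r i) \prod_(t < r j)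
    (if (key (Rank j t) < key (Rank i s))%N
     then sgn (deg (Rank i s) * deg (Rank j t)) else 1).

Lemma koszul_blocks (deg : sum_r -> int) (key : sum_r -> nat) :
  koszul deg key =
  (\prod_i koszul (fun s => deg (Rank i s)) (fun s => key (Rank i s))) *
  \prod_(i < n) \prod_(j < n | (i < j)%N) cross deg key i j :> k.
Proof.
rewrite koszulE big_Rank /= -big_split /=; apply: eq_bigr => i _.
rewrite koszulE; under eq_bigr => s _ do rewrite big_mkcond big_Rank /=.
rewrite exchange_big /= (bigD1 i) //=; congr (_ * _).
  by apply: eq_bigr => s _; rewrite [RHS]big_mkcond; apply: eq_bigr => t _; rewrite Rank_lt_in.
rewrite [RHS]big_mkcond [RHS](bigD1 i) //= ltnn mul1r; apply: eq_bigr => j ji.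
case: ltnP => ij; last first.
  have {}ij : (j < i)%N by rewrite ltn_neqAle ij andbT.
  rewrite big1 // => s _; rewrite big1 // => t _.
  by rewrite ltnNge ltnW //=; apply: Rank_lt.
by apply: eq_bigr => s _; apply: eq_bigr => t _; rewrite Rank_lt.
Qed.

Lemma cross_all (deg : sum_r -> int) (key : sum_r -> nat) i j (b : bool) :
  (forall s t, (key (Rank j t) < key (Rank i s))%N = b) ->
  cross deg key i j =
  if b then sgn ((\sum_s deg (Rank i s)) * (\sum_t deg (Rank j t))) else 1 :> k.
Proof.
move=> H; rewrite /cross.
under eq_bigr => s _ do under eq_bigr => t _ do rewrite H.
case: b H => _; last by rewrite big1 // => s _; rewrite big1.
rewrite mulr_suml sgn_sum; apply: eq_bigr => s _.
by rewrite mulr_sumr sgn_sum.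
Qed.

Lemma eq_koszul_key m (deg : 'I_m -> int) (key key' : 'I_m -> nat) :
  (forall i j, (key j < key i)%N = (key' j < key' i)%N) ->
  koszul deg key = koszul deg key' :> k.
Proof.
move=> H; rewrite !koszulE; apply: eq_bigr => i _; apply: eq_bigl => j.
by rewrite H.
Qed.

End Blocks.

Section MultiLift.
Context {k : comPzRingType} {n : nat} {X : 'I_n -> Type}.
Context {P : forall i (V : lmodType k), (X i -> V) -> Prop}.
Context {V : lmodType k} (phi : (forall i, X i) -> V) (b0 : forall i, X i).
Hypothesis phiP : forall b i, @P i V (fun y => phi (dfwith b y)).
Local Notation dflt i := (0, b0 i).

Definition mev (s : forall i, seq (k * X i)) : V :=
  \sum_(j : {dffun forall i, 'I_(size (s i))})
    (\prod_i (tnth (in_tuple (s i)) (j i)).1) *: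
    phi (fun i => (tnth (in_tuple (s i)) (j i)).2).

Let Z N (s : forall i, seq (k * X i)) : V :=
  \sum_(j : {ffun 'I_n -> 'I_N.+1})
    (\prod_i (nth (dflt i) (s i) (j i)).1) *: phi (fun i => (nth (dflt i) (s i) (j i)).2).

Let mevZ N s : (forall i, size (s i) <= N.+1)%N -> mev s = Z N s.
Proof.
move=> sN; pose w (j : {dffun forall i, 'I_(size (s i))}) : {ffun 'I_n -> 'I_N.+1} :=
  [ffun i => widen_ord (sN i) (j i)].
have wI : injective w.
  rewrite /w => j j' E; apply/ffunP => i; apply: val_inj.
  by have := congr1 (fun F : {ffun _ -> _} => val (F i)) E; rewrite !ffunE.
rewrite /Z (bigID (fun j => j \in w @: predT)) /= [X in _ + X]big1 ?addr0; last first.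
  move=> j njw; have [i Hi] : exists i, (size (s i) <= j i)%N.
    apply/existsP; apply: contraNT njw; rewrite negb_exists => /forallP H.
    have {}H i : (j i < size (s i))%N by rewrite ltnNge H.
    pose jd : {dffun forall i, 'I_(size (s i))} := [ffun i => Ordinal (H i)].
    apply/imsetP; exists jd => //; rewrite /w; apply/ffunP => i; apply: val_inj.
    by rewrite !ffunE.
  by rewrite (bigD1 i) //= nth_default //= mul0r scale0r.
rewrite big_imset /=; last by move=> ? ? _ _; exact: wI.
apply: eq_big => [j|j _]; first by rewrite inE.
congr (_ *: phi _).
  by apply: eq_bigr => i _; rewrite ffunE /= (tnth_nth (dflt i)).
by apply/functional_extensionality_dep => i; rewrite ffunE /= (tnth_nth (dflt i)).
Qed.

(** Expansion in the slot [i]; [slot s i] does not depend on [s i]. *)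
Let slot N s i (y : X i) : V :=
  \sum_(j : {ffun 'I_n -> 'I_N.+1} | j i == ord0)
    (\prod_(i' | i' != i) (nth (dflt i') (s i') (j i')).1) *:
    phi (dfwith (fun i' => (nth (dflt i') (s i') (j i')).2) y).

Let Z_slot N s i (t : seq (k * X i)) : (size t <= N.+1)%N ->
  Z N (dfwith s t) = ev (slot N s (i := i)) t.
Proof.
move=> tN; rewrite /ev (big_nth (dflt i)) big_mkord.
rewrite (big_ord_widen N.+1 (fun a => (nth (dflt i) t a).1 *: slot N s (nth (dflt i) t a).2)) //.
rewrite big_mkcond /= /Z (partition_big (fun j : {ffun 'I_n -> 'I_N.+1} => j i) predT) //=.
apply: eq_bigr => a _.
transitivity ((nth (dflt i) t a).1 *: slot N s (nth (dflt i) t a).2); last first.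
  by case: ltnP => // ta; rewrite nth_default //= scale0r.
rewrite /slot scaler_sumr.
rewrite (reindex_onto (fun j : {ffun 'I_n -> 'I_N.+1} => upd j i a) (fun j => upd j i ord0)) /=; last first.
  move=> j /eqP ja; apply/ffunP => i'; rewrite !ffunE; case: eqP => // ->.
  by rewrite ja.
apply: eq_big => [j|j].
  rewrite ffunE eqxx eqxx /=; apply/eqP/eqP => [<-|ji].
    by rewrite !ffunE eqxx.
  by apply/ffunP => i'; rewrite !ffunE; case: eqP => // ->.
rewrite ffunE eqxx eqxx /= => _; rewrite scalerA (bigD1 i) //= dfwith_in ffunE eqxx.
congr (_ * _ *: phi _).
  by apply: eq_bigr => i' ii'; rewrite dfwith_out 1?eq_sym // ffunE (negPf ii').
apply/functional_extensionality_dep => i'.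
have [<-|ii'] := eqVneq i i'; first by rewrite !dfwith_in ffunE eqxx.
by rewrite !dfwith_out // ffunE eq_sym (negPf ii').
Qed.

Let slot_cls N s i (t t' : seq (k * X i)) : pres_cls (@P i) t = pres_cls (@P i) t' ->
  ev (slot N s (i := i)) t = ev (slot N s (i := i)) t'.
Proof.
move=> /pres_clsP tt'.
have E u : ev (slot N s (i := i)) u = \sum_(j : {ffun 'I_n -> 'I_N.+1} | j i == ord0)
    (\prod_(i' | i' != i) (nth (dflt i') (s i') (j i')).1) *:
    ev (fun y => phi (dfwith (fun i' => (nth (dflt i') (s i') (j i')).2) y)) u.
  rewrite /ev /slot; under eq_bigr do rewrite scaler_sumr.
  rewrite exchange_big /=; apply: eq_bigr => j _; rewrite scaler_sumr.
  by apply: eq_bigr => p _; rewrite !scalerA mulrC.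
by rewrite !E; apply: eq_bigr => j _; rewrite (tt' V).
Qed.

Lemma dfwith_same (Y : 'I_n -> Type) (s : forall i, Y i) i : dfwith s (s i) = s.
Proof. by apply/functional_extensionality_dep => j; case: dfwithP. Qed.

Let bound (s : forall i, seq (k * X i)) : exists N, forall i, (size (s i) <= N.+1)%N.
Proof.
by exists (\sum_i size (s i))%N => i; rewrite (bigD1 i) //= leqW // leq_addr.
Qed.

Lemma mev_cls s s' : (forall i, pres_cls (@P i) (s i) = pres_cls (@P i) (s' i)) ->
  mev s = mev s'.
Proof.
move=> ss'; have [N HN] := bound s; have [N' HN'] := bound s'.
pose K := maxn N N'; pose hy (l : seq 'I_n) i := if i \in l then s' i else s i.
have szK l i : (size (hy l i) <= K.+1)%N.
  rewrite /hy /K; case: ifP => _.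
    by apply: leq_trans (HN' i) _; rewrite ltnS leq_maxr.
  by apply: leq_trans (HN i) _; rewrite ltnS leq_maxl.
have H l : mev (hy [::]) = mev (hy l).
  elim: l => // i l ->; rewrite !(mevZ (szK _)).
  have -> : hy l = dfwith (hy l) (hy l i) by rewrite dfwith_same.
  have -> : hy (i :: l) = dfwith (hy l) (hy (i :: l) i).
    apply/functional_extensionality_dep => j.
    have [<-|ij] := eqVneq i j; first by rewrite dfwith_in.
    by rewrite dfwith_out // /hy inE eq_sym (negPf ij).
  rewrite !Z_slot //; apply: slot_cls; rewrite /hy mem_head.
  by case: ifP.
have -> : s = hy [::] by [].
rewrite (H (enum 'I_n)); congr mev; apply/functional_extensionality_dep => i.
by rewrite /hy mem_enum.
Qed.

Lemma mlift_mev (x : forall i, pres (@P i)) s :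
  (forall i, pres_cls (@P i) (s i) = x i) -> mlift phi x = mev s.
Proof. by move=> H; apply: mev_cls => i; rewrite pres_repK H. Qed.

Lemma mlift_gen (y : forall i, X i) : mlift phi (fun i => gen (@P i) (y i)) = phi y.
Proof.
rewrite (mlift_mev (s := fun i => [:: (1, y i)])) // (@mevZ 0) // /Z.
rewrite (bigD1 [ffun=> ord0]) //= [X in _ + X]big1 ?addr0; last first.
  by move=> j /eqP []; apply/ffunP => i; rewrite ffunE [j i]ord1.
rewrite big1 ?scale1r; last by move=> i _; rewrite ffunE.
by congr phi; apply/functional_extensionality_dep => i; rewrite ffunE.
Qed.

Lemma mlift_slot (x : forall i, pres (@P i)) i : linear (fun z => mlift phi (dfwith x (i := i) z)).
Proof.
move=> a u v; pose s i := pres_rep (x i).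
have E w t : pres_cls (@P i) t = w -> mlift phi (dfwith x (i := i) w) = mev (dfwith s t).
  move=> tw; apply: mlift_mev => j; case: dfwithP => [|j' ij].
    by rewrite dfwith_in.
  by rewrite dfwith_out // pres_repK.
have Ea : pres_cls (@P i) (scale_seq a (pres_rep u) ++ pres_rep v) = a *: u + v.
  rewrite -[RHS]pres_repK; apply/pres_clsP => W psi Ppsi.
  rewrite ev_cat ev_scale -!/(lift _ _) -[X in _ = X]/(lift psi (a *: u + v)).
  by rewrite lift_is_linear.
rewrite (E _ _ Ea) (E _ _ (pres_repK u)) (E _ _ (pres_repK v)).
have [N HN] := bound s; pose L := scale_seq a (pres_rep u) ++ pres_rep v.
pose K := maxn N (size L).
have sL : size L = (size (pres_rep u) + size (pres_rep v))%N.
  by rewrite size_cat size_map.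
have szK t : (size t <= size L)%N -> forall j, (size (dfwith s (i := i) t j) <= K.+1)%N.
  move=> tL j; case: dfwithP => [|j' _]; first by apply: leq_trans tL _; rewrite leqW // leq_maxr.
  by apply: leq_trans (HN j') _; rewrite ltnS leq_maxl.
have [lu lv] : (size (pres_rep u) <= size L)%N /\ (size (pres_rep v) <= size L)%N.
  by rewrite sL leq_addr leq_addl.
have LK t : (size t <= size L)%N -> (size t <= K.+1)%N.
  by move=> tL; apply: leq_trans tL _; rewrite leqW // leq_maxr.
rewrite !(mevZ (szK _ _)) // !Z_slot ?LK //.
by rewrite /L ev_cat ev_scale.
Qed.

End MultiLift.

Lemma mpres_ext (k : comPzRingType) n (X : 'I_n -> Type)
    (P : forall i (V : lmodType k), (X i -> V) -> Prop) (V : lmodType k)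
    (F G : (forall i, pres (@P i)) -> V) :
  (forall u i, linear (fun v => F (dfwith u (i := i) v))) ->
  (forall u i, linear (fun v => G (dfwith u (i := i) v))) ->
  (forall x : forall i, X i, F (fun i => gen (@P i) (x i)) = G (fun i => gen (@P i) (x i))) ->
  F =1 G.
Proof.
move=> LF LG FG u.
have: forall i, i \notin enum 'I_n -> exists y : X i, u i = gen (@P i) y.
  by move=> i; rewrite mem_enum.
elim: (enum 'I_n) u => [|i l IH] u Hu.
  have Hy i : exists y : X i, u i = gen (@P i) y by apply: Hu.
  have -> : u = fun i => gen (@P i) (projT1 (cid (Hy i))).
    by apply/functional_extensionality_dep => i; exact: projT2 (cid (Hy i)).
  exact: FG.
rewrite -(dfwith_same u i); apply: (pres_ext (LF u i) (LG u i)) => y.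
apply: IH => j jl; have [<-|ij] := eqVneq i j; first by exists y; rewrite dfwith_in.
by rewrite dfwith_out //; apply: Hu; rewrite inE negb_or eq_sym ij.
Qed.

Section Flat.
Context {k : comPzRingType} {M : gmod k} {n : nat} {r : 'I_n -> nat}.
Implicit Types x : forall i, tgen M (r i).

Definition flat x : tgen M (\sum_i r i) := [ffun s => x (tagnat.sig1 s) (tagnat.sig2 s)].

Lemma flat_Rank x i s : flat x (tagnat.Rank i s) = x i s.
Proof. by rewrite ffunE (flatE (fun i => x i)). Qed.

Let P (i : 'I_n) (V : lmodType k) := @slotwise k (int * M) (@hlin k M) (r i) V.

Lemma flat_slot x i : @P i _ (fun y => ten (flat (dfwith x y))).
Proof.
move=> y s; have := @ten_slot k M _ (flat (dfwith x y)) (tagnat.Rank i s).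
congr hlin; apply/funext => a; congr ten; apply/ffunP.
apply: Rank_ind => j t; rewrite flat_Rank ffunE flat_Rank.
have [ij|ij] := eqVneq i j; last by rewrite !dfwith_out // eq_sym Rank_neq.
by subst j; rewrite !dfwith_in ffunE Rank_eq.
Qed.

Lemma tflat_ten x : tflat (fun i => ten (x i)) = ten (flat x).
Proof. by apply: (mlift_gen (fun i => [ffun=> (0, 0)])) => b i; exact: flat_slot. Qed.

Lemma tflat_slot (u : forall i, T M (r i)) i : linear (fun v => tflat (dfwith u (i := i) v)).
Proof.
apply: (mlift_slot (P := P) (fun i => [ffun=> (0, 0)])) => b j.
exact: flat_slot.
Qed.

Lemma multi_ext (V : lmodType k) (F G : (forall i, T M (r i)) -> V) :
  (forall u i, linear (fun v => F (dfwith u (i := i) v))) ->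
  (forall u i, linear (fun v => G (dfwith u (i := i) v))) ->
  (forall x, F (fun i => ten (x i)) = G (fun i => ten (x i))) -> F =1 G.
Proof. exact: (@mpres_ext k n (fun i => tgen M (r i)) P V F G). Qed.

Lemma tflat_scale (a : 'I_n -> k) (u : forall i, T M (r i)) :
  tflat (fun i => a i *: u i) = (\prod_i a i) *: tflat u.
Proof.
suff G (l : seq 'I_n) : uniq l ->
    tflat (fun i => (if i \in l then a i else 1) *: u i) = (\prod_(i <- l) a i) *: tflat u.
  have := G (enum 'I_n) (enum_uniq _); rewrite big_enum /= => <-; congr tflat.
  by apply/functional_extensionality_dep => i; rewrite mem_enum.
elim: l => [_|i l IH /= /andP[il ul]].
  rewrite big_nil scale1r; congr tflat.
  by apply/functional_extensionality_dep => i; rewrite scale1r.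
rewrite big_cons -scalerA -(IH ul).
set w := fun j => (if j \in l then a j else 1) *: u j.
have -> : (fun j => (if j \in i :: l then a j else 1) *: u j) = dfwith w (i := i) (a i *: w i).
  apply/functional_extensionality_dep => j; have [<-|ij] := eqVneq i j.
    by rewrite dfwith_in /w mem_head (negPf il) scale1r.
  by rewrite dfwith_out // /w inE eq_sym (negPf ij).
by rewrite (linZ _ _ (@tflat_slot w i)) dfwith_same.
Qed.

End Flat.

(** * Regrouping a word into blocks *)

(** The new member [v] is transported along [E], so that the arities [r] do not
    depend on it. *)
Lemma slot_family n (Y : nat -> Type) (b : 'I_n -> {r : nat & Y r}) i n0 (v0 : Y n0) :
  exists (r : 'I_n -> nat) (y : forall j, Y (r j)) (E : n0 = r i),
  forall v : Y n0, dfwith b (i := i) (existT Y n0 v) =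
    fun j => existT Y (r j) (dfwith y (eq_rect n0 Y v (r i) E) j).
Proof.
pose b' := dfwith b (i := i) (existT Y n0 v0).
have E : n0 = tag (b' i) by rewrite /b' dfwith_in.
exists (fun j => tag (b' j)), (fun j => tagged (b' j)), E => v.
apply/functional_extensionality_dep => j; have [<-|ij] := eqVneq i j.
  by rewrite !dfwith_in; case: _ / E.
by rewrite !dfwith_out // /b' dfwith_out //; case: (b j).
Qed.

Section Psi.
Context {k : comPzRingType} {sym : bool} {C : cooperad sym k}.
Implicit Types M N : gmod k.

Section OneModule.
Context {M : gmod k} {n : nat}.

(** [psi r c] regroups a word [y_1 .. y_m] into [(c_1; y_1 ..) .. (c_n; .. y_m)]. *)
Definition psi (r : 'I_n -> nat) (c : forall i, int * C (r i)) :
    T M (\sum_i r i) -> T (cofree C M) n :=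
  @cofunsplit k sym C M n (fun i => existT (fun r => (int * C r)%type) (r i) (c i)).

Definition part (r : 'I_n -> nat) (y : tgen M (\sum_i r i)) i : tgen M (r i) :=
  [ffun s => y (tagnat.Rank i s)].

Definition psig (r : 'I_n -> nat) (c : forall i, int * C (r i)) (y : tgen M (\sum_i r i)) :
    tgen (cofree C M) n :=
  [ffun i => ((c i).1 + tdeg (part y i), cof (c i) (ten (part y i)))].

Lemma part_upd (r : 'I_n -> nat) (y : tgen M (\sum_i r i)) i s a j :
  part (upd y (tagnat.Rank i s) a) j = dfwith (part y) (upd (part y i) s a) j.
Proof.
apply/ffunP => t; rewrite !ffunE; have [ij|ij] := eqVneq i j.
  by subst j; rewrite dfwith_in !ffunE Rank_eq.
by rewrite dfwith_out // ffunE Rank_neq // eq_sym.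
Qed.

Lemma part_flat (r : 'I_n -> nat) (x : forall i, tgen M (r i)) i : part (flat x) i = x i.
Proof. by apply/ffunP => s; rewrite ffunE flat_Rank. Qed.

Lemma flat_part (r : 'I_n -> nat) (y : tgen M (\sum_i r i)) : flat (part y) = y.
Proof. by apply/ffunP; apply: Rank_ind => i s; rewrite flat_Rank ffunE. Qed.

Lemma tdeg_part (r : 'I_n -> nat) (y : tgen M (\sum_i r i)) : tdeg y = \sum_i tdeg (part y i).
Proof.
rewrite /tdeg big_Rank; apply: eq_bigr => i _; apply: eq_bigr => s _.
by rewrite ffunE.
Qed.

Lemma psig_slot (r : 'I_n -> nat) (c : forall i, int * C (r i)) :
  slotwise (@hlin k M) (fun y : tgen M (\sum_i r i) => ten (psig c y)).
Proof.
move=> y z; move: z; apply: Rank_ind => i s.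
pose rest := \sum_(t | t != s) (part y i t).1.
have E a : psig c (upd y (tagnat.Rank i s) a) = upd (psig c y) i
    ((c i).1 + (a.1 + rest), cof (c i) (ten (upd (part y i) s a))).
  apply/ffunP => j; rewrite !ffunE !part_upd; case: (j =P i) => [->|/eqP ji].
    rewrite dfwith_in; congr (_ + _, _).
    rewrite /tdeg (bigD1 s) //= ffunE eqxx; congr (_ + _).
    by apply: eq_bigr => t /negPf ts; rewrite ffunE ts.
  by rewrite dfwith_out // eq_sym.
have [H1 H2] := @ten_slot k _ _ (psig c y) i; have [G1 G2] := @ten_slot k _ _ (part y i) s.
split=> [e a u v|e u]; rewrite !E /=; last by rewrite G2.
by rewrite G1 (@cof_lin _ _ _ _ _ (c i)) H1.
Qed.

Lemma psi_slot (r : 'I_n -> nat) (c : forall i, int * C (r i)) :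
  slotwise (@hlin k M) (fun y : tgen M (\sum_i r i) =>
    shuffle (fun i => (c i).1) (fun i => tdeg (part y i)) *: ten (psig c y)).
Proof.
have := slotwise_scale (fun e : 'I_(\sum_i r i) -> int =>
  shuffle (fun i => (c i).1) (fun i => \sum_s e (tagnat.Rank i s))) (psig_slot c).
congr slotwise; apply/funext => y; congr (shuffle _ _ *: _).
by apply/funext => i; apply: eq_bigr => s _; rewrite ffunE.
Qed.

Lemma psi_ten (r : 'I_n -> nat) (c : forall i, int * C (r i)) (y : tgen M (\sum_i r i)) :
  psi c (ten y) = shuffle (fun i => (c i).1) (fun i => tdeg (part y i)) *: ten (psig c y).
Proof. by rewrite /psi /cofunsplit lift_ten //; exact: psi_slot. Qed.

Lemma psi_lin (r : 'I_n -> nat) (c : forall i, int * C (r i)) : linear (psi c).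
Proof. exact/lift_lin/psi_slot. Qed.

Lemma dfwith_fst (r : 'I_n -> nat) (c : forall i, int * C (r i)) (i : 'I_n) (c0 : int * C (r i)) (j : 'I_n) :
  (dfwith c (i := i) c0 j).1 = if i == j then c0.1 else (c j).1.
Proof.
have [<-|ij] := eqVneq i j; first by rewrite dfwith_in.
by rewrite dfwith_out.
Qed.

Lemma psi_hlin (r : 'I_n -> nat) (c : forall i, int * C (r i)) i w :
  hlin (fun c0 => psi (dfwith c (i := i) c0) w).
Proof.
have E c0 y : psi (dfwith c (i := i) c0) (ten y) =
    shuffle (fun j => if i == j then c0.1 else (c j).1) (fun i => tdeg (part y i)) *:
    ten (upd (psig c y) i (c0.1 + tdeg (part y i), cof c0 (ten (part y i)))).
  rewrite psi_ten; congr (shuffle _ _ *: ten _).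
    by apply/funext => j; exact: dfwith_fst.
  apply/ffunP => j; rewrite !ffunE; case: (j =P i) => [->|/eqP ji].
    by rewrite dfwith_in.
  by rewrite dfwith_out // eq_sym.
have K y : hlin (fun c0 : int * C (r i) => psi (dfwith c (i := i) c0) (ten y)).
  have [H1 H2] := @ten_slot k _ _ (psig c y) i.
  have [G1 G2] := cof_hlin (C := C) (ten (part y i)).
  split=> [e a u v|e u]; rewrite !E /=; last by rewrite G2.
  by rewrite G1 H1 scalerDr !scalerA mulrC.
split=> [e a u v|e u].
  apply: (@ten_ext _ _ _ _ (psi (dfwith c (i := i) (e, a *: u + v)))
    (fun w => a *: psi (dfwith c (i := i) (e, u)) w + psi (dfwith c (i := i) (e, v)) w)).
  - exact: psi_lin.
  - by apply/linear_add/psi_lin/linear_scale/psi_lin.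
  - by move=> y; exact: (K y).1.
apply: (@ten_ext _ _ _ _ (psi (dfwith c (i := i) (e, pr (C (r i)) e u)))
  (psi (dfwith c (i := i) (e, u)))); try exact: psi_lin.
by move=> y; exact: (K y).2.
Qed.

Definition inner (r : 'I_n -> nat) (t : forall i, 'S_(r i)) (z : 'I_(\sum_i r i)) : 'I_(\sum_i r i) :=
  tagnat.Rank (tagnat.sig1 z) (t (tagnat.sig1 z) (tagnat.sig2 z)).

Arguments inner : simpl never.

Lemma inner_Rank (r : 'I_n -> nat) (t : forall i, 'S_(r i)) i s :
  inner t (tagnat.Rank i s) = tagnat.Rank i (t i s).
Proof. exact: (flatE (fun i s => tagnat.Rank i (t i s))). Qed.

Lemma inner_bij (r : 'I_n -> nat) (t : forall i, 'S_(r i)) : bijective (inner t).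
Proof.
exists (inner (fun i => (t i)^-1)%g); apply: Rank_ind => i s; rewrite !inner_Rank.
  by rewrite permK.
by rewrite permKV.
Qed.

Lemma inner_adm (r : 'I_n -> nat) (t : forall i, 'S_(r i)) : (forall i, adm sym (t i)) -> admb sym (inner t).
Proof.
move=> At; split=> //; first exact: inner_bij.
case sy: sym => //; rewrite orFb; apply/forallP; apply: Rank_ind => i s; rewrite inner_Rank.
by have := At i; rewrite /adm sy /= => /eqP ->; rewrite perm1.
Qed.

Lemma koszul_inner (r : 'I_n -> nat) (t : forall i, 'S_(r i)) (y : tgen M (\sum_i r i)) :
  koszul (fun a => (y (inner t a)).1) (fun a => inner t a) =
  \prod_i koszul (fun s => (part y i (t i s)).1) (fun s => t i s) :> k.
Proof.
rewrite koszul_blocks [X in _ * X]big1 ?mulr1; last first.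
  move=> i _; rewrite big1 // => j ij; rewrite (cross_all _ (b := false)) // => s u; cbv beta.
  by rewrite !inner_Rank; apply/negbTE; rewrite -leqNgt ltnW // Rank_lt.
apply: eq_bigr => i _; rewrite (eq_koszul_key _ (key' := fun s => t i s)); last first.
  by move=> s u; cbv beta; rewrite !inner_Rank Rank_lt_in.
by congr koszul; apply/funext => s; rewrite inner_Rank ffunE.
Qed.

Lemma psi_act (r : 'I_n -> nat) (e : 'I_n -> int) (c : forall i, C (r i)) (t : forall i, 'S_(r i)) :
  (forall i, adm sym (t i)) -> forall w : T M (\sum_i r i),
  psi (fun i => (e i, ract C (t i) (c i))) w =
  psi (fun i => (e i, c i)) (reind (inner (fun i => (t i)^-1)%g) w).
Proof.
move=> At; have bb := inner_bij (fun i => (t i)^-1)%g.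
apply: ten_ext; [exact: psi_lin|by apply: linear_comp; [exact: psi_lin|exact: reind_lin]|].
move=> y; rewrite reind_ten // (linZ _ _ (@psi_lin _ _)) !psi_ten scalerA mulrC -scalerA.
set y' := [ffun a => y _].
have py i : part y' i = [ffun s => part y i ((t i)^-1%g s)].
  by apply/ffunP => s; rewrite !ffunE inner_Rank.
have dy i : tdeg (part y' i) = tdeg (part y i).
  rewrite py /tdeg [RHS](reindex_inj (@perm_inj _ (t i)^-1%g)) /=.
  by apply: eq_bigr => s _; rewrite ffunE.
have -> : (fun i => tdeg (part y' i)) = (fun i => tdeg (part y i)) by apply/funext.
congr (_ *: _); rewrite koszul_inner.
pose K i : k := koszul (fun s => (part y i s).1) (fun s => t i s).
have -> : \prod_i koszul (fun s => (part y i ((t i)^-1%g s)).1) (fun s => (t i)^-1%g s) =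
    \prod_i K i.
  by apply: eq_bigr => i _; rewrite /K [RHS]koszul_invl.
have : forall i, psig (fun i => (e i, ract C (t i) (c i))) y i =
    ((psig (fun i => (e i, c i)) y' i).1, K i *: (psig (fun i => (e i, c i)) y' i).2).
  move=> i; rewrite !ffunE /= dy cof_act // tact_ten py.
  by rewrite (linZ _ _ (@cof_lin _ _ _ _ _ _)).
move: (psig _ y) (psig _ y') => x x' Hx.
suff G (l : seq 'I_n) : uniq l -> forall z : tgen (cofree C M) n,
    ten [ffun i => if i \in l then ((z i).1, K i *: (z i).2) else z i] =
    (\prod_(i <- l) K i) *: ten z.
  have := G (enum 'I_n) (enum_uniq _) x'; rewrite big_enum /= => <-; congr ten.
  by apply/ffunP => i; rewrite ffunE mem_enum Hx.
elim: l => [|i l IH] /=; first by move=> _ z; rewrite big_nil scale1r; congr ten; apply/ffunP => i; rewrite ffunE.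
move=> /andP[il ul] z; rewrite big_cons -scalerA -(IH ul).
have := hlinZ (z i).1 (K i) (z i).2 (@ten_slot k _ _ [ffun j => if j \in l then ((z j).1, K j *: (z j).2) else z j] i).
move=> E; transitivity (K i *: ten (upd [ffun j => if j \in l then ((z j).1, K j *: (z j).2) else z j] i ((z i).1, (z i).2))).
  rewrite -E; congr ten; apply/ffunP => j; rewrite !ffunE inE.
  by case: (j =P i) => //= ->.
congr (_ *: ten _); apply/ffunP => j; rewrite !ffunE.
by case: (j =P i) => // ->; rewrite (negPf il); case: (z i).
Qed.

Definition outer (r : 'I_n -> nat) (s : 'S_n) (z : 'I_(\sum_i r (s i))) : 'I_(\sum_i r i) :=
  tagnat.Rank (s (tagnat.sig1 z)) (tagnat.sig2 z : 'I_(r (s (tagnat.sig1 z)))).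

Arguments outer : simpl never.

Lemma outer_Rank (r : 'I_n -> nat) (s : 'S_n) i (a : 'I_(r (s i))) :
  outer (r := r) (tagnat.Rank (p_ := fun i => r (s i)) i a) = tagnat.Rank (s i) a.
Proof. exact: (flatE (fun i (a : 'I_(r (s i))) => tagnat.Rank (s i) a)). Qed.

Lemma sum_perm (r : 'I_n -> nat) (s : 'S_n) : (\sum_i r (s i) = \sum_i r i)%N.
Proof. by rewrite [RHS](reindex_inj (@perm_inj _ s)). Qed.

Lemma outer_bij (r : 'I_n -> nat) (s : 'S_n) : bijective (@outer r s).
Proof.
apply: inj_card_bij; last by rewrite !card_ord sum_perm.
apply: Rank_ind => i a; apply: Rank_ind => j b; rewrite !outer_Rank => E.
have := congr1 val E => /= /eqP; rewrite tagnat.eq_Rank (inj_eq perm_inj) => /andP[/eqP ij].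
by subst j => /eqP /val_inj ->.
Qed.

Lemma koszul_outer (r : 'I_n -> nat) (s : 'S_n) (y : tgen M (\sum_i r i)) :
  koszul (fun a => (y (@outer r s a)).1) (fun a => outer a) =
  koszul (fun i => tdeg (part y (s i))) (fun i => s i) :> k.
Proof.
rewrite koszul_blocks [X in X * _]big1 ?mul1r; last first.
  move=> i _; apply: koszul_mono => a b ab; cbv beta; rewrite !outer_Rank ltnW //.
  by rewrite Rank_lt_in.
rewrite koszulE; apply: eq_bigr => i _; rewrite big_mkcondr; apply: eq_bigr => j ij.
rewrite (cross_all _ (b := (s j < s i)%N)); last first.
  move=> a b; cbv beta; rewrite !outer_Rank.
  case: (ltngtP (s j) (s i)) => [ji|ji|/val_inj/perm_inj ji]; first exact: Rank_lt.
    by apply/negbTE; rewrite -leqNgt ltnW // Rank_lt.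
  by rewrite ji ltnn in ij.
by case: ifP => // _; congr (sgn (_ * _)); apply: eq_bigr => a _; rewrite outer_Rank ffunE.
Qed.

Lemma koszul_add m (c z : 'I_m -> int) (s : 'S_m) :
  koszul (fun i => c i + z i) (fun i => s i) * shuffle c z =
  koszul c (fun i => s i) * koszul z (fun i => s i) *
  shuffle (fun i => c (s^-1 i)%g) (fun i => z (s^-1 i)%g) :> k.
Proof.
have shE (x y : 'I_m -> int) : shuffle x y =
    \prod_(i < m) \prod_(j < m | (j < i)%N) sgn (x i * y j) :> k.
  by rewrite /shuffle sgn_sum; apply: eq_bigr => i _; rewrite sgn_sum.
have -> : shuffle (fun i => c (s^-1 i)%g) (fun i => z (s^-1 i)%g) =
    \prod_(i < m) \prod_(j < m | (s j < s i)%N) sgn (c i * z j) :> k.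
  rewrite shE (reindex_inj (@perm_inj _ s)) /=; apply: eq_bigr => i _.
  by rewrite (reindex_inj (@perm_inj _ s)) /=; apply: eq_bigr => j _; rewrite !permK.
rewrite shE !koszulE.
rewrite !(prod_pairs (P := fun i j => (j < i)%N)); last by move=> i; rewrite ltnn.
rewrite (prod_pairs (P := fun i j => (s j < s i)%N)); last by move=> i; rewrite ltnn.
rewrite -!big_split /=; apply: eq_bigr => i _.
rewrite !big_mkcondr -!big_split /=.
apply: eq_bigr => j ij; have ji : (j < i)%N = false by apply/negbTE; rewrite -leqNgt ltnW.
rewrite ij ji mul1r.
have : s i != s j :> nat by apply/eqP => /val_inj/perm_inj E; rewrite E ltnn in ij.
case: (ltngtP (s i) (s j)) => // _ _; rewrite ?mul1r ?mulr1 //.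
rewrite -!sgnD; apply: (@sgn_eq _ _ _ (c j * z i)); ring.
Qed.

Lemma tact_psi (r : 'I_n -> nat) (c : forall i, int * C (r i)) (s : 'S_n) (w : T M (\sum_i r i)) :
  tact s (psi c w) = koszul (fun i => (c i).1) (fun i => s i) *:
  psi (fun i => c (s^-1 i)%g) (reind (@outer r s^-1) w).
Proof.
have bb := outer_bij r s^-1; move: w; apply: ten_ext.
- by apply: linear_comp; [exact: tact_lin|exact: psi_lin].
- by apply: linear_scale; apply: linear_comp; [exact: psi_lin|exact: reind_lin].
move=> y; rewrite reind_ten // psi_ten (linZ _ _ (@tact_lin _ _ _ _)) tact_ten.
rewrite (linZ _ _ (@psi_lin _ _)) psi_ten !scalerA.
set y' := [ffun a => y _].
have py i : part y' i = part y ((s^-1)%g i).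
  by apply/ffunP => a; rewrite !ffunE outer_Rank.
congr (_ *: ten _); last by apply/ffunP => i; rewrite !ffunE py.
have -> : (fun i => (psig c y i).1) = (fun i => (c i).1 + tdeg (part y i)).
  by apply/funext => i; rewrite ffunE.
rewrite mulrC koszul_add koszul_outer.
have -> : (fun i => tdeg (part y' i)) = (fun i => tdeg (part y ((s^-1)%g i))).
  by apply/funext => i; rewrite py.
by rewrite -(koszul_invl (fun i => tdeg (part y i))) ?mulrA.
Qed.

Lemma outer_adm (r : 'I_n -> nat) s : adm sym s -> admb sym (@outer r s).
Proof.
move=> As; split; [exact: sum_perm|exact: outer_bij|].
case sy: sym => //; rewrite orFb; move: As; rewrite /adm sy orFb => /eqP ->.
apply/forallP; apply: Rank_ind => i a; rewrite outer_Rank !tagnat.RankEsum.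
by rewrite eqn_add2r; apply/eqP; apply: eq_big => j; rewrite !perm1.
Qed.

Lemma hdeg_psi (r : 'I_n -> nat) (c : forall i, int * C (r i)) w i : hdeg i w ->
  hdeg (M := T (cofree C M) n) (\sum_i (c i).1 + i) (psi c w).
Proof.
move=> <-; rewrite /hdeg.
have Lp := @pr_T_lin k (cofree C M) n; have Lq := @pr_T_lin k M (\sum_i r i).
move: w; apply: ten_ext.
- by apply: (linear_comp (Lp _)); apply: linear_comp; [exact: psi_lin|exact: Lq].
- by apply: linear_comp; [exact: psi_lin|exact: Lq].
move=> y; rewrite pr_ten; case: eqP => [<-|_]; last by rewrite (lin0 (@psi_lin _ _)) (lin0 (Lp _)).
rewrite psi_ten (linZ _ _ (Lp _)) pr_ten.
suff -> : tdeg (psig c y) = \sum_i (c i).1 + tdeg y by rewrite eqxx.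
by rewrite tdeg_part -big_split; apply: eq_bigr => j _; rewrite ffunE.
Qed.

Lemma ten_psi (x : tgen (cofree C M) n)
    (b : 'I_n -> {r : nat & ((int * C r) * tgen M r)%type}) :
  (forall i, (x i).2 = cof (tagged (b i)).1 (ten (tagged (b i)).2)) ->
  exists a w, ten x = a *: psi (r := fun i => tag (b i)) (fun i => (tagged (b i)).1) w.
Proof.
pose r i := tag (b i); pose c i : int * C (r i) := (tagged (b i)).1.
pose y i : tgen M (r i) := (tagged (b i)).2 => xE.
have [H|/existsNP[i Hi]] := pselect (forall i, (x i).1 = (c i).1 + tdeg (y i)).
  exists (shuffle (fun i => (c i).1) (fun i => tdeg (y i))), (ten (flat y)).
  rewrite psi_ten scalerA.
  have -> : (fun i => tdeg (part (flat y) i)) = (fun i => tdeg (y i)).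
    by apply/funext => i; rewrite part_flat.
  rewrite shuffle_sqr scale1r; congr ten; apply/ffunP => i.
  by rewrite ffunE part_flat -H -xE; case: (x i).
exists 0, 0; rewrite scale0r -(upd_same x i); move: (xE i) Hi; case: (x i) => e z /= -> /eqP ez.
have hz := hdeg_cof (c i) (hdeg_ten (y i)).
by rewrite (hlin_hdeg _ (cofree_gmod M) (@ten_slot k _ _ x i) hz) (negPf ez).
Qed.

Lemma psi_ext (V : lmodType k) (f g : T (cofree C M) n -> V) : linear f -> linear g ->
  (forall r (c : forall i, int * C (r i)) w, f (psi c w) = g (psi c w)) -> f =1 g.
Proof.
move=> Lf Lg fg.
apply: (ten_span (S := fun _ z => exists m (c : int * C m) (y : tgen M m), z = cof c (ten y))) => //.
  by move=> e z; apply: cof_span => m c y; exists m, c, y.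
move=> x /choice[r /(_ _)/cid H]; pose c i := projT1 (H i).
pose y i := projT1 (cid (projT2 (H i))).
have [|a [w ->]] := @ten_psi x (fun i => existT (fun r => (int * C r) * tgen M r)%type (r i) (c i, y i)).
  by move=> i; exact: (projT2 (cid (projT2 (H i)))).
by rewrite (linZ _ _ Lf) (linZ _ _ Lg) fg.
Qed.

End OneModule.

End Psi.

(** * Thick maps of cofree coalgebras *)

Lemma dfwith_dfwith n (X : 'I_n -> Type) (x : forall i, X i) i (u v : X i) :
  dfwith (dfwith x u) v = dfwith x v.
Proof.
apply/functional_extensionality_dep => j; have [<-|ij] := eqVneq i j.
  by rewrite !dfwith_in.
by rewrite !dfwith_out.
Qed.

Lemma dfwithC n (X : 'I_n -> Type) (x : forall i, X i) i j (u : X i) (v : X j) :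
  i != j -> dfwith (dfwith x u) v = dfwith (dfwith x v) u.
Proof.
move=> ij; apply/functional_extensionality_dep => l; have [<-|jl] := eqVneq j l.
  by rewrite dfwith_in dfwith_out // dfwith_in.
rewrite (dfwith_out _ _ jl); have [<-|il] := eqVneq i l; first by rewrite !dfwith_in.
by rewrite !dfwith_out.
Qed.

Lemma dfwith_map n (X Y : 'I_n -> Type) (F : forall i, X i -> Y i) (x : forall i, X i) i u j :
  F j (dfwith x (i := i) u j) = dfwith (fun j => F j (x j)) (F i u) j.
Proof.
have [<-|ij] := eqVneq i j; first by rewrite !dfwith_in.
by rewrite !dfwith_out.
Qed.

Section CofThick.
Context {k : comPzRingType} {sym : bool} {C : cooperad sym k}.
Implicit Types M N L : gmod k.

Lemma ract1 n (c : C n) : ract C 1%g c = c.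
Proof.
have [_ H] := cseqP C; have A1 : adm sym (1%g : 'S_n) by rewrite /adm eqxx orbT.
by have [_ _ -> _] := H n 1%g 1%g A1 A1.
Qed.

Lemma tflat_act M n (r : 'I_n -> nat) (t : forall i, 'S_(r i)) (u : forall i, T M (r i)) :
  tflat (fun i => tact (t i) (u i)) = reind (inner (fun i => (t i)^-1)%g) (tflat u).
Proof.
have bb := inner_bij (fun i => (t i)^-1)%g; move: u; apply: multi_ext => [u i|u i|x].
- have -> : (fun v => tflat (fun j => tact (t j) (dfwith u (i := i) v j))) =
     (fun v => tflat (dfwith (fun j => tact (t j) (u j)) (tact (t i) v))).
    apply/funext => v; congr tflat; apply/functional_extensionality_dep => j.
    exact: (dfwith_map (fun j => @tact k M _ (t j))).
  by apply: (linear_comp (f := fun v => tflat (dfwith (fun j => tact (t j) (u j)) (i := i) v))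
    (g := tact (t i))); [exact: tflat_slot|exact: tact_lin].
- by apply: linear_comp; [exact: reind_lin|exact: tflat_slot].
rewrite tflat_ten reind_ten //.
pose K i : k := koszul (fun s => (x i s).1) (fun s => t i s).
pose x' i := [ffun s => x i ((t i)^-1%g s)].
have -> : (fun i => tact (t i) (ten (x i))) = (fun i => K i *: ten (x' i)).
  by apply/functional_extensionality_dep => i; rewrite tact_ten.
rewrite tflat_scale tflat_ten koszul_inner; congr (_ *: ten _).
  apply: eq_bigr => i _; rewrite /K koszul_invl part_flat //.
by apply/ffunP; apply: Rank_ind => i s; rewrite flat_Rank [RHS]ffunE inner_Rank flat_Rank ffunE.
Qed.

Section Def.
Context {M N : gmod k} (m : int) {f : thick M N} (Lf : thick_lin (sym := sym) f) {n : nat}.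
Implicit Types (r : 'I_n -> nat).

Definition cofphi (e : 'I_n -> int) r (c : forall i, int * C (r i)) (u : forall i, T M (r i)) :
    T (cofree C N) n :=
  (shuffle (fun i => (c i).1) (fun i => e i - (c i).1) * sgn (m * \sum_i (c i).1)) *:
  psi c (@f _ (tflat (fun i => pr (T M (r i)) (e i - (c i).1) (u i)))).

Lemma cofphi_hlin (e : 'I_n -> int) r (c : forall i, int * C (r i)) u i :
  hlin (fun c0 => cofphi e (dfwith c (i := i) c0) u).
Proof.
pose dg (e0 : int) j := if i == j then e0 else (c j).1.
pose S e0 : k := shuffle (dg e0) (fun i => e i - dg e0 i) * sgn (m * \sum_i (dg e0) i).
pose W e0 := @f _ (tflat (fun j => pr (T M (r j)) (e j - dg e0 j) (u j))).
have E c0 : cofphi e (dfwith c (i := i) c0) u = S c0.1 *: psi (dfwith c (i := i) c0) (W c0.1).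
  have D : (fun j => (dfwith c (i := i) c0 j).1) = dg c0.1.
    by apply/funext => j; exact: dfwith_fst.
  have Dj j : (dfwith c (i := i) c0 j).1 = dg c0.1 j by exact: dfwith_fst.
  have D1 : (fun j => e j - (dfwith c (i := i) c0 j).1) = (fun j => e j - dg c0.1 j).
    by apply/funext => j; rewrite Dj.
  have D2 : \sum_j (dfwith c (i := i) c0 j).1 = \sum_j dg c0.1 j.
    by apply: eq_bigr => j _; rewrite Dj.
  have D3 : (fun j => pr (T M (r j)) (e j - (dfwith c (i := i) c0 j).1) (u j)) =
      (fun j => pr (T M (r j)) (e j - dg c0.1 j) (u j)).
    by apply/functional_extensionality_dep => j; rewrite Dj.
  by rewrite /cofphi D D1 D2 D3.
split=> [e0 a x y|e0 x]; rewrite !E /=.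
  by rewrite (psi_hlin c i (W e0)).1 scalerDr !scalerA mulrC.
by rewrite (psi_hlin c i (W e0)).2.
Qed.

Lemma cofphi_lin (e : 'I_n -> int) r (c : forall i, int * C (r i)) u i :
  linear (fun u0 => cofphi e c (dfwith u (i := i) u0)).
Proof.
apply: linear_scale.
have -> : (fun u0 => psi c (@f _ (tflat (fun j => pr (T M (r j)) (e j - (c j).1) (dfwith u (i := i) u0 j))))) =
  (fun u0 => psi c (@f _ (tflat (dfwith (fun j => pr (T M (r j)) (e j - (c j).1) (u j))
    (pr (T M (r i)) (e i - (c i).1) u0))))).
  apply/funext => u0; congr (psi c (@f _ (tflat _))); apply/functional_extensionality_dep => j.
  exact: (dfwith_map (fun j => pr (T M (r j)) (e j - (c j).1))).
apply: (linear_comp (f := psi c)); first exact: psi_lin.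
apply: linear_comp; first by case: Lf.
apply: (linear_comp (f := fun v => tflat (dfwith (fun j => pr (T M (r j)) (e j - (c j).1) (u j)) (i := i) v))
  (g := pr (T M (r i)) (e i - (c i).1))); [exact: tflat_slot|exact: pr_T_lin].
Qed.

Lemma cofphi_act (e : 'I_n -> int) r (d : 'I_n -> int) (c : forall i, C (r i)) (t : forall i, 'S_(r i)) u :
  (forall i, adm sym (t i)) ->
  cofphi e (fun i => (d i, ract C (t i) (c i))) u =
  cofphi e (fun i => (d i, c i)) (fun i => tact (t i) (u i)).
Proof.
move=> At; rewrite /cofphi /= psi_act //; congr (_ *: psi _ _).
have [_ sf] := Lf; rewrite -(thick_reind sf); last first.
  by apply: inner_adm => i; move: (At i); rewrite /adm; case: (sym) => //= /eqP ->; rewrite invg1.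
rewrite -tflat_act; congr (@f _ (tflat _)); apply/functional_extensionality_dep => i.
have [_ H] := reind_homog M (perm_bij (t i)^-1%g).
by rewrite !tactE H addr0.
Qed.

Definition cofpsi e (b : 'I_n -> totgen C (Tseq M)) : T (cofree C N) n :=
  cofphi e (fun i => (tagged (b i)).1) (fun i => (tagged (b i)).2).

Lemma cofpsi_family e b (i : 'I_n) n0 : exists r (c : forall j, int * C (r j))
    (u : forall j, T M (r j)) (E : n0 = r i), forall (c0 : int * C n0) (u0 : T M n0),
  cofpsi e (dfwith b (i := i) (Totgen (M := Tseq M) c0 u0)) =
  cofphi e (dfwith c (i := i) (eq_rect n0 (fun q => (int * C q)%type) c0 (r i) E))
           (dfwith u (i := i) (eq_rect n0 (fun q => T M q : Type) u0 (r i) E)).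
Proof.
pose Y q := ((int * C q) * T M q)%type.
have [r [y [E H]]] := slot_family b i ((0, 0), 0 : T M n0) (Y := Y).
exists r, (fun j => (y j).1), (fun j => (y j).2), (id E) => c0 v0.
rewrite [dfwith b _](H (c0, v0)) /cofpsi /=.
have -> : eq_rect n0 Y (c0, v0) (r i) E = (eq_rect n0 (fun q => (int * C q)%type) c0 (r i) E,
   eq_rect n0 (fun q => T M q : Type) v0 (r i) E) by clear H; case: _ / E.
congr cofphi; apply/functional_extensionality_dep => j.
  exact: (dfwith_map (fun j (p : Y (r j)) => p.1)).
exact: (dfwith_map (fun j (p : Y (r j)) => p.2)).
Qed.

Lemma cofpsi_pr e b (i : 'I_n) n0 (c0 : int * C n0) (u0 : T M n0) :
  cofpsi e (dfwith b (i := i) (Totgen (M := Tseq M) c0 (pr (T M n0) (e i - c0.1) u0))) =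
  cofpsi e (dfwith b (i := i) (Totgen (M := Tseq M) c0 u0)).
Proof.
have [r [c [u [E H]]]] := cofpsi_family e b i n0; subst n0; rewrite !H /= /cofphi.
congr (_ *: psi _ (@f _ (tflat _))); apply/functional_extensionality_dep => j.
have [<-|ij] := eqVneq i j; last by rewrite !dfwith_out.
by rewrite !dfwith_in; have [_ -> _] := T_gmod M (r i); rewrite eqxx.
Qed.

Lemma cofpsi_rel e b i : @totrel k sym C (Tseq M) _ (fun y => cofpsi e (dfwith b (i := i) y)).
Proof.
split=> [n0 u0|n0 c0 a u0 v0|n0 s As d c0 u0].
- have [r [c [u [E H]]]] := cofpsi_family e b i n0; subst n0.
  have [H1 H2] := cofphi_hlin e c (dfwith u u0) i.
  split=> [d a x y|d x]; rewrite !H /=; [exact: H1|exact: H2].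
- have [r [c [u [E H]]]] := cofpsi_family e b i n0; subst n0.
  by rewrite !H /=; exact: cofphi_lin.
- have [r [c [u [E H]]]] := cofpsi_family e b i n0; subst n0; rewrite !H /=.
  pose t := dfwith (fun j => 1%g : 'S_(r j)) s.
  have At j : adm sym (t j).
    rewrite /t; have [<-|ij] := eqVneq i j; first by rewrite dfwith_in.
    by rewrite dfwith_out // /adm eqxx orbT.
  pose c' := dfwith c (d, c0).
  have E1 : dfwith c (d, ract C s c0) = fun j => ((c' j).1, ract C (t j) (c' j).2).
    apply/functional_extensionality_dep => j; rewrite /c' /t; have [<-|ij] := eqVneq i j.
      by rewrite !dfwith_in.
    by rewrite !dfwith_out // ract1; case: (c j).
  have E2 : dfwith u (tact s u0) = fun j => tact (t j) (dfwith u u0 j).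
    apply/functional_extensionality_dep => j; rewrite /t; have [<-|ij] := eqVneq i j.
      by rewrite !dfwith_in.
    by rewrite !dfwith_out // tact1.
  rewrite E1 E2 cofphi_act //; congr cofphi; apply/functional_extensionality_dep => j.
  by rewrite -surjective_pairing.
Qed.

Let cofgen (i : 'I_n) : totgen C (Tseq M) := Totgen (C := C) (M := Tseq M) (n := 0) (0, 0) 0.

Lemma cofmlift_slot e (x : 'I_n -> cofree C M) i :
  linear (fun z => mlift (P := fun _ => @totrel k sym C (Tseq M)) (cofpsi e) (dfwith x (i := i) z)).
Proof. by apply: (mlift_slot cofgen) => b j; exact: cofpsi_rel. Qed.

Lemma cofmlift_gen e (b : 'I_n -> totgen C (Tseq M)) :
  mlift (P := fun _ => @totrel k sym C (Tseq M)) (cofpsi e) (fun i => gen _ (b i)) = cofpsi e b.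
Proof. by apply: (mlift_gen cofgen) => b' j; exact: cofpsi_rel. Qed.

Lemma cofthick_slot : slotwise (@hlin k (cofree C M)) (fun x : tgen (cofree C M) n =>
  mlift (P := fun _ => @totrel k sym C (Tseq M)) (cofpsi (fun i => (x i).1)) (fun i => (x i).2)).
Proof.
move=> x i; pose dg e0 j := if j == i then e0 else (x j).1.
have E e0 z : mlift (P := fun _ => @totrel k sym C (Tseq M))
      (cofpsi (fun j => (upd x i (e0, z) j).1)) (fun j => (upd x i (e0, z) j).2) =
    mlift (P := fun _ => @totrel k sym C (Tseq M)) (cofpsi (dg e0)) (dfwith (fun j => (x j).2) (i := i) z).
  congr (mlift (cofpsi _) _); apply/funext => j; rewrite ffunE /dg; first by case: eqP.
  by have [<-|ij] := eqVneq i j; rewrite ?dfwith_in ?dfwith_out.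
split=> [e0 a z w|e0 z].
  rewrite (E e0 (a *: z + w)) (E e0 z) (E e0 w).
  exact: (@cofmlift_slot (dg e0) (fun j => (x j).2) i a z w).
rewrite (E e0 z) (E e0 (pr (cofree C M) e0 z)).
pose x2 := dfwith (fun j => (x j).2) (i := i) z.
have -> : dfwith (fun j => (x j).2) (i := i) (pr (cofree C M) e0 z) =
    dfwith x2 (i := i) (pr (cofree C M) e0 (x2 i)) by rewrite /x2 dfwith_dfwith dfwith_in.
rewrite -/x2; move: x2; apply: (mpres_ext (P := fun _ => @totrel k sym C (Tseq M))) => [u j|u j|b].
- move=> a v w; have [ij|ij] := eqVneq j i.
    subst j; rewrite !dfwith_in !dfwith_dfwith.
    have [Lp _ _] := cofree_gmod (C := C) M; rewrite Lp.
    exact: (cofmlift_slot (dg e0) u).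
  rewrite !(dfwith_out _ _ ij) !(dfwithC _ _ _ ij).
  exact: (cofmlift_slot (dg e0)).
- exact: cofmlift_slot.
pose b' := dfwith b (i := i) (Totgen (C := C) (M := Tseq M) (tagged (b i)).1
    (pr (T M _) (e0 - (tagged (b i)).1.1) (tagged (b i)).2)).
have -> : dfwith (fun j => gen (@totrel k sym C (Tseq M)) (b j)) (i := i)
    (pr (cofree C M) e0 (gen (@totrel k sym C (Tseq M)) (b i))) =
    fun j => gen (@totrel k sym C (Tseq M)) (b' j).
  apply/functional_extensionality_dep => j; rewrite /b'; have [<-|ij] := eqVneq i j.
    rewrite !dfwith_in; have -> : gen (@totrel k sym C (Tseq M)) (b i) = cof (tagged (b i)).1 (tagged (b i)).2.
      by case: (b i) => q [].
    by rewrite pr_cof.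
  by rewrite !dfwith_out.
rewrite !cofmlift_gen.
rewrite /b' -[in RHS](dfwith_same b i); case: (b i) => q [c0 u0] /=.
have K := cofpsi_pr (dg e0) b i c0 u0.
by rewrite [dg e0 i](_ : _ = e0) in K; last by rewrite /dg eqxx.
Qed.

End Def.
End CofThick.

Section CofThickPsi.
Context {k : comPzRingType} {sym : bool} {C : cooperad sym k}.
Implicit Types M N L : gmod k.

Lemma cofthick_ten M N m (f : thick M N) n (x : tgen (cofree C M) n) : thick_lin (sym := sym) f ->
  cofthick m f (ten x) = mlift (P := fun _ => @totrel k sym C (Tseq M))
    (cofpsi m (f := f) (fun i => (x i).1)) (fun i => (x i).2).
Proof. by move=> Lf; rewrite /cofthick lift_ten //; exact: (cofthick_slot m Lf). Qed.

Lemma cofthick_lin M N m (f : thick M N) n : thick_lin (sym := sym) f ->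
  linear (@cofthick k sym C M N m f n).
Proof. by move=> Lf; apply: lift_lin; exact: (cofthick_slot m Lf). Qed.

Lemma cofthick_cof M N m (f : thick M N) n (e : 'I_n -> int) (r : 'I_n -> nat)
    (c : forall i, int * C (r i)) (u : forall i, T M (r i)) : thick_lin (sym := sym) f ->
  cofthick m f (ten [ffun i => (e i, cof (c i) (u i))]) = cofphi m (f := f) e c u.
Proof.
move=> Lf; rewrite cofthick_ten //.
have -> : (fun i => ([ffun i => (e i, cof (c i) (u i))] i).1) = e by apply/funext => i; rewrite ffunE.
have -> : (fun i => ([ffun i => (e i, cof (c i) (u i))] i).2) =
   (fun i => gen (@totrel k sym C (Tseq M)) (Totgen (M := Tseq M) (c i) (u i))).
  by apply/functional_extensionality_dep => i; rewrite ffunE.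
exact: (cofmlift_gen m Lf e (fun i => Totgen (M := Tseq M) (c i) (u i))).
Qed.

Lemma cofthick_psi M N m (f : thick M N) n (r : 'I_n -> nat) (c : forall i, int * C (r i))
    (w : T M (\sum_i r i)) : thick_lin (sym := sym) f ->
  cofthick m f (psi c w) = sgn (m * \sum_i (c i).1) *: psi c (f _ w).
Proof.
move=> Lf; have Lt := @cofthick_lin M N m f n Lf; have [Lf' _] := Lf.
move: w; apply: ten_ext.
- by apply: linear_comp => //; exact: psi_lin.
- by apply: linear_scale; apply: linear_comp; [exact: psi_lin|exact: Lf'].
move=> y; rewrite psi_ten (linZ _ _ Lt) cofthick_cof // /cofphi.
have -> : (fun i => (c i).1 + tdeg (part y i) - (c i).1) = (fun i => tdeg (part y i)).
  by apply/funext => i; rewrite addrAC subrr add0r.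
rewrite scalerA mulrA shuffle_sqr mul1r; congr (_ *: psi _ (f _ _)).
rewrite -[in RHS](flat_part y) -tflat_ten; congr tflat.
apply/functional_extensionality_dep => i.
by rewrite addrAC subrr add0r; exact: hdeg_ten.
Qed.

Lemma homog_psi M n (N : gmod k) m (f : T (cofree C M) n -> N) : is_gmod N -> linear f ->
  (forall (r : 'I_n -> nat) (c : forall i, int * C (r i)) w i, hdeg i w ->
    hdeg (\sum_i (c i).1 + i + m) (f (psi c w))) ->
  homog m f.
Proof.
move=> gN Lf Hf; split=> // i; have [LN _ _] := gN; have gC := T_gmod (cofree C M) n.
have [LC _ _] := gC.
apply: psi_ext; [exact: linear_comp|exact: linear_comp|move=> r c].
have gT := T_gmod M (\sum_i r i).
apply: (gmod_ext gT).
- apply: (linear_comp Lf); apply: (linear_comp (LC i)); exact: psi_lin.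
- apply: (linear_comp (LN _)); apply: (linear_comp Lf); exact: psi_lin.
move=> j u hu; rewrite (prE _ gC (hdeg_psi c hu)) (prE _ gN (Hf r c u j hu)).
by rewrite (inj_eq (addIr m)); case: eqP => // _; rewrite lin0.
Qed.

Lemma cofthick_homog M N m (f : thick M N) n : is_thick m f -> symmetric_thick sym f ->
  homog m (@cofthick k sym C M N m f n).
Proof.
move=> Hf sf; have Lf := thick_linP Hf sf.
apply: homog_psi; [exact: T_gmod|exact: cofthick_lin|move=> r c w i hw].
rewrite cofthick_psi // /hdeg (linZ _ _ (@pr_T_lin _ _ _ _)); congr (_ *: _).
by rewrite -addrA; apply: hdeg_psi; apply: hdeg_homog hw.
Qed.

Lemma adm_inv n (s : 'S_n) : adm sym s -> adm sym s^-1%g.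
Proof. by rewrite /adm; case: (sym) => //= /eqP ->; rewrite invg1. Qed.

Lemma cofthick_sym M N m (f : thick M N) : thick_lin (sym := sym) f ->
  symmetric_thick sym (@cofthick k sym C M N m f).
Proof.
move=> Lf n s As; have Lt n := @cofthick_lin M N m f n Lf; have [_ sf] := Lf.
have bb (r : 'I_n -> nat) := outer_bij r s^-1.
apply: psi_ext; [by apply: linear_comp => //; exact: tact_lin|by apply: linear_comp => //; exact: tact_lin|].
move=> r c w; rewrite tact_psi (linZ _ _ (Lt n)) !cofthick_psi // (linZ _ _ (@tact_lin _ _ _ _)).
rewrite tact_psi scalerA mulrC -scalerA (thick_reind sf); last exact/outer_adm/adm_inv.
by congr (sgn (m * _) *: _); rewrite [RHS](reindex_inj (@perm_inj _ s^-1%g)).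
Qed.

Lemma thick_lin_cofthick M N m (f : thick M N) : thick_lin (sym := sym) f ->
  thick_lin (sym := sym) (@cofthick k sym C M N m f).
Proof. by move=> Lf; split=> [n|]; [exact: cofthick_lin|exact: cofthick_sym]. Qed.

Lemma cofthick_comp M N L m m' (f : thick N L) (g : thick M N) :
  thick_lin (sym := sym) f -> thick_lin (sym := sym) g ->
  forall n (u : T (cofree C M) n), cofthick m f (cofthick m' g u) =
    cofthick (m + m') (fun n u => f n (g n u)) u.
Proof.
move=> Lf Lg n; have Lfg := thick_lin_comp Lf Lg.
have K := fun M N m f => @cofthick_lin M N m f n.
apply: psi_ext; [by apply: linear_comp; exact: cofthick_lin|exact: cofthick_lin|].
move=> r c w; rewrite !cofthick_psi // (linZ _ _ (@cofthick_lin _ _ _ _ _ Lf)) cofthick_psi //.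
by rewrite scalerA -sgnD; congr (sgn _ *: _); ring.
Qed.

Lemma cofthick_id M n (u : T (cofree C M) n) : cofthick 0 (thick_id M) u = u.
Proof.
have Li : thick_lin (sym := sym) (thick_id M) by exact: thick_lin_id.
move: u; apply: psi_ext => //; first exact: cofthick_lin.
by move=> r c w; rewrite cofthick_psi // mul0r scale1r.
Qed.

Lemma cofthick_eq M N m (f g : thick M N) n (u : T (cofree C M) n) :
  thick_eq f g -> cofthick m f u = cofthick m g u.
Proof.
by move=> fg; congr (cofthick m _ u); do 2!apply/functional_extensionality_dep => ?; exact: fg.
Qed.

Lemma thick_lin_zero M N : thick_lin (sym := sym) (thick_zero M N).
Proof. by split=> [n|n s _ u]; [exact: linear_zero|rewrite /thick_zero (lin0 (@tact_lin _ _ _ _))]. Qed.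

Lemma cofthick_zero M N m n (u : T (cofree C M) n) : cofthick m (thick_zero M N) u = 0.
Proof.
have Lz := @thick_lin_zero M N.
move: u; apply: psi_ext; [exact: cofthick_lin|exact: linear_zero|].
by move=> r c w; rewrite cofthick_psi // /thick_zero (lin0 (@psi_lin _ _ _ _ _ _ _)) scaler0.
Qed.

Lemma cofthick_lincomb M N m (f g : thick M N) a :
  thick_lin (sym := sym) f -> thick_lin (sym := sym) g ->
  forall n (u : T (cofree C M) n), cofthick m (fun n u => a *: f n u + g n u) u =
    a *: cofthick m f u + cofthick m g u.
Proof.
move=> Lf Lg n; have Lfg := thick_lin_lincomb a Lf Lg.
apply: psi_ext; first exact: cofthick_lin.
  by apply: linear_add; [apply: linear_scale|]; exact: cofthick_lin.
move=> r c w; rewrite !cofthick_psi // (@psi_lin _ _ _ _ _ _ c) scalerDr !scalerA.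
by rewrite mulrC.
Qed.

Lemma cofthick_tpow M N (f : M -> N) : homog 0 f ->
  forall n (u : T (cofree C M) n), cofthick 0 (tpow f) u = tpow (cofmap 0 (tpow f)) u.
Proof.
move=> Hf n; have Lf : thick_lin (sym := sym) (tpow f) := thick_lin_tpow Hf.
have Hc : homog 0 (cofmap 0 (tpow f) : cofree C M -> cofree C N).
  by apply: cofmap_homog => [n'|]; [exact: tpow_homog|case: Lf].
apply: psi_ext; [exact: cofthick_lin|exact: tpow_lin|move=> r c].
apply: ten_ext.
- by apply: linear_comp; [exact: cofthick_lin|exact: psi_lin].
- by apply: linear_comp; [exact: tpow_lin|exact: psi_lin].
move=> y; rewrite cofthick_psi // mul0r scale1r tpow_ten // !psi_ten.
rewrite (linZ _ _ (@tpow_lin _ _ _ _ _ Hc)) tpow_ten //.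
set y' := [ffun a => ((y a).1, _)].
have dy i : tdeg (part y' i) = tdeg (part y i).
  by apply: eq_bigr => s _; rewrite !ffunE.
congr (shuffle _ _ *: ten _); first by apply/funext => i; rewrite dy.
apply/ffunP => i; rewrite !ffunE dy cofmap_cof // mul0r scale1r tpow_ten //.
by congr (_, cof _ (ten _)); apply/ffunP => s; rewrite !ffunE.
Qed.

Section Cat.
Context {p q : nat} (r : 'I_(p + q) -> nat).
Let rl i := r (lshift q i).
Let rr j := r (rshift p j).

Fact sum_cat : (\sum_i r i = \sum_i rl i + \sum_j rr j)%N.
Proof. exact: big_split_ord. Qed.

Definition catb : 'I_(\sum_i r i) -> 'I_(\sum_i rl i + \sum_j rr j) := cast_ord sum_cat.

Lemma catb_l i (s : 'I_(rl i)) :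
  catb (tagnat.Rank (lshift q i) s) = lshift _ (tagnat.Rank (p_ := rl) i s).
Proof.
apply: val_inj.
change (tagnat.Rank (lshift q i) s = tagnat.Rank (p_ := rl) i s :> nat).
rewrite !tagnat.RankEsum; congr (_ + _)%N.
rewrite big_split_ord /= [X in (_ + X)%N]big1 ?addn0 // => j.
by rewrite ltnNge ltnW //; apply: ltn_addr.
Qed.

Lemma catb_r j (s : 'I_(rr j)) :
  catb (tagnat.Rank (rshift p j) s) = rshift _ (tagnat.Rank (p_ := rr) j s).
Proof.
apply: val_inj.
change (tagnat.Rank (rshift p j) s = (\sum_i rl i + tagnat.Rank (p_ := rr) j s)%N :> nat).
rewrite !tagnat.RankEsum addnA.
congr (_ + _)%N; rewrite big_split_ord /=; congr (_ + _)%N.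
  by rewrite big_mkcond; apply: eq_bigr => i _; rewrite /= ltn_addr.
by apply: eq_bigl => i; rewrite ltn_add2l.
Qed.

Lemma catb_bij : bijective catb.
Proof. by exists (cast_ord (esym sum_cat)) => z; rewrite /catb ?cast_ordK ?cast_ordKV. Qed.

Lemma catb_adm : admb sym catb.
Proof.
split; [exact: sum_cat|exact: catb_bij|].
by case: (sym) => //; apply/forallP => a /=.
Qed.

Lemma reind_catb_ten M (y : tgen M (\sum_i rl i + \sum_j rr j)) :
  reind catb (ten y) = ten [ffun a => y (catb a)].
Proof.
rewrite reind_ten; last exact: catb_bij.
by rewrite koszul_mono ?scale1r // => i j /ltnW.
Qed.

Context (c : forall i, int * C (r i)).
Let cl i : int * C (rl i) := c (lshift q i).
Let cr j : int * C (rr j) := c (rshift p j).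

Lemma psi_cat M (u : T M (\sum_i rl i)) (v : T M (\sum_j rr j)) i : hdeg i u ->
  psi c (reind catb (tcat u v)) = sgn ((\sum_j (cr j).1) * i) *: tcat (psi cl u) (psi cr v).
Proof.
have Lr := reind_lin (M := M) catb_bij; have [Lp _ _] := T_gmod M (\sum_i rl i).
have Lpsi := fun n r c => @psi_lin k sym C M n r c.
move=> <-; move: v; apply: ten_ext.
- apply: (linear_comp (f := psi c)) => //; apply: linear_comp => //; exact: tcat_linr.
- by apply: linear_scale; apply: linear_comp => //; exact: tcat_linr.
move=> y2; move: u; apply: ten_ext.
- apply: (linear_comp (f := psi c)) => //; apply: linear_comp => //.
  apply: (linear_comp (f := fun u => tcat u _)) => //; exact: tcat_linl.
- apply: linear_scale; apply: (linear_comp (f := fun u => tcat u _)); first exact: tcat_linl.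
  exact: linear_comp.
move=> y1; rewrite pr_ten; case: eqP => [<-|_]; last first.
  by rewrite (lin0 (Lpsi _ _ _)) !tcat0l (lin0 Lr) (lin0 (Lpsi _ _ _)) scaler0.
rewrite tcat_ten reind_catb_ten !psi_ten tcatZl tcatZr tcat_ten !scalerA.
set y := [ffun a => _].
have pl i' : part y (lshift q i') = part y1 i'.
  by apply/ffunP => s; rewrite !ffunE catb_l split_lshift ?ffunE.
have pr' j : part y (rshift p j) = part y2 j.
  by apply/ffunP => s; rewrite !ffunE catb_r split_rshift ?ffunE.
congr (_ *: ten _); last first.
  apply/ffunP => s; rewrite [LHS]ffunE; case: (split_ordP s) => i' ->.
    by rewrite gcatl ffunE pl.
  by rewrite gcatr ffunE pr'.
rewrite -!sgnD; congr sgn; rewrite big_split_ord addrCA; congr (_ + _).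
  apply: eq_bigr => i' _; rewrite big_split_ord /= [X in _ + X]big1 ?addr0; last first.
    by move=> j; rewrite ltnNge ltnW //; apply: ltn_addr.
  by apply: eq_bigr => j _; rewrite pl.
rewrite mulr_suml -big_split /=; apply: eq_bigr => j _.
rewrite big_split_ord /=; congr (_ + _); last first.
  by apply: eq_big => [i'|i' _]; rewrite ?ltn_add2l ?pr'.
rewrite [tdeg y1]tdeg_part mulr_sumr big_mkcond /=; apply: eq_bigr => i' _.
by rewrite ltn_addr // pl.
Qed.

Lemma cofthick_tens M N m mf (f g : thick M N) :
  is_thick mf f -> symmetric_thick sym f -> thick_lin (sym := sym) g ->
  forall w, tens m (@cofthick k sym C M N mf f p) (@cofthick k sym C M N m g q) (psi c (reind catb w)) =
  sgn ((mf + m) * \sum_i (c i).1) *: psi c (reind catb (tens m (f _) (g _) w)).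
Proof.
move=> Hf sf Lg; have Lf := thick_linP Hf sf; have [Lg' _] := Lg; have [Lf' _] := Lf.
have Lcf := @cofthick_lin M N mf f p Lf; have Lcg := @cofthick_lin M N m g q Lg.
have LrM := reind_lin (M := M) catb_bij; have LrN := reind_lin (M := N) catb_bij.
have Lt := tens_lin m Lcf Lcg; have Lt' := tens_lin m (Lf' (\sum_i rl i)%N) (Lg' (\sum_j rr j)%N).
apply: ten_ext.
- by apply: linear_comp => //; apply: linear_comp => //; exact: psi_lin.
- by apply: linear_scale; apply: (linear_comp (f := psi c)); [exact: psi_lin|exact: linear_comp].
move=> y; rewrite ten_cat; set y1 := gl y; set y2 := gr y.
have h1 : hdeg (M := T M _) (tdeg y1) (ten y1) := hdeg_ten y1.
rewrite (psi_cat _ h1) (linZ _ _ Lt) (tens_tcat _ _ Lcf Lcg (hdeg_psi cl h1)).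
rewrite !cofthick_psi // tcatZl tcatZr (tens_tcat _ _ (Lf' _) (Lg' _) h1).
rewrite (linZ _ _ LrN) (linZ _ _ (@psi_lin _ _ _ _ _ _ c)).
rewrite (psi_cat _ (hdeg_homog (Hf _) h1)) !scalerA -!sgnD; congr (_ *: _).
set a := \sum_j (cr j).1; set b := \sum_i (cl i).1; set d := tdeg y1.
have -> : \sum_i (c i).1 = b + a by rewrite big_split_ord.
by apply: (@sgn_eq _ _ _ (- mf * a)); ring.
Qed.

End Cat.

Lemma psi_cat_ext M (V : lmodType k) p q (L1 L2 : T (cofree C M) (p + q) -> V) :
  linear L1 -> linear L2 ->
  (forall (r : 'I_(p + q) -> nat) (c : forall i, int * C (r i)) w,
    L1 (psi c (reind (catb (r := r)) w)) = L2 (psi c (reind (catb (r := r)) w))) ->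
  L1 =1 L2.
Proof.
move=> l1 l2 H; apply: psi_ext => // r c w.
have [b' bK b'K] := catb_bij r.
have bb' : bijective b' by exists (catb (r := r)).
have -> : w = reind (catb (r := r)) (reind b' w).
  by rewrite reind_comp //; [rewrite reind_mono // => a; rewrite bK|exact: catb_bij].
exact: H.
Qed.

Section Dif.
Context {M : gmod k} {d : M -> M} (Hd : homog (-1) d) {n : nat}.

Definition dblock (r : 'I_n -> nat) (c : forall i, int * C (r i)) (i : 'I_n) j : int * C (r j) :=
  if j == i then ((c j).1 - 1, dif (C (r j)) (c j).2) else c j.

Lemma tdif_psi (r : 'I_n -> nat) (c : forall i, int * C (r i)) w :
  tdif (cofdif d) (psi c w) =
  \sum_(i < n) sgn (\sum_(j < n | (j < i)%N) (c j).1) *: psi (dblock c i) w +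
  sgn (\sum_i (c i).1) *: psi c (tdif d w).
Proof.
have HC := cofdif_homog (C := C) Hd; have Hi := homog_id M; have HiC := homog_id (cofree C M).
have Ld := @tins_lin k M (-1) d id _ Hd Hi.
move: w; apply: ten_ext.
- by apply: linear_comp; [exact: tins_lin|exact: psi_lin].
- apply: linear_add; first by apply: linear_sum => i; apply: linear_scale; exact: psi_lin.
  apply: linear_scale; apply: (linear_comp (f := psi c)); [exact: psi_lin|exact: Ld].
move=> y; rewrite psi_ten /tdif (linZ _ _ (@tins_lin _ _ _ _ _ _ HC HiC)).
rewrite !tins_ten // (lin_sum _ _ _ (@psi_lin _ _ _ _ _ _ c)) big_Rank /= !scaler_sumr -big_split.
apply: eq_bigr => i _ /=.
pose D := \sum_(j < n | (j < i)%N) ((c j).1 + tdeg (part y j)).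
have -> : \sum_(j < n | (j < i)%N) (psig c y j).1 = D by apply: eq_bigr => j _; rewrite ffunE.
set e := (c i).1 + tdeg (part y i) - 1.
have ginsE' : ginsf (-1) (cofdif d) id i (psig c y) =
    upd (psig c y) i (e, cofdif d (cof (c i) (ten (part y i)))).
  by rewrite ginsE ffunE.
have [H1 _] := @ten_slot k _ _ (psig c y) i.
rewrite ginsE' cofdif_cof // (hlinD _ _ _ (@ten_slot k _ _ (psig c y) i)) scalerDr scalerDr.
congr (_ + _).
  rewrite psi_ten !scalerA; congr (_ *: ten _); last first.
    apply/ffunP => j; rewrite !ffunE /dblock; case: (j =P i) => [->|//].
    by rewrite /e /= addrAC.
  rewrite -!sgnD; set S1 := \sum_i0 _; set S2 := \sum_i0 _.
  have -> : S1 = S2 + \sum_(j < n | (j < i)%N) tdeg (part y j).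
    rewrite /S1 /S2 (bigD1 i) //= [in RHS](bigD1 i) //= /dblock eqxx /= addrAC; congr (_ + _).
      by rewrite -big_split /=; apply: eq_bigr => j _; ring.
    by apply: eq_bigr => j /negPf ->.
  have -> : D = \sum_(j < n | (j < i)%N) (c j).1 + \sum_(j < n | (j < i)%N) tdeg (part y j).
    by rewrite -big_split.
  by apply: (@sgn_eq _ _ _ (- (\sum_(j < n | (j < i)%N) (c j).1))); ring.
rewrite /tdif tins_ten // (lin_sum _ _ _ (@cof_lin _ _ _ _ _ (c i))) scaler_sumr.
rewrite (lin_sum _ _ _ (hlin_linear e (@ten_slot k _ _ (psig c y) i))) !scaler_sumr.
apply: eq_bigr => s _.
rewrite (linZ _ _ (@cof_lin _ _ _ _ _ (c i))) 2!(hlinZ e _ _ (@ten_slot k _ _ (psig c y) i)).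
rewrite (linZ _ _ (@psi_lin _ _ _ _ _ _ c)) psi_ten !scalerA.
have py j : part (ginsf (-1) d id (tagnat.Rank i s) y) j =
    dfwith (part y) (ginsf (-1) d id s (part y i)) j.
  by rewrite !ginsE part_upd !ffunE.
congr (_ *: ten _); last first.
  apply/ffunP => j; rewrite !ffunE !py; case: (j =P i) => [->|/eqP ji].
    by rewrite dfwith_in tdeg_gins /e addrA.
  by rewrite dfwith_out // eq_sym.
have -> : \sum_(z < \sum_i r i | (z < tagnat.Rank i s)%N) (y z).1 =
    \sum_(j < n | (j < i)%N) tdeg (part y j) + \sum_(t < r i | (t < s)%N) (part y i t).1.
  rewrite big_mkcond big_Rank /= (bigD1 i) //= addrC; congr (_ + _).
    rewrite [RHS]big_mkcond [RHS](bigD1 i) //= ltnn add0r; apply: eq_bigr => j ji.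
    case: ltnP => ij.
      by apply: eq_bigr => t _; rewrite Rank_lt // ffunE.
    rewrite big1 // => t _; rewrite ltnNge ltnW //=; apply: Rank_lt.
    by rewrite ltn_neqAle eq_sym ji.
  by rewrite [RHS]big_mkcond; apply: eq_bigr => t _; rewrite Rank_lt_in ffunE.
set S3 := \sum_(t < r i | _) _.
rewrite -!sgnD; set S1 := \sum_i0 _; set S2 := \sum_i0 (\sum_(j < n | _) _ * _).
have E : S1 = S2 + \sum_(j < n | (i < j)%N) (c j).1.
  rewrite /S1 /S2 [X in _ + X]big_mkcond -big_split /=; apply: eq_bigr => j _.
  case: ltnP => ij.
    rewrite (bigD1 i) //= [in RHS](bigD1 i) //= py dfwith_in tdeg_gins.
    rewrite [X in _ + X = _](eq_bigr (fun l => (c j).1 * tdeg (part (ginsf (-1) d id (tagnat.Rank i s) y) l))).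
      by ring.
    by move=> l /andP[_ li]; rewrite py dfwith_out // eq_sym.
  rewrite addr0; apply: eq_bigr => l lj; rewrite py dfwith_out //.
  by apply/eqP => il; move: lj; rewrite -il ltnNge ij.
have -> : D = \sum_(j < n | (j < i)%N) (c j).1 + \sum_(j < n | (j < i)%N) tdeg (part y j).
  by rewrite -big_split.
have -> : \sum_i0 (c i0).1 = \sum_(j < n | (j < i)%N) (c j).1 + (c i).1 + \sum_(j < n | (i < j)%N) (c j).1.
  rewrite (bigD1 i) //= (bigID (fun j : 'I_n => (j < i)%N)) /= addrCA addrA; congr (_ + _ + _).
    by apply: eq_bigl => j; rewrite andbC; case: ltnP => // ji; rewrite -val_eqE /= ltn_eqF.
  by apply: eq_bigl => j; rewrite -leqNgt ltn_neqAle eq_sym.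
by rewrite E; apply: (@sgn_eq _ _ _ (- (\sum_(j < n | (j < i)%N) (c j).1))); ring.
Qed.

Lemma sum_dblock (r : 'I_n -> nat) (c : forall i, int * C (r i)) i :
  \sum_j (dblock c i j).1 = \sum_j (c j).1 - 1.
Proof.
rewrite (bigD1 i) //= [in RHS](bigD1 i) //= /dblock eqxx /= addrAC; congr (_ + _ - _).
by apply: eq_bigr => j /negPf ->.
Qed.

End Dif.

Lemma cofthick_bound M N (dM : M -> M) (dN : N -> N) m (f : thick M N) :
  homog (-1) dM -> homog (-1) dN -> thick_lin (sym := sym) f ->
  forall n (u : T (cofree C M) n),
  tdif (cofdif dN) (cofthick m f u) - sgn m *: cofthick m f (tdif (cofdif dM) u) =
  cofthick (m - 1) (fun n u => tdif dN (f n u) - sgn m *: f n (tdif dM u)) u.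
Proof.
move=> HM HN Lf n; have [Lf' sf] := Lf.
have LdN : thick_lin (sym := sym) (@tdif k N dN) := thick_lin_tins HN.
have LdM : thick_lin (sym := sym) (@tdif k M dM) := thick_lin_tins HM.
have Lg : thick_lin (sym := sym) (fun n u => tdif dN (f n u) - sgn m *: f n (tdif dM u)).
  have -> : (fun n u => tdif dN (f n u) - sgn m *: f n (tdif dM u)) =
    (fun n (u : T M n) => (- sgn m) *: f n (tdif dM u) + tdif dN (f n u)).
    by do 2!apply/functional_extensionality_dep => ?; rewrite scaleNr addrC.
  by apply: thick_lin_lincomb; apply: thick_lin_comp.
have LN : linear (@tdif k (cofree C N) (cofdif dN) n).
  exact: tins_lin (cofdif_homog HN) (homog_id _).
have LM : linear (@tdif k (cofree C M) (cofdif dM) n).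
  exact: tins_lin (cofdif_homog HM) (homog_id _).
have Lm := @cofthick_lin M N m f n Lf.
apply: psi_ext; [|exact: cofthick_lin|].
  by apply: linear_sub; [exact: linear_comp|apply: linear_scale; exact: linear_comp].
move=> r c w; rewrite !cofthick_psi // (tdif_psi HM) (linD _ _ Lm) (linZ _ _ Lm) (linZ _ _ LN).
rewrite (lin_sum _ _ _ Lm) (tdif_psi HN) cofthick_psi //.
have -> : \sum_(i < n) cofthick m f (sgn (\sum_(j < n | (j < i)%N) (c j).1) *: psi (dblock c i) w) =
   sgn (m * (\sum_i (c i).1 - 1)) *:
   \sum_(i < n) sgn (\sum_(j < n | (j < i)%N) (c j).1) *: psi (dblock c i) (f _ w).
  rewrite scaler_sumr; apply: eq_bigr => i _; rewrite (linZ _ _ Lm) cofthick_psi //.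
  by rewrite sum_dblock !scalerA mulrC.
set X := \sum_i _ *: psi _ _; set s := \sum_i (c i).1.
have Lp := @psi_lin k sym C N n r c.
rewrite (linB _ _ Lp) (linZ _ _ Lp) !(scalerDr, scalerBr, scalerA, opprD) addrACA -[RHS]add0r.
congr (_ + _).
  by rewrite -sgnD (@sgn_eq _ (m * s) (m + m * (s - 1)) 0) ?subrr //; ring.
rewrite mulrN1 mulNr scaleNr -!sgnD; congr (_ *: _ - _ *: _).
  by apply: (@sgn_eq _ _ _ s); ring.
by apply: (@sgn_eq _ _ _ s); ring.
Qed.

End CofThickPsi.

(** * The comultiplication *)

Section Lift.
Context {k : comPzRingType} {X : Type} {P : forall V : lmodType k, (X -> V) -> Prop}.

Lemma lift_lin_out (V W : lmodType k) (L : V -> W) (phi : X -> V) (v : pres P) :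
  linear L -> lift (fun x => L (phi x)) v = L (lift phi v).
Proof. by move=> LL; rewrite /lift /ev lin_sum //; apply: eq_bigr => p _; rewrite linZ. Qed.

Lemma lift_lin_in (V W : lmodType k) (phi : X -> V -> W) (v : pres P) :
  (forall x, linear (phi x)) -> linear (fun u => lift (fun x => phi x u) v).
Proof. by move=> Lphi; rewrite /lift /ev; apply: linear_sum => p; apply/linear_scale/Lphi. Qed.

Lemma lift_eq (V : lmodType k) (phi psi : X -> V) (v : pres P) :
  phi =1 psi -> lift phi v = lift psi v.
Proof. by move=> /funext ->. Qed.

End Lift.

Lemma lift_tenE (k : comPzRingType) (M : gmod k) n (V : lmodType k) (L : T M n -> V) (u : T M n) :
  linear L -> lift (fun x : tgen M n => L (ten x)) u = L u.
Proof.
move=> LL; rewrite /lift /ev [u in RHS]pres_repE lin_sum //.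
by apply: eq_bigr => p _; rewrite linZ.
Qed.

Lemma admb_inv sym m n (b : 'I_m -> 'I_n) (c : 'I_n -> 'I_m) :
  cancel b c -> cancel c b -> admb sym b -> admb sym c.
Proof.
move=> bK cK [mn bb ab]; split=> //; first by exists b.
by case: sym ab => //= /forallP ab; apply/forallP => a; rewrite -(eqP (ab (c a))) cK.
Qed.

Lemma admb_compE sym l m n (b : 'I_m -> 'I_n) (c : 'I_l -> 'I_m) :
  admb sym c -> admb sym (fun a => b (c a)) <-> admb sym b.
Proof.
move=> Ac; split=> [A|Ab]; last exact: admb_comp Ab Ac.
have [_ [c' cK c'K] _] := Ac; have := admb_comp A (admb_inv cK c'K Ac).
by congr admb; apply/funext => a; rewrite c'K.
Qed.

Lemma admb_compEl sym l m n (b : 'I_m -> 'I_n) (c : 'I_l -> 'I_m) :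
  admb sym b -> admb sym (fun a => b (c a)) <-> admb sym c.
Proof.
move=> Ab; split=> [A|Ac]; last exact: admb_comp Ab Ac.
have [_ [b' bK b'K] _] := Ab; have := admb_comp (admb_inv bK b'K Ab) A.
by congr admb; apply/funext => a; rewrite bK.
Qed.

Section Day.
Context {k : comPzRingType} {sym : bool}.
Implicit Types D : sseq k.

Section Generators.
Context {D : sseq k} {j n : nat}.

Definition blab (b : 'I_j -> blk D n) (z : 'I_(\sum_i arty (b i))) : 'I_n :=
  blb (b (tagnat.sig1 z)) (tagnat.sig2 z).
Arguments blab : clear implicits.

Lemma blab_Rank (b : 'I_j -> blk D n) i (s : 'I_(arty (b i))) :
  blab b (tagnat.Rank (p_ := fun i => arty (b i)) i s) = blb (b i) s.
Proof. exact: (flatE (fun i (s : 'I_(arty (b i))) => blb (b i) s)). Qed.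

Definition badm (b : 'I_j -> blk D n) : Prop := admb sym (blab b).

Lemma dayokP (g : daygen D j n) : reflect (badm (fun i => g i)) (dayok sym g).
Proof.
apply: (iffP and3P) => [[/eqP E /injectiveP I A]|[E B A]].
  by split=> //; apply: inj_card_bij; rewrite // !card_ord E.
by split=> //; [apply/eqP|apply/injectiveP/bij_inj].
Qed.

Lemma blkrel_scale (V : lmodType k) (s : int -> k) (phi : blk D n -> V) :
  blkrel sym phi -> blkrel sym (fun b => s (bel b).1 *: phi b).
Proof.
move=> [H1 H2]; split=> [r l|r tau At e d l]; last by rewrite H2.
exact: (hlin_scale s (H1 r l)).
Qed.

Lemma blkrel_relabel (V : lmodType k) n' (rho : 'I_n' -> 'I_n) (phi : blk D n -> V) :
  blkrel sym phi ->
  blkrel sym (fun b : blk D n' => phi (Blk (bel b) [ffun s => rho (blb b s)])).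
Proof.
move=> [H1 H2]; split=> [r l|r tau At e d l]; first exact: (H1 r [ffun s => rho (l s)]).
rewrite [LHS](H2 r tau) //; congr (phi (Blk _ _)); apply/ffunP => s.
by rewrite !ffunE.
Qed.

Lemma day_rel (V : lmodType k) (phi : daygen D j n -> V) :
  dayrel sym phi -> linear (lift phi : day sym D n j -> V).
Proof. exact: lift_is_linear. Qed.

Lemma dayg_rel : dayrel sym (@dayg k sym D j n).
Proof.
have G (s t : seq (k * daygen D j n)) := @gen_relE k _ (@dayrel k sym D j n) s t.
split=> [x i|g ng]; last first.
  have /= := G [:: (1, g)] [::]; rewrite !big_cons !big_nil /= !scale1r !addr0; apply.
  by move=> V phi [_ H]; rewrite /ev !big_cons !big_nil /= scale1r addr0 H.
split=> [r l|r tau At e d l].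
  split=> [e a u v|e u].
    have /= := G [:: (1, upd x i (Blk (e, a *: u + v) l))]
      [:: (a, upd x i (Blk (e, u) l)); (1, upd x i (Blk (e, v) l))].
    rewrite !big_cons !big_nil /= !scale1r !addr0; apply=> V phi [H _].
    by rewrite /ev !big_cons !big_nil /= !scale1r !addr0 ((H x i).1 r l).1.
  have /= := G [:: (1, upd x i (Blk (e, pr (D r) e u) l))] [:: (1, upd x i (Blk (e, u) l))].
  rewrite !big_cons !big_nil /= !scale1r !addr0; apply=> V phi [H _].
  by rewrite /ev !big_cons !big_nil /= !scale1r !addr0 ((H x i).1 r l).2.
have /= := G [:: (1, upd x i (Blk (e, ract D tau d) l))]
  [:: (1, upd x i (Blk (e, d) [ffun s => l (tau^-1%g s)]))].
rewrite !big_cons !big_nil /= !scale1r !addr0; apply=> V phi [H _].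
by rewrite /ev !big_cons !big_nil /= !scale1r !addr0 ((H x i).2 r tau).
Qed.

Lemma day_ext (V : lmodType k) (f g : day sym D n j -> V) : linear f -> linear g ->
  (forall x : daygen D j n, f (dayg sym x) = g (dayg sym x)) -> f =1 g.
Proof. exact: pres_ext. Qed.

End Generators.
Arguments blab {D j n} b z.

Section Maps.
Context {D : sseq k} {j n : nat}.

Definition relb n' (rho : 'I_n -> 'I_n') (b : blk D n) : blk D n' :=
  Blk (bel b) [ffun s => rho (blb b s)].

Lemma relb_id (b : blk D n) : relb id b = b.
Proof.
case: b => r [d l]; rewrite /relb /bel /blb /=; congr (Blk _ _).
by apply/ffunP => s; rewrite ffunE.
Qed.

(** Applied to the projections, to the actions and to the relabellings of [day]. *)
Lemma dayrel_map (V : lmodType k) (S : ('I_j -> int) -> k) (rho : 'I_n -> 'I_n) (s : 'S_j)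
    (phi : daygen D j n -> V) : dayrel sym phi -> adm sym s -> admb sym rho ->
  dayrel sym (fun g => S (fun i => (bel (g i)).1) *: phi [ffun i => relb rho (g (s i))]).
Proof.
move=> [H1 H2] As Ar.
have abE (b : 'I_j -> blk D n) : badm (fun i => relb rho (b (s i))) <-> badm b.
  rewrite /badm.
  have -> : blab (fun i => relb rho (b (s i))) =
      (fun z => rho (blab b (outer (r := fun i => arty (b i)) z))).
    by apply/funext; apply: Rank_ind => i a; rewrite blab_Rank outer_Rank blab_Rank ffunE.
  by rewrite (admb_compE (fun a => rho (blab b a)) (outer_adm _ As)); exact: admb_compEl.
split=> [x i|g /dayokP ng]; last first.
  rewrite H2 ?scaler0 //; apply/dayokP.
  have -> : (fun i => [ffun i => relb rho (g (s i))] i) = (fun i => relb rho (g (s i))).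
    by apply/funext => i; rewrite ffunE.
  by move/abE.
have B := blkrel_scale (fun e => S (fun l => if l == i then e else (bel (x l)).1))
  (blkrel_relabel rho (H1 [ffun i => relb rho (x (s i))] (s^-1%g i))).
congr (blkrel sym _): B; apply/funext => b; congr (S _ *: phi _).
  by apply/funext => l; rewrite ffunE; case: (l == i).
apply/ffunP => l; rewrite !ffunE -(inj_eq (@perm_inj _ s)) permKV.
by case: eqP.
Qed.

Lemma adm1 m : adm sym (1%g : 'S_m).
Proof. by rewrite /adm eqxx orbT. Qed.

Lemma admb_id : admb sym (@id 'I_n).
Proof. by split; [by []|exists id|case: (sym) => //; apply/forallP]. Qed.

Lemma relb_same (g : daygen D j n) : [ffun i => relb id (g ((1%g : 'S_j) i))] = g.
Proof. by apply/ffunP => i; rewrite ffunE perm1 relb_id. Qed.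

Lemma day_pr_rel m : dayrel sym (fun g : daygen D j n =>
  if \sum_i (bel (g i)).1 == m then dayg sym g else 0).
Proof.
have := dayrel_map (fun e => if \sum_i e i == m then 1 else 0) (@dayg_rel D j n) (adm1 j) admb_id.
congr dayrel; apply/funext => g; rewrite relb_same.
by case: eqP => _; rewrite ?scale1r ?scale0r.
Qed.

Lemma day_act_rel (s : 'S_j) : adm sym s -> dayrel sym (fun g : daygen D j n =>
  koszul (fun i => (bel (g i)).1) (fun i => s i) *: dayg sym [ffun i => g (s^-1%g i)]).
Proof.
move=> As; have As' := adm_inv As.
have := dayrel_map (fun e => koszul e (fun i => s i)) (@dayg_rel D j n) As' admb_id.
congr dayrel; apply/funext => g; congr (_ *: dayg sym _).
by apply/ffunP => i; rewrite !ffunE relb_id.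
Qed.

Lemma day_relabel_rel (s : 'S_n) : adm sym s -> dayrel sym (fun g : daygen D j n =>
  dayg sym [ffun i => Blk (bel (g i)) [ffun a => s^-1%g (blb (g i) a)]]).
Proof.
move=> As; have As' : admb sym (fun i => s^-1%g i).
  split=> //; first exact: perm_bij.
  move: As; rewrite /adm; case: (sym) => //= /eqP ->; apply/forallP => a.
  by rewrite invg1 perm1.
have := dayrel_map (fun => 1) (@dayg_rel D j n) (adm1 j) As'.
congr dayrel; apply/funext => g; rewrite scale1r; congr (dayg sym _).
by apply/ffunP => i; rewrite !ffunE perm1.
Qed.

End Maps.
Lemma pr_dayg D j n m (g : daygen D j n) :
  pr (day sym D n j) m (dayg sym g) = if \sum_i (bel (g i)).1 == m then dayg sym g else 0.
Proof. by rewrite /= lift_gen //; exact: day_pr_rel. Qed.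

Lemma lact_dayg D j n (s : 'S_j) (g : daygen D j n) : adm sym s ->
  lact (day sym D n) s (dayg sym g) =
  koszul (fun i => (bel (g i)).1) (fun i => s i) *: dayg sym [ffun i => g (s^-1%g i)].
Proof. by move=> As; rewrite /= lift_gen //; exact: day_act_rel. Qed.

Lemma dayrelabel_dayg D j n (s : 'S_n) (g : daygen D j n) : adm sym s ->
  dayrelabel s (dayg sym g) =
  dayg sym [ffun i => Blk (bel (g i)) [ffun a => s^-1%g (blb (g i) a)]].
Proof. by move=> As; rewrite /dayrelabel lift_gen //; exact: day_relabel_rel. Qed.

Lemma lact_day_lin D j n (s : 'S_j) : adm sym s -> linear (lact (day sym D n) s).
Proof. by move=> As; apply/day_rel/day_act_rel. Qed.

Lemma dayrelabel_lin D j n (s : 'S_n) : adm sym s ->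
  linear (@dayrelabel k sym D n s j).
Proof. by move=> As; apply/day_rel/day_relabel_rel. Qed.

Lemma day_lseq D n : is_lseq (sym := sym) (day sym D n).
Proof.
have Lp j m : linear (pr (day sym D n j) m) by apply/day_rel/day_pr_rel.
have hd j (g : daygen D j n) : hdeg (M := day sym D n j) (\sum_i (bel (g i)).1) (dayg sym g).
  by rewrite /hdeg pr_dayg eqxx.
have PP j i i' : (fun x => pr (day sym D n j) i (pr (day sym D n j) i' x)) =1
    (fun x => if i == i' then pr (day sym D n j) i x else 0).
  apply: day_ext; first exact: linear_comp.
    by case: eqP => _; [exact: Lp|exact: linear_zero].
  move=> g; rewrite pr_dayg; set d := \sum_i0 _.
  have Ed i0 : pr (day sym D n j) i0 (dayg sym g) = if d == i0 then dayg sym g else 0 by exact: pr_dayg.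
  have [<-|di'] := eqVneq d i'; rewrite ?Ed ?(lin0 (Lp j _)).
    by rewrite eq_sym; case: eqP.
  case: (eqVneq i i') => [->|//]; by rewrite (negPf di').
split=> [j|j s As].
  split; [exact: Lp|exact: PP|apply: pres_ind => [|a x y Hx Hy|g]].
  - exact: (finsupp0 (M := day sym D n j)).
  - by apply: (finsupp_lin (M := day sym D n j)) Hx Hy; [exact: Lp|exact: PP].
  - exact: (finsupp_hdeg (hd j g)).
have La := @lact_day_lin D j n s As.
split=> // i; apply: day_ext; [exact: linear_comp|exact: linear_comp|move=> g].
rewrite addr0 pr_dayg lact_dayg // (linZ _ _ (Lp j i)) pr_dayg.
have -> : \sum_i0 (bel ([ffun i => g (s^-1%g i)] i0)).1 = \sum_i0 (bel (g i0)).1.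
  by rewrite [RHS](reindex_inj (@perm_inj _ s^-1%g)); apply: eq_bigr => l _; rewrite ffunE.
by case: eqP => _; rewrite ?lact_dayg // (lin0 La) scaler0.
Qed.

End Day.

Arguments blab {k D j n} b z.

Section Delta.
Context {k : comPzRingType} {sym : bool} {C : cooperad sym k}.
Implicit Types M N : gmod k.

Section OneModule.
Context {M : gmod k} {j n : nat}.

(** The word [(b_1; u_1) .. (b_j; u_j)], where [u_i] consists of the letters of [u]
    in the places labelled by [b_i]. *)
Definition dpart (b : 'I_j -> blk C n) (u : T M n) : T (cofree C M) j :=
  if `[< badm (sym := sym) b >] then psi (fun i => bel (b i)) (reind (blab b) u) else 0.

Lemma dpart_lin (b : 'I_j -> blk C n) : linear (dpart b).
Proof.
rewrite /dpart; case: asboolP => [[_ bb _]|_]; last exact: linear_zero.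
apply: (linear_comp (f := psi _)); [exact: psi_lin|exact: reind_lin].
Qed.

Lemma upd_dfwith (g : daygen C j n) i b : (fun l => upd g i b l) = dfwith (fun l => g l) (i := i) b.
Proof.
apply/functional_extensionality_dep => l; rewrite ffunE; case: (l =P i) => [->|/eqP il].
  by rewrite dfwith_in.
by rewrite dfwith_out // eq_sym.
Qed.

Definition dpartc (r : 'I_j -> nat) (c : forall i, int * C (r i))
    (l : forall i, {ffun 'I_(r i) -> 'I_n}) (u : T M n) : T (cofree C M) j :=
  dpart (fun i => Blk (c i) (l i)) u.

Lemma dpartc_hlin (r : 'I_j -> nat) (c : forall i, int * C (r i))
    (l : forall i, {ffun 'I_(r i) -> 'I_n}) i u :
  hlin (fun d => dpartc (dfwith c (i := i) d) l u).
Proof.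
pose b : 'I_j -> blk C n := fun i => Blk (c i) (l i).
have -> : (fun d => dpartc (dfwith c (i := i) d) l u) = (fun d =>
    if `[< badm (sym := sym) b >] then psi (dfwith c (i := i) d) (reind (blab b) u) else 0).
  by apply/funext.
case: asboolP => _; first exact: psi_hlin.
by split=> [*|//]; rewrite scaler0 addr0.
Qed.

Lemma dpartc_act (r : 'I_j -> nat) (e : 'I_j -> int) (c : forall i, C (r i))
    (l : forall i, {ffun 'I_(r i) -> 'I_n}) (t : forall i, 'S_(r i)) u :
  (forall i, adm sym (t i)) ->
  dpartc (fun i => (e i, ract C (t i) (c i))) l u =
  dpartc (fun i => (e i, c i)) (fun i => [ffun s => l i ((t i)^-1%g s)]) u.
Proof.
move=> At; have At' i : adm sym (t i)^-1%g by apply: adm_inv.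
have Ai := inner_adm At'; pose b : 'I_j -> blk C n := fun i => Blk (e i, c i) (l i).
have E : blab (fun i => Blk (e i, c i) [ffun s => l i ((t i)^-1%g s)] : blk C n) =
    (fun z => blab b (inner (fun i => (t i)^-1%g) z)).
  by apply/funext; apply: Rank_ind => i s; rewrite blab_Rank inner_Rank blab_Rank ffunE.
rewrite /dpartc /dpart /badm E -[blab (fun i => Blk _ (l i))]/(blab b) /=.
have -> : `[< admb sym (fun z => blab b (inner (fun i => (t i)^-1%g) z)) >] = `[< admb sym (blab b) >].
  exact: asbool_equiv_eq (admb_compE _ Ai).
case: asboolP => // -[_ bb _]; have [_ bi _] := Ai.
by rewrite [LHS](psi_act _ _ At) reind_comp.
Qed.

Lemma dpart_rel (u : T M n) : dayrel sym (fun g : daygen C j n => dpart (fun i => g i) u).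
Proof.
split=> [g i|g /dayokP ng]; last by rewrite /dpart; case: asboolP.
have -> : (fun b => dpart (fun l => upd g i b l) u) =
    (fun b => dpart (dfwith (fun l => g l) (i := i) b) u).
  by apply/funext => b; rewrite upd_dfwith.
have key r0 (l0 : {ffun 'I_r0 -> 'I_n}) :
    exists r (c : forall i, int * C (r i)) (l : forall i, {ffun 'I_(r i) -> 'I_n}) (E : r0 = r i),
    forall d l', dfwith (fun l => g l) (i := i) (Blk d l') =
    fun m => Blk (dfwith c (eq_rect r0 (fun r => int * C r)%type d _ E) m)
      (dfwith l (eq_rect r0 (fun r => {ffun 'I_r -> 'I_n}) l' _ E) m).
  have [r [y [E H]]] := slot_family (fun l => g l) i ((0, 0) : int * C r0, l0).
  exists r, (fun m => (y m).1), (fun m => (y m).2), E => d l'.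
  rewrite H; subst r0 => /=; apply/functional_extensionality_dep => m; rewrite /Blk; congr existT.
  by have [<-|im] := eqVneq i m; rewrite ?dfwith_in ?dfwith_out //; case: (y m).
split=> [r0 l0|r0 tau At e d l0].
  have [r [c [l [E H]]]] := key r0 l0; subst r0.
  have := dpartc_hlin c (dfwith l l0) i u; congr hlin; apply/funext => d.
  by rewrite H.
have [r [c [l [E H]]]] := key r0 l0; subst r0; rewrite !H /=.
pose e' m := (dfwith c (i := i) (e, d) m).1; pose c' m := (dfwith c (i := i) (e, d) m).2.
pose t := dfwith (fun m => 1%g : 'S_(r m)) (i := i) tau.
have At' m : adm sym (t m).
  by rewrite /t; have [<-|im] := eqVneq i m; rewrite ?dfwith_in ?dfwith_out // adm1.
have := dpartc_act e' c' (dfwith l l0) u At'; rewrite /dpartc.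
have -> : (fun m => Blk (e' m, ract C (t m) (c' m)) (dfwith l l0 m) : blk C n) =
    (fun m => Blk (dfwith c (e, ract C tau d) m) (dfwith l l0 m)).
  apply/functional_extensionality_dep => m; rewrite /e' /c' /t; congr Blk.
  have [<-|im] := eqVneq i m; first by rewrite !dfwith_in.
  by rewrite !dfwith_out // ract1; case: (c m).
move=> ->; congr (dpart _ u); apply/functional_extensionality_dep => m; rewrite /e' /c' /t.
have [<-|im] := eqVneq i m; first by rewrite !dfwith_in.
rewrite !dfwith_out //; congr Blk; first by case: (c m).
by apply/ffunP => s; rewrite ffunE invg1 perm1.
Qed.

Definition dayT (v : day sym C n j) (u : T M n) : T (cofree C M) j :=
  lift (fun g : daygen C j n => dpart (fun i => g i) u) v.

Lemma dayT_dayg (g : daygen C j n) u : dayT (dayg sym g) u = dpart (fun i => g i) u.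
Proof. by rewrite /dayT lift_gen //; exact: dpart_rel. Qed.

Lemma dayT_lin (v : day sym C n j) : linear (dayT v).
Proof. by apply: lift_lin_in => g; exact: dpart_lin. Qed.

Lemma dayT_linl (u : T M n) : linear (dayT^~ u).
Proof. exact/day_rel/dpart_rel. Qed.

Lemma dayT_relabel (s : 'S_n) (v : day sym C n j) u : adm sym s ->
  dayT (dayrelabel s v) u = dayT v (tact s u).
Proof.
move=> As; move: v; apply: day_ext.
- by apply: (linear_comp (f := dayT^~ u)); [exact: dayT_linl|exact: dayrelabel_lin].
- exact: dayT_linl.
move=> g; rewrite dayrelabel_dayg // !dayT_dayg.
set b := fun i => g i; have -> : (fun i => [ffun i => Blk (bel (g i)) [ffun a => s^-1%g (blb (g i) a)]] i) =
   (fun i => relb (fun a => s^-1%g a) (b i)) by apply/funext => i; rewrite ffunE.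
have Ap : admb sym (fun a => s^-1%g a).
  by split=> //; [exact: perm_bij|move: As; rewrite /adm; case: (sym) => //= /eqP ->;
    apply/forallP => a; rewrite invg1 perm1].
have E : blab (fun i => relb (fun a => s^-1%g a) (b i)) = (fun z => s^-1%g (blab b z)).
  by apply/funext; apply: Rank_ind => i a; rewrite blab_Rank [LHS]ffunE blab_Rank.
rewrite /dpart /badm E /= (asbool_equiv_eq (admb_compEl _ Ap)).
case: asboolP => // -[_ bb _]; rewrite tactE reind_comp //.
exact: perm_bij.
Qed.

Lemma dayT_act (s : 'S_j) (v : day sym C n j) u : adm sym s ->
  dayT (lact (day sym C n) s v) u = tact s (dayT v u).
Proof.
move=> As; move: v; apply: day_ext.
- by apply: (linear_comp (f := dayT^~ u)); [exact: dayT_linl|exact: lact_day_lin].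
- by apply: (linear_comp (f := tact s)); [exact: tact_lin|exact: dayT_linl].
move=> g; rewrite lact_dayg // (linZ _ _ (dayT_linl u)) !dayT_dayg.
set b := fun i => g i; have -> : (fun i => [ffun i => g (s^-1%g i)] i) = (fun i => b (s^-1%g i)).
  by apply/funext => i; rewrite ffunE.
have E : blab (fun i => b (s^-1%g i)) = (fun z => blab b (outer (r := fun i => arty (b i)) z)).
  by apply/funext; apply: Rank_ind => i a; rewrite outer_Rank !blab_Rank.
have Ao := outer_adm (fun i => arty (b i)) (adm_inv As).
rewrite /dpart /badm E (asbool_equiv_eq (admb_compE _ Ao)).
case: asboolP => [[_ bb _]|_]; last by rewrite scaler0 (lin0 (@tact_lin _ _ _ _)).
by have [_ bo _] := Ao; rewrite tact_psi reind_comp.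
Qed.

End OneModule.
Lemma dpartE M j n (g : daygen C j n) (x : tgen M n) : dayok sym g ->
  dpart (fun i => g i) (ten x) = daysign g (fun s => (x s).1) *:
    ten [ffun i => ((bel (g i)).1 + \sum_s (x (blb (g i) s)).1,
      cof (bel (g i)) (ten [ffun s => x (blb (g i) s)]))].
Proof.
move=> /dayokP Ag; rewrite /dpart; case: asboolP => // _; have [_ bb _] := Ag.
rewrite reind_ten // (linZ _ _ (@psi_lin _ _ _ _ _ _ _)) psi_ten scalerA mulrC.
set y := [ffun a => x _].
have py i : part y i = [ffun s => x (blb (g i) s)].
  by apply/ffunP => s; rewrite !ffunE blab_Rank.
have dy i : tdeg (part y i) = \sum_s (x (blb (g i) s)).1.
  by rewrite py; apply: eq_bigr => s _; rewrite ffunE.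
congr (shuffle _ _ * _ *: ten _); first by apply/funext => i; exact: dy.
by apply/ffunP => i; rewrite !ffunE dy py.
Qed.

Definition dterm M n (z : comp sym C C n) (u : T M n) : cofree C (cofree C M) :=
  tlift (M := day sym C n) (fun j c' v => cof c' (dayT v u)) z.

Lemma cofdelta_def M (x : cofree C M) : cofdelta x =
  tlift (M := Tseq M) (fun n c u => dterm (decomp C (pr (C n) c.1 c.2)) u) x.
Proof.
congr (tlift _ x); apply/functional_extensionality_dep => n.
apply/functional_extensionality_dep => c; apply/functional_extensionality_dep => u.
congr (tlift _ _); apply/functional_extensionality_dep => j.
apply/functional_extensionality_dep => c'; apply/functional_extensionality_dep => v.
rewrite /daylift /dayT -lift_lin_out; last exact: cof_lin.
apply: lift_eq => g; case: ifP => [ok|/negbT/dayokP ng]; last first.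
  by rewrite /dpart; case: asboolP => // _; rewrite (lin0 (@cof_lin _ _ _ _ _ _)).
rewrite -(lift_tenE (L := fun u => cof c' (dpart (fun i => g i) u))); last first.
  by apply: (linear_comp (f := fun u => cof c' u)); [exact: cof_lin|exact: dpart_lin].
by apply: lift_eq => y; rewrite dpartE // (linZ _ _ (@cof_lin _ _ _ _ _ _)).
Qed.

Lemma dterm_totbal M n (u : T M n) :
  @totbal k sym C (day sym C n) _ (fun j c' v => cof c' (dayT v u)).
Proof.
split=> [j v|j c|j s As e c v]; first exact: cof_hlin.
  by apply: (linear_comp (f := fun v => cof c v)); [exact: cof_lin|exact: dayT_linl].
by rewrite cof_act // dayT_act.
Qed.

Lemma dterm_linl M n (u : T M n) : linear (@dterm M n ^~ u).
Proof. exact/tlift_lin/dterm_totbal. Qed.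

Lemma dterm_lin M n (z : comp sym C C n) : linear (@dterm M n z).
Proof.
apply: lift_lin_in => g /=.
by apply: (linear_comp (f := fun v => cof _ v)); [exact: cof_lin|exact: dayT_lin].
Qed.

Lemma dterm_totg M n j (c : int * C j) (v : day sym C n j) (u : T M n) :
  dterm (totg sym c v) u = cof c (dayT v u).
Proof. exact: (tlift_totg _ _ (dterm_totbal u)). Qed.

Lemma dterm_act M n (s : 'S_n) (z : comp sym C C n) (u : T M n) : adm sym s ->
  dterm (ract (comp sym C C) s z) u = dterm z (tact s u).
Proof.
move=> As.
have tb : @totbal k sym C (day sym C n) _ (fun j (c : int * C j) v =>
    sgn (0 * c.1) *: (totg sym c (@dayrelabel k sym C n s j v) : tot sym C (day sym C n))).
  apply: (@totbal_comp k sym C _ _ _ _ (fun e => sgn (0 * e)) (fun j _ => @dayrelabel k sym C n s j)).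
  - exact: totbal_totg.
  - by move=> j _; exact: dayrelabel_lin.
  - move=> j t At _; apply: day_ext.
    + by apply: linear_comp; [exact: dayrelabel_lin|exact: lact_day_lin].
    + by apply: linear_comp; [exact: lact_day_lin|exact: dayrelabel_lin].
    move=> g; rewrite lact_dayg // dayrelabel_dayg // (linZ _ _ (dayrelabel_lin As)).
    rewrite dayrelabel_dayg // lact_dayg //; congr (_ *: dayg sym _).
      by congr koszul; apply/funext => i; rewrite ffunE.
    by apply/ffunP => i; rewrite !ffunE.
move: z; apply: tot_ext.
- by apply: (linear_comp (f := @dterm M n ^~ u)); [exact: dterm_linl|exact: tlift_lin].
- exact: dterm_linl.
move=> j c v; rewrite dterm_totg -dayT_relabel // /= /totmap tlift_totg // mul0r scale1r.
exact: dterm_totg.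
Qed.

Lemma cofdelta_totbal M : @totbal k sym C (Tseq M) _
  (fun n c u => dterm (decomp C (pr (C n) c.1 c.2)) u).
Proof.
have [Ccx Cact] := cseqP C.
have Ldec n : linear (@decomp _ _ C n) by case: (decompP C n) => [[]].
split=> [n u|n c|n s As e c u] /=.
- have [[Lp pp _] _ _] := Ccx n; split=> [e a x y|e x] /=; last by rewrite pp eqxx.
  by rewrite (Lp e) (Ldec n) (@dterm_linl M n u).
- exact: dterm_lin.
- have [[_ Hr] _ _ _] := Cact n s s As As; have [_ _ da] := decompP C n.
  by rewrite -[e in pr _ e (ract _ _ _)]addr0 -Hr da // dterm_act.
Qed.

Lemma cofdelta_cof M n (c : int * C n) (u : T M n) :
  cofdelta (cof c u) = dterm (decomp C (pr (C n) c.1 c.2)) u.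
Proof. by rewrite cofdelta_def; exact: (tlift_totg (M := Tseq M) _ _ (cofdelta_totbal M)). Qed.

Lemma cofdelta_lin M : linear (@cofdelta k sym C M).
Proof.
have -> : @cofdelta k sym C M = tlift (M := Tseq M) (fun n c u => dterm (decomp C (pr (C n) c.1 c.2)) u).
  by apply/funext => x; exact: cofdelta_def.
exact/(tlift_lin (M := Tseq M))/cofdelta_totbal.
Qed.

Lemma cofdelta_natural M N m (f : thick M N) : thick_lin (sym := sym) f ->
  forall x : cofree C M, cofdelta (cofmap m f x) = cofmap m (cofthick m f) (cofdelta x).
Proof.
move=> Lf; have Lt := thick_lin_cofthick (C := C) m Lf; have [Lf' sf] := Lf.
have LD M' := @cofdelta_lin M'; have Lm := cofmap_lin (C := C) m Lt.
apply: cof_ext; first by apply: linear_comp => //; exact: cofmap_lin.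
  exact: linear_comp.
move=> n c u; rewrite cofmap_cof // (linZ _ _ (LD N)) !cofdelta_cof.
have [Ccx _] := cseqP C; have [gC _ _] := Ccx n; have [[Ldec Hdec] _ _] := decompP C n.
have gcomp := tot_gmod (C := C) (day_lseq (sym := sym) C n); have [Lp _ _] := gcomp.
rewrite -[pr (C n) c.1 c.2]((hdeg_pr c.1 c.2 gC)) Hdec addr0.
move: (decomp C _); apply: tot_ext.
- apply: linear_scale; apply: (linear_comp (f := @dterm N n ^~ _)); [exact: dterm_linl|exact: Lp].
- apply: (linear_comp Lm); apply: (linear_comp (f := @dterm M n ^~ _)); [exact: dterm_linl|exact: Lp].
move=> j c' v; rewrite pr_totg; last exact: day_lseq.
rewrite !dterm_totg cofmap_cof //.
have [gday _] := day_lseq (sym := sym) C n; have [Lpd _ _] := gday j.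
have Lcof N' := @cof_lin k sym C N' j c'.
move: v; apply: day_ext.
- apply: linear_scale; apply: (linear_comp (Lcof _)).
  by apply: (linear_comp (f := dayT^~ _)); [exact: dayT_linl|exact: Lpd].
- apply: linear_scale; apply: (linear_comp (Lcof _)); apply: linear_comp; first by case: Lt.
  by apply: (linear_comp (f := dayT^~ _)); [exact: dayT_linl|exact: Lpd].
move=> g; rewrite pr_dayg; case: eqP => [E|_]; last first.
  rewrite !(lin0 (dayT_linl _)) (lin0 (Lt.1 j)) !(lin0 (Lcof _)) !scaler0 //.
rewrite !dayT_dayg /dpart; case: asboolP => [Ab|_]; last first.
  by rewrite (lin0 (Lt.1 j)) !(lin0 (Lcof _)) !scaler0.
rewrite cofthick_psi // (thick_reind sf Ab) (linZ _ _ (Lcof _)) scalerA -sgnD -mulrDr E.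
by rewrite addrC subrK.
Qed.

End Delta.

(** * Weights and geometric series *)

Section Filtration.
Context {k : comPzRingType} {V : lmodType k} (fil : nat -> V -> Prop) (S : V -> V).

Definition filtered : Prop :=
  [/\ forall N x, fil N x -> fil N.+1 x, forall x, exists N, fil N x &
      forall x, fil 0%N x -> x = 0].

Definition geom (x : V) : V := ssum (fun i => iter i S x).

Hypotheses (Hfil : filtered) (LS : linear S) (HS : forall N x, fil N.+1 x -> fil N (S x)).

Lemma iter_fil N x : fil N x -> forall i, (N <= i)%N -> iter i S x = 0.
Proof.
have [_ _ fil0] := Hfil; elim: N x => [|N IH] x fx i.
  by move=> _; rewrite (fil0 x fx) (lin0 (linear_iter i LS)).
by case: i => // i Ni; rewrite iterSr IH //; exact: HS.
Qed.

Lemma geom_summable x : summable (fun i => iter i S x).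
Proof. by have [_ /(_ x) [N fx] _] := Hfil; exists N; exact: iter_fil. Qed.

End Filtration.

Lemma ssumE (V : zmodType) (s : nat -> V) N : (forall i, (N <= i)%N -> s i = 0) ->
  ssum s = \sum_(i < N) s i.
Proof.
move=> H; rewrite /ssum (fsbigE (iota 0 N)) ?iota_uniq //=.
- rewrite -(big_mkord xpredT) /index_iota subn0 big_mkcond; apply: eq_bigr => i _.
  by rewrite mem_set.
- by move=> i _; rewrite mem_iota /= add0n -leqNgt => /H.
Qed.

Section Geometric.
Context {k : comPzRingType} {V : lmodType k} (S : V -> V).
Hypotheses (LS : linear S) (sS : forall x, summable (fun i => iter i S x)).

Lemma geom_lin_out (W : lmodType k) (L : V -> W) x : linear L ->
  ssum (fun i => L (iter i S x)) = L (geom S x).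
Proof.
move=> LL; have [N H] := sS x; rewrite /geom !(@ssumE _ _ N) // ?lin_sum //.
by move=> i Ni; rewrite H // lin0.
Qed.

Lemma geom_lin : linear (geom S).
Proof.
move=> a x y; have [N Hx] := sS x; have [N' Hy] := sS y.
have Z i : (maxn N N' <= i)%N -> iter i S x = 0 /\ iter i S y = 0.
  by rewrite geq_max => /andP[/Hx -> /Hy ->].
rewrite /geom !(@ssumE _ _ (maxn N N')); last 1 first.
- by move=> i Ni; rewrite (linear_iter i LS); have [-> ->] := Z i Ni; rewrite scaler0 addr0.
- by rewrite scaler_sumr -big_split; apply: eq_bigr => i _; exact: (linear_iter i LS).
- by move=> i /Z[].
- by move=> i /Z[].
Qed.

Lemma geomSr x : geom S x = x + geom S (S x).
Proof.
have [N H] := sS x; rewrite /geom (@ssumE _ _ N.+1) => [|i Ni]; last exact/H/ltnW.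
rewrite (@ssumE _ _ N) => [|i Ni]; last by rewrite -iterSr H // leqW.
by rewrite big_ord_recl; congr (_ + _); apply: eq_bigr => i _; rewrite -iterSr.
Qed.

Lemma geomSl x : geom S x = x + S (geom S x).
Proof. by rewrite {1}geomSr; congr (_ + _); rewrite -geom_lin_out // /geom; congr ssum; apply/funext => i; rewrite -iterSr. Qed.

Lemma geom_fil (fil : V -> Prop) x :
  fil 0 -> (forall x y, fil x -> fil y -> fil (x + y)) -> (forall x, fil x -> fil (S x)) ->
  fil x -> fil (geom S x).
Proof.
move=> f0 fD fS fx; have [N H] := sS x; rewrite /geom (@ssumE _ _ N) //.
by elim/big_rec: _ => // i y _; apply: fD; elim: (nat_of_ord i) => // j; exact: fS.
Qed.

End Geometric.

Lemma ten_spanP (k : comPzRingType) (M : gmod k) n (S : 'I_n -> M -> Prop) (x : tgen M n) :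
  (forall i, span (S i) (x i).2) ->
  span (fun v => exists2 y : tgen M n, v = ten y & forall i, (y i).1 = (x i).1 /\ S i (y i).2) (ten x).
Proof.
move=> Hx; set Q := fun v => _.
suff: forall l : seq 'I_n, forall y : tgen M n,
    (forall i, (y i).1 = (x i).1 /\ if i \in l then span (S i) (y i).2 else S i (y i).2) ->
    span Q (ten y).
  by move=> /(_ (enum 'I_n) x); apply=> i; rewrite mem_enum; split=> //; exact: Hx.
elim=> [|i l IH] y Hy; first by apply: span_gen; exists y.
rewrite -(upd_same y i); case yi: (y i) => [e u].
have Lt : linear (fun u => ten (upd y i (e, u))) := hlin_linear e (@ten_slot k M n y i).
have [ei] := Hy i; rewrite yi inE eqxx /= => Su; elim: Su => [|a v w Sv _ IHw].
  by rewrite (lin0 Lt); exact: span0.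
rewrite Lt; apply: span_add => //; apply: span_scale; apply: IH => j.
rewrite ffunE; case: eqP => [->|/eqP ji] /=; first by rewrite -ei yi; case: ifP => // _; split=> //; exact: span_gen.
by have := Hy j; rewrite inE (negPf ji).
Qed.

Lemma span_mono (k : comPzRingType) (V : lmodType k) (S S' : V -> Prop) x :
  (forall y, S y -> S' y) -> span S x -> span S' x.
Proof. by move=> H; apply: (span_lin (linear_id (U := V))) => y /H; exact: span_gen. Qed.

Lemma span_bound (k : comPzRingType) (V : lmodType k) (S : nat -> V -> Prop) x :
  (forall N N' y, (N <= N')%N -> S N y -> S N' y) ->
  span (fun y => exists N, S N y) x -> exists N, span (S N) x.
Proof.
move=> mono; elim=> [|a y z [N Sy] _ [N' sz]]; first by exists 0%N; exact: span0.
exists (maxn N N'); apply: spanD; first exact: mono (leq_maxl _ _) Sy.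
by apply: span_mono sz => w; apply: mono; exact: leq_maxr.
Qed.

Section Weights.
Context {k : comPzRingType} {sym : bool} {C : cooperad sym k} {M : gmod k}.

Definition cfil N : cofree C M -> Prop :=
  span (fun z => exists n (c : int * C n) (y : tgen M n), (n < N)%N /\ z = cof c (ten y)).

Definition tfil n N : T (cofree C M) n -> Prop :=
  span (fun z => exists (r : 'I_n -> nat) (c : forall i, int * C (r i)) w,
    (\sum_i r i < N)%N /\ z = psi c w).

Lemma cfil_mono N N' x : (N <= N')%N -> cfil N x -> cfil N' x.
Proof.
move=> NN'; apply: span_mono => z [n [c [y [nN ->]]]]; exists n, c, y.
by split=> //; exact: leq_trans NN'.
Qed.

Lemma tfil_mono n N N' (x : T (cofree C M) n) : (N <= N')%N -> tfil N x -> tfil N' x.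
Proof.
move=> NN'; apply: span_mono => z [r [c [w [rN ->]]]]; exists r, c, w.
by split=> //; exact: leq_trans NN'.
Qed.

Lemma cfil_filtered : filtered cfil.
Proof.
split=> [N x|x|N]; first exact/cfil_mono/leqnSn.
  apply: (span_bound (S := fun N z => exists n (c : int * C n) (y : tgen M n), (n < N)%N /\ z = cof c (ten y))).
    by move=> N N' y NN' [n [c [z [nN ->]]]]; exists n, c, z; split=> //; exact: leq_trans NN'.
  by apply: cof_span => n c y; exists n.+1, n, c, y.
by elim=> // a y z [n [c [w [//]]]].
Qed.

Lemma tfil_filtered n : filtered (@tfil n).
Proof.
split=> [N x|x|N]; first exact/tfil_mono/leqnSn.
  apply: (span_bound (S := fun N z => exists (r : 'I_n -> nat) (c : forall i, int * C (r i)) w,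
    (\sum_i r i < N)%N /\ z = psi c w)).
    by move=> N N' y NN' [r [c [w [rN ->]]]]; exists r, c, w; split=> //; exact: leq_trans NN'.
  move: x; apply: pres_ind => [|a y z Hy Hz|x]; first exact: span0.
    by apply: span_add => //; exact: span_scale.
  have Hx (i : 'I_n) : span (fun z : cofree C M => exists m (c : int * C m) (y : tgen M m), z = cof c (ten y)) (x i).2.
    by apply: cof_span => m c y; exists m, c, y.
  apply: (span_lin (linear_id (U := T (cofree C M) n)) _ (ten_spanP Hx)) => _ [y -> Hy].
  have /choice[r /(_ _)/cid H] := fun i => (Hy i).2; pose c i := projT1 (H i).
  pose y' i := projT1 (cid (projT2 (H i))).
  have [|a [w ->]] := @ten_psi _ _ _ _ _ y (fun i => existT (fun r => (int * C r) * tgen M r)%type (r i) (c i, y' i)).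
    by move=> i; exact: (projT2 (cid (projT2 (H i)))).
  by apply/span_scale/span_gen; eexists; exists r, c, w.
by elim=> // a y z [r [c [w [//]]]].
Qed.

Lemma wpr_cfil N x : cfil N x -> forall m, (N <= m)%N -> wpr m x = 0.
Proof.
move=> fx m Nm; have Lw := @wpr_lin k sym C (Tseq M) m.
have Z : linear (fun _ : cofree C M => 0 : cofree C M) by exact: linear_zero.
apply: (span_eq (L2 := fun=> 0) Lw Z _ fx) => z [n [c [y [nN ->]]]].
by rewrite wpr_cof ltn_eqF // (leq_trans nN).
Qed.

Lemma cfil_wpr n x : cfil n.+1 (wpr n x).
Proof.
apply: (span_lin (@wpr_lin k sym C (Tseq M) n) _
  (@cof_span k sym C M (fun z => exists n (c : int * C n) (y : tgen M n), z = cof c (ten y)) _ x)); last first.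
  by move=> m c y; exists m, c, y.
move=> _ [m [c [y ->]]]; rewrite wpr_cof; case: eqP => [<-|_]; last exact: span0.
by apply: span_gen; exists m, c, y.
Qed.

Lemma sum_wpr (x : cofree C M) : exists N, forall N', (N <= N')%N -> x = \sum_(m < N') wpr m x.
Proof.
move: x; apply: pres_ind => [|a x y [N Hx] [N' Hy]|[n [c u]]].
- by exists 0%N => N' _; rewrite big1 // => m _; rewrite (lin0 (@wpr_lin _ _ _ _ _)).
- exists (maxn N N') => N''; rewrite geq_max => /andP[/Hx Ex /Hy Ey].
  rewrite {1}Ex {1}Ey scaler_sumr -big_split; apply: eq_bigr => m _.
  by rewrite (@wpr_lin _ _ _ _ m).
exists n.+1 => N' nN; rewrite -[gen _ _]/(cof c u) (bigD1 (Ordinal nN)) //= big1 ?addr0.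
  by rewrite wpr_cof eqxx.
move=> m mn; rewrite wpr_cof; case: ifP => // /eqP E; case/eqP: mn.
exact/val_inj/esym.
Qed.

Lemma cfilP N x : cfil N x <-> forall m, (N <= m)%N -> wpr m x = 0.
Proof.
split=> [/wpr_cfil //|H]; have [N' /(_ _ (leq_maxr N N')) ->] := sum_wpr x.
apply: span_sum => m _; case: (leqP N m) => [/H ->|mN]; first exact: span0.
exact: cfil_mono mN (cfil_wpr _ _).
Qed.

End Weights.

Section Lowering.
Context {k : comPzRingType} {sym : bool} {C : cooperad sym k}.
Implicit Types M N : gmod k.

Lemma cofmap_cfil M N m (f : thick M N) n (x : cofree C M) : thick_lin (sym := sym) f ->
  cfil n x -> cfil n (cofmap m f x).
Proof.
move=> Lf fx; apply: (span_lin (cofmap_lin (C := C) m Lf) _ fx) => _ [l [c [y [ln ->]]]].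
rewrite cofmap_cof //; apply: span_scale.
move: (f l (ten y)); apply: pres_ind => [|a u v Hu Hv|z].
- by rewrite (lin0 (@cof_lin _ _ _ _ _ _)); exact: span0.
- by rewrite (@cof_lin _ _ _ _ _ c); apply: span_add => //; exact: span_scale.
- by apply: span_gen; exists l, c, z.
Qed.

Lemma cofthick_tfil M N m (f : thick M N) n l (u : T (cofree C M) l) :
  thick_lin (sym := sym) f -> tfil n u -> tfil n (cofthick m f u).
Proof.
move=> Lf fu; apply: (span_lin (@cofthick_lin _ _ C _ _ m f l Lf) _ fu) => _ [r [c [w [rn ->]]]].
by rewrite cofthick_psi //; apply/span_scale/span_gen; exists r, c, (f _ w).
Qed.

Context {M : gmod k} {t : cofree C M -> cofree C M} (Ht : homog (-1) t)
  (wt : forall m n x, (n <= m)%N -> wpr m (t (wpr n x)) = 0).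

Lemma lower_cfil l x : cfil l.+1 x -> cfil l (t x).
Proof.
move=> /cfilP fx; apply/cfilP => m lm; have [N' /(_ _ (leqnn _)) ->] := sum_wpr x.
have Lt := homog_lin Ht; have Lw := @wpr_lin k sym C (Tseq M) m.
rewrite (lin_sum _ _ _ Lt) (lin_sum _ _ _ Lw) big1 // => n _.
case: (leqP n m) => [nm|mn]; first exact: wt.
by rewrite fx ?(lin0 Lt) ?(lin0 Lw) //; exact: leq_ltn_trans mn.
Qed.

Lemma lower_tfil n l (u : T (cofree C M) n) : tfil l.+1 u -> tfil l (derivation t u).
Proof.
have HiC := homog_id (cofree C M); have Ltt := @tins_lin k _ (-1) t id n Ht HiC.
move=> fu; apply: (span_lin Ltt _ fu) => _ [r [c [w [rN ->]]]].
move: w; apply: pres_ind => [|a u' v Hu Hv|y].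
- by rewrite (lin0 (@psi_lin _ _ _ _ _ _ c)) (lin0 Ltt); exact: span0.
- by rewrite (@psi_lin _ _ _ _ _ _ c) Ltt; apply: span_add => //; exact: span_scale.
rewrite -[gen _ _]/(ten y) psi_ten (linZ _ _ Ltt) tins_ten //; apply/span_scale/span_sum => i _.
apply: span_scale; have -> : ginsf (-1) t id i (psig c y) =
    upd (psig c y) i ((psig c y i).1 - 1, t (cof (c i) (ten (part y i)))).
  by rewrite ginsE [in RHS]ffunE ffunE.
set e := _ - 1.
have ft : cfil (r i) (t (cof (c i) (ten (part y i)))).
  by apply: lower_cfil; apply: span_gen; exists (r i), (c i), (part y i).
apply: (span_lin (hlin_linear e (@ten_slot k _ _ (psig c y) i)) _ ft) => _ [n' [c' [y' [n'r ->]]]].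
pose b0 j := existT (fun r => (int * C r) * tgen M r)%type (r j) (c j, part y j).
pose b := dfwith b0 (i := i) (existT (fun r => (int * C r) * tgen M r)%type n' (c', y')).
have [|a [w ->]] := @ten_psi _ _ _ _ _ (upd (psig c y) i (e, cof c' (ten y'))) b.
  move=> j; rewrite ffunE /b; case: (j =P i) => [->|/eqP ji]; first by rewrite dfwith_in.
  by rewrite dfwith_out 1?eq_sym // ffunE.
apply/span_scale/span_gen; eexists _, _, w; split; last by [].
rewrite ltnS in rN; apply: leq_trans rN; rewrite (bigD1 i) //= [X in (_ < X)%N](bigD1 i) //= -addSn.
apply: leq_add; first by rewrite /b dfwith_in.
by apply: leq_sum => j ji; rewrite /b dfwith_out // eq_sym.
Qed.

End Lowering.

(** * Perturbation of thick maps *)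

Section PerturbedContraction.
Context {k : comPzRingType} {V V' : lmodType k}.
Context {d t H W Wt : lend V} {d' : V' -> V'} {F : V -> V'} {G : V' -> V}.
Hypotheses (LF : linear F) (LG : linear G).
Let p : lend V := Lend (linear_comp LG LF).
Hypotheses (dF : forall x, d' (F x) = F (d x)) (dG : forall y, d (G y) = G (d' y)).
Hypotheses (FG : forall y, F (G y) = y) (FH : forall x, F (H x) = 0)
  (HG : forall y, H (G y) = 0) (HH : H * H = 0).
Hypotheses (dH : d * H + H * d = p - 1) (dt : d * t + t * d + t * t = 0).
Hypotheses (rW : resolvent (t * H) W) (rWt : resolvent (H * t) Wt).

Let Fp x : F (p x) = F x. Proof. by rewrite /= FG. Qed.
Let pG y : p (G y) = G y. Proof. by rewrite /= FG. Qed.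

Let pH : p * H = 0.
Proof. by apply: lendP => x; rewrite lendE /= FH (lin0 LG). Qed.
Let Hp : H * p = 0.
Proof. by apply: lendP => x; rewrite lendE /= HG. Qed.

Let lE (u v : lend V) x : u = v -> u x = v x. Proof. by move=> ->. Qed.

Lemma pert_FG y : F (W (G y)) = y.
Proof. by rewrite (resolvent_right rW) !lendE HG (lin0 (lfunP t)) (lin0 (lfunP W)) addr0 FG. Qed.

Lemma pert_tE y : F (t (Wt (G y))) = F (W (t (G y))).
Proof. by congr F; exact: (lE _ (pert_tWt rW rWt)). Qed.

Lemma pert_dF x : d' (F (W x)) + F (t (Wt (G (F (W x))))) = F (W (d x + t x)).
Proof.
have E := lE x (pert_Wd (p := p) rW dH dt).
have -> : F (W (d x + t x)) = F (d (W x)) + F (W (t (p (W x)))).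
  by rewrite -(linD _ _ LF); congr F; exact: E.
by rewrite pert_tE dF.
Qed.

Lemma pert_dG y : d (Wt (G y)) + t (Wt (G y)) = Wt (G (d' y + F (t (Wt (G y))))).
Proof.
have E := lE (G y) (pert_dWt (p := p) rWt dH dt).
by rewrite (linD _ _ LG) -dG (linD _ _ (lfunP Wt)); exact: E.
Qed.

Lemma pert_dH x : d (H (W x)) + t (H (W x)) + H (W (d x + t x)) = Wt (G (F (W x))) - x.
Proof. exact: (lE x (pert_dH' (p := p) rW rWt dH dt)). Qed.

Lemma pert_FGK y : F (W (Wt (G y))) = y.
Proof.
have E := lE (G y) (pert_HWp rWt HH Hp); rewrite !lendE pG in E.
rewrite -[W (Wt (G y))]/((W * Wt) (G y)) (pert_WWt (Wt := Wt) rW) !lendE E.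
rewrite (lin0 (lfunP t)) (lin0 (lfunP W)) addr0.
by rewrite (resolvent_left rWt) !lendE (linD _ _ LF) FH addr0 FG.
Qed.

Lemma pert_FH x : F (W (H (W x))) = 0.
Proof.
have := lE (W x) (pert_pWH rW HH pH); rewrite !lendE => E.
by rewrite -Fp E (lin0 LF).
Qed.

Lemma pert_HH x : H (W (H (W x))) = 0.
Proof. exact: (lE x (pert_HWHW rW rWt HH)). Qed.

Lemma pert_HG y : H (W (Wt (G y))) = 0.
Proof.
have E := lE (G y) (pert_HWp rWt HH Hp); rewrite !lendE pG in E.
rewrite -[W (Wt (G y))]/((W * Wt) (G y)) (pert_WWt (Wt := Wt) rW) !lendE E.
by rewrite (lin0 (lfunP t)) (lin0 (lfunP W)) addr0 E.
Qed.

Lemma pert_tt y :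
  d' (F (t (Wt (G y)))) + F (t (Wt (G (d' y)))) + F (t (Wt (G (F (t (Wt (G y))))))) = 0.
Proof.
have E := lE (G y) (pert_dt' (p := p) rWt dH dt).
by rewrite dF -dG -!(linD _ _ LF) -[RHS](lin0 LF); congr F; exact: E.
Qed.

End PerturbedContraction.

Lemma resolvent_conv (R : pzRingType) (x W : R) : resolvent x W -> @resolvent R^c x W.
Proof. by case. Qed.

Section Generation.
Context {k : comPzRingType}.
Implicit Types M N : gmod k.

Lemma tpow_level0 M N (f g : M -> N) (u : T M 0) : homog 0 f -> homog 0 g -> tpow f u = tpow g u.
Proof.
move=> Hf Hg; move: u; apply: ten_ext; try exact: tpow_lin.
by move=> x; rewrite !tpow_ten //; congr ten; apply/ffunP => -[].
Qed.

Lemma thick_morphism_tpow M N (ff : thick M N) (f : M -> N) : is_gmod M -> homog 0 f ->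
  is_gmod N -> thick_morphism ff -> (forall u, ff 0%N u = tpow f u) ->
  (forall a, ff 1%N (one a) = one (f a)) -> forall n u, ff n u = tpow f u.
Proof.
move=> gM Hf gN mor f0 f1; have {}f1 : forall u, ff 1%N u = tpow f u.
  by apply: (T1_ext gM) => a; rewrite f1 tpow_one.
apply: T_ind => // n _ IH u; rewrite mor tpow_split //.
by congr (tens 0 _ _ u); apply/funext.
Qed.

Lemma thick_derivation_tins M (tt : thick M M) m (t : M -> M) : is_gmod M -> homog m t ->
  (forall p q u, tt (p + q)%N u = tens 0 (@tt p) id u + tens m id (@tt q) u) ->
  (forall u, tt 0%N u = 0) -> (forall a, tt 1%N (one a) = one (t a)) ->
  forall n u, tt n u = tins m t id u.
Proof.
move=> gM Ht der t0 t1; have Hi := homog_id M.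
have {}t1 : forall u, tt 1%N u = tins m t id u by apply: (T1_ext gM) => a; rewrite t1 tins_one.
apply: T_ind => // [u|n _ IH u]; first by rewrite t0 tins0.
rewrite der tins_split //; congr (tens 0 _ _ u + tens m id _ u); try exact/funext.
by apply/funext => v; rewrite tpow_id.
Qed.

End Generation.

Lemma resolvent_homog (k : comPzRingType) (M : gmod k) (s w : lend M) : is_gmod M ->
  resolvent s w -> homog 0 s -> homog 0 w.
Proof.
move=> [Lp _ _] r [_ Hs]; split=> [|i u]; first exact: lfunP.
pose e : lend M := Lend (Lp i); rewrite addr0.
suff E : e * w = w * e by exact: (congr1 (fun f : lend M => f u) (esym E)).
by apply: (comm_resolvent r); apply: lendP => v; rewrite !lendE /= Hs addr0.
Qed.

Section Levels.
Context {k : comPzRingType} {X Y : gmod k}.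
Context {d t H W Wt : forall n, lend (T X n)} {F : X -> Y} {G : Y -> X}.
Hypotheses (HF : homog 0 F) (HG : homog 0 G) (FG : forall y, F (G y) = y).
Hypotheses (tS : forall p q, t (p + q) = tl q (t p) + tr p (-1) (t q))
  (Ht : forall n, homog (M := T X n) (N := T X n) (-1) (t n))
  (HH : forall n, homog (M := T X n) (N := T X n) 1 (H n))
  (rW : forall n, resolvent (t n * H n) (W n))
  (rWt : forall n, resolvent (H n * t n) (Wt n)).
Hypotheses (FH : forall n u, tpow F (H n u) = 0) (HGz : forall n u, H n (tpow G u) = 0)
  (dS : forall p q, d (p + q) = tl q (d p) + tr p (-1) (d q))
  (Hd : forall n, homog (M := T X n) (N := T X n) (-1) (d n))
  (dH : forall n u, d n (H n u) + H n (d n u) = tpow G (tpow F u) - u)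
  (PD1 : forall p q, (tl q (H p) - tr p 1 (H q)) * H (p + q) = tl q (H p) * tr p 1 (H q))
  (PD2 : forall p q, H (p + q) * (tl q (H p) - tr p 1 (H q)) = - (tl q (H p) * tr p 1 (H q))).

Let HW n : homog (M := T X n) (N := T X n) 0 (W n).
Proof. by apply: (resolvent_homog (T_gmod X n) (rW n)); have := homog_comp (Ht n) (HH n); rewrite subrr. Qed.

Let HWt n : homog (M := T X n) (N := T X n) 0 (Wt n).
Proof. by apply: (resolvent_homog (T_gmod X n) (rWt n)); have := homog_comp (HH n) (Ht n); rewrite addNr. Qed.

Let HP : homog 0 (fun x => G (F x)).
Proof. by have := homog_comp HG HF; rewrite addr0. Qed.

Definition ppow n : lend (T X n) := Lend (@tpow_lin k X X (fun x => G (F x)) n HP).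

Let ppowE n u : ppow n u = tpow G (tpow F u).
Proof. by rewrite /= tpow_comp. Qed.

Let Fppow n u : tpow F (ppow n u) = tpow F u.
Proof.
by rewrite ppowE [LHS]tpow_comp //; under [f in tpow f]funext do rewrite FG; rewrite tpow_id.
Qed.

Let Pp n : homog (M := T X n) (N := T X n) 0 (ppow n) := tpow_homog n HP.

Let dHp n : d n * H n + H n * d n = ppow n - 1.
Proof. by apply: lendP => u; rewrite !lendE dH ppowE. Qed.

Let ppow_split p q : ppow (p + q) = tl q (ppow p) * tr p 0 (ppow q).
Proof. by rewrite -tens_lr; apply: lendP => u /=; rewrite tpow_split. Qed.

Let pp n : ppow n * ppow n = ppow n.
Proof. by apply: lendP => u; rewrite lendE ppowE Fppow -ppowE. Qed.
Let pH n : ppow n * H n = 0.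
Proof. by apply: lendP => u; rewrite lendE ppowE FH (lin0 (tpow_lin HG)). Qed.
Let Hp n : H n * ppow n = 0.
Proof. by apply: lendP => u; rewrite lendE ppowE HGz. Qed.

Section Pair.
Context {p q : nat}.
Let h1 := tl q (H p). Let h2 := tr p 1 (H q).
Let a := tl q (t p). Let b := tr p (-1) (t q).
Let p1 := tl q (ppow p). Let p2 := tr p 0 (ppow q).
Let U := tl q (W p). Let V := tr p 0 (W q).
Let Ut := tl q (Wt p). Let Vt := tr p 0 (Wt q).
Let d1 := tl q (d p). Let d2 := tr p (-1) (d q).

Let c12 : h2 * h1 = - (h1 * h2). Proof. exact: tr_tl_anti (HH p) _. Qed.
Let cab : b * a = - (a * b). Proof. exact: tr_tl_anti (Ht p) _. Qed.
Let cah2 : h2 * a = - (a * h2). Proof. exact: tr_tl_anti (Ht p) _. Qed.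
Let cbh1 : b * h1 = - (h1 * b). Proof. exact: tr_tl_anti (HH p) _. Qed.
Let cp2h1 : p2 * h1 = h1 * p2. Proof. exact: tr_tl_comm (HH p) _. Qed.
Let cp1h2 : p1 * h2 = h2 * p1. Proof. exact/esym/(tr_tl_comm _ (Pp p)). Qed.
Let cp : p2 * p1 = p1 * p2. Proof. exact: tr_tl_comm (Pp p) _. Qed.
Let cp2a : p2 * a = a * p2. Proof. exact: tr_tl_comm (Ht p) _. Qed.
Let cp1b : p1 * b = b * p1. Proof. exact/esym/(tr_tl_comm _ (Pp p)). Qed.
Let cd1h2 : d1 * h2 = - (h2 * d1). Proof. by rewrite (tr_tl_anti _ (Hd p)) ?opprK. Qed.
Let cd2h1 : d2 * h1 = - (h1 * d2). Proof. exact: tr_tl_anti (HH p) _. Qed.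

Let rU : resolvent (a * h1) U.
Proof. by have [r1 r2] := rW p; split; rewrite -tlM -(@tl1 k X p q) -tlN -tlD -tlM ?r1 ?r2. Qed.
Let rV : resolvent (b * h2) V.
Proof.
have [r1 r2] := rW q; split; rewrite -trM addNr -(@tr1 k X p q) -trN -trD;
  by rewrite -[0]addr0 -trM addr0 ?r1 ?r2.
Qed.
Let rUt : resolvent (h1 * a) Ut.
Proof. by have [r1 r2] := rWt p; split; rewrite -tlM -(@tl1 k X p q) -tlN -tlD -tlM ?r1 ?r2. Qed.
Let rVt : resolvent (h2 * b) Vt.
Proof.
have [r1 r2] := rWt q; split; rewrite -trM subrr -(@tr1 k X p q) -trN -trD;
  by rewrite -[0]addr0 -trM addr0 ?r1 ?r2.
Qed.
Let rWpq : resolvent ((a + b) * H (p + q)) (W (p + q)).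
Proof. by rewrite /a /b -tS. Qed.
Let rWtpq : resolvent (H (p + q) * (a + b)) (Wt (p + q)).
Proof. by rewrite /a /b -tS. Qed.

Let dh1 : d1 * h1 + h1 * d1 = p1 - 1.
Proof. by rewrite -!tlM -tlD dHp tlD tlN tl1. Qed.
Let dh2 : d2 * h2 + h2 * d2 = p2 - 1.
Proof. by rewrite -!trM addNr subrr -trD dHp trD trN tr1. Qed.
Let dHpq : d (p + q) * H (p + q) + H (p + q) * d (p + q) = p1 * p2 - 1.
Proof. by rewrite dHp ppow_split. Qed.
Let h1p : h1 * p1 = 0. Proof. by rewrite -tlM Hp tl0. Qed.
Let ph1 : p1 * h1 = 0. Proof. by rewrite -tlM pH tl0. Qed.
Let h2p : h2 * p2 = 0. Proof. by rewrite -trM Hp tr0. Qed.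
Let ph2 : p2 * h2 = 0. Proof. by rewrite -trM pH tr0. Qed.
Let pp1 : p1 * p1 = p1. Proof. by rewrite -tlM pp. Qed.
Let pp2 : p2 * p2 = p2. Proof. by rewrite -trM addr0 pp. Qed.
Let ppH : p1 * p2 * H (p + q) = 0. Proof. by rewrite -ppow_split pH. Qed.

Let PD : (h1 - h2) * H (p + q) = h1 * h2. Proof. exact: PD1. Qed.
Let p1H : p1 * H (p + q) = p1 * h2.
Proof.
exact: (proj1_homotopy (dS p q) dh1 dh2 dHpq cd1h2 cd2h1 cp h1p ph1 h2p pp1 ppH PD).
Qed.
Let p2H : p2 * H (p + q) = h1 * p2.
Proof.
exact: (proj2_homotopy (dS p q) dh1 dh2 dHpq cd1h2 cd2h1 cp2h1 cp h1p h2p ph2 pp2 ppH PD).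
Qed.

Lemma ppowW : ppow (p + q) * W (p + q) = ppow (p + q) * (U * V).
Proof.
rewrite [X in _ = X]mulrA ppow_split.
exact: (morphism_resolvents rU rV rWpq c12 cab cah2 cbh1 cp2h1 cp1h2 cp cp2a cp1b p1H p2H PD).
Qed.

(** The mirror images are the same statements in the converse ring. *)
Let opp (x y : lend (T X (p + q))) : x * y = - (y * x) -> y * x = - (x * y).
Proof. by move=> ->; rewrite opprK. Qed.
Let PDc : H (p + q) * (h1 - h2) = h2 * h1. Proof. by rewrite c12; exact: PD2. Qed.
Let dh1c : h1 * d1 + d1 * h1 = p1 - 1. Proof. by rewrite addrC. Qed.
Let dh2c : h2 * d2 + d2 * h2 = p2 - 1. Proof. by rewrite addrC. Qed.
Let dHc : H (p + q) * d (p + q) + d (p + q) * H (p + q) = p2 * p1 - 1.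
Proof. by rewrite addrC cp. Qed.
Let Hppc : H (p + q) * (p2 * p1) = 0. Proof. by rewrite cp -ppow_split Hp. Qed.

Let Hp1 : H (p + q) * p1 = h2 * p1.
Proof.
exact: (@proj1_homotopy (lend (T X (p + q)))^c _ _ _ _ _ _ _ _ (dS p q) dh1c dh2c dHc
  (opp cd1h2) (opp cd2h1) (esym cp) ph1 h1p ph2 pp1 Hppc PDc).
Qed.
Let Hp2 : H (p + q) * p2 = p2 * h1.
Proof.
exact: (@proj2_homotopy (lend (T X (p + q)))^c _ _ _ _ _ _ _ _ (dS p q) dh1c dh2c dHc
  (opp cd1h2) (opp cd2h1) (esym cp2h1) (esym cp) ph1 ph2 h2p pp2 Hppc PDc).
Qed.

Lemma Wtppow : Wt (p + q) * ppow (p + q) = Vt * (Ut * ppow (p + q)).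
Proof.
rewrite ppow_split -[tl _ _ * tr _ _ _]/(p1 * p2) -cp.
exact: (@morphism_resolvents (lend (T X (p + q)))^c a b h1 h2 (H (p + q)) p1 p2 Ut Vt
  (Wt (p + q)) (resolvent_conv rUt) (resolvent_conv rVt)
  (resolvent_conv rWtpq)
  (opp c12) (opp cab) (opp cah2) (opp cbh1) (esym cp2h1) (esym cp1h2) (esym cp)
  (esym cp2a) (esym cp1b) Hp1 Hp2 PDc).
Qed.

Lemma pd_left : (h1 * U - h2 * V) * (H (p + q) * W (p + q)) = h1 * U * (h2 * V).
Proof. exact: (pseudo_derivation_resolvents rU rV rWpq c12 cab cah2 cbh1 PD). Qed.

Lemma pd_right : H (p + q) * W (p + q) * (h1 * U - h2 * V) = - (h1 * U * (h2 * V)).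
Proof.
have HWE n : H n * W n = Wt n * H n := pert_HW (rW n) (rWt n).
have E1 : h1 * U = Ut * h1 by rewrite -!tlM HWE.
have E2 : h2 * V = Vt * h2 by rewrite -!trM HWE addr0 add0r.
have E12 : h1 * U * (h2 * V) = - (Vt * h2 * (Ut * h1)).
  rewrite -E1 -E2 -!tlM -!trM addr0; apply: opp; apply: (tr_tl_anti (d := 1)) => //.
  by have := homog_comp (HH p) (HW p); rewrite add0r.
rewrite E12 opprK HWE E1 E2.
exact: (@pseudo_derivation_resolvents (lend (T X (p + q)))^c a b h1 h2 (H (p + q)) Ut Vt
  (Wt (p + q)) (resolvent_conv rUt) (resolvent_conv rVt)
  (resolvent_conv rWtpq)
  (opp c12) (opp cab) (opp cah2) (opp cbh1) PDc).
Qed.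

End Pair.

Lemma tpowW_morphism p q u : tpow F (W (p + q) u) =
  tens 0 (fun v => tpow F (W p v)) (fun v => tpow F (W q v)) u.
Proof.
have LFn n := @tpow_lin k X Y F n HF.
rewrite -Fppow -lendM ppowW lendM Fppow tpow_split // -tens_lr.
by rewrite [LHS](tens_comp _ _ (LFn p) (LFn q) (HW p) (lfunP (W q))) mulr0 scale1r addr0.
Qed.

Lemma WttpowG p q u : Wt (p + q) (tpow G u) =
  tens 0 (fun v => Wt p (tpow G v)) (fun v => Wt q (tpow G v)) u.
Proof.
have pG n (v : T Y n) : ppow n (tpow G v) = tpow G v.
  by rewrite ppowE [tpow F _]tpow_comp //; congr tpow; under [f in tpow f]funext do rewrite FG; rewrite tpow_id.
rewrite -pG -lendM Wtppow !lendM pG -lendM (tr_tl_comm _ (HWt p)) // -tens_lr tpow_split //.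
rewrite [LHS](tens_comp _ _ (lfunP (Wt p)) (lfunP (Wt q)) (tpow_homog p HG) (@tpow_lin k Y X G q HG)).
by rewrite mulr0 scale1r addr0.
Qed.

Hypothesis FGW : forall n u, tpow F (W n (tpow G u)) = u.

Lemma tpow_tt_split p q u : tpow F (W (p + q) (t (p + q) (tpow G u))) =
  tens 0 (fun v => tpow F (W p (t p (tpow G v)))) id u +
  tens (-1) id (fun v => tpow F (W q (t q (tpow G v)))) u.
Proof.
have LFW n : linear (fun v => tpow F (W n v)).
  by apply: linear_comp; [exact: tpow_lin|exact: lfunP].
have LG n := @tpow_lin k Y X G n HG; have Hg n := @tpow_homog k Y X G n HG.
have LtG n : linear (fun v => t n (tpow G v)) by apply: linear_comp; [exact: lfunP|].
have Li n := @linear_id k (T X n).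
rewrite tpowW_morphism tS lendD (linD _ _ (tens_lin 0 (LFW p) (LFW q))) tpow_split //=.
congr (_ + _).
  rewrite (tens_comp _ _ (lfunP (t p)) (Li q) (Hg p) (LG q)) mulr0 scale1r addr0.
  have HtG := homog_comp (Ht p) (Hg p).
  rewrite (tens_comp _ _ (LFW p) (LFW q) HtG (LG q)) mul0r scale1r addr0.
  by congr (tens 0 _ _ u); apply/funext => v; rewrite FGW.
rewrite (tens_comp _ _ (Li p) (lfunP (t q)) (Hg p) (LG q)) mulr0 scale1r addr0.
rewrite (tens_comp _ _ (LFW p) (LFW q) (Hg p) (LtG q)) mul0r scale1r add0r.
by congr (tens (-1) _ _ u); apply/funext => v; rewrite FGW.
Qed.

End Levels.

(** * Resolvents and the projection to cogenerators *)

Lemma geom_resolvent (k : comPzRingType) (V : lmodType k) (S : lend V)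
    (sS : forall x, summable (fun i => iter i S x)) :
  resolvent S (Lend (geom_lin (lfunP S) sS)).
Proof.
split; apply: lendP => x; first exact: (canLR (addrK _) (geomSl (lfunP S) sS x)).
rewrite lendM /= (linB _ _ (geom_lin (lfunP S) sS)).
exact: (canLR (addrK _) (geomSr sS x)).
Qed.

Lemma ins_dt (k : comPzRingType) (M : gmod k) (d t : M -> M) (gM : is_gmod M)
    (Hd : homog (-1) d) (Ht : homog (-1) t) : (forall x, d (d x) = 0) ->
  (forall x, d (t x) + t (d x) + t (t x) = 0) ->
  forall n, ins Hd n * ins Ht n + ins Ht n * ins Hd n + ins Ht n * ins Ht n = 0.
Proof.
move=> dd dt n; have Hdt := homog_add gM Hd Ht.
have E : ins Hdt n = ins Hd n + ins Ht n.
  by apply: lendP => u; exact: (tinsD gM Hd Ht).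
have : ins Hdt n * ins Hdt n = 0.
  apply: ins_sqr => // x; rewrite (linD _ _ (homog_lin Hd)) (linD _ _ (homog_lin Ht)) dd add0r.
  by rewrite addrA dt.
by rewrite E mulrDl !mulrDr ins_sqr // add0r addrA.
Qed.

Section Resolvents.
Context {k : comPzRingType} {sym : bool} {C : cooperad sym k} {M : gmod k}.
Local Notation X := (cofree C M).

Lemma thick_lin_resolvent (N : gmod k) (SS WW : forall n, lend (T N n)) :
  (forall n, resolvent (SS n) (WW n)) -> thick_lin (sym := sym) (fun n u => SS n u) ->
  thick_lin (sym := sym) (fun n u => WW n u).
Proof.
move=> rW [_ sS]; split=> [n|n s As u]; first exact: lfunP.
pose y : lend (T N n) := Lend (@tact_lin k N n s).
have /(congr1 (fun f : lend (T N n) => f u)) // : WW n * y = y * WW n.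
by apply/esym/(comm_resolvent (rW n)); apply: lendP => v; exact/esym/sS.
Qed.

Lemma one_resolvent (N : gmod k) (S W : lend N) (S1 W1 : lend (T N 1)) : is_gmod N ->
  resolvent S W -> resolvent S1 W1 -> (forall x, S1 (one x) = one (S x)) ->
  forall x, W1 (one x) = one (W x).
Proof.
move=> gN [rW _] [_ rW1] E x; have Lo := @one_lin k N gN.
have Ex : x = W x - S (W x) by have := congr1 (fun f : lend N => f x) rW.
rewrite {1}Ex (linB _ _ Lo) -E.
exact: (congr1 (fun f : lend (T N 1) => f (one (W x))) rW1).
Qed.

Lemma delta_resolvent (S W : lend X) (SS WW : forall n, lend (T X n)) :
  resolvent S W -> (forall n, resolvent (SS n) (WW n)) ->
  thick_lin (sym := sym) (fun n u => SS n u) ->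
  (forall x, cofdelta (S x) = cofmap 0 (fun n u => SS n u) (cofdelta x)) ->
  forall x, cofdelta (W x) = cofmap 0 (fun n u => WW n u) (cofdelta x).
Proof.
move=> [rW _] rWW LS E x; have LW := thick_lin_resolvent rWW LS.
have Ex : x = W x - S (W x) by have := congr1 (fun f : lend X => f x) rW.
set z := cofdelta (W x); have -> : cofdelta x = z - cofmap 0 (fun n u => SS n u) z.
  by rewrite {1}Ex (linB _ _ (@cofdelta_lin _ _ _ _)) E.
have LWS := thick_lin_comp LW LS.
rewrite (linB _ _ (cofmap_lin 0 LW)) cofmap_comp // addr0 addrC -scaleN1r.
rewrite -cofmap_lincomb //.
rewrite (@cofmap_eq k sym C X X 0 _ (thick_id X)) ?cofmap_id // => n u.
have [_ r2] := rWW n; rewrite scaleN1r addrC -(linB _ _ (lfunP (WW n))).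
exact: (congr1 (fun f : lend (T X n) => f u) r2).
Qed.

Section One.
Context {n : nat}.

Let b (s : 'I_n) : 'I_(\sum_(i < 1) n) := tagnat.Rank (p_ := fun _ : 'I_1 => n) ord0 s.

Let b_val s : b s = s :> nat.
Proof. by rewrite /b tagnat.RankEsum big_pred0. Qed.

Let b_adm : admb sym b.
Proof.
have E : n = (\sum_(i < 1) n)%N by rewrite big_ord1.
split=> //; last by case: (sym) => //; apply/forallP => s; rewrite b_val.
apply: inj_card_bij; last by rewrite !card_ord -E.
by move=> s s' /(congr1 (fun z : 'I_(\sum_(i < 1) n) => nat_of_ord z)); rewrite !b_val => /val_inj.
Qed.

Let psi_one (N : gmod k) (c : int * C n) (w : T N (\sum_(i < 1) n)) :
  psi (fun _ : 'I_1 => c) w = one (cof c (reind b w)).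
Proof.
have [_ bb _] := b_adm; have gX := @cofree_gmod k sym C N.
move: w; apply: ten_ext; first exact: psi_lin.
  apply: (linear_comp (one_lin gX)); apply: (linear_comp (f := fun u => cof c u)); first exact: cof_lin.
  exact: reind_lin.
move=> y; rewrite psi_ten reind_ten // koszul_mono => [|i j ij]; last by rewrite !b_val ltnW.
rewrite scale1r (one_hdeg gX (hdeg_cof c (hdeg_ten _))).
rewrite /shuffle big_ord1 big_pred0 // scale1r; congr ten; apply/ffunP => i.
have E : part y i = [ffun a => y (b a)] by apply/ffunP => s; rewrite !ffunE (ord1 i).
by rewrite !ffunE E.
Qed.

Lemma cofthick_one_cof N m (f : thick M N) (c : int * C n) (u : T M n) : thick_lin (sym := sym) f ->
  cofthick m f (one (cof c u)) = one (cofmap m f (cof c u)).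
Proof.
move=> Lf; have [_ sf] := Lf; have [mn bb ab] := b_adm; have [b' bK b'K] := bb.
have bb' : bijective b' by exists b.
have -> : u = reind b (reind b' u).
  by rewrite reind_comp // reind_mono // => a; rewrite bK.
rewrite -psi_one cofthick_psi // psi_one big_ord1 -(thick_reind sf b_adm).
by rewrite cofmap_cof // (linZ _ _ (one_lin (cofree_gmod N))).
Qed.
End One.
Lemma cofthick_one N m (f : thick M N) : thick_lin (sym := sym) f ->
  forall x : X, cofthick m f (one x) = one (cofmap m f x).
Proof.
move=> Lf; have [L1 L2] := (one_lin (cofree_gmod (C := C) M), one_lin (cofree_gmod (C := C) N)).
apply: cof_ext; first by apply: linear_comp => //; exact: cofthick_lin.
  by apply: linear_comp => //; exact: cofmap_lin.
by move=> n c u; exact: cofthick_one_cof.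
Qed.

End Resolvents.

Section Projection.
Context {k : comPzRingType} {sym : bool} {C : cooperad sym k} {M : gmod k} (gM : is_gmod M).

Definition projn n (c : int * C n) (u : T M n) : M := lift (fun x : tgen M n =>
  eps C (pr (C n) c.1 c.2) *: \sum_i pr M (x i).1 (x i).2) u.

Lemma projn_neq1 n c u : n != 1%N -> @projn n c u = 0.
Proof.
move=> n1; have [_ _ _ /(_ n1) e0] := epsP C n.
by rewrite /projn e0 /lift /ev big1 // => p _; rewrite scale0r scaler0.
Qed.

Lemma projn1 (c : int * C 1) u : projn c u = eps C (pr (C 1) c.1 c.2) *: unone u.
Proof.
rewrite /projn -(lift_lin_out (L := fun y : M => eps C (pr (C 1) c.1 c.2) *: y)); last first.
  by apply: linear_scale; exact: linear_id.
by apply: lift_eq => x; rewrite big_ord1.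
Qed.

Lemma cofproj_totbal : @totbal k sym C (Tseq M) _ projn.
Proof.
split=> [n u|n c|n s As e c u]; (have [n1|n1] := eqVneq n 1%N; first subst n).
- have -> : (fun c : int * C 1 => projn c u) = (fun c => eps C (pr (C 1) c.1 c.2) *: unone u).
    by apply/funext => c; rewrite projn1.
  have [[gC _ _] _] := (cseqP C).1 1%N; have [Le _ _ _] := epsP C 1.
  have [Lp pp _] : is_gmod (C 1%N) by have [gC' _ _] := (cseqP C).1 1%N.
  split=> [e a x y|e x] /=; last by rewrite pp eqxx.
  by rewrite (Lp e) Le scalerDl scalerA.
- have -> : (fun c : int * C n => projn c u) = (fun c => 0).
    by apply/funext => c; rewrite projn_neq1.
  by split=> [*|//]; rewrite scaler0 addr0.
- have -> : projn c = (fun u => eps C (pr (C 1) c.1 c.2) *: unone u).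
    by apply/funext => u; rewrite projn1.
  by apply: linear_scale; exact: unone_lin.
- by have -> : projn c = (fun u => 0); [apply/funext => u; rewrite projn_neq1|exact: linear_zero].
- have -> : s = 1%g by apply/permP => i; rewrite !ord1.
  by rewrite ract1 /= tact1.
- by rewrite !projn_neq1.
Qed.

Lemma cofproj_cof n (c : int * C n) (u : T M n) : cofproj (cof c u) = projn c u.
Proof. exact: (tlift_totg (M := Tseq M) _ _ cofproj_totbal). Qed.

Lemma cofproj_lin : linear (@cofproj k sym C M).
Proof. exact: (tlift_lin (M := Tseq M) cofproj_totbal). Qed.

Lemma cofproj_cfil (x : cofree C M) : cfil 1 x -> cofproj x = 0.
Proof.
have Z : linear (fun _ : cofree C M => 0 : M) by exact: linear_zero.
apply: (span_eq (L2 := fun=> 0) cofproj_lin Z) => z [n [c [y [n1 ->]]]].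
by rewrite cofproj_cof projn_neq1 // ltn_eqF.
Qed.

End Projection.

Lemma cofproj_cofmap (k : comPzRingType) (sym : bool) (C : cooperad sym k) (M N : gmod k) m
    (f : thick M N) (f1 : M -> N) : is_gmod M -> is_gmod N -> thick_lin (sym := sym) f ->
  linear f1 -> (forall a, first_level f a = f1 a) ->
  forall x : cofree C M, cofproj (cofmap m f x) = f1 (cofproj x).
Proof.
move=> gM gN Lf Lf1 E; apply: cof_ext.
- by apply: linear_comp; [exact: cofproj_lin|exact: cofmap_lin].
- by apply: linear_comp => //; exact: cofproj_lin.
move=> n c u; rewrite cofmap_cof // (linZ _ _ (cofproj_lin gN)) !cofproj_cof //.
have [n1|n1] := eqVneq n 1%N; last by rewrite !projn_neq1 // scaler0 (lin0 Lf1).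
subst n; rewrite !projn1 (linZ _ _ Lf1) scalerA -E /first_level unoneK //.
have [c0|c0] := eqVneq c.1 0; first by rewrite c0 mulr0 mul1r.
have [_ -> // _ _] := epsP C 1; by rewrite mulr0.
Qed.

(** * The perturbed contraction *)

Lemma tins_tpow (k : comPzRingType) (M N : gmod k) m (f : M -> N) (d : M -> M) (d' : N -> N) :
  homog 0 f -> homog m d -> homog m d' -> (forall x, d' (f x) = f (d x)) ->
  forall n (u : T M n), tins m d' id (tpow f u) = tpow f (tins m d id u).
Proof.
move=> Hf Hd Hd' fd n; have [Hi Hi'] := (homog_id M, homog_id N).
have Lf := @tpow_lin k M N f n Hf.
apply: ten_ext; first by apply: linear_comp => //; exact: tins_lin.
  by apply: linear_comp => //; exact: tins_lin.
move=> x; rewrite tpow_ten // !tins_ten // (lin_sum _ _ _ Lf); apply: eq_bigr => i _.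
rewrite (linZ _ _ Lf) tpow_ten //; congr (sgn (m * _) *: ten _).
  by apply: eq_bigr => j _; rewrite ffunE.
by rewrite !ginsE; apply/ffunP => j; rewrite !ffunE /=; case: (j == i) => //=; rewrite fd.
Qed.

Lemma cofmap_cofdif (k : comPzRingType) (sym : bool) (C : cooperad sym k) (M N : gmod k)
    (dM : M -> M) (dN : N -> N) (f : thick M N) : thick_lin (sym := sym) f ->
  homog (-1) dM -> homog (-1) dN -> (forall n u, tdif dN (f n u) = f n (tdif dM u)) ->
  forall x : cofree C M, cofdif dN (cofmap 0 f x) = cofmap 0 f (cofdif dM x).
Proof.
move=> Lf HM HN df; have Lm := cofmap_lin (C := C) 0 Lf.
apply: cof_ext.
- by apply: linear_comp => //; exact: cofdif_lin.
- by apply: linear_comp => //; exact: cofdif_lin.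
move=> n c u; rewrite cofdif_cof // (linD _ _ Lm) (linZ _ _ Lm) !cofmap_cof // !mul0r !scale1r.
by rewrite cofdif_cof // df.
Qed.

Lemma cofdif_sqr (k : comPzRingType) (sym : bool) (C : cooperad sym k) (M : gmod k) (d : M -> M) :
  is_gmod M -> homog (-1) d -> (forall x, d (d x) = 0) ->
  forall x : cofree C M, cofdif d (cofdif d x) = 0.
Proof.
move=> gM Hd dd; have Lc := @cofdif_lin k sym C M d Hd.
apply: cof_ext; [exact: linear_comp|exact: linear_zero|move=> n c u].
rewrite cofdif_cof // (linD _ _ Lc) (linZ _ _ Lc) !cofdif_cof //=.
have [_ _ dC] := (cseqP C).1 n.
rewrite dC (hlin0 _ (cof_hlin u)) add0r scalerDr addrA scalerA sgn_sqr scale1r.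
have -> : tdif d (tdif d u) = 0.
  exact: (congr1 (fun f : lend (T M n) => f u) (ins_sqr Hd gM isT dd n)).
rewrite (lin0 (@cof_lin _ _ _ _ _ c)) addr0 -scalerDl sgnD.
by rewrite -[sgn (-1)]/(-1) mulrN1 addNr scale0r.
Qed.

Section Assembly.
Context {k : comPzRingType} {A B : chain_complex k} {f : A -> B} {g : B -> A} {h : A -> A}.
Hypothesis cfgh : contraction f g h.
Context {sym : bool} {C : cooperad sym k} {t : cofree C A -> cofree C A}.
Hypothesis Ot : omega_algebra t.
Context {hh : thick A A}.
Hypothesis Hhh : thick_homotopy sym f g h hh.

Local Notation X := (cofree C A).
Local Notation Y := (cofree C B).

Let gA : is_gmod A. Proof. by have [] := ccxP A. Qed.
Let gB : is_gmod B. Proof. by have [] := ccxP B. Qed.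
Let HdA : homog (-1) (dif A). Proof. by have [] := ccxP A. Qed.
Let HdB : homog (-1) (dif B). Proof. by have [] := ccxP B. Qed.
Let ddA : forall x, dif A (dif A x) = 0. Proof. by have [] := ccxP A. Qed.
Let Hf : homog 0 f. Proof. by have [[]] := cfgh. Qed.
Let Hg : homog 0 g. Proof. by have [[]] := cfgh. Qed.
Let fd : forall x, dif B (f x) = f (dif A x). Proof. by have [_ [[]]] := cfgh. Qed.
Let gd : forall y, dif A (g y) = g (dif B y). Proof. by have [_ [[]]] := cfgh. Qed.
Let fg : forall y, f (g y) = y. Proof. by have [_ [_ []]] := cfgh. Qed.

Let gX : is_gmod X := cofree_gmod A.
Let gY : is_gmod Y := cofree_gmod B.

Let Ht : homog (-1) t. Proof. by have [] := Ot. Qed.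
Let deltat : forall x, cofdelta (t x) = cofmap (-1) (derivation t) (cofdelta x).
Proof. by have [] := Ot. Qed.
Let wt : forall m n (x : X), (n <= m)%N -> wpr m (t (wpr n x)) = 0.
Proof. by have [] := Ot. Qed.
Let dt0 : forall x, cofdif (dif A) (t x) + t (cofdif (dif A) x) + t (t x) = 0.
Proof. by have [] := Ot. Qed.

Let Thh : is_thick 1 hh. Proof. by have [[]] := Hhh. Qed.
Let Shh : symmetric_thick sym hh. Proof. by have [[]] := Hhh. Qed.
Let Phh : pseudo_derivation hh. Proof. by have [[]] := Hhh. Qed.
Let hh1 : forall a, first_level hh a = h a. Proof. by have [[]] := Hhh. Qed.
Let Bhh : thick_bound (dif A) (dif A) 1 hh
  (thick_sub (thick_comp (tpow g) (tpow f)) (thick_id A)).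
Proof. by have [_ []] := Hhh. Qed.
Let fhh : thick_eq (thick_comp (tpow f) hh) (thick_zero A B). Proof. by have [_ []] := Hhh. Qed.
Let hhg : thick_eq (thick_comp hh (tpow g)) (thick_zero B A). Proof. by have [_ []] := Hhh. Qed.
Let hhhh : thick_eq (thick_comp hh hh) (thick_zero A A). Proof. by have [_ []] := Hhh. Qed.

Let Lhh : thick_lin (sym := sym) hh := thick_linP Thh Shh.
Let Lf : thick_lin (sym := sym) (tpow f) := thick_lin_tpow Hf.
Let Lg : thick_lin (sym := sym) (tpow g) := thick_lin_tpow Hg.
Let Ltt : thick_lin (sym := sym) (derivation t) := thick_lin_tins Ht.
Let F : X -> Y := cofmap 0 (tpow f).
Let G : Y -> X := cofmap 0 (tpow g).
Let H : X -> X := cofmap 1 hh.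
Let tt : thick X X := derivation t.
Let HH : thick X X := cofthick 1 hh.

Let HdX : homog (-1) (cofdif (dif A) : X -> X) := cofdif_homog HdA.
Let HdY : homog (-1) (cofdif (dif B) : Y -> Y) := cofdif_homog HdB.
Let HF : homog 0 F. Proof. by apply: cofmap_homog; [move=> n; exact: tpow_homog|case: Lf]. Qed.
Let HG : homog 0 G. Proof. by apply: cofmap_homog; [move=> n; exact: tpow_homog|case: Lg]. Qed.
Let HHm : homog 1 H. Proof. exact: cofmap_homog. Qed.
Let LF : linear F := homog_lin HF.
Let LG : linear G := homog_lin HG.
Let LHH : thick_lin (sym := sym) HH := thick_lin_cofthick 1 Lhh.

Let dX : lend X := Lend (homog_lin HdX).
Let tX : lend X := Lend (homog_lin Ht).
Let HX : lend X := Lend (homog_lin HHm).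
Let dT n : lend (T X n) := ins HdX n.
Let tT n : lend (T X n) := ins Ht n.
Let HT n : lend (T X n) := Lend (LHH.1 n).

Let sX x : summable (fun i => iter i (tX * HX) x).
Proof.
apply: (geom_summable (@cfil_filtered k sym C A) (lfunP (tX * HX))) => N y fy.
by apply: (lower_cfil Ht wt); exact: cofmap_cfil.
Qed.
Let sXt x : summable (fun i => iter i (HX * tX) x).
Proof.
apply: (geom_summable (@cfil_filtered k sym C A) (lfunP (HX * tX))) => N y fy.
by apply: cofmap_cfil => //; apply: (lower_cfil Ht wt).
Qed.
Let sT n u : summable (fun i => iter i (tT n * HT n) u).
Proof.
apply: (geom_summable (@tfil_filtered k sym C A n) (lfunP (tT n * HT n))) => N y fy.
by apply: (lower_tfil Ht wt); exact: cofthick_tfil.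
Qed.
Let sTt n u : summable (fun i => iter i (HT n * tT n) u).
Proof.
apply: (geom_summable (@tfil_filtered k sym C A n) (lfunP (HT n * tT n))) => N y fy.
by apply: cofthick_tfil => //; apply: (lower_tfil Ht wt).
Qed.

Let W : lend X := Lend (geom_lin (lfunP (tX * HX)) sX).
Let Wt : lend X := Lend (geom_lin (lfunP (HX * tX)) sXt).
Let WT n : lend (T X n) := Lend (geom_lin (lfunP (tT n * HT n)) (sT (n := n))).
Let WtT n : lend (T X n) := Lend (geom_lin (lfunP (HT n * tT n)) (sTt (n := n))).
Let rW : resolvent (tX * HX) W := geom_resolvent sX.
Let rWt : resolvent (HX * tX) Wt := geom_resolvent sXt.
Let rWT n : resolvent (tT n * HT n) (WT n) := geom_resolvent (sT (n := n)).
Let rWtT n : resolvent (HT n * tT n) (WtT n) := geom_resolvent (sTt (n := n)).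

Let F' := pertF F t H.
Let G' := pertG t H G.
Let H' := pertH t H.
Let t' := pertt F t H G.
Let HH' := pert_thick tt HH.

Let F'E x : F' x = F (W x). Proof. exact: (geom_lin_out sX). Qed.
Let G'E y : G' y = Wt (G y). Proof. by []. Qed.
Let H'E x : H' x = H (W x). Proof. exact: (geom_lin_out sX _ (lfunP HX)). Qed.
Let t'E y : t' y = F (t (Wt (G y))).
Proof. exact: (geom_lin_out sXt (L := fun x => F (t x)) _ (linear_comp LF (lfunP tX))). Qed.
Let HH'E n u : @HH' n u = HT n (WT n u). Proof. exact: (geom_lin_out (sT (n := n)) _ (lfunP (HT n))). Qed.

Lemma assembly_summable : pert_summable F t H G /\
  forall n u, summable (fun i => termH (@tt n) (@HH n) i u).
Proof.
have z (U V : zmodType) (L : U -> V) (s : nat -> U) : L 0 = 0 -> summable s -> summable (fun i => L (s i)).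
  by move=> L0 [N Hs]; exists N => i /Hs ->.
split; last by move=> n u; apply: (z _ _ (HT n) _ _ (sT u)); exact: (lin0 (lfunP (HT n))).
split=> x.
- exact: (z _ _ F _ (lin0 LF) (sX x)).
- exact: (sXt (G x)).
- exact: (z _ _ H _ (lin0 (lfunP HX)) (sX x)).
- by apply: (z _ _ (fun x => F (tX x)) _ _ (sXt (G x))); rewrite (lin0 (lfunP tX)) (lin0 LF).
Qed.

Let FE n (u : T X n) : tpow F u = cofthick 0 (tpow f) u.
Proof. exact/esym/cofthick_tpow. Qed.
Let GE n (u : T Y n) : tpow G u = cofthick 0 (tpow g) u.
Proof. exact/esym/cofthick_tpow. Qed.

Let TFG n (u : T Y n) : tpow F (tpow G u) = u.
Proof.
rewrite FE GE cofthick_comp // (@cofthick_eq _ _ _ _ _ _ _ (thick_id B)) ?cofthick_id //.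
move=> m v; rewrite tpow_comp //; have -> : (fun x => f (g x)) = id by apply/funext.
exact: tpow_id.
Qed.
Let TFH n u : tpow F (HT n u) = 0.
Proof. by rewrite FE [LHS]cofthick_comp // (@cofthick_eq _ _ _ _ _ _ _ (thick_zero A B)) ?cofthick_zero. Qed.
Let THG n u : HT n (tpow G u) = 0.
Proof. by rewrite GE [LHS]cofthick_comp // (@cofthick_eq _ _ _ _ _ _ _ (thick_zero B A)) ?cofthick_zero. Qed.
Let THH n : HT n * HT n = 0.
Proof.
apply: lendP => u; rewrite lendE [LHS]cofthick_comp //.
by rewrite (@cofthick_eq _ _ _ _ _ _ _ (thick_zero A A)) ?cofthick_zero.
Qed.
Let dF x : cofdif (dif B) (F x) = F (cofdif (dif A) x).
Proof. by apply: cofmap_cofdif => // n u; exact: tins_tpow. Qed.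
Let dG y : cofdif (dif A) (G y) = G (cofdif (dif B) y).
Proof. by apply: cofmap_cofdif => // n u; exact: tins_tpow. Qed.
Let TdH n u : dT n (HT n u) + HT n (dT n u) = tpow G (tpow F u) - u.
Proof.
have := cofthick_bound (C := C) 1 HdA HdA Lhh u; rewrite -[sgn 1]/(-1) scaleN1r opprK => ->.
rewrite subrr FE GE cofthick_comp // addr0.
rewrite (@cofthick_eq _ _ _ _ _ _ _ (fun n u => (-1) *: thick_id A n u + tpow g (tpow f u))).
  rewrite cofthick_lincomb //; last exact: thick_lin_comp.
  by rewrite cofthick_id scaleN1r addrC.
by move=> m v; have := Bhh v; rewrite -[sgn 1]/(-1) => ->; rewrite scaleN1r addrC.
Qed.

Let one_inj (M : gmod k) (gM : is_gmod M) : injective (@one k M) := can_inj (oneK gM).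
Let oneH x : HT 1 (one x) = one (H x). Proof. exact: cofthick_one. Qed.
Let onet x : tT 1 (one x) = one (t x). Proof. exact: tins_one (homog_id X). Qed.
Let oned x : dT 1 (one x) = one (cofdif (dif A) x). Proof. exact: tins_one (homog_id X). Qed.
Let oneF x : tpow F (one x) = one (F x). Proof. exact: tpow_one. Qed.
Let oneG y : tpow G (one y) = one (G y). Proof. exact: tpow_one. Qed.
Let LoX : linear (@one k X) := one_lin gX.
Let FG y : F (G y) = y.
Proof. by apply: (one_inj gY); rewrite -oneF -oneG TFG. Qed.
Let dHX : dX * HX + HX * dX = Lend (linear_comp LG LF) - 1.
Proof.
apply: lendP => x; apply: (one_inj gX); have := TdH (one x).
by rewrite oneF oneG oned !oneH oned -(linD _ _ LoX) -(linB _ _ LoX).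
Qed.
Let dtX : dX * tX + tX * dX + tX * tX = 0.
Proof. by apply: lendP => x; exact: dt0. Qed.
Let dtT n : dT n * tT n + tT n * dT n + tT n * tT n = 0.
Proof.
by apply: ins_dt => // x; exact: cofdif_sqr.
Qed.

Section Pair.
Context {p q : nat} (r : 'I_(p + q) -> nat) (c : forall i, int * C (r i)).
Let catb_r := @catb p q r.
Let a := \sum_(i < p) r (lshift q i). Let b := \sum_(j < q) r (rshift p j).
Implicit Types w : T A (a + b).

Let tid (n : nat) : @id (T X n) = @cofthick k sym C A A 0 (thick_id A) n.
Proof. by apply/funext => u; rewrite cofthick_id. Qed.
Let Tid : is_thick 0 (thick_id A). Proof. by move=> n; exact: homog_id. Qed.
Let Sid : symmetric_thick sym (thick_id A). Proof. by []. Qed.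
Let Lid : thick_lin (sym := sym) (thick_id A) := thick_linP Tid Sid.

Let el w : tl q (HT p) (psi c (reind catb_r w)) =
  sgn (\sum_i (c i).1) *: psi c (reind catb_r (tens 0 (@hh a) id w)).
Proof. by rewrite /= tid [LHS](cofthick_tens c 0 Thh Shh Lid) addr0 mul1r. Qed.

Let er w : tr p 1 (HT q) (psi c (reind catb_r w)) =
  sgn (\sum_i (c i).1) *: psi c (reind catb_r (tens 1 id (@hh b) w)).
Proof. by rewrite /= tid [LHS](cofthick_tens c 1 Tid Sid Lhh) add0r mul1r. Qed.

Let elr w : (tl q (HT p) * tr p 1 (HT q)) (psi c (reind catb_r w)) =
  psi c (reind catb_r (tens 1 (@hh a) (@hh b) w)).
Proof.
rewrite -tens_lr /= [LHS](cofthick_tens c 1 Thh Shh Lhh) (@sgn_eq _ _ 0 (\sum_i (c i).1)).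
  by rewrite scale1r.
by ring.
Qed.

Let e0 w : HT (p + q) (psi c (reind catb_r w)) =
  sgn (\sum_i (c i).1) *: psi c (reind catb_r (@hh (a + b)%N w)).
Proof. by rewrite [LHS](cofthick_psi _ _ _ Lhh) mul1r (thick_reind Shh) //; exact: catb_adm. Qed.

Let Lpsi w w' : psi c (reind catb_r w) - psi c (reind catb_r w') = psi c (reind catb_r (w - w')).
Proof. by rewrite (linB _ _ (reind_lin (catb_bij r))) (linB _ _ (@psi_lin _ _ _ _ _ _ c)). Qed.

Lemma pd_psi1 w : ((tl q (HT p) - tr p 1 (HT q)) * HT (p + q)) (psi c (reind catb_r w)) =
  (tl q (HT p) * tr p 1 (HT q)) (psi c (reind catb_r w)).
Proof.
rewrite elr lendM e0 (linZ _ _ (lfunP _)) !lendE el er -scalerBr scalerA sgn_sqr scale1r Lpsi.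
by have [-> _] := Phh w.
Qed.

Lemma pd_psi2 w : (HT (p + q) * (tl q (HT p) - tr p 1 (HT q))) (psi c (reind catb_r w)) =
  (- (tl q (HT p) * tr p 1 (HT q))) (psi c (reind catb_r w)).
Proof.
rewrite lendN elr lendM !lendE el er -scalerBr (linZ _ _ (lfunP _)) Lpsi e0 scalerA sgn_sqr scale1r.
have [_ ->] := Phh w.
by rewrite (linN _ (reind_lin (catb_bij r))) (linN _ (@psi_lin _ _ _ _ _ _ c)).
Qed.

End Pair.

Let PD1 p q : (tl q (HT p) - tr p 1 (HT q)) * HT (p + q) = tl q (HT p) * tr p 1 (HT q).
Proof. by apply/lendP/psi_cat_ext; [exact: lfunP|exact: lfunP|exact: pd_psi1]. Qed.
Let PD2 p q : HT (p + q) * (tl q (HT p) - tr p 1 (HT q)) = - (tl q (HT p) * tr p 1 (HT q)).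
Proof. by apply/lendP/psi_cat_ext; [exact: lfunP|exact: lfunP|exact: pd_psi2]. Qed.

Let tS p q : tT (p + q) = tl q (tT p) + tr p (-1) (tT q) := ins_split Ht p q.
Let dS p q : dT (p + q) = tl q (dT p) + tr p (-1) (dT q) := ins_split HdX p q.
Let HtT n : homog (M := T X n) (N := T X n) (-1) (tT n) := ins_homog Ht n.
Let HdT n : homog (M := T X n) (N := T X n) (-1) (dT n) := ins_homog HdX n.
Let HHT n : homog (M := T X n) (N := T X n) 1 (HT n) := cofthick_homog n Thh Shh.

Let FGW n u : tpow F (WT n (tpow G u)) = u.
Proof. exact: (pert_FG (@TFG n) (@THG n) (rWT n)). Qed.

Let HW : homog (M := X) (N := X) 0 W.
Proof. by apply: (resolvent_homog gX rW); have := homog_comp Ht HHm; rewrite subrr. Qed.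
Let HWt : homog (M := X) (N := X) 0 Wt.
Proof. by apply: (resolvent_homog gX rWt); have := homog_comp HHm Ht; rewrite addNr. Qed.
Let HF' : homog 0 F'.
Proof. by rewrite (funext F'E); have := homog_comp HF HW; rewrite addr0. Qed.
Let HG' : homog 0 G'.
Proof. by rewrite (funext G'E); have := homog_comp HWt HG; rewrite addr0. Qed.
Let Ht' : homog (-1) t'.
Proof.
rewrite (funext t'E).
by have := homog_comp HF (homog_comp Ht (homog_comp HWt HG)); rewrite !(add0r, addr0).
Qed.

Let oneW x : WT 1 (one x) = one (W x).
Proof. by apply: (one_resolvent gX rW (rWT 1)) => y; rewrite !lendM oneH onet. Qed.
Let oneWt x : WtT 1 (one x) = one (Wt x).
Proof. by apply: (one_resolvent gX rWt (rWtT 1)) => y; rewrite !lendM onet oneH. Qed.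

Let tT0 : tT 0 = 0 := ins0 Ht.
Let WT0 u : WT 0 u = u.
Proof. by rewrite (resolvent_right (rWT 0)) tT0 mul0r mulr0 addr0. Qed.
Let WtT0 u : WtT 0 u = u.
Proof. by rewrite (resolvent_right (rWtT 0)) tT0 !mulr0 addr0. Qed.

(** The perturbed thick maps are determined by their first levels, so that
    identities between maps of coalgebras reduce to identities in [lend]. *)
Let F'T n u : tpow F (WT n u) = tpow F' u.
Proof.
apply: (thick_morphism_tpow (ff := fun n u => tpow F (WT n u)) gX HF' gY) => {n u} [p q u|u|x].
- exact: (tpowW_morphism HF HG FG tS HtT HHT rWT TFH THG dS HdT TdH PD1).
- by rewrite WT0; exact: tpow_level0.
- by rewrite oneW oneF F'E.
Qed.
Let G'T n u : WtT n (tpow G u) = tpow G' u.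
Proof.
apply: (thick_morphism_tpow (ff := fun n u => WtT n (tpow G u)) gY HG' gX) => {n u} [p q u|u|x].
- exact: (WttpowG HF HG FG tS HtT HHT rWtT TFH THG dS HdT TdH PD2).
- by rewrite WtT0; exact: tpow_level0.
- by rewrite oneG oneWt G'E.
Qed.
Let t'T n u : tpow F (tT n (WtT n (tpow G u))) = derivation t' u.
Proof.
rewrite (pert_tE (rWT n) (rWtT n)).
apply: (thick_derivation_tins (tt := fun n u => tpow F (WT n (tT n (tpow G u)))) gY Ht') => {n u} [p q u|u|y].
- exact: (tpow_tt_split HF HG FG tS HtT HHT rWT TFH THG dS HdT TdH PD1 FGW).
- by rewrite tT0 lendE (lin0 (lfunP (WT 0))) (lin0 (tpow_lin HF)).
- by rewrite oneG onet oneW oneF t'E (pert_tE rW rWt).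
Qed.

Let HWT n : lend (T X n) := HT n * WT n.
Let HH'T : HH' = fun n u => HWT n u.
Proof. by apply/functional_extensionality_dep => n; apply/funext => u; exact: HH'E. Qed.

Let HHWT n : homog (M := T X n) (N := T X n) 1 (HWT n).
Proof.
have HWTn : homog (M := T X n) (N := T X n) 0 (WT n).
  by apply: (resolvent_homog (T_gmod X n) (rWT n)); have := homog_comp (HtT n) (HHT n); rewrite subrr.
by have := homog_comp (HHT n) HWTn; rewrite add0r.
Qed.

Let LS : thick_lin (sym := sym) (fun n u => (tT n * HT n) u) := thick_lin_comp Ltt LHH.
Let LSt : thick_lin (sym := sym) (fun n u => (HT n * tT n) u) := thick_lin_comp LHH Ltt.
Let LWT : thick_lin (sym := sym) (fun n u => WT n u) := thick_lin_resolvent rWT LS.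
Let LWtT : thick_lin (sym := sym) (fun n u => WtT n u) := thick_lin_resolvent rWtT LSt.
Let LTF : thick_lin (sym := sym) (tpow F) := thick_lin_tpow HF.
Let LTG : thick_lin (sym := sym) (tpow G) := thick_lin_tpow HG.

Let deltaF x : cofdelta (F x) = cofmap 0 (tpow F) (cofdelta x).
Proof.
rewrite [LHS](cofdelta_natural 0 Lf); apply: cofmap_eq => n u; exact/esym/FE.
Qed.
Let deltaG y : cofdelta (G y) = cofmap 0 (tpow G) (cofdelta y).
Proof.
rewrite [LHS](cofdelta_natural 0 Lg); apply: cofmap_eq => n u; exact/esym/GE.
Qed.
Let deltaH x : cofdelta (H x) = cofmap 1 HH (cofdelta x).
Proof. exact: cofdelta_natural. Qed.
Let deltaW x : cofdelta (W x) = cofmap 0 (fun n u => WT n u) (cofdelta x).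
Proof.
apply: (delta_resolvent rW rWT LS) => {}x.
by rewrite lendM [LHS]deltat deltaH (cofmap_comp (-1) 1 Ltt LHH).
Qed.
Let deltaWt x : cofdelta (Wt x) = cofmap 0 (fun n u => WtT n u) (cofdelta x).
Proof.
apply: (delta_resolvent rWt rWtT LSt) => {}x.
by rewrite lendM [LHS]deltaH deltat (cofmap_comp 1 (-1) LHH Ltt).
Qed.
Let deltaF' x : cofdelta (F' x) = cofmap 0 (tpow F') (cofdelta x).
Proof.
rewrite F'E deltaF deltaW (cofmap_comp 0 0 LTF LWT).
by apply: cofmap_eq => n u; exact: F'T.
Qed.
Let deltaG' y : cofdelta (G' y) = cofmap 0 (tpow G') (cofdelta y).
Proof.
rewrite G'E deltaWt deltaG (cofmap_comp 0 0 LWtT LTG).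
by apply: cofmap_eq => n u; exact: G'T.
Qed.
Let deltaH' x : cofdelta (H' x) = cofmap 1 HH' (cofdelta x).
Proof. by rewrite H'E deltaH deltaW (cofmap_comp 1 0 LHH LWT) HH'T. Qed.
Let deltat' y : cofdelta (t' y) = cofmap (-1) (derivation t') (cofdelta y).
Proof.
have L1 := thick_lin_comp LWtT LTG; have L2 := thick_lin_comp Ltt L1.
rewrite t'E deltaF deltat deltaWt deltaG (cofmap_comp 0 0 LWtT LTG).
rewrite (cofmap_comp (-1) 0 Ltt L1) (cofmap_comp 0 (-1) LTF L2).
by apply: cofmap_eq => n u; exact: t'T.
Qed.

Let wt' m n y : (n <= m)%N -> wpr m (t' (wpr n y)) = 0.
Proof.
move=> nm; rewrite t'E; apply: wpr_cfil nm; apply: cofmap_cfil => //.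
apply: (lower_cfil Ht wt).
apply: (geom_fil sXt (fil := cfil n.+1)).
- exact: span0.
- by move=> x z; exact: span_add.
- move=> x fx; apply: cofmap_cfil => //; apply: cfil_mono (leqnSn n) _.
  exact: (lower_cfil Ht wt).
- by apply: cofmap_cfil => //; exact: cfil_wpr.
Qed.

Lemma omega_algebra_pert : omega_algebra t'.
Proof.
split=> // y; rewrite !t'E.
exact: (pert_tt (d := dX) (t := tX) (Wt := Wt) dF dG dHX dtX rWt).
Qed.

Let first' (M N : gmod k) (u : M -> N) (gM : is_gmod M) (gN : is_gmod N) a :
  homog 0 u -> first_level (@tpow k M N u) a = u a.
Proof. by move=> Hu; rewrite /first_level tpow_one // oneK. Qed.

(** On weight 1 the perturbation has weight 0, where the projection vanishes. *)
Let geom_cfil (S : lend X) (sS : forall x, summable (fun i => iter i S x)) x :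
  (forall n z, cfil n.+1 z -> cfil n (S z)) -> cfil 2 x -> cfil 1 (geom S x - x).
Proof.
move=> HS fx; rewrite (geomSr sS) addrAC subrr add0r.
apply: (geom_fil sS (fil := cfil 1)).
- exact: span0.
- by move=> y z; exact: span_add.
- by move=> y fy; apply: cfil_mono (leq0n 1) _; exact: HS.
- exact: HS.
Qed.

Let lower_S n (z : X) : cfil n.+1 z -> cfil n ((tX * HX) z).
Proof. by move=> fz; apply: (lower_cfil Ht wt); exact: cofmap_cfil. Qed.
Let lower_St n (z : X) : cfil n.+1 z -> cfil n ((HX * tX) z).
Proof. by move=> fz; apply: cofmap_cfil => //; exact: (lower_cfil Ht wt). Qed.

Let cofproj_eq (M : gmod k) (x y : cofree C M) : is_gmod M -> cfil 1 (x - y) -> cofproj x = cofproj y.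
Proof.
move=> gM fxy; apply/eqP; rewrite -subr_eq0 -(linB _ _ (cofproj_lin gM)).
by rewrite (cofproj_cfil gM fxy).
Qed.

Lemma omega_morphism_F : omega_morphism t t' f F'.
Proof.
split=> // x.
- rewrite /bardif !F'E t'E.
  exact: (pert_dF (d := dX) (t := tX) (W := W) (Wt := Wt) dF dHX dtX rW rWt).
- rewrite F'E (cofproj_eq (y := F (wpr 1 x))) //.
    by apply: cofproj_cofmap => //; [exact: homog_lin Hf|move=> a; exact: first'].
  rewrite -(linB _ _ LF); apply: cofmap_cfil => //.
  by apply: (geom_cfil sX); [exact: lower_S|exact: cfil_wpr].
Qed.

Lemma omega_morphism_G : omega_morphism t' t g G'.
Proof.
split=> // y.
- rewrite /bardif !G'E t'E.
  exact: (pert_dG (d := dX) (t := tX) (Wt := Wt) dG dHX dtX rWt).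
- rewrite G'E (cofproj_eq (y := G (wpr 1 y))) //.
    by apply: cofproj_cofmap => //; [exact: homog_lin Hg|move=> a; exact: first'].
  apply: (geom_cfil sXt); first exact: lower_St.
  by apply: cofmap_cfil => //; exact: cfil_wpr.
Qed.

Let first_HH' x : first_level HH' x = H' x.
Proof. by rewrite /first_level HH'E oneW oneH oneK // H'E. Qed.

Let HH'_coalg : thick_coalg_map 1 (@cofdelta k sym C A) (@cofdelta k sym C A) HH'.
Proof.
split=> [n|n s As u|x]; last by rewrite first_HH'.
- by rewrite HH'T; exact: HHWT.
- by rewrite HH'T; exact: (thick_lin_comp LHH LWT).2.
Qed.

Lemma omega_homotopy_H : omega_homotopy h H' HH'.
Proof.
split=> // x; have Lh : linear h by have [[_ _ []]] := cfgh.
rewrite H'E (cofproj_eq (y := H (wpr 1 x))) //; first exact: cofproj_cofmap.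
rewrite -(linB _ _ (homog_lin HHm)); apply: cofmap_cfil => //.
by apply: (geom_cfil sX); [exact: lower_S|exact: cfil_wpr].
Qed.

Let Hbar : homog (-1) (bardif t). Proof. exact: homog_add. Qed.
Let Hbar' : homog (-1) (bardif t'). Proof. exact: homog_add. Qed.

Let tpow_coalg (M N : gmod k) (u : cofree C M -> cofree C N) : homog 0 u ->
  (forall x, cofdelta (u x) = cofmap 0 (tpow u) (cofdelta x)) ->
  thick_coalg_map 0 (@cofdelta k sym C M) (@cofdelta k sym C N) (tpow u).
Proof.
move=> Hu du; split=> [n|n s As v|x]; first exact: tpow_homog.
  by have [_ su] := thick_lin_tpow (sym := sym) Hu; exact: su.
by rewrite (first' (cofree_gmod M) (cofree_gmod N)).
Qed.

Let TdHp n : dT n * HT n + HT n * dT n = Lend (linear_comp (tpow_lin HG) (tpow_lin HF)) - 1.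
Proof. by apply: lendP => u; exact: TdH. Qed.

Lemma coalg_contraction_pert : coalg_contraction (bardif t) (bardif t')
  (@cofdelta k sym C A) (@cofdelta k sym C B) (tpow F') (tpow G') HH'.
Proof.
have [_ bF _ _] := omega_morphism_F; have [_ bG _ _] := omega_morphism_G.
have LFn n := @tpow_lin k X Y F n HF; have LGn n := @tpow_lin k Y X G n HG.
split; [|split; [|split]]; split.
- exact: tpow_coalg.
- exact: tpow_coalg.
- exact: HH'_coalg.
- move=> n u; rewrite scale1r; apply/eqP; rewrite subr_eq0; apply/eqP.
  exact: (tins_tpow HF' Hbar Hbar').
- move=> n u; rewrite scale1r; apply/eqP; rewrite subr_eq0; apply/eqP.
  exact: (tins_tpow HG' Hbar' Hbar).
- move=> n u; have E v : tdif (bardif t) v = dT n v + tT n v by exact: tinsD.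
  rewrite -[sgn 1]/(-1) scaleN1r opprK !HH'E !E.
  rewrite (pert_dH (TdHp n) (dtT n) (rWT n) (rWtT n)).
  by rewrite /thick_sub /thick_comp G'T F'T.
- move=> n u; rewrite /thick_comp -F'T -G'T.
  exact: (pert_FGK (LFn n) (LGn n) (@TFG n) (@TFH n) (@THG n) (THH n) (rWT n) (rWtT n)).
- move=> n u; rewrite /thick_comp -F'T HH'E.
  exact: (pert_FH (LFn n) (LGn n) (@TFG n) (@TFH n) (THH n) (rWT n)).
- move=> n u; rewrite /thick_comp !HH'E.
  exact: (pert_HH (THH n) (rWT n) (rWtT n)).
- move=> n u; rewrite /thick_comp HH'E -G'T.
  exact: (pert_HG (LFn n) (LGn n) (@TFG n) (@THG n) (THH n) (rWT n) (rWtT n)).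
- by move=> p q u; exact: tpow_split.
- by move=> p q u; exact: tpow_split.
- rewrite HH'T => p q u.
  have E1 := pd_left tS HtT HHT rWT PD1 (p := p) (q := q).
  have E2 := pd_right tS HtT HHT rWT rWtT PD2 (p := p) (q := q).
  rewrite -!tlM -!trM addr0 -tens_lr in E1; rewrite -!tlM -!trM addr0 -tens_lr in E2.
  split; first exact: (congr1 (fun v : lend (T X (p + q)) => v u) E1).
  exact: (congr1 (fun v : lend (T X (p + q)) => v u) E2).
Qed.

End Assembly.

(* [sym = true]: symmetric cooperads and symmetric pseudo-derivations;
   [sym = false]: non-symmetric cooperads, no symmetry condition. *)
Theorem theorem1p5 (k : comPzRingType) (A B : chain_complex k)
    (f : A -> B) (g : B -> A) (h : A -> A) :
  contraction f g h ->
  (forall (sym : bool) (C : cooperad sym k), connected C ->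
   forall t : cofree C A -> cofree C A, omega_algebra t ->
   forall hh : thick A A, thick_homotopy sym f g h hh ->
   let F : cofree C A -> cofree C B := cofmap 0 (tpow f) in
   let G : cofree C B -> cofree C A := cofmap 0 (tpow g) in
   let H : cofree C A -> cofree C A := cofmap 1 hh in
   let F' := pertF F t H in
   let G' := pertG t H G in
   let H' := pertH t H in
   let t' := pertt F t H G in
   let tt : thick (cofree C A) (cofree C A) := derivation t in
   let HH : thick (cofree C A) (cofree C A) := cofthick 1 hh in
   let HH' := pert_thick tt HH in
   [/\ pert_summable F t H G,
       forall n u, summable (fun i => termH (@tt n) (@HH n) i u) &
       omega_algebra t'] /\
   [/\ omega_morphism t t' f F',
       omega_morphism t' t g G' &
       omega_homotopy h H' HH'] /\
   coalg_contraction (bardif t) (bardif t')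
     (@cofdelta k sym C A) (@cofdelta k sym C B) (tpow F') (tpow G') HH') /\
  thick_homotopy false f g h (standard_homotopy f g h) /\
  (forall iota : {rmorphism rat -> k}, injective iota ->
   thick_homotopy true f g h (symmetrize iota (standard_homotopy f g h))).
Proof.
move=> cfgh; split; [|split].
- move=> sym C _ t Ot hh Hhh; have [s1 s2] := assembly_summable cfgh Ot Hhh.
  split; [|split].
  + by split=> //; exact: (omega_algebra_pert cfgh Ot Hhh).
  + split; [exact: (omega_morphism_F cfgh Ot Hhh)|exact: (omega_morphism_G cfgh Ot Hhh)|].
    exact: (omega_homotopy_H cfgh Ot Hhh).
  + exact: (coalg_contraction_pert cfgh Ot Hhh).
- exact: standard_homotopy_thick.
- by move=> iota _; exact: symmetrize_thick.
Qed.
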